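(* (i) We have $\operatorname{mon}H_\infty(\mathbb{T}^\infty)=\operatorname{mon}H_\infty(\mathbb{D}^\infty)$. In particular, $$\tfrac{1}{\sqrt2}\mathbf{B}\subseteq\operatorname{mon}H_\infty(\mathbb{T}^\infty)\subseteq\overline{\mathbf{B}}.$$ (ii) For $1\le p<\infty$ we have $\operatorname{mon}H_p(\mathbb{T}^\infty)=\ell_2\cap\mathbb{D}^\infty$.
   Context: $\mathbb{D}^\infty$ denotes the open unit ball of the complex Banach space $\ell_\infty$ of bounded sequences. $H_\infty(\mathbb{D}^\infty)$ is the Banach space of all bounded holomorphic (Fréchet complex-differentiable) functions $f:\mathbb{D}^\infty\to\mathbb{C}$. $\mathbb{Z}^{(\mathbb{N})}$ (resp. $\mathbb{N}_0^{(\mathbb{N})}$) is the set of finitely supported sequences of integers (resp. non-negative integers), $\mathbb{N}_0^k$ being identified with those in $\mathbb{N}_0^{(\mathbb{N})}$ supported in the first $k$ coordinates, and $z^\alpha=\prod_jz_j^{\alpha_j}$. The monomial coefficients $c_\alpha(f)$ of $f\in H_\infty(\mathbb{D}^\infty)$ are the unique complex numbers such that for every $k$ and every $z\in\mathbb{D}^k$ (identified with $\mathbb{D}^k\times\{0\}$), $f(z)=\sum_{\alpha\in\mathbb{N}_0^k}c_\alpha(f)z^\alpha$. Set $$\operatorname{mon}H_\infty(\mathbb{D}^\infty)=\Big\{z\in\mathbb{D}^\infty:\forall f\in H_\infty(\mathbb{D}^\infty),\ f(z)=\sum_{\alpha\in\mathbb{N}_0^{(\mathbb{N})}}c_\alpha(f)z^\alpha\Big\},$$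 where the equality means that the series converges absolutely (as a net) with sum $f(z)$. $\mathbb{T}^\infty$ is the countable product of unit circles with $m$ the product of the normalized Lebesgue measures. For $f\in L_p(\mathbb{T}^\infty)$ and $\alpha\in\mathbb{Z}^{(\mathbb{N})}$, $\hat f(\alpha)=\int_{\mathbb{T}^\infty}f(w)w^{-\alpha}\,dm(w)$. For $1\le p\le\infty$, $$H_p(\mathbb{T}^\infty)=\{f\in L_p(\mathbb{T}^\infty):\hat f(\alpha)=0\ \ \forall\alpha\in\mathbb{Z}^{(\mathbb{N})}\setminus\mathbb{N}_0^{(\mathbb{N})}\},$$ $$\operatorname{mon}H_p(\mathbb{T}^\infty)=\Big\{z\in\mathbb{D}^\infty:\sum_\alpha|\hat f(\alpha)z^\alpha|<\infty\text{ for all }f\in H_p(\mathbb{T}^\infty)\Big\}.$$ For $z\in\ell_\infty$ the decreasing rearrangement is $z_n^*=\inf\{\sup_{j\in\mathbb{N}\setminus J}|z_j|:J\subseteq\mathbb{N},\ \operatorname{card}(J)<n\}$. Further $$\mathbf{B}=\Big\{z\in\mathbb{D}^\infty:\limsup_{n\to\infty}\frac1{\log n}\sum_{j=1}^n(z_j^* )^2<1\Big\},\qquad \overline{\mathbf{B}}=\Big\{z\in\mathbb{D}^\infty:\limsup_{n\to\infty}\frac1{\log n}\sum_{j=1}^n(z_j^* )^2\le1\Big\},$$ and $\frac1{\sqrt2}\mathbf{B}=\{\frac1{\sqrt2}z:z\in\mathbf{B}\}$. *)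

(* Defs.v *)
(* Complex numbers are R[i] for R : realType; R[i]^o is the same field seen as a
   normed module over itself.  Coordinates of sequences are indexed from 0. *)
From HB Require Import structures.
From mathcomp Require Import all_boot all_order all_algebra finmap complex.
From mathcomp Require Import all_classical all_reals all_analysis.
From mathcomp Require Import measurable_realfun ring lra.
From mathcomp.analysis.showcase Require Import summability.
Set Implicit Arguments. Unset Strict Implicit. Unset Printing Implicit Defensive.
Import Order.TTheory GRing.Theory Num.Theory numFieldNormedType.Exports.
Import ComplexField.Normc.
Local Open Scope classical_set_scope.
Local Open Scope ring_scope.
Local Open Scope complex_scope.

Section ell_infty.
Variable R : realType.

Lemma normc_ge0 (x : R[i]) : 0 <= normc x.
Proof. by case: x => a b; rewrite /normc sqrtr_ge0. Qed.

Definition bounded_seq : {pred nat -> R[i]} :=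
  [pred z : nat -> R[i] | `[< exists M : R, forall j, normc (z j) <= M >]].

Lemma bounded_seq_submod : submod_closed bounded_seq.
Proof.
split; first by apply/asboolP; exists 0 => j; rewrite normc0.
move=> a u v /asboolP[M hM] /asboolP[N hN]; apply/asboolP.
exists (normc a * M + N) => j; apply: le_trans (le_normcD _ _) _.
by rewrite normcM lerD// ler_wpM2l ?normc_ge0.
Qed.

HB.instance Definition _ :=
  GRing.isSubmodClosed.Build R[i] (nat -> R[i]) bounded_seq bounded_seq_submod.

Record ell_infty := EllInfty {
  ell_infty_val :> nat -> R[i];
  _ : ell_infty_val \in bounded_seq }.

HB.instance Definition _ := [isSub for ell_infty_val].
HB.instance Definition _ := gen_eqMixin ell_infty.
HB.instance Definition _ := gen_choiceMixin ell_infty.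
HB.instance Definition _ := [SubChoice_isSubLmodule of ell_infty by <:].

Definition sup_norm (z : nat -> R[i]) : R := sup (range (fun j => normc (z j))).

Lemma ell_infty_bounded (z : ell_infty) : has_ubound (range (fun j => normc (z j))).
Proof. by case: z => z /= /asboolP[M hM]; exists M => _ [j _ <-]. Qed.

Lemma le_sup_norm (z : ell_infty) j : normc (z j) <= sup_norm z.
Proof. by apply: ub_le_sup; [exact: ell_infty_bounded|exists j]. Qed.

Lemma sup_norm_le (z : ell_infty) M : (forall j, normc (z j) <= M) -> sup_norm z <= M.
Proof. by move=> h; apply: ge_sup; [exists (normc (z 0%N)); exists 0%N|move=> _ [j _ <-]]. Qed.

Let norm (z : ell_infty) : R[i] := (sup_norm z)%:C.

Let ler_normD (x y : ell_infty) : norm (x + y) <= norm x + norm y.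
Proof.
rewrite -rmorphD lecR; apply: sup_norm_le => j.
by apply: le_trans (le_normcD (x j) (y j)) _; exact: lerD (le_sup_norm x j) (le_sup_norm y j).
Qed.

Let normrZ (l : R[i]) (x : ell_infty) : norm (l *: x) = `|l| * norm x.
Proof.
rewrite /norm -rmorphM; congr (_%:C); apply/eqP; rewrite eq_le; apply/andP; split.
  by apply: sup_norm_le => j; rewrite [leLHS](normcM l (x j)) ler_wpM2l ?normc_ge0 ?le_sup_norm.
have [->|l0] := eqVneq l 0.
  by rewrite normc0 mul0r (le_trans (normc_ge0 _) (le_sup_norm _ 0%N)).
have nl : 0 < normc l.
  by rewrite lt_def normc_ge0 andbT; apply: contra l0 => /eqP/eq0_normc ->.
rewrite -ler_pdivlMl//; apply: sup_norm_le => j.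
by rewrite ler_pdivlMl// -normcM; exact: (le_sup_norm (l *: x) j).
Qed.

Let normr0_eq0 (x : ell_infty) : norm x = 0 -> x = 0.
Proof.
move=> /eqP; rewrite /norm (fmorph_eq0 (real_complex R)) => /eqP x0.
apply/val_inj/funext => j; apply/eq0_normc/eqP.
by rewrite eq_le normc_ge0 andbT -x0 le_sup_norm.
Qed.

HB.instance Definition _ := Lmodule_isNormed.Build R[i] ell_infty
  ler_normD normrZ normr0_eq0.

End ell_infty.

Section seq_space.
Context d (S : measurableType d).

Definition seq_cylinders : set (set (nat -> S)) :=
  \bigcup_j preimage_set_system setT (fun w : nat -> S => w j) measurable.

Definition seq_space := g_sigma_algebraType seq_cylinders.
HB.instance Definition _ := Measurable.on seq_space.

Definition box (n : nat) (A : nat -> set S) : set seq_space :=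
  [set w | forall i, (i < n)%N -> A i (w i)].

Lemma measurable_coord j : measurable_fun setT (fun w : seq_space => w j).
Proof.
by move=> _ Y mY; apply: sub_sigma_algebra; exists j => //; exists Y.
Qed.

Lemma measurable_to_seq d' (T : measurableType d') (f : T -> seq_space) :
  (forall j, measurable_fun setT (fun x => f x j)) -> measurable_fun setT f.
Proof.
move=> mf; apply: (@measurability _ _ T seq_space setT f seq_cylinders erefl).
by move=> _ [_ [j _ [Y mY <-]] <-]; rewrite !setTI; have := mf j measurableT Y mY; rewrite setTI.
Qed.

Lemma boxE n A : box n A = \bigcap_(i in [set i | (i < n)%N]) ((fun w : seq_space => w i) @^-1` A i).
Proof. by apply/seteqP; split => w /=. Qed.

Lemma measurable_box n A : (forall i, measurable (A i)) -> measurable (box n A).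
Proof.
move=> mA; rewrite boxE; apply: bigcap_measurableType => i _.
by rewrite -[X in measurable X]setTI; exact: measurable_coord.
Qed.

Definition boxes : set (set seq_space) :=
  [set X | exists n A, (forall i, measurable (A i)) /\ X = box n A].

Lemma box_pad n N (A : nat -> set S) : (n <= N)%N ->
  box n A = box N (fun i => if (i < n)%N then A i else setT).
Proof.
move=> nN; apply/seteqP; split => w h i.
  by move=> _; case: ifPn => // /h.
by move=> ni; have := h i (leq_trans ni nN); rewrite ni.
Qed.

Lemma boxes_setI : setI_closed boxes.
Proof.
move=> _ _ [n [A [mA ->]]] [m [B [mB ->]]].
rewrite (box_pad A (leq_maxl n m)) (box_pad B (leq_maxr n m)).
exists (maxn n m), (fun i => (if (i < n)%N then A i else setT) `&` (if (i < m)%N then B i else setT)).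
split; first by move=> i; apply: measurableI; case: ifP.
apply/seteqP; split => w.
  by move=> [h k] i im; split; [exact: h|exact: k].
by move=> h; split => i im; have [] := h i im.
Qed.

Lemma measurable_boxes : @measurable _ seq_space = <<s boxes >>.
Proof.
apply/seteqP; split.
  apply: smallest_sub; first exact: smallest_sigma_algebra.
  move=> _ [j _ [Y mY <-]]; apply: sub_sigma_algebra.
  exists j.+1, (fun i => if i == j then Y else setT); split; first by move=> i; case: ifP.
  rewrite setTI; apply/seteqP; split => w.
    by move=> Yw i _; case: ifPn => // /eqP ->.
  by move=> /(_ j (ltnSn j)); rewrite eqxx.
apply: smallest_sub; first exact: sigma_algebra_measurable.
by move=> _ [n [A [mA ->]]]; exact: measurable_box.
Qed.

Lemma boxes_unique (R : realType) (m1 m2 : {measure set seq_space -> \bar R}) :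
  (forall X, boxes X -> m1 X = m2 X) -> (m1 setT < +oo)%E ->
  forall X, measurable X -> m1 X = m2 X.
Proof.
move=> m12 m1f; apply: (measure_unique boxes (fun=> setT)) => //.
- exact: measurable_boxes.
- exact: boxes_setI.
- by move=> _; exists 0%N, (fun=> setT); split => //; apply/seteqP; split.
- by apply/seteqP; split => // w _; exists 0%N.
Qed.

End seq_space.

(* Existence of the infinite product of a law on S.  If g and h are independent
   and h preserves P, then g, g \o h, g \o h \o h, ... is an i.i.d. sequence.
   The binary digits of a uniform variable are obtained this way from the
   doubling map; splitting them into even and odd positions gives a pair
   (g, h) for which g is again uniform. *)
Section iid.
Context (R : realType) d (Om : measurableType d) d' (S : measurableType d').
Variables (P : probability Om R) (g : Om -> S) (h : Om -> Om).
Hypotheses (mg : measurable_fun setT g) (mh : measurable_fun setT h).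
Hypothesis ind : forall A B, measurable A -> measurable B ->
  P (g @^-1` A `&` h @^-1` B) = (P (g @^-1` A) * P B)%E.

Definition orbit_seq (x : Om) : seq_space S := fun j => g (iter j h x).

Lemma measurable_orbit_seq : measurable_fun setT orbit_seq.
Proof.
apply: measurable_to_seq => j; apply: measurableT_comp => //.
elim: j => [|j IH] /=; first exact: measurable_id.
exact: measurableT_comp.
Qed.

Lemma orbit_seq_box n (A : nat -> set S) : (forall i, measurable (A i)) ->
  P (orbit_seq @^-1` box n A) = (\prod_(i < n) P (g @^-1` A i))%E.
Proof.
elim: n A => [|n IH] A mA.
  rewrite big_ord0 -[RHS](probability_setT P); congr (P _).
  by apply/seteqP; split.
rewrite big_ord_recl -(IH (fun i => A i.+1))// -ind//; last first.
  rewrite -[X in measurable X]setTI.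
  by apply: measurable_orbit_seq => //; exact: measurable_box.
congr (P _); apply/seteqP; split => x /=.
  move=> H; split; first exact: (H 0%N).
  by move=> i ni; rewrite /orbit_seq -iterSr; exact: (H i.+1).
move=> [H0 H] [|i] ni; first exact: H0.
by have := H i ni; rewrite /orbit_seq -iterSr.
Qed.

End iid.

Section split.
Context (R : realType) d (S : measurableType d).
Variables (P : probability (seq_space S) R) (q : set S -> \bar R).
Hypothesis qT : q setT = 1%E.
Hypothesis Pbox : forall n A, (forall i, measurable (A i)) ->
  P (box n A) = (\prod_(i < n) q (A i))%E.

Definition evens (w : seq_space S) : seq_space S := fun i => w i.*2.
Definition odds (w : seq_space S) : seq_space S := fun i => w i.*2.+1.

Lemma measurable_evens : measurable_fun setT evens.
Proof. by apply: measurable_to_seq => j; exact: measurable_coord. Qed.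

Lemma measurable_odds : measurable_fun setT odds.
Proof. by apply: measurable_to_seq => j; exact: measurable_coord. Qed.

Lemma evens_odds_box n (A B : nat -> set S) :
  (forall i, measurable (A i)) -> (forall i, measurable (B i)) ->
  P (evens @^-1` box n A `&` odds @^-1` box n B) = (P (box n A) * P (box n B))%E.
Proof.
move=> mA mB.
pose C i := if odd i then B i./2 else A i./2.
have mC i : measurable (C i) by rewrite /C; case: ifP.
rewrite (_ : _ `&` _ = box n.*2 C); last first.
  apply/seteqP; split => w.
    move=> [hA hB] i; rewrite -(odd_double_half i) /C; case: (odd i) => /=.
      rewrite add1n ltn_Sdouble /= odd_double/= uphalf_double => /hB.
      by [].
    rewrite add0n ltn_double odd_double doubleK => /hA.
    by [].
  move=> hC; split => i ni.
    have := hC i.*2; rewrite /C odd_double doubleK ltn_double; exact.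
  have := hC i.*2.+1; rewrite /C/= odd_double uphalf_double ltn_Sdouble; exact.
rewrite !Pbox//; elim: n => [|n IH]; first by rewrite double0 !big_ord0 mule1.
rewrite doubleS !big_ord_recr/= IH /C/= odd_double/= doubleK uphalf_double.
by rewrite muleACA muleA.
Qed.

Lemma evens_odds X Y : measurable X -> measurable Y ->
  P (evens @^-1` X `&` odds @^-1` Y) = (P X * P Y)%E.
Proof.
have mO Z : measurable Z -> measurable (odds @^-1` Z).
  by move=> mZ; rewrite -[X in measurable X]setTI; exact: measurable_odds.
have mE Z : measurable Z -> measurable (evens @^-1` Z).
  by move=> mZ; rewrite -[X in measurable X]setTI; exact: measurable_evens.
have step1 X' Y' : boxes X' -> boxes Y' ->
    P (evens @^-1` X' `&` odds @^-1` Y') = (P X' * P Y')%E.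
  move=> [n [A [mA ->]]] [m [B [mB ->]]].
  rewrite (box_pad A (leq_maxl n m)) (box_pad B (leq_maxr n m)).
  by apply: evens_odds_box => i; case: ifP.
have mb (X' : set (seq_space S)) : boxes X' -> measurable X'.
  by move=> [n [A [mA ->]]]; exact: measurable_box.
have k Z : measurable Z -> (0 <= fine (P Z))%R by move=> mZ; exact: fine_ge0.
have finP Z : measurable Z -> P Z = (fine (P Z))%:E.
  by move=> mZ; rewrite fineK// fin_num_measure.
have step2 X' Y' : measurable X' -> boxes Y' ->
    P (evens @^-1` X' `&` odds @^-1` Y') = (P X' * P Y')%E.
  move=> mX' bY'; have mY' := mb _ bY'.
  pose m2 := mscale (NngNum (k _ mY')) P.
  have mm1 : measurable_fun setT evens := measurable_evens.
  pose M1 := [the measure _ _ of pushforward (mrestr P (mO _ mY')) evens].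
  pose M2 : {measure set _ -> \bar R} := m2.
  have e : M1 measurable_evens X' = M2 X'.
    apply: boxes_unique => //; last first.
      by rewrite /M1/= /pushforward /mrestr/= preimage_setT setTI; apply: (le_lt_trans (probability_le1 P _)); [exact: (mO _ mY')|exact: ltry].
    move=> Z bZ; rewrite /M1 /M2 /m2 /=/pushforward /mrestr /mscale /= step1//.
    by rewrite [P Y']finP// muleC.
  move: e; rewrite /M1 /M2 /m2 /=/pushforward /mrestr /mscale /= => ->.
  by rewrite [P Y']finP// muleC.
move=> mX mY.
pose M1 := [the measure _ _ of pushforward (mrestr P (mE _ mX)) odds].
pose M2 : {measure set _ -> \bar R} := mscale (NngNum (k _ mX)) P.
have e : M1 measurable_odds Y = M2 Y.
  apply: boxes_unique => //; last first.
    by rewrite /M1/= /pushforward /mrestr/= preimage_setT setTI; apply: (le_lt_trans (probability_le1 P _)); [exact: (mE _ mX)|exact: ltry].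
  move=> Z bZ; rewrite /M1 /M2 /=/pushforward /mrestr /mscale /= setIC step2//.
  by rewrite [P X]finP//.
move: e; rewrite /M1 /M2 /=/pushforward /mrestr /mscale /= setIC => ->.
by rewrite [P X]finP.
Qed.

End split.

Section encoding.
Context (R : realType) d (Om : measurableType d) d0 (S0 : measurableType d0)
  d' (S : measurableType d').
Variables (P0 : probability Om R) (g : Om -> S0) (h : Om -> Om).
Hypotheses (mg : measurable_fun setT g) (mh : measurable_fun setT h).
Hypothesis ind : forall A B, measurable A -> measurable B ->
  P0 (g @^-1` A `&` h @^-1` B) = (P0 (g @^-1` A) * P0 B)%E.
Variables (v : seq_space S0 -> Om) (mv : measurable_fun setT v).
Hypothesis lawv : forall A, measurable A ->
  P0 ((v \o orbit_seq g h) @^-1` A) = P0 A.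

Let preT d1 d2 (T1 : measurableType d1) (T2 : measurableType d2) (f : T1 -> T2) A :
  measurable_fun setT f -> measurable A -> measurable (f @^-1` A).
Proof. by move=> mf mA; rewrite -[X in measurable X]setTI; exact: mf. Qed.

Let P : probability (seq_space S0) R :=
  distribution P0 (mfun_Sub (mem_set (measurable_orbit_seq mg mh))).

Let PE X : P X = P0 (orbit_seq g h @^-1` X). Proof. by []. Qed.

Let Pbox n A : (forall i, measurable (A i)) ->
  P (box n A) = (\prod_(i < n) P0 (g @^-1` A i))%E.
Proof. by move=> mA; rewrite PE; exact: orbit_seq_box. Qed.

Let splitP X Y : measurable X -> measurable Y ->
  P (@evens _ S0 @^-1` X `&` @odds _ S0 @^-1` Y) = (P X * P Y)%E.
Proof. exact: (evens_odds (q := fun A => P0 (g @^-1` A))). Qed.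

Let evensP X : measurable X -> P (@evens _ S0 @^-1` X) = P X.
Proof.
move=> mX; have := splitP mX measurableT.
by rewrite preimage_setT setIT probability_setT mule1.
Qed.

Lemma ex_iid (c : Om -> S) : measurable_fun setT c ->
  exists m : probability (seq_space S) R, forall n A,
    (forall i, measurable (A i)) ->
    m (box n A) = (\prod_(i < n) P0 (c @^-1` A i))%E.
Proof.
move=> mc; pose u : seq_space S0 -> S := c \o (v \o @evens _ S0).
have mvA A : measurable A -> measurable ((c \o v) @^-1` A).
  by move=> mA; apply: preT => //; exact: measurableT_comp.
have mu : measurable_fun setT u.
  by do 2!apply: measurableT_comp => //; exact: measurable_evens.
have uE A : u @^-1` A = @evens _ S0 @^-1` ((c \o v) @^-1` A) by [].
have uind A B : measurable A -> measurable B ->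
    P (u @^-1` A `&` @odds _ S0 @^-1` B) = (P (u @^-1` A) * P B)%E.
  by move=> mA mB; rewrite uE evensP ?splitP//; exact: mvA.
have mo : measurable_fun setT (@odds _ S0) := @measurable_odds _ _.
exists (distribution P (mfun_Sub (mem_set (measurable_orbit_seq mu mo)))) => n A mA.
transitivity (P (orbit_seq u (@odds _ S0) @^-1` box n A)); first by [].
rewrite (orbit_seq_box mu mo uind)//; apply: eq_bigr => i _.
rewrite uE evensP; last exact: mvA.
rewrite PE -(lawv (A := c @^-1` A i))//; exact: preT.
Qed.

End encoding.

Section uniform_iid.
Variable R : realType.
Local Notation P0 := (uniform_prob (@ltr01 R)).
Local Notation mu := (@lebesgue_measure R).

Lemma uniform_prob01E (A : set R) : measurable A ->
  P0 A = mu (A `&` `[0, 1[).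
Proof.
move=> mA; rewrite /uniform_prob integral_uniform_pdf.
rewrite (eq_integral (cst 1%E)); last first.
  move=> x; rewrite inE /= => -[_]; rewrite in_itv /= => x01.
  by rewrite /uniform_pdf x01 subr0 invr1.
rewrite integral_cst ?mul1e; last exact: measurableI.
apply/eqP; rewrite eq_le; apply/andP; split; last first.
  apply: le_measure; rewrite ?inE; [exact: measurableI|exact: measurableI|].
  by apply: setIS => x /=; rewrite !in_itv/= => /andP[-> /ltW].
apply: (@le_trans _ _ (mu ((A `&` `[0, 1[) `|` [set 1]))).
  apply: le_measure; rewrite ?inE; [exact: measurableI|by apply: measurableU => //; exact: measurableI|].
  rewrite -(@setUitv1 _ _ (BLeft 0) 1 true) ?bnd_simp//= => x [Ax [x01|x1]]; [left|right] => //.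
apply: (le_trans (measureU2 _ _ _)) => //; first exact: measurableI.
by rewrite [X in (_ + X)%E](lebesgue_measure_set1 1) adde0.
Qed.

Let aff (b x : R) := 2 * x - b.

Let maff b : measurable_fun setT (aff b).
Proof. by apply: measurable_funB => //; exact: measurable_funM. Qed.

Let lebesgue_aff b (A : set R) : measurable A ->
  mu (aff b @^-1` A) = ((2^-1)%:E * mu A)%E.
Proof.
move=> mA.
pose M := [the measure _ _ of pushforward mu (aff b : R -> measurableTypeR R)].
pose M2 : {measure set _ -> \bar R} := mscale (NngNum (ler0n R 2)) (M (maff b)).
have -> : mu A = M2 A.
  apply: lebesgue_measure_unique => //= _ [[x y]] _ <-.
  rewrite /M2 /mscale /= /pushforward /=.
  rewrite (_ : aff b @^-1` _ = `](x + b) / 2, (y + b) / 2]%classic); last first.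
    by apply/seteqP; split => z /=; rewrite !in_itv /= /aff => /andP[h1 h2]; apply/andP; split; lra.
  rewrite !lebesgue_measure_itv /= !lte_fin.
  have -> : ((x + b) / 2 < (y + b) / 2) = (x < y) by apply/idP/idP => h; lra.
  case: ifP => _; last by rewrite mule0.
  by rewrite -!EFinD -EFinM; congr EFin; field.
rewrite /M2 /mscale /= /pushforward muleA -EFinM mulVf ?mul1e//.
Qed.

Let bit (x : R) : bool := 2^-1 <= x.
Let dbl (x : R) : R := 2 * x - (bit x)%:R.

Let mbit : measurable_fun setT bit.
Proof. exact: measurable_fun_ler. Qed.

Let mdbl : measurable_fun setT dbl.
Proof.
rewrite (_ : dbl = fun x => if bit x then aff 1 x else aff 0 x).
  by apply: measurable_fun_ifT => //; exact: maff.
by apply/funext => x; rewrite /dbl; case: ifP.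
Qed.

Let half c (B : set R) : measurable B ->
  P0 (bit @^-1` [set c] `&` dbl @^-1` B) = ((2^-1)%:E * P0 B)%E.
Proof.
move=> mB; rewrite !uniform_prob01E//; last first.
  by apply: measurableI; rewrite -[X in measurable X]setTI; [exact: mbit|exact: mdbl].
rewrite -(lebesgue_aff c%:R); last exact: measurableI.
congr (mu _); apply/seteqP; split => x /=; rewrite !in_itv /= /dbl /bit /aff.
  move=> [[bc hB]] /andP[x0 x1]; rewrite -bc; split => //.
  by case: (leP 2^-1 x) => /= h; rewrite ?mulr1n ?mulr0n; apply/andP; split; lra.

move=> [hB /andP[x0 x1]].
have e : (2^-1 <= x) = c by case: c x0 x1 {hB} => /=; rewrite ?mulr1n ?mulr0n => x0 x1; [|apply/negbTE; rewrite -ltNge]; move: x0 x1; rewrite ?mulr1n ?mulr0n => x0 x1; lra.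
rewrite e; split => //; case: c x0 x1 {hB e} => /=; rewrite ?mulr1n ?mulr0n => x0 x1; apply/andP; split; lra.
Qed.

Let bit_dbl (A : set bool) (B : set R) : measurable A -> measurable B ->
  P0 (bit @^-1` A `&` dbl @^-1` B) = (P0 (bit @^-1` A) * P0 B)%E.
Proof.
move=> _ mB.
have mb c : measurable (bit @^-1` [set c]) by rewrite -[X in measurable X]setTI; exact: mbit.
have md : measurable (dbl @^-1` B) by rewrite -[X in measurable X]setTI; exact: mdbl.
have hc c : P0 (bit @^-1` [set c]) = (2^-1)%:E.
  by have := half c measurableT; rewrite preimage_setT setIT probability_setT mule1.
have [/eqP->|/eqP->|/eqP->|/eqP->] := set_bool A.
- by rewrite half// hc.
- by rewrite half// hc.
- by rewrite preimage_set0 set0I measure0 mul0e.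
have -> : [set: bool] = [set true] `|` [set false].
  by apply/seteqP; split => -[] //= _; [left|right].
rewrite preimage_setU setIUl.
have dis : bit @^-1` [set true] `&` bit @^-1` [set false] = set0.
  by rewrite -preimage_setI; apply/seteqP; split => x //= [->].
have mm c : measurable (bit @^-1` [set c] `&` dbl @^-1` B) by exact: measurableI.
have e1 : P0 ((bit @^-1` [set true] `&` dbl @^-1` B) `|` (bit @^-1` [set false] `&` dbl @^-1` B)) =
    (P0 (bit @^-1` [set true] `&` dbl @^-1` B) + P0 (bit @^-1` [set false] `&` dbl @^-1` B))%E.
  by apply: (measureU P0 (mm true) (mm false)); rewrite setIACA dis set0I.
have e2 : P0 (bit @^-1` [set true] `|` bit @^-1` [set false]) =
    (P0 (bit @^-1` [set true]) + P0 (bit @^-1` [set false]))%E.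
  exact: (measureU P0 (mb true) (mb false)).
by rewrite e1 e2 !half// !hc ge0_muleDl.
Qed.

Let E : measurableTypeR R -> seq_space bool := @orbit_seq _ (measurableTypeR R) _ bool bit dbl.

Let mE : measurable_fun setT E.
Proof. exact: (@measurable_orbit_seq _ (measurableTypeR R)). Qed.

Let partial (w : seq_space bool) n : R := \sum_(k < n) (w k)%:R / 2 ^+ k.+1.
Let value (w : seq_space bool) : R := limn_sup (partial w).

Let partial01 w n : 0 <= partial w n <= 1 - 2 ^- n.
Proof.
elim: n => [|n /andP[IH0 IH1]]; first by rewrite /partial big_ord0 expr0 invr1 subrr lexx.
rewrite /partial big_ord_recr /= -/(partial w n).
have p : (0 : R) < 2 ^- n by rewrite invr_gt0 exprn_gt0.
have e : 2 ^- n.+1 = 2^-1 * 2 ^- n :> R by rewrite exprS invfM.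
have b0 : 0 <= (w n)%:R / 2 ^+ n.+1 :> R by rewrite divr_ge0 ?exprn_ge0.
have b1 : (w n)%:R / 2 ^+ n.+1 <= 2 ^- n.+1 :> R.
  by rewrite ler_piMl ?invr_ge0 ?exprn_ge0// lern1 leq_b1.
set t := (w n)%:R / _ in b0 b1 *; rewrite e in b1 *.
by apply/andP; split; lra.
Qed.

Let mvalue : measurable_fun setT value.
Proof.
apply: (@measurable_fun_limn_sup _ _ _ setT (fun n w => partial w n)).
- move=> w _; exists 1 => _ [n _ <-]; have /andP[_ h] := partial01 w n.
  by rewrite (le_trans h)// gerBl invr_ge0 exprn_ge0.
- by move=> w _; exists 0 => _ [n _ <-]; have /andP[] := partial01 w n.
- move=> n; apply: measurable_sum => k.
  apply: measurable_funM => //.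
  apply: (measurableT_comp (f := fun b : bool => b%:R : R)) => //.
  exact: measurable_coord.
Qed.

Let value_E x : 0 <= x < 1 -> value (E x) = x.
Proof.
move=> x01.
have it n : 0 <= iter n dbl x < 1 /\ x = partial (E x) n + iter n dbl x / 2 ^+ n.
  elim: n => [|n [h0 hx]] /=; first by rewrite /partial big_ord0 add0r expr0 divr1.
  split.
    move: h0; set y := iter n dbl x; rewrite /dbl /bit => /andP[y0 y1].
    by case: (leP 2^-1 y) => /= h; rewrite ?mulr1n ?mulr0n; apply/andP; split; lra.
  rewrite {1}hx /partial big_ord_recr /= -/(partial _ n) {3}/E /orbit_seq -addrA; congr (_ + _).
  rewrite -/(bit (iter n dbl x)); set y := iter n dbl x; rewrite /dbl exprS.
  by field; rewrite expf_neq0.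
apply: (cvg_limn_inf_sup _).2.
have c2 : (fun n => x - 2^-1 ^+ n) @ \oo --> x.
  rewrite -[X in _ --> X]subr0; apply: cvgB; first exact: cvg_cst.
  by apply: cvg_expr; rewrite ger0_norm ?invr_ge0// invf_lt1 ?ltr1n.
apply: (squeeze_cvgr _ c2 (cvg_cst x)); apply: nearW => n.
have [/andP[h0 h1] e] := it n; have p : (0 : R) < 2 ^- n by rewrite invr_gt0 exprn_gt0.
have q0 : 0 <= iter n dbl x / 2 ^+ n by rewrite divr_ge0 ?exprn_ge0.
have q1 : iter n dbl x / 2 ^+ n <= 2 ^- n by rewrite ler_piMl// ltW.
rewrite exprVn; set q := _ / _ in e q0 q1; set t := 2 ^- n in q1 *.
set u := partial _ _ in e *; clearbody q t u; apply/andP; split; lra.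
Qed.

Let value_law A : measurable A -> P0 ((value \o E) @^-1` A) = P0 A.
Proof.
move=> mA; have mvE : measurable_fun setT (value \o E) by exact: measurableT_comp.
have mA' : measurable ((value \o E) @^-1` A).
  by rewrite -[X in measurable X]setTI; exact: mvE.
rewrite !uniform_prob01E//; congr (mu _).
apply/seteqP; split => x [] /=; rewrite in_itv /= => h x01; split => //.
  by move: h; rewrite value_E.
by rewrite value_E.
Qed.

Lemma ex_iid_seq d (S : measurableType d) (c : measurableTypeR R -> S) :
  measurable_fun setT c ->
  exists m : probability (seq_space S) R, forall n A,
    (forall i, measurable (A i)) ->
    m (box n A) = (\prod_(i < n) pushforward P0 c (A i))%E.
Proof.
exact: (@ex_iid R _ (measurableTypeR R) _ bool _ S P0 bit dbl mbit mdbl bit_dbl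
  value mvalue value_law).
Qed.

End uniform_iid.

Section torus.
Variable R : realType.

Definition circle := {w : R[i] | `|w| == 1}.

Let one_circle : `|1 : R[i]| == 1. Proof. by rewrite normr1. Qed.
HB.instance Definition _ := Choice.on circle.
HB.instance Definition _ := isPointed.Build circle (exist _ 1 one_circle).

Definition circle_borel : set (set circle) :=
  preimage_set_system setT (fun w : circle => val w : R[i]^o) open.

Definition circle_space := g_sigma_algebraType circle_borel.
HB.instance Definition _ := Measurable.on circle_space.

Let normr_expi (t : R) : `|cos t +i* sin t| == 1.
Proof. by rewrite normc_def /= cos2Dsin2 sqrtr1. Qed.

Definition angle (t : measurableTypeR R) : circle_space :=
  exist _ (cos (2 * pi * t) +i* sin (2 * pi * t)) (normr_expi _).

(* normalized arc length *)
Definition arc_measure : set circle_space -> \bar R :=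
  pushforward (uniform_prob (@ltr01 R)) angle.

Let continuous_expi : continuous (fun t : R => cos t +i* sin t : R[i]^o).
Proof.
move=> t; apply/cvgrPdist_lt => -[e e'] e0.
have [-> {}e0] : e' = 0 /\ 0 < e by move: e0; rewrite ltcE /= => /andP[/eqP -> ->].
have e2 : 0 < e / 2 by rewrite divr_gt0.
have /cvgrPdist_lt/(_ _ e2) hc := @continuous_cos R t.
have /cvgrPdist_lt/(_ _ e2) hs := @continuous_sin R t.
near=> s.
rewrite (_ : _ - _ = (cos t - cos s)%:C + 'i * (sin t - sin s)%:C); last first.
  by simpc.
apply: (le_lt_trans (ler_normD _ _)); rewrite normrM !normc_def /=.
rewrite !(expr0n, expr1n, addr0, add0r, sqrtr1, mul1r, sqrtr_sqr) /=.
rewrite normr1 -rmorphM mul1r -rmorphD /= ltcR [ltRHS]splitr.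
by apply: ltrD; near: s.
Unshelve. all: by end_near. Qed.

Lemma measurable_angle : measurable_fun setT angle.
Proof.
apply: (@measurability _ _ _ circle_space setT angle _ erefl).
move=> _ [_ [U oU <-] <-]; rewrite !setTI.
apply: open_measurable.
have cf : continuous (fun t : R => cos (2 * pi * t) +i* sin (2 * pi * t) : R[i]^o).
  move=> t; apply: (@continuous_comp _ _ _ (fun t : R => 2 * pi * t)
    (fun t : R => cos t +i* sin t : R[i]^o)); last exact: continuous_expi.
  exact: mulrl_continuous.
by move/continuousP : cf; apply.
Qed.

Definition torus := seq_space circle_space.
HB.instance Definition _ := Measurable.on torus.

Lemma ex_torus_measure : exists m : probability torus R, forall n A,
  (forall i, measurable (A i)) ->
  m (box n A) = (\prod_(i < n) arc_measure (A i))%E.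
Proof. exact: ex_iid_seq measurable_angle. Qed.

(* the product measure; it is determined by torus_measure_box (boxes_unique) *)
Definition torus_measure : probability torus R := sval (cid ex_torus_measure).

Lemma torus_measure_box n A : (forall i, measurable (A i)) ->
  torus_measure (box n A) = (\prod_(i < n) arc_measure (A i))%E.
Proof. exact: svalP (cid ex_torus_measure) n A. Qed.

End torus.

Section monomial_convergence.
Variable R : realType.

(* Z^(N), with N_0^(N) and N_0^k as subsets *)
Definition multi_index := {fsfun nat -> int with 0}.
Definition nonneg_index : set multi_index := [set a | forall j, 0 <= a j].
Definition nonneg_index_lt (k : nat) : set multi_index :=
  [set a | nonneg_index a /\ forall j, (k <= j)%N -> a j = 0].

Definition monomial (z : nat -> R[i]) (a : multi_index) : R[i] :=
  \prod_(j <- finsupp a) z j ^ a j.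

(* absolute convergence of the sum of u over A, with sum s *)
Definition abs_sums_to (I : choiceType) (A : set I) (u : I -> R[i]) (s : R[i]) :=
  (\esum_(i in A) (normc (u i))%:E < +oo)%E /\
  partial_sum (fun i => if i \in A then u i else 0) @ totally --> (s : R[i]^o).

Definition unit_ball : set (ell_infty R) := [set z | `|z| < 1].

(* functions on the ball are total functions whose values outside are ignored *)
Definition Hinf_ball : set (ell_infty R -> R[i]^o) :=
  [set f : ell_infty R -> R[i]^o |
           (forall z, unit_ball z -> differentiable f z) /\
           exists M : R, forall z, unit_ball z -> normc (f z : R[i]) <= M].

Definition is_monomial_coef (f : ell_infty R -> R[i]) (c : multi_index -> R[i]) :=
  forall (k : nat) (z : ell_infty R),
    unit_ball z -> (forall j, (k <= j)%N -> z j = 0) ->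
    abs_sums_to (nonneg_index_lt k) (fun a => c a * monomial z a) (f z).

(* only the values on nonneg_index are determined and used *)
Definition monomial_coef (f : ell_infty R -> R[i]) : multi_index -> R[i] :=
  xget (fun=> 0) (is_monomial_coef f).

Definition mon_Hinf_ball : set (ell_infty R) :=
  [set z | unit_ball z /\ forall f, Hinf_ball f ->
    abs_sums_to nonneg_index (fun a => monomial_coef f a * monomial z a) (f z)].

Definition torus_integral (f : torus R -> R[i]) : R[i] :=
  (\int[torus_measure R]_w complex.Re (f w)) +i* (\int[torus_measure R]_w complex.Im (f w)).

Definition Lp_torus (p : \bar R) : set (torus R -> R[i]) :=
  [set f : torus R -> R[i] | [/\ measurable_fun setT (fun w => complex.Re (f w)),
               measurable_fun setT (fun w => complex.Im (f w)) &
               (Lnorm (torus_measure R) p (fun w => (normc (f w))%:E) < +oo)%E]].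

Definition fourier_coef (f : torus R -> R[i]) (a : multi_index) : R[i] :=
  torus_integral (fun w => f w * (monomial (fun j => val (w j)) a)^-1).

Definition Hp_torus (p : \bar R) : set (torus R -> R[i]) :=
  [set f | Lp_torus p f /\ forall a, ~ nonneg_index a -> fourier_coef f a = 0].

Definition mon_Hp_torus (p : \bar R) : set (ell_infty R) :=
  [set z | unit_ball z /\ forall f, Hp_torus p f ->
    (\esum_(a in nonneg_index) (normc (fourier_coef f a * monomial z a))%:E
       < +oo)%E].

Definition decr_rearr (z : nat -> R[i]) (n : nat) : R :=
  inf [set sup [set normc (z j) | j in [set j | j \notin J]]
      | J in [set J : {fset nat} | (#|` J| < n)%N]].

Definition log_mean (z : nat -> R[i]) (n : nat) : R :=
  (ln n%:R)^-1 * \sum_(1 <= j < n.+1) decr_rearr z j ^+ 2.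

Definition B_set : set (ell_infty R) :=
  [set z | unit_ball z /\ (limn_esup (fun n => (log_mean z n)%:E) < 1)%E].

Definition Bbar_set : set (ell_infty R) :=
  [set z | unit_ball z /\ (limn_esup (fun n => (log_mean z n)%:E) <= 1)%E].

Definition ell_2 : set (ell_infty R) :=
  [set z | (\sum_(0 <= j <oo) (normc (z j) ^+ 2)%:E < +oo)%E].

End monomial_convergence.

Arguments unit_ball R : clear implicits.
Arguments mon_Hinf_ball R : clear implicits.
Arguments mon_Hp_torus R p : clear implicits.
Arguments B_set R : clear implicits.
Arguments Bbar_set R : clear implicits.
Arguments ell_2 R : clear implicits.

(* Main.v *)
(* Both sets of the first part consist of the points z of the ball such that
   sum |c_a z^a| <= C sup |sum c_a w^a|, the supremum being over the torus, for all
   polynomials (poly_majorized). Fejer means transfer this inequality to H_oo of the torus,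
   and a function f on the ball is reached through w |-> f(r w_1, ..., r w_k, 0, ...), whose
   Fourier coefficients are the monomial coefficients of f times r^|a| by Cauchy's formula.
   If the inequality fails, a sum of polynomials with disjoint spectra, separated by powers
   of one variable, has a divergent monomial series at z.
   Random polynomials of degree at most 3 in each of n variables turn the inequality into
   prod (1 + x + x^2 + x^3) <= K n log n over any n values x = |z_j|^2, whence the upper
   inclusion. For the lower one, each monomial is charged to the coordinate of its support
   where z is smallest, and the inequality sum |c_a|^2 / prod (a_j + 1) <= (int |P|)^2, which
   tensorizes Carleman's, is applied to the partial derivatives of P.
   The latter inequality also gives absolute convergence on l_2 for H_1. Conversely, if z is
   not in l_2, a sum of linear forms in disjoint blocks of variables diverges at z, and is in
   every L_p with p finite by Khintchine's inequality. *)
From HB Require Import structures.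
From mathcomp Require Import all_boot all_order all_algebra finmap complex.
From mathcomp Require Import all_classical all_reals all_analysis.
From mathcomp Require Import measurable_realfun ess_sup_inf ring lra zify.
From mathcomp.analysis.showcase Require Import summability.
Require Import Defs.
Set Implicit Arguments. Unset Strict Implicit. Unset Printing Implicit Defensive.
Import Order.TTheory GRing.Theory Num.Theory numFieldNormedType.Exports.
Import ComplexField.Normc.
Local Open Scope classical_set_scope.
Local Open Scope ring_scope.
Local Open Scope complex_scope.

(** The constants come from two computations. Let n be the number of coordinates with |z_j| >=
    |z_k|. The charge to k costs |z_k|, at most of order sqrt(log n / n), times prod 1 / (1 -
    |z_j|^2), about exp(sum |z_j|^2). This stays bounded while sum |z_j|^2 is below (1/2) log n with
    a margin, whence the factor 1 / sqrt 2 in front of [B_set]. In the other direction 1 + x + x^2 +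
    x^3 >= e^x on [0, 1], so the product over n coordinates is at least exp(sum |z_j|^2), and
    comparison with n^(1 + e) leaves sum |z_j|^2 <= (1 + e) log n + K. The inequality for
    polynomials spares an identification of the two spaces by boundary values, but on the ball it
    only yields absolute convergence. That the sum is f(z) needs z in c_0, since f is recovered from
    finitely many variables by continuity in norm; the estimate by random polynomials supplies this
    too. Carleman's inequality rests on writing an H_1 function as a product of two H_2 functions.
    Here only polynomials occur: they split into linear factors, whose square roots are approximated
    by polynomials, zeros inside the disc being reflected in the circle. *)

(** * Complex numbers: modulus, integration, topology *)

Section complex_modulus.
Variable R : realType.
Implicit Types x y z : R[i].
Local Notation Re := complex.Re.
Local Notation Im := complex.Im.

Lemma normE x : `|x| = (normc x)%:C.
Proof. by rewrite normc_def; case: x. Qed.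

Lemma cReD x y : Re (x + y) = Re x + Re y.
Proof. by case: x y => [a b] [c d]. Qed.

Lemma cImD x y : Im (x + y) = Im x + Im y.
Proof. by case: x y => [a b] [c d]. Qed.

Lemma cReM x y : Re (x * y) = Re x * Re y - Im x * Im y.
Proof. by case: x y => [a b] [c d]. Qed.

Lemma cImM x y : Im (x * y) = Re x * Im y + Im x * Re y.
Proof. by case: x y => [a b] [c d]. Qed.

Lemma cReN x : Re (- x) = - Re x.
Proof. by case: x. Qed.

Lemma cImN x : Im (- x) = - Im x.
Proof. by case: x. Qed.

Lemma Re_conjc x : Re (conjc x) = Re x.
Proof. by case: x. Qed.

Lemma Im_conjc x : Im (conjc x) = - Im x.
Proof. by case: x. Qed.

Lemma complexP x y : Re x = Re y -> Im x = Im y -> x = y.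
Proof. by case: x y => [a b] [c d] /= -> ->. Qed.

Lemma cRe_sum (I : Type) (s : seq I) (P : pred I) (F : I -> R[i]) :
  Re (\sum_(i <- s | P i) F i) = \sum_(i <- s | P i) Re (F i).
Proof. exact: (big_morph _ cReD (erefl : Re (0 : R[i]) = 0)). Qed.

Lemma cIm_sum (I : Type) (s : seq I) (P : pred I) (F : I -> R[i]) :
  Im (\sum_(i <- s | P i) F i) = \sum_(i <- s | P i) Im (F i).
Proof. exact: (big_morph _ cImD (erefl : Im (0 : R[i]) = 0)). Qed.

Lemma normcB x y : normc (x - y) <= normc x + normc y.
Proof. by rewrite (le_trans (le_normcD _ _))// normcN. Qed.

Lemma normc_distC x y : normc (x - y) = normc (y - x).
Proof. by rewrite -normcN opprB. Qed.

Lemma normc_sum (I : Type) (s : seq I) (P : pred I) (F : I -> R[i]) :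
  normc (\sum_(i <- s | P i) F i) <= \sum_(i <- s | P i) normc (F i).
Proof.
elim/big_rec2: _ => [|i x y _ h]; first by rewrite normc0.
by rewrite (le_trans (le_normcD _ _))// lerD2l.
Qed.

Lemma normc_prod (I : Type) (s : seq I) (P : pred I) (F : I -> R[i]) :
  normc (\prod_(i <- s | P i) F i) = \prod_(i <- s | P i) normc (F i).
Proof. exact: (big_morph _ (@normcM _) (@normc1 _)). Qed.

Lemma normcX x n : normc (x ^+ n) = normc x ^+ n.
Proof. by elim: n => [|n IH]; rewrite ?expr0 ?normc1// !exprS normcM IH. Qed.

Lemma normc_real (a : R) : normc (a%:C) = `|a|.
Proof. by rewrite /= expr0n addr0 sqrtr_sqr. Qed.

Lemma normc_conjc x : normc (conjc x) = normc x.
Proof. by case: x => a b /=; rewrite sqrrN. Qed.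

Lemma sqr_normcE x : normc x ^+ 2 = Re x ^+ 2 + Im x ^+ 2.
Proof. by case: x => a b /=; rewrite sqr_sqrtr// addr_ge0 ?sqr_ge0. Qed.

Lemma mulcJ x : x * conjc x = (normc x ^+ 2)%:C.
Proof.
rewrite sqr_normcE; apply: complexP; rewrite ?cReM ?cImM Re_conjc Im_conjc /=; ring.
Qed.

Lemma Re_le_normc x : `|Re x| <= normc x.
Proof.
by rewrite -(@ler_pXn2r _ 2)// ?nnegrE ?normc_ge0// sqr_normcE real_normK ?num_real// lerDl sqr_ge0.
Qed.

Lemma Im_le_normc x : `|Im x| <= normc x.
Proof.
by rewrite -(@ler_pXn2r _ 2)// ?nnegrE ?normc_ge0// sqr_normcE real_normK ?num_real// lerDr sqr_ge0.
Qed.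

Lemma normc_le_ReIm x : normc x <= `|Re x| + `|Im x|.
Proof.
rewrite -(@ler_pXn2r _ 2)// ?nnegrE ?normc_ge0 ?addr_ge0// sqr_normcE sqrrD !real_normK ?num_real//.
have : 0 <= `|Re x| * `|Im x| by rewrite mulr_ge0.
set t := _ * _ => t0; lra.
Qed.

Lemma normc_eq0 x : (normc x == 0) = (x == 0).
Proof. by apply/eqP/eqP => [/eq0_normc//|->]; rewrite normc0. Qed.

Lemma normc_gt0 x : (0 < normc x) = (x != 0).
Proof. by rewrite lt_def normc_ge0 andbT normc_eq0. Qed.

Lemma ler_normc_dist x y : `|normc x - normc y| <= normc (x - y).
Proof.
rewrite ler_norml; apply/andP; split.
  by rewrite lerNl opprB lerBlDl -{1}(subrK x y) addrC (le_trans (le_normcD _ _))// lerD2l normc_distC.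
by rewrite lerBlDl -{1}(subrK y x) addrC le_normcD.
Qed.

Lemma unimodularV x : normc x = 1 -> x^-1 = conjc x.
Proof.
move=> x1; have x0 : x != 0 by rewrite -normc_gt0 x1.
by apply: (mulfI x0); rewrite mulcJ x1 expr1n divff.
Qed.

(** The value 1 at the origin makes the modulus equal to 1 everywhere, so that phases can serve as
    directions in the polydisc without a case distinction. *)
Definition phase x : R[i] := if x == 0 then 1 else conjc x / (normc x)%:C.

Lemma normc_phase x : normc (phase x) = 1.
Proof.
rewrite /phase; case: ifPn => [_|x0]; first exact: normc1.
rewrite normcM normcV normc_conjc normc_real ger0_norm ?normc_ge0// divff//.
by rewrite normc_eq0.
Qed.

Lemma phaseM x : phase x * x = (normc x)%:C.
Proof.
rewrite /phase; case: ifPn => [/eqP ->|x0]; first by rewrite mulr0 normc0.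
rewrite mulrAC [conjc _ * _]mulrC mulcJ -fmorphV -rmorphM/= expr2 mulfK// normc_eq0//.
Qed.

End complex_modulus.

Section complex_integral.
Context d (T : measurableType d) (R : realType).
Local Notation Re := complex.Re.
Local Notation Im := complex.Im.
Implicit Types f g : T -> R[i].

Definition cmeasurable f :=
  measurable_fun setT (fun x => Re (f x)) /\ measurable_fun setT (fun x => Im (f x)).

Lemma eq_cmeasurable f g : f =1 g -> cmeasurable f -> cmeasurable g.
Proof. by move=> /funext ->. Qed.

Lemma cmeasurableD f g : cmeasurable f -> cmeasurable g ->
  cmeasurable (fun x => f x + g x).
Proof.
move=> [f1 f2] [g1 g2]; split.
  by under eq_fun do rewrite cReD; exact: measurable_funD.
by under eq_fun do rewrite cImD; exact: measurable_funD.
Qed.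

Lemma cmeasurableM f g : cmeasurable f -> cmeasurable g ->
  cmeasurable (fun x => f x * g x).
Proof.
move=> [f1 f2] [g1 g2]; split.
  by under eq_fun do rewrite cReM; apply: measurable_funB; exact: measurable_funM.
by under eq_fun do rewrite cImM; apply: measurable_funD; exact: measurable_funM.
Qed.

Lemma cmeasurableJ f : cmeasurable f -> cmeasurable (fun x => conjc (f x)).
Proof.
move=> [f1 f2]; split; first by under eq_fun do rewrite Re_conjc.
by under eq_fun do rewrite Im_conjc; exact: measurable_funN.
Qed.

Lemma cmeasurable_cst c : cmeasurable (fun=> c).
Proof. by []. Qed.

Lemma cmeasurable_real (f : T -> R) : measurable_fun setT f -> cmeasurable (fun x => (f x)%:C).
Proof. by []. Qed.

Lemma cmeasurable_sum (I : Type) (s : seq I) (F : I -> T -> R[i]) :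
  (forall i, cmeasurable (F i)) -> cmeasurable (fun x => \sum_(i <- s) F i x).
Proof.
move=> mF; elim: s => [|i s IH]; first by under eq_fun do rewrite big_nil.
by under eq_fun do rewrite big_cons; exact: cmeasurableD.
Qed.

Lemma cmeasurable_prod (I : Type) (s : seq I) (F : I -> T -> R[i]) :
  (forall i, cmeasurable (F i)) -> cmeasurable (fun x => \prod_(i <- s) F i x).
Proof.
move=> mF; elim: s => [|i s IH]; first by under eq_fun do rewrite big_nil.
by under eq_fun do rewrite big_cons; exact: cmeasurableM.
Qed.

Lemma cmeasurableX f n : cmeasurable f -> cmeasurable (fun x => f x ^+ n).
Proof.
move=> mf; elim: n => [|n IH]; first by under eq_fun do rewrite expr0.
by under eq_fun do rewrite exprS; exact: cmeasurableM.
Qed.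

Lemma cmeasurableXz f (k : int) : (forall x, normc (f x) = 1) -> cmeasurable f ->
  cmeasurable (fun x => f x ^ k).
Proof.
move=> f1 mf; case: k => n; first exact: cmeasurableX.
apply: (@eq_cmeasurable (fun x => conjc (f x) ^+ n.+1)).
  by move=> x; rewrite NegzE -exprnN -exprVn (unimodularV (f1 x)).
by apply: cmeasurableX; exact: cmeasurableJ.
Qed.

Lemma measurable_normc f : cmeasurable f -> measurable_fun setT (fun x => normc (f x)).
Proof.
move=> [f1 f2].
rewrite (_ : (fun x => _) = Num.sqrt \o (fun x => Re (f x) ^+ 2 + Im (f x) ^+ 2)); last first.
  by apply/funext => x /=; case: (f x).
apply: measurableT_comp.
  by apply: continuous_measurable_fun; exact: sqrt_continuous.
by apply: measurable_funD; exact: measurable_funX.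
Qed.

Lemma cmeasurable_comp d' (T' : measurableType d') (h : T' -> T) f :
  measurable_fun setT h -> cmeasurable f ->
  measurable_fun setT (fun x => Re (f (h x))) /\ measurable_fun setT (fun x => Im (f (h x))).
Proof.
move=> mh [f1 f2]; split.
  exact: (measurableT_comp f1 mh).
exact: (measurableT_comp f2 mh).
Qed.

Variable mu : probability T R.

Definition cintegral f : R[i] := (\int[mu]_x Re (f x)) +i* (\int[mu]_x Im (f x)).

Definition cintegrable f :=
  mu.-integrable setT (fun x => (Re (f x))%:E) /\ mu.-integrable setT (fun x => (Im (f x))%:E).

Lemma cintegrable_meas f : cintegrable f -> cmeasurable f.
Proof.
by move=> [f1 f2]; split; [have /measurable_int/measurable_EFinP := f1|
  have /measurable_int/measurable_EFinP := f2].
Qed.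

Lemma integrable_le (f g : T -> R) : measurable_fun setT f ->
  (forall x, `|f x| <= g x) -> mu.-integrable setT (EFin \o g) ->
  mu.-integrable setT (EFin \o f).
Proof.
move=> mf fg ig; apply: (le_integrable measurableT) ig => //.
  exact/measurable_EFinP.
by move=> x _; rewrite /= lee_fin (le_trans (fg x))// ler_norm.
Qed.

Lemma integrable_bounded (f : T -> R) M : measurable_fun setT f ->
  (forall x, `|f x| <= M) -> mu.-integrable setT (EFin \o f).
Proof.
move=> mf fM; apply: (integrable_le mf fM).
by apply: (@finite_measure_integrable_cst _ _ _ mu).
Qed.

Lemma cintegrable_normcP f : cmeasurable f ->
  (cintegrable f <-> mu.-integrable setT (fun x => (normc (f x))%:E)).
Proof.
move=> mf; have [f1 f2] := mf; split.
  move=> [i1 i2].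
  apply: (@integrable_le (fun x => normc (f x)) (fun x => `|Re (f x)| + `|Im (f x)|)).
  - exact: measurable_normc.
  - by move=> x; rewrite ger0_norm ?normc_ge0// normc_le_ReIm.
  - exact: (integrableD measurableT (integrable_abse i1) (integrable_abse i2)).
move=> i; split.
- apply: (@integrable_le _ (fun x => normc (f x))) => // x; exact: Re_le_normc.
- apply: (@integrable_le _ (fun x => normc (f x))) => // x; exact: Im_le_normc.
Qed.

Lemma cintegrable_normc f : cintegrable f -> mu.-integrable setT (fun x => (normc (f x))%:E).
Proof. by move=> i; exact: (cintegrable_normcP (cintegrable_meas i)).1. Qed.

Lemma cintegrable_bounded f M : cmeasurable f -> (forall x, normc (f x) <= M) ->
  cintegrable f.
Proof.
move=> [f1 f2] fM; split; apply: (@integrable_bounded _ M) => // x.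
  exact: le_trans (Re_le_normc _) _.
exact: le_trans (Im_le_normc _) _.
Qed.

Lemma eq_cintegrable f g : f =1 g -> cintegrable f -> cintegrable g.
Proof. by move=> /funext ->. Qed.

Lemma cintegrableM_bounded f g M : cintegrable f -> cmeasurable g ->
  (forall x, normc (g x) <= M) -> cintegrable (fun x => f x * g x).
Proof.
move=> i mg gM; have mf := cintegrable_meas i.
apply/cintegrable_normcP; first exact: cmeasurableM.
apply: (@integrable_le _ (fun x => M * normc (f x))).
- by apply: measurable_normc; exact: cmeasurableM.
- by move=> x; rewrite ger0_norm ?normc_ge0// normcM mulrC ler_wpM2r ?normc_ge0.
- exact: (integrableZl measurableT M (cintegrable_normc i)).
Qed.

Lemma cintegrable_cst c : cintegrable (fun=> c).
Proof. by apply: (@cintegrable_bounded _ (normc c)). Qed.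

Lemma cintegrableD f g : cintegrable f -> cintegrable g -> cintegrable (fun x => f x + g x).
Proof.
move=> [f1 f2] [g1 g2]; split.
  by under eq_fun do rewrite cReD EFinD; apply: integrableD.
by under eq_fun do rewrite cImD EFinD; apply: integrableD.
Qed.

Lemma cintegrableZ c f : cintegrable f -> cintegrable (fun x => c * f x).
Proof.
move=> i; under eq_fun do rewrite mulrC.
exact: (@cintegrableM_bounded _ _ (normc c)).
Qed.

Lemma cintegrableN f : cintegrable f -> cintegrable (fun x => - f x).
Proof. by move=> i; under eq_fun do rewrite -mulN1r; exact: cintegrableZ. Qed.

Lemma cintegrableB f g : cintegrable f -> cintegrable g -> cintegrable (fun x => f x - g x).
Proof. by move=> i j; apply: cintegrableD => //; exact: cintegrableN. Qed.

Lemma cintegrable_sum (I : Type) (s : seq I) (F : I -> T -> R[i]) :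
  (forall i, cintegrable (F i)) -> cintegrable (fun x => \sum_(i <- s) F i x).
Proof.
move=> mF; elim: s => [|i s IH].
  by under eq_fun do rewrite big_nil; exact: cintegrable_cst.
by under eq_fun do rewrite big_cons; exact: cintegrableD.
Qed.

Lemma eq_cintegral f g : f =1 g -> cintegral f = cintegral g.
Proof. by move=> fg; rewrite (_ : f = g)//; exact/funext. Qed.

Lemma cintegralD f g : cintegrable f -> cintegrable g ->
  cintegral (fun x => f x + g x) = cintegral f + cintegral g.
Proof.
move=> [f1 f2] [g1 g2]; apply: complexP => /=.
  by under eq_Rintegral do rewrite cReD; rewrite RintegralD.
by under eq_Rintegral do rewrite cImD; rewrite RintegralD.
Qed.

Lemma cintegralZ c f : cintegrable f -> cintegral (fun x => c * f x) = c * cintegral f.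
Proof.
move=> [f1 f2]; have iZ (a : R) (h : T -> R) : mu.-integrable setT (EFin \o h) ->
    mu.-integrable setT (EFin \o (fun x => a * h x)).
  by move=> ih; exact: (integrableZl measurableT a ih).
apply: complexP; rewrite ?cReM ?cImM /=.
  by under eq_Rintegral do rewrite cReM; rewrite RintegralB ?RintegralZl//; exact: iZ.
by under eq_Rintegral do rewrite cImM; rewrite RintegralD ?RintegralZl//; exact: iZ.
Qed.

Lemma cintegralN f : cintegrable f -> cintegral (fun x => - f x) = - cintegral f.
Proof.
move=> i; rewrite -mulN1r -cintegralZ//.
by apply: eq_cintegral => x; rewrite mulN1r.
Qed.

Lemma cintegralB f g : cintegrable f -> cintegrable g ->
  cintegral (fun x => f x - g x) = cintegral f - cintegral g.
Proof. by move=> i j; rewrite cintegralD ?cintegralN//; exact: cintegrableN. Qed.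

Lemma Rintegral_prob_cst (r : R) : \int[mu]_(x in setT) r = r.
Proof.
rewrite Rintegral_cst// -[RHS]mulr1; congr (_ * _).
exact: (congr1 fine (probability_setT mu)).
Qed.

Lemma cintegral_cst c : cintegral (fun=> c) = c.
Proof.
by apply: complexP; exact: Rintegral_prob_cst.
Qed.

Lemma cintegral_sum (I : Type) (s : seq I) (F : I -> T -> R[i]) :
  (forall i, cintegrable (F i)) ->
  cintegral (fun x => \sum_(i <- s) F i x) = \sum_(i <- s) cintegral (F i).
Proof.
move=> iF; elim: s => [|i s IH].
  by rewrite big_nil -[RHS]cintegral_cst; apply: eq_cintegral => x; rewrite big_nil.
rewrite big_cons -IH -cintegralD//; last exact: cintegrable_sum.
by apply: eq_cintegral => x; rewrite big_cons.
Qed.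

Lemma normc_cintegral_le f : cintegrable f ->
  normc (cintegral f) <= \int[mu]_x normc (f x).
Proof.
move=> i; set I := cintegral f.
(* Rotating the integral to the positive axis reduces the inequality to one between real integrals,
   as the real part of the rotated integrand is at most its modulus. *)
have iu : cintegrable (fun x => phase I * f x) by exact: cintegrableZ.
have -> : normc I = \int[mu]_x Re (phase I * f x).
  by have := phaseM I; rewrite -cintegralZ// => -[].
apply: le_Rintegral => //.
- by case: iu.
- exact: cintegrable_normc.
- move=> x _; apply: le_trans (ler_norm _) _; apply: le_trans (Re_le_normc _) _.
  by rewrite normcM normc_phase mul1r.
Qed.

Lemma normc_cintegral_bound f M : cmeasurable f -> (forall x, normc (f x) <= M) ->
  normc (cintegral f) <= M.
Proof.
move=> mf fM; have i := cintegrable_bounded mf fM.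
apply: le_trans (normc_cintegral_le i) _.
rewrite -[leRHS]Rintegral_prob_cst; apply: le_Rintegral => //.
- exact: cintegrable_normc.
- exact: (@finite_measure_integrable_cst _ _ _ mu).
Qed.

End complex_integral.

Section complex_topology.
Variable R : realType.
Local Notation Re := complex.Re.
Local Notation Im := complex.Im.

Lemma complex_ltc0 (e : R[i]) : 0 < e -> exists2 e' : R, 0 < e' & e = e'%:C.
Proof.
by case: e => a b; rewrite ltcE /= => /andP[/eqP -> a0]; exists a.
Qed.

Lemma nbhs_normcP (z : R[i]^o) (A : set R[i]^o) : nbhs z A <->
  exists2 e : R, 0 < e & forall y, normc (z - y : R[i]) < e -> A y.
Proof.
split.
  move=> /nbhs_ballP[e /= e0 h]; have [e' e'0 ee] := complex_ltc0 e0.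
  by exists e' => // y zy; apply: h; rewrite /ball /= normE ee ltcR.
move=> [e e0 h]; apply/nbhs_ballP; exists e%:C => /=; first by rewrite ltcR.
by move=> y; rewrite /ball /= normE ltcR; exact: h.
Qed.

Lemma cvgc_normP (T : Type) (F : set_system T) {FF : Filter F} (f : T -> R[i]^o) (l : R[i]^o) :
  f @ F --> l <-> forall e : R, 0 < e -> \forall x \near F, normc (l - f x : R[i]) < e.
Proof.
split.
  by move=> fl e e0; apply: (fl [set y | normc (l - y : R[i]) < e]); apply/nbhs_normcP; exists e.
move=> h A /nbhs_normcP[e e0 hA].
by apply: (@filterS _ F FF _ _ _ (h e e0)) => x; exact: hA.
Qed.

Lemma continuous_Re : continuous (fun z : R[i]^o => Re z).
Proof.
move=> z; apply/(cvgrPdist_lt (FF := nbhs_filter z)) => e e0; apply/nbhs_normcP; exists e => // y zy.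
by apply: le_lt_trans zy; rewrite -cReN -cReD; exact: Re_le_normc.
Qed.

Lemma continuous_Im : continuous (fun z : R[i]^o => Im z).
Proof.
move=> z; apply/(cvgrPdist_lt (FF := nbhs_filter z)) => e e0; apply/nbhs_normcP; exists e => // y zy.
by apply: le_lt_trans zy; rewrite -cImN -cImD; exact: Im_le_normc.
Qed.

End complex_topology.

(** * Coordinates on the torus *)

Section torus_coordinates.
Variable R : realType.
Local Notation Re := complex.Re.
Local Notation Im := complex.Im.

Definition tval (w : torus R) : nat -> R[i] := fun j => val (w j).

Lemma normc_circle (c : circle R) : normc (val c) = 1.
Proof. by have /eqP := valP c; rewrite normE => /complexI. Qed.

Lemma normc_tval w j : normc (tval w j) = 1.
Proof. exact: normc_circle. Qed.

Lemma tval_neq0 w j : tval w j != 0.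
Proof. by rewrite -normc_gt0 normc_tval. Qed.

Lemma measurable_open_circle (h : R[i]^o -> R) : continuous h ->
  measurable_fun setT (fun c : circle_space R => h (val c)).
Proof.
move=> ch; apply: (@measurability _ _ _ _ setT _ _ (RGenOInfty.measurableE R)).
move=> _ [_ [x ->] <-]; rewrite setTI.
apply: sub_sigma_algebra; exists (h @^-1` `]x, +oo[%classic); last by rewrite setTI.
by move/continuousP : ch; apply; exact: interval_open.
Qed.

Lemma cmeasurable_circle : cmeasurable (fun c : circle_space R => val c).
Proof.
by split; apply: measurable_open_circle; [exact: continuous_Re|exact: continuous_Im].
Qed.

Lemma cmeasurable_tval j : cmeasurable (fun w : torus R => tval w j).
Proof.
exact: (cmeasurable_comp (@measurable_coord _ (circle_space R) j) cmeasurable_circle).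
Qed.

Definition upd (w : torus R) (j : nat) (c : circle_space R) : torus R :=
  fun i => if i == j then c else w i.

Definition P01 : probability (measurableTypeR R) R := uniform_prob (@ltr01 R).

Let updp j (p : measurableTypeR R * torus R) : torus R := upd p.2 j (angle p.1).

Let measurable_updp j : measurable_fun setT (updp j).
Proof.
apply: measurable_to_seq => i; rewrite /updp /upd.
case: (i == j).
  by apply: (measurableT_comp (@measurable_angle R)); exact: measurable_fst.
by apply: (measurableT_comp (@measurable_coord _ (circle_space R) i)); exact: measurable_snd.
Qed.

Lemma measurable_upd j w : measurable_fun setT (fun t : measurableTypeR R => upd w j (angle t)).
Proof.
have := @measurable_updp j => mj.
rewrite (_ : (fun t => _) = updp j \o (fun t => (t, w)))//.
by apply: measurableT_comp => //; exact: measurable_fun_pair.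
Qed.

(** On a box the condition on coordinate [j] separates from the others: the first has its arc
    measure, the rest form a box that leaves [j] free. Boxes determine the measure. This is the
    independence of the coordinates in the form used below. *)
Let law j (X : set (torus R)) : measurable X ->
  pushforward (P01 \x torus_measure R)%E (updp j) X = torus_measure R X.
Proof.
pose m1 := [the measure _ _ of pushforward (P01 \x torus_measure R)%E (updp j)].
move=> mX; apply: (@boxes_unique _ _ _ (m1 (measurable_updp j)) (torus_measure R)) mX; last first.
  rewrite /m1/= /pushforward preimage_setT.
  by rewrite [X in (X < _)%E](probability_setT (P01 \x torus_measure R)%E) ltry.
move=> _ [n [A [mA ->]]].
(* The box is padded so that [j] is one of its coordinates. *)
pose N := maxn n j.+1.
pose A' i := if (i < n)%N then A i else setT.
have jN : (j < N)%N by rewrite leq_maxr.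
have mA' i : measurable (A' i) by rewrite /A'; case: ifP.
rewrite (box_pad A (leq_maxl n j.+1)) -/N -/A'.
pose B i := if i == j then setT else A' i.
have mB i : measurable (B i) by rewrite /B; case: ifP.
rewrite /m1/= /pushforward.
have -> : updp j @^-1` box N A' = (angle (R := R) @^-1` A' j) `*` box N B.
  apply/seteqP; split => -[t w] /=.
    move=> h; split; first by have := h j jN; rewrite /updp /upd eqxx.
    by move=> i iN; rewrite /B; case: ifPn => // /negbTE ij; have := h i iN; rewrite /updp /upd ij.
  move=> [h1 h2] i iN; rewrite /updp /upd /=; case: ifPn => [/eqP ->//|/negbTE ij].
  by have := h2 i iN; rewrite /B ij.
rewrite product_measure1E//; last 2 first.
- by rewrite -[X in measurable X]setTI; exact: measurable_angle.
- exact: measurable_box.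
transitivity (arc_measure (A' j) * torus_measure R (box N B))%E; first by [].
rewrite !torus_measure_box// (bigD1 (Ordinal jN))//= [in RHS](bigD1 (Ordinal jN))//=.
have -> : B j = setT by rewrite /B eqxx.
have -> : arc_measure [set: circle_space R] = 1%E.
  by rewrite /arc_measure /pushforward preimage_setT; exact: (probability_setT P01).
rewrite mul1e; congr (_ * _)%E; apply: eq_bigr => i ij.
rewrite /B; case: ifPn => // /eqP eij; exfalso; move/eqP: ij; apply; exact/val_inj.
Qed.

(** Fubini for the product of the uniform law and the torus, transported by [law]. The inductions
    over variables below rest on it. *)
Lemma resample_real j (f : torus R -> R) M : measurable_fun setT f -> (forall w, `|f w| <= M) ->
  measurable_fun setT (fun w => \int[P01]_t f (upd w j (angle t))) /\
  \int[torus_measure R]_w f w = \int[torus_measure R]_w \int[P01]_t f (upd w j (angle t)).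
Proof.
move=> mf fM.
have mfu : measurable_fun setT (f \o updp j) by apply: measurableT_comp => //.
pose PP : probability (measurableTypeR R * torus R)%type R := (P01 \x torus_measure R)%E.
have ifu : PP.-integrable setT (EFin \o (f \o updp j)).
  apply: (le_integrable measurableT (f := EFin \o (f \o updp j)) (g := fun=> M%:E)) => //.
  - exact/measurable_EFinP.
  - by move=> x _; rewrite /= lee_fin (le_trans (fM _))// ler_norm.
  - exact: (@finite_measure_integrable_cst _ _ _ PP).
have mG := measurable_fubini_G ifu.
have GE w : fubini_G P01 (EFin \o (f \o updp j)) w = (\int[P01]_t f (upd w j (angle t)))%:E.
  rewrite /fubini_G /Rintegral fineK//; apply: integrable_fin_num => //.
  apply: (@integrable_bounded _ _ _ P01 _ M) => //.
  exact: measurableT_comp (measurable_upd j w).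
have mG' : measurable_fun setT (fun w => \int[P01]_t f (upd w j (angle t))).
  by apply/measurable_EFinP; rewrite (_ : EFin \o _ = fubini_G P01 (EFin \o (f \o updp j)))//; apply/funext => w; rewrite GE.
split => //.
rewrite /Rintegral; congr fine.
have -> : (\int[torus_measure R]_w (f w)%:E = \int[pushforward PP (updp j)]_w (f w)%:E)%E.
  by apply: eq_measure_integral => X mX _; exact/esym/law.
rewrite integral_pushforward//; last exact/measurable_EFinP.
rewrite preimage_setT -(integral21_prod_meas1 ifu).
by apply: eq_integral => w _; rewrite GE.
Qed.
End torus_coordinates.


(** * Resampling a coordinate of the torus *)

Section complex_resample.
Variable R : realType.
Local Notation Re := complex.Re.
Local Notation Im := complex.Im.

Lemma resample j (f : torus R -> R[i]) M : cmeasurable f -> (forall w, normc (f w) <= M) ->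
  cmeasurable (fun w => cintegral (P01 R) (fun t => f (upd w j (angle t)))) /\
  cintegral (torus_measure R) f =
    cintegral (torus_measure R) (fun w => cintegral (P01 R) (fun t => f (upd w j (angle t)))).
Proof.
move=> [f1 f2] fM.
have b1 w : `|Re (f w)| <= M by exact: le_trans (Re_le_normc _) (fM w).
have b2 w : `|Im (f w)| <= M by exact: le_trans (Im_le_normc _) (fM w).
have [m1 e1] := resample_real j f1 b1.
have [m2 e2] := resample_real j f2 b2.
by split => //; apply: complexP.
Qed.

Lemma tval_upd (w : torus R) j (c : circle R) i : tval (upd w j c) i = if i == j then val c else tval w i.
Proof. by rewrite /tval /upd; case: ifP. Qed.

End complex_resample.

(** * Real integrals over an interval *)

Section real_interval_integral.
Variable R : realType.
Local Notation mu := (@lebesgue_measure R).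
Implicit Types (f F : R -> R) (a b m x M : R).

Lemma Rintegral_P01 f M : measurable_fun setT f -> (forall x, `|f x| <= M) ->
  \int[P01 R]_x f x = \int[mu]_(x in `[0, 1]) f x.
Proof.
move=> mf fM.
have iP : (P01 R).-integrable setT (EFin \o f) by apply: (@integrable_bounded _ _ _ (P01 R) _ M).
have fin1 : (mu `[0%R, 1%R]%classic < +oo)%E by rewrite /= lebesgue_measure_itv /= lte_fin ltr01 -EFinD ltry.
have icst (r : R) : mu.-integrable `[0, 1]%classic (EFin \o (fun=> r)).
  by apply: measurable_bounded_integrable => //; exact: bounded_cst.
have iL : mu.-integrable `[0, 1]%classic (EFin \o f).
  apply: (le_integrable _ _ _ (icst M)) => //; first exact/measurable_EFinP/measurable_funTS.
  by move=> x _; rewrite /= lee_fin (le_trans (fM _))// ler_norm.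
have iPM : (P01 R).-integrable setT (EFin \o (fun=> M)).
  exact: (@finite_measure_integrable_cst _ _ _ (P01 R)).
(* Adding the bound [M] makes the integrand nonnegative, as the formula for the uniform law
   requires. *)
apply: (addIr M).
have eP : M = \int[P01 R]_x M by rewrite Rintegral_prob_cst.
rewrite [X in _ + X = _]eP.
have eM : M = \int[mu]_(x in `[0, 1]) M.
  by rewrite Rintegral_cst//= lebesgue_measure_itv /= lte_fin ltr01 -EFinD/= subr0 mulr1.
rewrite [X in _ = _ + X]eM.
rewrite -!RintegralD//.
rewrite /Rintegral; congr fine.
rewrite integral_uniform ?subr0 ?invr1 ?mul1e//.
  by apply/measurable_EFinP; apply: measurable_funD.
move=> x; rewrite lee_fin -lerBlDr sub0r lerNl.
by rewrite (le_trans _ (fM x))// -normrN ler_norm.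
Qed.

Lemma within_continuous f a b : {in `[a, b], continuous f} -> {within `[a, b], continuous f}.
Proof. by move=> cf; apply: continuous_in_subspaceT => x /set_mem; exact: cf. Qed.

Lemma integrable_continuous f a b : {in `[a, b], continuous f} ->
  mu.-integrable `[a, b]%classic (EFin \o f).
Proof.
by move=> cf; apply: continuous_compact_integrable; [exact: segment_compact|exact: within_continuous].
Qed.

Lemma Rintegral_FTC f F a b : a <= b -> {in `[a, b], continuous f} ->
  (forall x : R, is_derive x (1 : R) F (f x)) -> \int[mu]_(x in `[a, b]) f x = F b - F a.
Proof.
rewrite le_eqVlt => /predU1P[->|ab] cf dF.
  by rewrite subrr set_itv1 Rintegral_set1.
have cF x : {for x, continuous F}.
  apply: differentiable_continuous; apply/derivable1_diffP.
  by have [] := dF x.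
rewrite /Rintegral (continuous_FTC2 (F := F) ab)//.
- exact: within_continuous.
- split; first by move=> x _; have [] := dF x.
    by apply: cvg_at_right_filter; exact: cF.
  by apply: cvg_at_left_filter; exact: cF.
- by move=> x _; rewrite derive1E; have [_] := dF x.
Qed.

Lemma Rintegral_le_norm f a b M : a <= b -> {in `[a, b], continuous f} ->
  (forall x, a <= x <= b -> `|f x| <= M) -> `|\int[mu]_(x in `[a, b]) f x| <= M * (b - a).
Proof.
move=> ab cf fM; have i := integrable_continuous cf.
apply: le_trans (le_normr_Rintegral _ i) _ => //.
have -> : M * (b - a) = \int[mu]_(x in `[a, b]) M.
  rewrite Rintegral_cst//= lebesgue_measure_itv /= lte_fin.
  by case: ltP ab => [_ _|ba ab]; rewrite ?EFinB//= (@le_anti _ _ a b) ?ab// subrr.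
apply: le_Rintegral => //; first exact: integrable_abse i.
by apply: integrable_continuous => x _; exact: cvg_cst.
Qed.

Lemma Rintegral_split f a m b : a <= m -> m <= b -> {in `[a, b], continuous f} ->
  \int[mu]_(x in `[a, b]) f x = \int[mu]_(x in `[a, m]) f x + \int[mu]_(x in `[m, b]) f x.
Proof.
move=> am mb cf; have i := integrable_continuous cf.
have am' : (BLeft a <= BRight m)%O by rewrite bnd_simp.
have mb' : (BRight m <= BRight b)%O by rewrite bnd_simp.
have := Rintegral_itvB i am' mb'.
rewrite Rintegral_itv_obnd_cbnd; last first.
  by apply: integrableS i => //; apply: subset_itvr; rewrite bnd_simp.
by move=> <-; rewrite addrC subrK.
Qed.

End real_interval_integral.

(** * Goursat's bisection argument *)

Section bisection.
Variable R : realType.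

Lemma exists_pow2_gt (x d : R) : 0 < d -> exists n, x / 2 ^+ n < d.
Proof.
move=> d0; exists (Num.bound (`|x| / d)).
have := archi_boundP (divr_ge0 (normr_ge0 x) (ltW d0)).
set N := Num.bound _ => hN.
rewrite ltr_pdivrMr ?exprn_gt0// mulrC -ltr_pdivrMr//.
apply: le_lt_trans (_ : x / d <= `|x| / d) _; first by rewrite ler_pM2r ?invr_gt0// ler_norm.
apply: lt_trans hN _; rewrite -natrX ltr_nat; exact: ltn_expl.
Qed.

Lemma nested_intervals (u v : nat -> R) : nondecreasing_seq u -> nonincreasing_seq v ->
  (forall n, u n <= v n) -> exists x, forall n, u n <= x <= v n.
Proof.
move=> iu dv uv.
have h m n : u m <= v n.
  apply: (le_trans (iu _ _ (leq_maxl m n))); apply: (le_trans (uv _)).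
  exact: dv (leq_maxr m n).
have hb : has_ubound (range u) by exists (v 0%N) => _ [n _ <-].
exists (sup (range u)) => n; apply/andP; split.
  by apply: ub_le_sup => //; exists n.
by apply: ge_sup; [exists (u 0%N); exists 0%N|move=> _ [m _ <-]].
Qed.

Record rect := Rect { rl : R; rr : R; rb : R; rt : R }.

(** [E] stands for an integral round the boundary of a rectangle. The argument only uses its
    additivity and its smallness on rectangles that shrink to a point, so it does not depend on the
    form that is integrated. *)
Variable E : R -> R -> R -> R -> R[i].
Variables a b c d : R.
Hypotheses (ab : a <= b) (cd : c <= d).
Hypothesis E_split1 : forall x1 m x2 y1 y2, a <= x1 -> x1 <= m -> m <= x2 -> x2 <= b ->
  c <= y1 -> y1 <= y2 -> y2 <= d -> E x1 x2 y1 y2 = E x1 m y1 y2 + E m x2 y1 y2.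
Hypothesis E_split2 : forall x1 x2 y1 m y2, a <= x1 -> x1 <= x2 -> x2 <= b ->
  c <= y1 -> y1 <= m -> m <= y2 -> y2 <= d -> E x1 x2 y1 y2 = E x1 x2 y1 m + E x1 x2 m y2.
Hypothesis E_local : forall x y, a <= x <= b -> c <= y <= d -> forall e, 0 < e ->
  exists2 del, 0 < del & forall x1 x2 y1 y2, a <= x1 -> x1 <= x -> x <= x2 -> x2 <= b ->
  c <= y1 -> y1 <= y -> y <= y2 -> y2 <= d -> x2 - x1 < del -> y2 - y1 < del ->
  normc (E x1 x2 y1 y2) <= e * ((x2 - x1) + (y2 - y1)) ^+ 2.

Let valid p := [/\ a <= rl p, rl p <= rr p, rr p <= b & [/\ c <= rb p, rb p <= rt p & rt p <= d]].
Let N p := normc (E (rl p) (rr p) (rb p) (rt p)).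
Let mid (x y : R) := (x + y) / 2.

Let quarter (i : bool * bool) p :=
  Rect (if i.1 then mid (rl p) (rr p) else rl p) (if i.1 then rr p else mid (rl p) (rr p))
       (if i.2 then mid (rb p) (rt p) else rb p) (if i.2 then rt p else mid (rb p) (rt p)).

(** For a valid [p] the default never occurs: by additivity and the triangle inequality one of the
    quarters carries at least a quarter of the modulus. *)
Let step p := if [pick i | N p / 4 <= N (quarter i p)] is Some i then quarter i p else p.

Let stepP p : valid p -> [/\ valid (step p), N p / 4 <= N (step p),
  rr (step p) - rl (step p) = (rr p - rl p) / 2, rt (step p) - rb (step p) = (rt p - rb p) / 2 &
  [/\ rl p <= rl (step p), rr (step p) <= rr p, rb p <= rb (step p) & rt (step p) <= rt p]].
Proof.
move=> [h1 h2 h3 [h4 h5 h6]].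
have m1 : rl p <= mid (rl p) (rr p) by rewrite /mid; lra.
have m2 : mid (rl p) (rr p) <= rr p by rewrite /mid; lra.
have m3 : rb p <= mid (rb p) (rt p) by rewrite /mid; lra.
have m4 : mid (rb p) (rt p) <= rt p by rewrite /mid; lra.
rewrite /step; case: pickP => [i hi|h].
  split=> //.
  - by case: i hi => -[] [] _; split => //=; rewrite ?(le_trans h1)// ?(le_trans m2)//;
      split => //=; rewrite ?(le_trans h4)// ?(le_trans m4).
  - by rewrite /=; case: (i.1); rewrite /mid; field.
  - by rewrite /=; case: (i.2); rewrite /mid; field.
  - by case: i hi => -[] [].
exfalso.
have k i : N (quarter i p) < N p / 4 by rewrite ltNge h.
have := k (false, false); have := k (false, true); have := k (true, false); have := k (true, true).
rewrite /N /=.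
set A := E (rl p) (rr p) (rb p) (rt p); set m := mid (rl p) _; set n := mid (rb p) _.
have e1 : A = E (rl p) m (rb p) (rt p) + E m (rr p) (rb p) (rt p) by apply: E_split1.
have e2 : E (rl p) m (rb p) (rt p) = E (rl p) m (rb p) n + E (rl p) m n (rt p).
  by apply: E_split2 => //; exact: le_trans m2 h3.
have e3 : E m (rr p) (rb p) (rt p) = E m (rr p) (rb p) n + E m (rr p) n (rt p).
  by apply: E_split2 => //; exact: le_trans h1 m1.
rewrite e1 e2 e3.
have t1 := le_normcD (E (rl p) m (rb p) n + E (rl p) m n (rt p)) (E m (rr p) (rb p) n + E m (rr p) n (rt p)).
have t2 := le_normcD (E (rl p) m (rb p) n) (E (rl p) m n (rt p)).
have t3 := le_normcD (E m (rr p) (rb p) n) (E m (rr p) n (rt p)).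
lra.
Qed.

(** The nested rectangles shrink to a point (x, y). The local estimate there gives a bound e (L /
    2^n)^2 for a quantity that is at least |E| / 4^n. *)
Lemma bisection_eq0 : E a b c d = 0.
Proof.
pose p n := iter n step (Rect a b c d).
have vp n : valid (p n) by elim: n => [|n IH] //=; have [] := stepP IH.
have sE n : p n.+1 = step (p n) by [].
have pX n : rr (p n) - rl (p n) = (b - a) / 2 ^+ n.
  elim: n => [|n IH]; first by rewrite expr0 divr1.
  by rewrite sE; have [_ _ -> _ _] := stepP (vp n); rewrite IH exprS invfM; ring.
have pY n : rt (p n) - rb (p n) = (d - c) / 2 ^+ n.
  elim: n => [|n IH]; first by rewrite expr0 divr1.
  by rewrite sE; have [_ _ _ -> _] := stepP (vp n); rewrite IH exprS invfM; ring.
have pN n : normc (E a b c d) / 4 ^+ n <= N (p n).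
  elim: n => [|n IH]; first by rewrite expr0 divr1.
  rewrite sE; have [_ h _ _ _] := stepP (vp n); apply: le_trans h.
  by rewrite exprSr invfM mulrA ler_pM2r ?invr_gt0.
have [x hx] : exists x, forall n, rl (p n) <= x <= rr (p n).
  apply: nested_intervals.
  - by apply/nondecreasing_seqP => n; rewrite sE; have [_ _ _ _ []] := stepP (vp n).
  - by apply/nonincreasing_seqP => n; rewrite sE; have [_ _ _ _ []] := stepP (vp n).
  - by move=> n; have [] := vp n.
have [y hy] : exists y, forall n, rb (p n) <= y <= rt (p n).
  apply: nested_intervals.
  - by apply/nondecreasing_seqP => n; rewrite sE; have [_ _ _ _ []] := stepP (vp n).
  - by apply/nonincreasing_seqP => n; rewrite sE; have [_ _ _ _ []] := stepP (vp n).
  - by move=> n; have [_ _ _ []] := vp n.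
apply/eqP; rewrite -normc_eq0; apply/negPn/negP => E0.
have {}E0 : 0 < normc (E a b c d) by rewrite lt_def E0 normc_ge0.
set eta := normc _ in E0 *.
pose L := (b - a) + (d - c).
have L0 : 0 <= L by rewrite /L addr_ge0// subr_ge0.
(* Once the factors 4^n cancel, this choice gives e L^2 < eta. *)
pose e := eta / (2 * (L ^+ 2 + 1)).
have q0 : 0 < L ^+ 2 + 1 by rewrite ltr_pwDr// sqr_ge0.
have e0 : 0 < e by rewrite divr_gt0// mulr_gt0.
have [del del0 hdel] := E_local (hx 0%N) (hy 0%N) e0.
have [n hn] := exists_pow2_gt L del0.
have p2 : 0 < 2 ^- n :> R by rewrite invr_gt0 exprn_gt0.
have [v1 v2 v3 [v4 v5 v6]] := vp n.
have [/andP[x1 x2] /andP[y1 y2]] := (hx n, hy n).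
have := hdel _ _ _ _ v1 x1 x2 v3 v4 y1 y2 v6.
rewrite pX pY -mulrDl -/L => /(_ _ _)/wrap[].
  by apply: le_lt_trans hn; rewrite ler_pM2r// /L lerDl subr_ge0.
  by apply: le_lt_trans hn; rewrite ler_pM2r// /L lerDr subr_ge0.
apply/negP; rewrite -ltNge; apply: lt_le_trans (pN n).
have -> : 4 ^+ n = (2 ^+ n) ^+ 2 :> R.
  by rewrite -exprM mulnC exprM; congr (_ ^+ n); ring.
rewrite -/eta expr_div_n mulrA.
rewrite ltr_pM2r ?invr_gt0 ?exprn_gt0//.
rewrite /e mulrAC ltr_pdivrMr ?mulr_gt0// ltr_pM2l//.
have := sqr_ge0 L; set t := L ^+ 2; lra.
Qed.

End bisection.

(** * Calculus along complex curves *)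

Section complex_curves.
Variable R : realType.
Local Notation Re := complex.Re.
Local Notation Im := complex.Im.
Local Notation mu := (@lebesgue_measure R).
Implicit Types f g F G : R -> R[i].

(** By real and imaginary parts, so that the real fundamental theorem of calculus applies to each of
    them. *)
Definition cderiv F f := (forall t : R, is_derive t (1 : R) (fun x => Re (F x)) (Re (f t))) /\
  (forall t : R, is_derive t (1 : R) (fun x => Im (F x)) (Im (f t))).

Lemma cderiv_cst (k : R[i]) : cderiv (fun=> k) (fun=> 0).
Proof. by split => t; exact: is_derive_cst. Qed.

Lemma cderiv_id : cderiv (fun t => t%:C) (fun=> 1).
Proof. by split => t /=; [exact: is_derive_id|exact: is_derive_cst]. Qed.

Lemma cderiv_ext F f g : f =1 g -> cderiv F f -> cderiv F g.
Proof. by move=> /funext ->. Qed.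

Lemma cderivD F f G g : cderiv F f -> cderiv G g ->
  cderiv (fun t => F t + G t) (fun t => f t + g t).
Proof.
move=> [F1 F2] [G1 G2]; split => t.
  under eq_fun do rewrite cReD; rewrite cReD.
  by have := is_deriveD (F1 t) (G1 t).
under eq_fun do rewrite cImD; rewrite cImD.
by have := is_deriveD (F2 t) (G2 t).
Qed.

Lemma cderivM F f G g : cderiv F f -> cderiv G g ->
  cderiv (fun t => F t * G t) (fun t => f t * G t + F t * g t).
Proof.
move=> [F1 F2] [G1 G2]; split => t.
  under eq_fun do rewrite cReM; rewrite cReD !cReM.
  have := is_deriveB (is_deriveM (F1 t) (G1 t)) (is_deriveM (F2 t) (G2 t)).
  by move/is_derive_eq; apply; rewrite /GRing.scale /=; ring.
under eq_fun do rewrite cImM; rewrite cImD !cImM.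
have := is_deriveD (is_deriveM (F1 t) (G2 t)) (is_deriveM (F2 t) (G1 t)).
by move/is_derive_eq; apply; rewrite /GRing.scale /=; ring.
Qed.

Lemma cderivZ (k : R[i]) F f : cderiv F f -> cderiv (fun t => k * F t) (fun t => k * f t).
Proof.
by move=> h; apply: cderiv_ext (cderivM (cderiv_cst k) h) => t; rewrite mul0r add0r.
Qed.

Definition ccont f (t : R) := 
  (fun x => Re (f x)) x @[x --> t] --> Re (f t) /\ (fun x => Im (f x)) x @[x --> t] --> Im (f t).

Lemma cderiv_cont F f t : cderiv F f -> ccont F t.
Proof.
by move=> [F1 F2]; split; apply: differentiable_continuous; apply/derivable1_diffP;
  [have [] := F1 t|have [] := F2 t].
Qed.

Lemma ccontP f t : ccont f t <-> forall e, 0 < e ->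
  exists2 del, 0 < del & forall s, `|t - s| < del -> normc (f t - f s) < e.
Proof.
split.
  move=> [f1 f2] e e0; have e2 : 0 < e / 2 by rewrite divr_gt0.
  have /cvgrPdist_lt/(_ _ e2)/nbhs_ballP[d1 /= d10 h1] := f1.
  have /cvgrPdist_lt/(_ _ e2)/nbhs_ballP[d2 /= d20 h2] := f2.
  exists (Num.min d1 d2); first by rewrite lt_min d10.
  move=> s; rewrite lt_min => /andP[s1 s2].
  apply: le_lt_trans (normc_le_ReIm _) _.
  have {}h1 := h1 s s1; have {}h2 := h2 s s2.
  rewrite /= in h1 h2; rewrite !(cReD, cImD, cReN, cImN).
  lra.
move=> h; split; apply/cvgrPdist_lt => e e0; have [del del0 hd] := h e e0; apply/nbhs_ballP;
  exists del => //= s ts; apply: le_lt_trans (hd s ts).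
- by rewrite -cReN -cReD; exact: Re_le_normc.
- by rewrite -cImN -cImD; exact: Im_le_normc.
Qed.

Lemma ccontD f g t : ccont f t -> ccont g t -> ccont (fun t => f t + g t) t.
Proof.
move=> [f1 f2] [g1 g2]; split.
  by under eq_fun do rewrite cReD; rewrite cReD; exact: cvgD.
by under eq_fun do rewrite cImD; rewrite cImD; exact: cvgD.
Qed.

Lemma ccontM f g t : ccont f t -> ccont g t -> ccont (fun t => f t * g t) t.
Proof.
move=> [f1 f2] [g1 g2]; split.
  by under eq_fun do rewrite cReM; rewrite cReM; apply: cvgB; exact: cvgM.
by under eq_fun do rewrite cImM; rewrite cImM; apply: cvgD; exact: cvgM.
Qed.

Lemma ccont_cst (k : R[i]) t : ccont (fun=> k) t.
Proof. by split; exact: cvg_cst. Qed.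

Definition lint (a b : R) f : R[i] :=
  (\int[mu]_(x in `[a, b]) Re (f x)) +i* (\int[mu]_(x in `[a, b]) Im (f x)).

Lemma eq_lint a b f g : (forall t, a <= t <= b -> f t = g t) -> lint a b f = lint a b g.
Proof.
by move=> fg; apply: complexP; apply: eq_Rintegral => x; rewrite inE /= in_itv /= => /fg ->.
Qed.

Lemma lintD a b f g : (forall t, a <= t <= b -> ccont f t) -> (forall t, a <= t <= b -> ccont g t) ->
  lint a b (fun t => f t + g t) = lint a b f + lint a b g.
Proof.
move=> cf cg; apply: complexP; rewrite ?cReD ?cImD /lint /=.
  under eq_Rintegral do rewrite cReD.
  by rewrite RintegralD//; apply: integrable_continuous => t; rewrite in_itv /= => /[dup] /cf[? ?] /cg[].
under eq_Rintegral do rewrite cImD.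
by rewrite RintegralD//; apply: integrable_continuous => t; rewrite in_itv /= => /[dup] /cf[? ?] /cg[].
Qed.

Lemma lint_FTC a b F f : a <= b -> (forall t, a <= t <= b -> ccont f t) -> cderiv F f ->
  lint a b f = F b - F a.
Proof.
move=> ab cf [F1 F2]; apply: complexP; rewrite ?cReD ?cImD ?cReN ?cImN /lint /=;
  apply: Rintegral_FTC => // t; rewrite in_itv /= => /cf[]//.
Qed.

Lemma lint_split a m b f : a <= m -> m <= b -> (forall t, a <= t <= b -> ccont f t) ->
  lint a b f = lint a m f + lint m b f.
Proof.
move=> am mb cf; apply: complexP; rewrite ?cReD ?cImD /lint /=;
  apply: Rintegral_split => // t; rewrite in_itv /= => /cf[]//.
Qed.

(** The factor 2 comes from estimating the two parts separately; it is harmless in the bisection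
    argument. *)
Lemma lint_bound a b f M : a <= b -> (forall t, a <= t <= b -> ccont f t) ->
  (forall t, a <= t <= b -> normc (f t) <= M) -> normc (lint a b f) <= 2 * M * (b - a).
Proof.
move=> ab cf fM; apply: le_trans (normc_le_ReIm _) _; rewrite /lint /= -mulrA mulr_natl mulr2n.
apply: lerD; apply: Rintegral_le_norm => //.
- by move=> t; rewrite in_itv /= => /cf[].
- by move=> t /fM; apply: le_trans; exact: Re_le_normc.
- by move=> t; rewrite in_itv /= => /cf[].
- by move=> t /fM; apply: le_trans; exact: Im_le_normc.
Qed.

(** Of period one, so that the normalized arc length is the law of [expi t] for [t] uniform on the
    unit interval. *)
Definition expi (t : R) : R[i] := cos (2 * pi * t) +i* sin (2 * pi * t).

Lemma val_angle t : val (angle t) = expi t :> R[i]. Proof. by []. Qed.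

Lemma normc_expi t : normc (expi t) = 1.
Proof. by rewrite -val_angle normc_circle. Qed.

Lemma cderiv_expi : cderiv expi (fun t => (0 +i* (2 * pi)) * expi t).
Proof.
have dl (t : R) : is_derive t (1 : R) (fun x : R => 2 * pi * x) (2 * pi).
  have := is_deriveZ (2 * pi : R) (is_derive_id t (1 : R)).
  by move/is_derive_eq; apply; rewrite /GRing.scale /= mulr1.
split => t /=.
  have := is_derive1_comp (is_derive_cos (2 * pi * t)) (dl t).
  by move/is_derive_eq; apply; simpc; rewrite /GRing.scale /=; ring.
have := is_derive1_comp (is_derive_sin (2 * pi * t)) (dl t).
by move/is_derive_eq; apply; simpc; rewrite /GRing.scale /=; ring.
Qed.

End complex_curves.

(** * Characters of the circle and the Cauchy kernel *)

Section circle_orthogonality.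
Variable R : realType.
Local Notation Re := complex.Re.
Local Notation Im := complex.Im.

Lemma cmeasurable_cont (f : R -> R[i]) : (forall t, ccont f t) ->
  cmeasurable (f : measurableTypeR R -> R[i]).
Proof.
by move=> cf; split; apply: continuous_measurable_fun => t; have [] := cf t.
Qed.

Lemma cintegral_P01 (f : R -> R[i]) M : (forall t, ccont f t) -> (forall t, normc (f t) <= M) ->
  cintegral (P01 R) f = lint 0 1 f.
Proof.
move=> cf fM; have [f1 f2] := cmeasurable_cont cf.
apply: complexP; rewrite /cintegral /lint /=; apply: (@Rintegral_P01 _ _ M) => // t.
  exact: le_trans (Re_le_normc _) (fM t).
exact: le_trans (Im_le_normc _) (fM t).
Qed.

Lemma expi0 : expi (0 : R) = 1.
Proof. by rewrite /expi mulr0 cos0 sin0. Qed.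

Lemma expi1 : expi (1 : R) = 1.
Proof. by rewrite /expi mulr1 mulr_natl cos2pi sin2pi. Qed.

Lemma cderiv_expiX k : cderiv (fun t : R => expi t ^+ k)
  (fun t => (k%:R * (0 +i* (2 * pi))) * expi t ^+ k).
Proof.
elim: k => [|k IH].
  by apply: cderiv_ext (cderiv_cst 1) => t; rewrite !mul0r.
rewrite (_ : (fun t => _) = (fun t => expi t * expi t ^+ k)); last first.
  by apply/funext => t; rewrite exprS.
apply: cderiv_ext (cderivM (@cderiv_expi R) IH) => t.
by rewrite exprS -[k.+1]addn1 natrD; ring.
Qed.

Lemma ccont_expi (t : R) : ccont (@expi R) t.
Proof. exact: cderiv_cont (@cderiv_expi R). Qed.

Lemma ccontX (f : R -> R[i]) n t : ccont f t -> ccont (fun t => f t ^+ n) t.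
Proof.
move=> cf; elim: n => [|n IH]; first by under eq_fun do rewrite expr0; exact: ccont_cst.
by under eq_fun do rewrite exprS; exact: ccontM.
Qed.

Lemma ccontJ (f : R -> R[i]) t : ccont f t -> ccont (fun t => conjc (f t)) t.
Proof.
move=> /ccontP cf; apply/ccontP => e e0; have [d d0 h] := cf e e0.
by exists d => // s ts; rewrite -rmorphB normc_conjc; exact: h.
Qed.

Lemma cintegral_expiX k : cintegral (P01 R) (fun t => expi t ^+ k) = (k == 0%N)%:R.
Proof.
case: k => [|k].
  by under eq_fun do rewrite expr0; rewrite cintegral_cst.
rewrite (@cintegral_P01 _ 1); last 2 first.
- by move=> t; apply: ccontX; exact: ccont_expi.
- by move=> t; rewrite normcX normc_expi expr1n.
set c := (k.+1%:R * (0 +i* (2 * pi))) : R[i].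
have c0 : c != 0.
  rewrite mulf_neq0 ?pnatr_eq0// -normc_eq0 /= expr0n add0r sqrtr_sqr normr_eq0.
  by rewrite mulf_neq0// gt_eqF// pi_gt0.
rewrite (@lint_FTC _ _ _ (fun t => c^-1 * expi t ^+ k.+1))//.
- by rewrite expi1 expi0 subrr.
- by move=> t _; apply: ccontX; exact: ccont_expi.
- apply: cderiv_ext (cderivZ c^-1 (cderiv_expiX k.+1)) => t.
  by rewrite -/c mulrA mulVf// mul1r.
Qed.

Lemma cintegral_conj d (T : measurableType d) (mu : probability T R) (f : T -> R[i]) :
  cintegrable mu f -> cintegral mu (fun t => conjc (f t)) = conjc (cintegral mu f).
Proof.
move=> [_ i2]; apply: complexP; rewrite ?Re_conjc ?Im_conjc /cintegral /=.
  by apply: eq_Rintegral => x _; rewrite Re_conjc.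
rewrite -mulN1r -RintegralZl//.
by apply: eq_Rintegral => x _; rewrite Im_conjc mulN1r.
Qed.

Lemma cintegral_expiJX k : cintegral (P01 R) (fun t => conjc (expi t) ^+ k) = (k == 0%N)%:R.
Proof.
rewrite -[RHS]conjc_nat -cintegral_expiX -cintegral_conj.
  by apply: eq_cintegral => t; rewrite rmorphXn.
apply: (@cintegrable_bounded _ _ _ _ _ 1).
  by apply: cmeasurable_cont => t; apply: ccontX; exact: ccont_expi.
by move=> t; rewrite normcX normc_expi expr1n.
Qed.

Lemma geometric_remainder (x : R[i]) n : x != 1 ->
  (1 - x)^-1 = \sum_(k < n) x ^+ k + x ^+ n / (1 - x).
Proof.
move=> x1; have x10 : 1 - x != 0 by rewrite subr_eq0 eq_sym.
apply: (mulIf x10); rewrite mulVf// mulrDl mulfVK//.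
have := subrX1 x n; set S := \sum_(_ < _) _ => h.
have -> : S * (1 - x) = - ((x - 1) * S) by ring.
by rewrite -h opprB subrK.
Qed.

Lemma normc_1B_ge (x : R[i]) : 1 - normc x <= normc (1 - x).
Proof.
by rewrite lerBlDr -(@normc1 R) -{1}(subrK x 1) le_normcD.
Qed.

Lemma cvg_pow0 (q : R) : 0 <= q < 1 -> forall C e : R, 0 < e -> exists n, C * q ^+ n < e.
Proof.
move=> /andP[q0 q1] C e e0.
have : (fun n => C * q ^+ n) @ \oo --> (0 : R).
  rewrite -[0](mulr0 C); apply: cvgMr; apply: cvg_expr; rewrite ger0_norm//.
move=> /cvgr0Pnorm_lt/(_ e e0)[N _ /(_ N (leqnn N))] h; exists N.
by apply: le_lt_trans h; exact: ler_norm.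
Qed.

Lemma ccontN (f : R -> R[i]) t : ccont f t -> ccont (fun t => - f t) t.
Proof.
move=> cf; under eq_fun do rewrite -mulN1r.
by apply: ccontM => //; exact: ccont_cst.
Qed.

Lemma ccontV (f : R -> R[i]) t : f t != 0 -> ccont f t -> ccont (fun t => (f t)^-1) t.
Proof.
move=> f0 /ccontP cf; apply/ccontP => e e0.
set a := normc (f t).
have a0 : 0 < a by rewrite normc_gt0.
have m0 : 0 < Num.min (a / 2) (e * (a * a) / 2).
  by rewrite lt_min !divr_gt0 ?mulr_gt0.
have [d d0 h] := cf _ m0; exists d => // s ts.
have := h s ts; rewrite lt_min => /andP[h1 h2].
have fs : a / 2 < normc (f s).
  have := le_normcD (f t - f s) (f s); rewrite subrK -/a; lra.
have fs0 : f s != 0 by rewrite -normc_gt0; apply: le_lt_trans fs; rewrite divr_ge0// ltW.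
have -> : (f t)^-1 - (f s)^-1 = (f s - f t) / (f t * f s).
  by field; rewrite fs0 f0.
rewrite normcM normcV normc_distC normcM -/a ltr_pdivrMr ?mulr_gt0 ?normc_gt0//.
apply: (lt_le_trans h2).
by rewrite -[leLHS]mulrA ler_pM2l// -mulrA ler_pM2l// ltW.
Qed.

(** Only the constant term of the geometric series in [conjc (expi t)] has a nonzero mean;
    truncation leaves a remainder of at most |x|^n / (1 - |x|), which tends to 0. *)
Lemma cauchy_kernel_mean (x : R[i]) : normc x < 1 ->
  cintegral (P01 R) (fun t => (1 - x * conjc (expi t))^-1) = 1.
Proof.
move=> x1.
have nx t : normc (x * conjc (expi t)) = normc x by rewrite normcM normc_conjc normc_expi mulr1.
have ne1 t : x * conjc (expi t) != 1.
  by apply/eqP => h; have := nx t; rewrite h normc1 => e; rewrite -e ltxx in x1.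
have cx t : ccont (fun t => x * conjc (expi t)) t.
  by apply: ccontM; [exact: ccont_cst|apply: ccontJ; exact: ccont_expi].
have cV t : ccont (fun t => (1 - x * conjc (expi t))^-1) t.
  apply: ccontV; first by rewrite subr_eq0 eq_sym.
  by apply: ccontD; [exact: ccont_cst|exact: ccontN].
have lb t : 1 - normc x <= normc (1 - x * conjc (expi t)) by rewrite -(nx t) normc_1B_ge.
have d0 : 0 < 1 - normc x by rewrite subr_gt0.
have bV t : normc ((1 - x * conjc (expi t))^-1) <= (1 - normc x)^-1.
  by rewrite normcV lef_pV2// posrE// (lt_le_trans d0).
have iX n : cintegrable (P01 R) (fun t => (x * conjc (expi t)) ^+ n).
  apply: (@cintegrable_bounded _ _ _ _ _ (normc x ^+ n)).
    by apply: cmeasurable_cont => t; exact: ccontX.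
  by move=> t; rewrite normcX nx.
have mrem n : cmeasurable (fun t : measurableTypeR R => (x * conjc (expi t)) ^+ n / (1 - x * conjc (expi t))).
  by apply: cmeasurable_cont => t; apply: ccontM => //; exact: ccontX.
have brem n t : normc ((x * conjc (expi t)) ^+ n / (1 - x * conjc (expi t))) <= normc x ^+ n * (1 - normc x)^-1.
  by rewrite normcM normcX nx ler_wpM2l// exprn_ge0// normc_ge0.
have e1 n : cintegral (P01 R) (fun t => (1 - x * conjc (expi t))^-1) =
    1 + cintegral (P01 R) (fun t => (x * conjc (expi t)) ^+ n.+1 / (1 - x * conjc (expi t))).
  under eq_cintegral do rewrite (geometric_remainder n.+1 (ne1 _)).
  rewrite cintegralD; last 2 first.
  - by apply: cintegrable_sum => k; exact: iX.
  - exact: (cintegrable_bounded _ (mrem n.+1) (brem n.+1)).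
  congr (_ + _); rewrite cintegral_sum; last by move=> k; exact: iX.
  rewrite big_ord_recl big1 ?addr0.
    by under eq_cintegral do rewrite expr0; rewrite cintegral_cst.
  move=> k _; under eq_cintegral do rewrite exprMn.
  rewrite cintegralZ ?cintegral_expiJX ?mulr0//.
  apply: (@cintegrable_bounded _ _ _ _ _ 1).
    by apply: cmeasurable_cont => t; apply: ccontX; apply: ccontJ; exact: ccont_expi.
  by move=> t; rewrite normcX normc_conjc normc_expi expr1n.
apply/eqP; rewrite -subr_eq0 -normc_eq0; apply/negPn/negP => E0.
have {}E0 : 0 < normc (cintegral (P01 R) (fun t => (1 - x * conjc (expi t))^-1) - 1) by rewrite lt_def E0 normc_ge0.
have q01 : 0 <= normc x < 1 by rewrite normc_ge0.
have [n] := cvg_pow0 q01 (1 - normc x)^-1 E0.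
apply/negP; rewrite -leNgt (e1 n) addrC addKr.
apply: le_trans (normc_cintegral_bound (P01 R) (mrem n.+1) (brem n.+1)) _.
rewrite mulrC ler_wpM2l ?invr_ge0 ?(ltW d0)//.
by rewrite ler_wiXn2l ?normc_ge0// ltW.
Qed.

End circle_orthogonality.

(** * Cauchy's formula in one variable *)

Section cauchy_one_variable.
Variable R : realType.
Local Notation Re := complex.Re.
Local Notation Im := complex.Im.
Local Notation C := (R[i]).

(** Differentiability at a single point. No continuity of the derivative is assumed, which is why
    Goursat's argument is needed for Cauchy's formula. *)
Definition complex_diff (g : C -> C) (u : C) := exists c : C, forall e : R, 0 < e ->
  exists2 del, 0 < del & forall v, normc (v - u) < del ->
    normc (g v - g u - c * (v - u)) <= e * normc (v - u).

Lemma complex_diff_cont (g : C -> C) u : complex_diff g u -> forall e : R, 0 < e ->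
  exists2 del, 0 < del & forall v, normc (v - u) < del -> normc (g v - g u) < e.
Proof.
move=> [c hc] e e0; have [d d0 hd] := hc 1 ltr01.
have k0 : 0 < 1 + normc c by rewrite ltr_pwDl// normc_ge0.
exists (Num.min d (e / (1 + normc c))); first by rewrite lt_min d0 divr_gt0.
move=> v; rewrite lt_min => /andP[/hd h1 h2].
rewrite -(subrK (c * (v - u)) (g v - g u)).
apply: le_lt_trans (le_normcD _ _) _.
rewrite normcM; apply: le_lt_trans (lerD h1 (lexx _)) _.
by rewrite -mulrDl mulrC -ltr_pdivlMr.
Qed.

Lemma complex_diffM (f g : C -> C) u : complex_diff f u -> complex_diff g u ->
  complex_diff (fun v => f v * g v) u.
Proof.
move=> [a ha] df; have := df => -[b hb]; exists (a * g u + f u * b) => e e0.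
pose K := 1 + normc (g u) + normc (f u) + normc a.
have K0 : 0 < K by rewrite /K -!addrA ltr_pwDl// !addr_ge0// normc_ge0.
pose e1 := Num.min 1 (e / (3 * K)).
have e10 : 0 < e1 by rewrite lt_min ltr01 divr_gt0// mulr_gt0.
have [d1 d10 h1] := ha e1 e10.
have [d2 d20 h2] := hb e1 e10.
have [d3 d30 h3] := complex_diff_cont df e10.
exists (Num.min d1 (Num.min d2 d3)); first by rewrite !lt_min d10 d20.
move=> v; rewrite !lt_min => /and3P[/h1 {}h1 /h2 {}h2 /h3 {}h3].
set w := normc (v - u) in h1 h2 *.
have -> : f v * g v - f u * g u - (a * g u + f u * b) * (v - u) =
   (f v - f u - a * (v - u)) * g v + a * (v - u) * (g v - g u) + f u * (g v - g u - b * (v - u)) by ring.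
apply: le_trans (le_normcD _ _) _.
apply: (le_trans (lerD (le_normcD _ _) (lexx _))).
rewrite !normcM -/w.
have w0 : 0 <= w := normc_ge0 _.
have e11 : e1 <= 1 by rewrite ge_min lexx.
have e1K : e1 * K <= e / 3.
  have : e1 <= e / (3 * K) by rewrite ge_min lexx orbT.
  rewrite ler_pdivlMr ?mulr_gt0//; lra.
have gv : normc (g v) <= K.
  have := le_normcD (g v - g u) (g u); rewrite subrK /K.
  have := normc_ge0 (f u); have := normc_ge0 a; lra.
have b1 : normc (f v - f u - a * (v - u)) * normc (g v) <= e1 * w * K.
  by apply: ler_pM => //; exact: normc_ge0.
have b2 : normc a * w * normc (g v - g u) <= K * w * e1.
  apply: ler_pM => //; rewrite ?mulr_ge0 ?normc_ge0//; last exact: ltW.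
  apply: ler_wpM2r => //; rewrite /K; have := normc_ge0 (f u); have := normc_ge0 (g u); lra.
have b3 : normc (f u) * normc (g v - g u - b * (v - u)) <= K * (e1 * w).
  apply: ler_pM => //; rewrite ?normc_ge0//.
  rewrite /K; have := normc_ge0 a; have := normc_ge0 (g u); lra.
have : e1 * K * w <= e / 3 * w by apply: ler_wpM2r.
nra.
Qed.

Lemma complex_diff_invB (z u : C) : u != z -> complex_diff (fun v => (v - z)^-1) u.
Proof.
rewrite -subr_eq0 => uz; set a := u - z; have a0 : 0 < normc a by rewrite normc_gt0.
exists (- a^-1 ^+ 2) => e e0.
pose A := normc a.
exists (Num.min (A / 2) (e * A ^+ 3 / 2)).
  by rewrite lt_min !divr_gt0 ?mulr_gt0 ?exprn_gt0.
move=> v; rewrite lt_min => /andP[h1 h2].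
set w := v - u in h1 h2 *.
have vz : v - z = a + w by rewrite /a /w; ring.
have b1 : A / 2 <= normc (a + w).
  have := le_normcD (a + w) (- w); rewrite addrK normcN -/A; lra.
have b0 : 0 < normc (a + w) by apply: lt_le_trans b1; rewrite divr_gt0.
have aw0 : a + w != 0 by rewrite -normc_gt0.
rewrite vz.
have -> : (a + w)^-1 - a^-1 - - a^-1 ^+ 2 * w = w ^+ 2 / ((a + w) * a ^+ 2).
  by field; rewrite aw0 uz.
rewrite normcM normcV normcX (normcM (a + w)) normcX -/A ler_pdivrMr; last by rewrite mulr_gt0// exprn_gt0.
rewrite expr2 [leRHS]mulrAC; apply: ler_wpM2r; first exact: normc_ge0.
apply: le_trans (ltW h2) _.
have -> : e * A ^+ 3 / 2 = e * (A / 2 * A ^+ 2) by rewrite !exprS expr0; field.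
by rewrite ler_pM2l// ler_pM2r// exprn_gt0.
Qed.

Variables (g : C -> C) (M r : R) (z : C).
Hypothesis dg : forall u, normc u < 1 -> complex_diff g u.
Hypothesis gM : forall u, normc u < 1 -> normc (g u) <= M.
Hypotheses (r0 : 0 < r) (r1 : r < 1) (zr : normc z < r).

(* The form g(u)/(u - z) du is pulled back to the (s, t) plane along the homotopy
   gam from the constant loop z to the circle |u| = r. *)
Let Gam (t : R) : C := r%:C * expi t.
Let dGam (t : R) : C := r%:C * ((0 +i* (2 * pi)) * expi t).
Let v t := Gam t - z.
Let gam (s t : R) : C := z + s%:C * v t.
Let h (u : C) : C := g u * (u - z)^-1.
Let P (f : C -> C) (s t : R) := f (gam s t) * v t.
Let Q (f : C -> C) (s t : R) := f (gam s t) * (s%:C * dGam t).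
(** The integral of f(u) du counterclockwise round the boundary of a rectangle, pulled back by
    [gam]: [P] is its ds part and [Q] its dt part. *)
Let E (f : C -> C) x1 x2 y1 y2 : C :=
  lint x1 x2 (P f ^~ y1) + lint y1 y2 (Q f x2) - lint x1 x2 (P f ^~ y2) - lint y1 y2 (Q f x1).

Let normGam t : normc (Gam t) = r.
Proof. by rewrite /Gam normcM normc_real normc_expi mulr1 gtr0_norm. Qed.

Let normdGam t : normc (dGam t) <= 2 * pi.
Proof.
have p0 := pi_gt0 R.
rewrite /dGam !normcM normc_real normc_expi mulr1 gtr0_norm//= expr0n add0r sqrtr_sqr.
rewrite gtr0_norm ?mulr_gt0// ler_piMl ?mulr_ge0 ?ltW//.
Qed.

Let v_lb t : r - normc z <= normc (v t).
Proof. by rewrite lerBlDr -(normGam t) -{1}(subrK z (Gam t)) le_normcD. Qed.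

Let v_neq0 t : v t != 0.
Proof. by rewrite -normc_gt0; apply: lt_le_trans (v_lb t); rewrite subr_gt0. Qed.

Let v_ub t : normc (v t) <= 2.
Proof.
apply: (le_trans (normcB (Gam t) z)); rewrite normGam; have := ltW zr; have := ltW r1; lra.
Qed.

Let gam_lt1 s t : 0 <= s <= 1 -> normc (gam s t) < 1.
Proof.
move=> /andP[s0 s1].
have -> : gam s t = (1 - s)%:C * z + s%:C * Gam t.
  by rewrite /gam /v rmorphB /= rmorph1; ring.
apply: le_lt_trans (le_normcD _ _) _.
rewrite (normcM _ z) (normcM s%:C) normGam !normc_real !ger0_norm ?subr_ge0//.
apply: le_lt_trans r1.
have : (1 - s) * normc z <= (1 - s) * r by rewrite ler_wpM2l ?subr_ge0// ltW.
lra.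
Qed.

Let cderiv_Gam : cderiv Gam dGam.
Proof. exact: cderivZ (@cderiv_expi R). Qed.

Let cderiv_v : cderiv v dGam.
Proof.
apply: cderiv_ext (cderivD cderiv_Gam (cderiv_cst (- z))) => t; exact: addr0.
Qed.

Let cderiv_gam_s t : cderiv (gam ^~ t) (fun=> v t).
Proof.
apply: cderiv_ext (cderivD (cderiv_cst z) (cderivM (@cderiv_id R) (cderiv_cst (v t)))) => s.
by rewrite mulr0 addr0 add0r mul1r.
Qed.

Let cderiv_gam_t s : cderiv (gam s) (fun t => s%:C * dGam t).
Proof.
by apply: cderiv_ext (cderivD (cderiv_cst z) (cderivZ s%:C cderiv_v)) => t; rewrite add0r.
Qed.

Let lip_Gam t u : normc (Gam t - Gam u) <= 4 * pi * `|t - u|.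
Proof.
have cG x : ccont dGam x.
  by apply: ccontM; [exact: ccont_cst|apply: ccontM; [exact: ccont_cst|exact: ccont_expi]].
wlog ut : t u / u <= t.
  by move=> H; have [/H//|/ltW/H] := leP u t; rewrite normc_distC distrC.
rewrite -(@lint_FTC _ u t _ dGam)//.
apply: le_trans (lint_bound ut _ (fun x _ => normdGam x)) _ => //.
by rewrite ger0_norm ?subr_ge0// !mulrA -natrM.
Qed.

Let K := 2 + 4 * (pi : R).

Let K_gt0 : 0 < K. Proof. by rewrite ltr_pwDl// mulr_ge0// pi_ge0. Qed.

Let lip_gam s t s' t' : 0 <= s' <= 1 -> normc (gam s t - gam s' t') <= K * (`|s - s'| + `|t - t'|).
Proof.
move=> /andP[s0 s1].
have -> : gam s t - gam s' t' = (s - s')%:C * v t + s'%:C * (Gam t - Gam t').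
  by rewrite /gam /v rmorphB /=; ring.
apply: le_trans (le_normcD _ _) _; rewrite !normcM !normc_real (ger0_norm s0).
have p0 : 0 <= pi :> R := pi_ge0 R.
have a1 : `|s - s'| * normc (v t) <= `|s - s'| * 2 by apply: ler_wpM2l.
have a2 : s' * normc (Gam t - Gam t') <= 4 * pi * `|t - t'|.
  by apply: le_trans (lip_Gam t t'); rewrite ler_piMl// normc_ge0.
have n1 := normr_ge0 (s - s'); have n2 := normr_ge0 (t - t').
have p1 : 0 <= pi * `|s - s'| by rewrite mulr_ge0.
apply: (le_trans (lerD a1 a2)).
have -> : K * (`|s - s'| + `|t - t'|) =
    `|s - s'| * 2 + 4 * pi * `|t - t'| + (2 * `|t - t'| + 4 * (pi * `|s - s'|)) by rewrite /K; ring.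
by rewrite lerDl addr_ge0// mulr_ge0.
Qed.

Let ccont_comp_s f s t : 0 <= s <= 1 -> complex_diff f (gam s t) -> ccont (fun x => f (gam x t)) s.
Proof.
move=> s01 df; apply/ccontP => e e0; have [d d0 hd] := complex_diff_cont df e0.
exists (d / K); first by rewrite divr_gt0.
move=> x sx; rewrite normc_distC; apply: hd; apply: le_lt_trans (lip_gam _ _ _ s01) _.
by rewrite subrr normr0 addr0 distrC mulrC -ltr_pdivlMr.
Qed.

Let ccont_comp_t f s t : 0 <= s <= 1 -> complex_diff f (gam s t) -> ccont (fun x => f (gam s x)) t.
Proof.
move=> s01 df; apply/ccontP => e e0; have [d d0 hd] := complex_diff_cont df e0.
exists (d / K); first by rewrite divr_gt0.
move=> x sx; rewrite normc_distC; apply: hd; apply: le_lt_trans (lip_gam _ _ _ s01) _.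
by rewrite subrr normr0 add0r distrC mulrC -ltr_pdivlMr.
Qed.

Let ccont_dGam s t : ccont (fun x => s%:C * dGam x) t.
Proof.
do 2!(apply: ccontM; first exact: ccont_cst).
by apply: ccontM; [exact: ccont_cst|exact: ccont_expi].
Qed.

Let ccont_P f s t : 0 <= s <= 1 -> complex_diff f (gam s t) -> ccont (P f ^~ t) s.
Proof. by move=> s01 df; apply: ccontM; [exact: ccont_comp_s|exact: ccont_cst]. Qed.

Let ccont_Q f s t : 0 <= s <= 1 -> complex_diff f (gam s t) -> ccont (Q f s) t.
Proof. by move=> s01 df; apply: ccontM; [exact: ccont_comp_t|exact: ccont_dGam]. Qed.

Let gam_neq s t : 0 < s -> gam s t != z.
Proof.
move=> s0; rewrite -subr_eq0 /gam addrAC subrr add0r mulf_neq0//.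
by rewrite -normc_eq0 normc_real normr_eq0 gt_eqF.
Qed.

Let dh s t : 0 < s <= 1 -> complex_diff h (gam s t).
Proof.
move=> /andP[s0 s1]; apply: complex_diffM.
  by apply: dg; apply: gam_lt1; rewrite ltW.
by apply: complex_diff_invB; exact: gam_neq.
Qed.

Lemma complex_diff_affine (a b u0 u : C) : complex_diff (fun u => a + b * (u - u0)) u.
Proof.
exists b => e e0; exists 1 => // w _.
have -> : a + b * (w - u0) - (a + b * (u - u0)) - b * (w - u) = 0 by ring.
by rewrite normc0 mulr_ge0 ?normc_ge0// ltW.
Qed.

(** An affine function has the primitive [H], and the values of [H] at the four corners cancel. *)
Let E_affine a b u0 x1 x2 y1 y2 : 0 <= x1 -> x1 <= x2 -> x2 <= 1 -> y1 <= y2 ->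
  E (fun u => a + b * (u - u0)) x1 x2 y1 y2 = 0.
Proof.
move=> x10 x12 x21 y12.
pose H (u : C) := a * u + b / 2 * (u - u0) ^+ 2.
have two0 : (2 : C) != 0 by rewrite pnatr_eq0.
have dH F f : cderiv F f -> cderiv (fun t => H (F t)) (fun t => (a + b * (F t - u0)) * f t).
  move=> dF; have dF' : cderiv (fun t => F t - u0) f.
    by apply: cderiv_ext (cderivD dF (cderiv_cst (- u0))) => t; rewrite addr0.
  apply: cderiv_ext (cderivD (cderivZ a dF) (cderivZ (b / 2) (cderivM dF' dF'))) => t.
  by have e : b = b / 2 * 2 by [rewrite mulfVK]; rewrite {2}e; ring.
have s01 t : x1 <= t <= x2 -> 0 <= t <= 1.
  by move=> /andP[? ?]; rewrite (le_trans x10)//= (le_trans _ x21).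
rewrite /E.
rewrite (@lint_FTC _ x1 x2 (fun s => H (gam s y1)))//; last 2 first.
- by move=> t /s01 h01; apply: ccont_P => //; exact: complex_diff_affine.
- exact: dH (cderiv_gam_s y1).
rewrite (@lint_FTC _ x1 x2 (fun s => H (gam s y2)))//; last 2 first.
- by move=> t /s01 h01; apply: ccont_P => //; exact: complex_diff_affine.
- exact: dH (cderiv_gam_s y2).
rewrite (@lint_FTC _ y1 y2 (fun t => H (gam x2 t)))//; last 2 first.
- move=> t _; apply: ccont_Q; last exact: complex_diff_affine.
  by apply: s01; rewrite x12 lexx.
- exact: (dH (gam x2) (fun t => x2%:C * dGam t) (cderiv_gam_t x2)).
rewrite (@lint_FTC _ y1 y2 (fun t => H (gam x1 t)))//; last 2 first.
- move=> t _; apply: ccont_Q; last exact: complex_diff_affine.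
  by apply: s01; rewrite lexx x12.
- exact: (dH (gam x1) (fun t => x1%:C * dGam t) (cderiv_gam_t x1)).
ring.
Qed.

Let E_D f1 f2 x1 x2 y1 y2 : 0 <= x1 -> x1 <= x2 -> x2 <= 1 ->
  (forall s t, x1 <= s <= x2 -> complex_diff f1 (gam s t)) ->
  (forall s t, x1 <= s <= x2 -> complex_diff f2 (gam s t)) ->
  E (fun u => f1 u + f2 u) x1 x2 y1 y2 = E f1 x1 x2 y1 y2 + E f2 x1 x2 y1 y2.
Proof.
move=> x10 x12 x21 d1 d2.
have s01 t : x1 <= t <= x2 -> 0 <= t <= 1.
  by move=> /andP[? ?]; rewrite (le_trans x10)//= (le_trans _ x21).
have i1 : x1 <= x1 <= x2 by rewrite lexx.
have i2 : x1 <= x2 <= x2 by rewrite lexx andbT.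
have PE y : lint x1 x2 (P (fun u => f1 u + f2 u) ^~ y) = lint x1 x2 (P f1 ^~ y) + lint x1 x2 (P f2 ^~ y).
  rewrite -lintD.
  - by apply: eq_lint => t _; rewrite /P mulrDl.
  - by move=> t tx; apply: ccont_P; [exact: s01|exact: d1].
  - by move=> t tx; apply: ccont_P; [exact: s01|exact: d2].
have QE x : x1 <= x <= x2 -> lint y1 y2 (Q (fun u => f1 u + f2 u) x) = lint y1 y2 (Q f1 x) + lint y1 y2 (Q f2 x).
  move=> hx; rewrite -lintD.
  - by apply: eq_lint => t _; rewrite /Q mulrDl.
  - by move=> t tx; apply: ccont_Q; [exact: s01|exact: d1].
  - by move=> t tx; apply: ccont_Q; [exact: s01|exact: d2].
rewrite /E !PE !QE//.
have sh (a1 a2 b1 b2 c1 c2 e1 e2 : C) : a1 + a2 + (b1 + b2) - (c1 + c2) - (e1 + e2) =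
  a1 + b1 - c1 - e1 + (a2 + b2 - c2 - e2) by ring.
exact: sh.
Qed.


Let E_split1 eta x1 m x2 y1 y2 : 0 < eta -> eta <= x1 -> x1 <= m -> m <= x2 -> x2 <= 1 ->
  E h x1 x2 y1 y2 = E h x1 m y1 y2 + E h m x2 y1 y2.
Proof.
move=> e0 ex xm mx x21.
have cP y t : x1 <= t <= x2 -> ccont (P h ^~ y) t.
  move=> /andP[xt tx]; have t0 : 0 < t by rewrite (lt_le_trans e0)// (le_trans ex).
  have t1 : t <= 1 by rewrite (le_trans tx).
  by apply: ccont_P; [rewrite ltW|apply: dh; rewrite t0].
have hP y : lint x1 x2 (P h ^~ y) = lint x1 m (P h ^~ y) + lint m x2 (P h ^~ y).
  by apply: lint_split => // t; exact: cP.
rewrite /E !hP.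
have sh (a1 a2 b c c1 c2 e1 : C) : a1 + a2 + b - (c1 + c2) - e1 =
  a1 + c - c1 - e1 + (a2 + b - c2 - c) by ring.
exact: sh.
Qed.

Let E_split2 eta x1 x2 y1 m y2 : 0 < eta -> eta <= x1 -> x1 <= x2 -> x2 <= 1 -> y1 <= m -> m <= y2 ->
  E h x1 x2 y1 y2 = E h x1 x2 y1 m + E h x1 x2 m y2.
Proof.
move=> e0 ex xx x21 ym my.
have hQ x : x1 <= x <= x2 -> lint y1 y2 (Q h x) = lint y1 m (Q h x) + lint m y2 (Q h x).
  move=> /andP[xt tx]; have t0 : 0 < x by rewrite (lt_le_trans e0)// (le_trans ex).
  have t1 : x <= 1 by rewrite (le_trans tx).
  apply: lint_split => // t _.
  by apply: ccont_Q; [rewrite ltW|apply: dh; rewrite t0].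
rewrite /E !hQ ?lexx ?xx//.
have sh (a b1 b2 c c' e1 e2 : C) : a + (b1 + b2) - c - (e1 + e2) =
  a + b1 - c' - e1 + (c' + b2 - c - e2) by ring.
exact: sh.
Qed.

(** Near a point, [h] is an affine function plus [rho]. The affine part integrates to zero, and
    [rho] is at most a small multiple of the diameter, on a boundary whose length is of the same
    order. Staying at s >= [eta] keeps away from the pole of [h] at [z]. *)
Let E_local eta x y : 0 < eta -> eta <= x <= 1 -> forall e, 0 < e ->
  exists2 del, 0 < del & forall x1 x2 y1 y2, eta <= x1 -> x1 <= x -> x <= x2 -> x2 <= 1 ->
  y1 <= y -> y <= y2 -> x2 - x1 < del -> y2 - y1 < del ->
  normc (E h x1 x2 y1 y2) <= e * ((x2 - x1) + (y2 - y1)) ^+ 2.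
Proof.
move=> eta0 /andP[ex x1] e e0.
have x0 : 0 < x by apply: lt_le_trans ex.
have x01 : 0 <= x <= 1 by rewrite ltW.
have dhx : complex_diff h (gam x y) by apply: dh; rewrite x0.
have [c hc] := dhx.
(* The four sides contribute at most 4 e1 K^2 w^2, half of what is allowed: a factor 2 comes from
   [lint_bound], one [K] from the Lipschitz bound of [gam] and one from its speed. *)
pose e1 := e / (8 * K ^+ 2).
have e10 : 0 < e1 by rewrite divr_gt0// mulr_gt0// exprn_gt0.
have [d d0 hd] := hc e1 e10.
exists (d / (2 * K)); first by rewrite divr_gt0// mulr_gt0.
move=> x1' x2 y1 y2 ex1 x1x xx2 x21 y1y yy2 dx dy.
set w := (x2 - x1') + (y2 - y1).
have w0 : 0 <= w by rewrite /w addr_ge0// subr_ge0 ?(le_trans x1x)// (le_trans y1y).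
have Kw : K * w < d.
  have : w < d / (2 * K) + d / (2 * K) by exact: ltrD.
  have -> : d / (2 * K) + d / (2 * K) = d / K by field; rewrite gt_eqF.
  by rewrite ltr_pdivlMr// mulrC.
pose u0 := gam x y.
pose A (u : C) := h u0 + c * (u - u0).
pose rho (u : C) := h u - A u.
have dA u : complex_diff A u by exact: complex_diff_affine.
have drho s t : x1' <= s <= x2 -> complex_diff rho (gam s t).
  move=> /andP[xs sx]; rewrite /rho.
  have [c' hc'] : complex_diff h (gam s t).
    by apply: dh; rewrite (lt_le_trans eta0 (le_trans ex1 xs)) (le_trans sx).
  have [c'' hc''] := dA (gam s t).
  exists (c' - c'') => e2 e20; have e3 : 0 < e2 / 2 by rewrite divr_gt0.
  have [d1 d10 h1] := hc' _ e3; have [d2 d20 h2] := hc'' _ e3.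
  exists (Num.min d1 d2); first by rewrite lt_min d10.
  move=> u; rewrite lt_min => /andP[/h1 {}h1 /h2 {}h2].
  have -> : h u - A u - (h (gam s t) - A (gam s t)) - (c' - c'') * (u - gam s t) =
    (h u - h (gam s t) - c' * (u - gam s t)) - (A u - A (gam s t) - c'' * (u - gam s t)) by ring.
  apply: le_trans (normcB _ _) _; lra.
have x10 : 0 <= x1' by rewrite (le_trans (ltW eta0)).
have x12 : x1' <= x2 by rewrite (le_trans x1x).
have y12 : y1 <= y2 by rewrite (le_trans y1y).
have s01 s : x1' <= s <= x2 -> 0 <= s <= 1.
  by move=> /andP[? ?]; rewrite (le_trans x10)//= (le_trans _ x21).
have Eh : E h x1' x2 y1 y2 = E rho x1' x2 y1 y2.
  have hE : h = (fun u => A u + rho u) by apply/funext => u; rewrite /rho addrC subrK.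
  rewrite [in LHS]hE (@E_D A rho)//.
  have -> : E A x1' x2 y1 y2 = 0 by exact: E_affine.
  exact: add0r.
have near s t : x1' <= s <= x2 -> y1 <= t <= y2 -> normc (gam s t - u0) <= K * w.
  move=> /andP[xs sx] /andP[yt ty].
  apply: le_trans (lip_gam _ _ _ x01) _; rewrite ler_pM2l// /w.
  by apply: lerD; rewrite ler_norml; apply/andP; split; lra.
have brho s t : x1' <= s <= x2 -> y1 <= t <= y2 -> normc (rho (gam s t)) <= e1 * (K * w).
  move=> hs ht; have hn := near s t hs ht.
  have -> : rho (gam s t) = h (gam s t) - h u0 - c * (gam s t - u0) by rewrite /rho /A; ring.
  apply: le_trans (hd _ (le_lt_trans hn Kw)) _.
  by rewrite ler_pM2l.
have p0 : 0 <= pi :> R := pi_ge0 R.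
have K2 : 2 <= K by rewrite lerDl mulr_ge0.
have Kpi : 2 * pi <= K by rewrite /K; lra.
have b0 : 0 <= e1 * (K * w) by apply: mulr_ge0; [exact: ltW|apply: mulr_ge0 => //; exact: ltW].
have bP t : y1 <= t <= y2 -> normc (lint x1' x2 (P rho ^~ t)) <= 2 * (e1 * (K * w) * K) * (x2 - x1').
  move=> ht; apply: lint_bound => // s hs.
    by apply: ccont_P; [exact: s01|exact: drho].
  rewrite /P normcM; apply: ler_pM; rewrite ?normc_ge0//; first exact: brho.
  exact: le_trans (v_ub t) K2.
have bQ s : x1' <= s <= x2 -> normc (lint y1 y2 (Q rho s)) <= 2 * (e1 * (K * w) * K) * (y2 - y1).
  move=> hs; apply: lint_bound => // t ht.
    by apply: ccont_Q; [exact: s01|exact: drho].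
  rewrite /Q normcM; apply: ler_pM; rewrite ?normc_ge0//; first exact: brho.
  have /andP[hs0 hs1] := s01 _ hs.
  rewrite normcM normc_real ger0_norm//; apply: le_trans Kpi.
  by apply: le_trans (normdGam t); rewrite ler_piMl// normc_ge0.
rewrite Eh /E.
apply: le_trans (normcB _ _) _.
apply: le_trans (lerD (normcB _ _) (lexx _)) _.
apply: le_trans (lerD (lerD (le_normcD _ _) (lexx _)) (lexx _)) _.
have h1 := bP y1 _; have h2 := bP y2 _; have h3 := bQ x1' _; have h4 := bQ x2 _.
rewrite !lexx ?y12 ?x12 in h1 h2 h3 h4.
have {}h1 := h1 isT; have {}h2 := h2 isT; have {}h3 := h3 isT; have {}h4 := h4 isT.
have eq1 : e * w ^+ 2 = 2 * (2 * (e1 * (K * w) * K) * (x2 - x1')) + 2 * (2 * (e1 * (K * w) * K) * (y2 - y1)) + e * w ^+ 2 / 2.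
  by rewrite /e1 /w; field; rewrite gt_eqF.
have h5 : 0 <= e * w ^+ 2 / 2 by rewrite divr_ge0// mulr_ge0 ?sqr_ge0// ltW.
rewrite eq1; lra.
Qed.

(** The loops are closed, so the sides t = 0 and t = 1 of the rectangle [eta, 1] x [0, 1] cancel and
    only the two loops remain. *)
Let homotopy_invariance eta : 0 < eta -> eta <= 1 -> lint 0 1 (Q h eta) = lint 0 1 (Q h 1).
Proof.
move=> eta0 eta1.
have E0 : E h eta 1 0 1 = 0.
  apply: bisection_eq0 => //.
  - move=> x1 m x2 y1 y2 a1 a2 a3 a4 _ _ _; exact: (@E_split1 eta).
  - move=> x1 x2 y1 m y2 a1 a2 a3 _ a4 a5 _; exact: (@E_split2 eta).
  - move=> x y hx hy e e0; have [del del0 H] := E_local y eta0 hx e0.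
    by exists del => // x1 x2 y1 y2 a1 a2 a3 a4 _ a5 a6 _; exact: H.
have PE : P h ^~ 0 = P h ^~ 1.
  by apply/funext => s; rewrite /P /gam /v /Gam expi0 expi1.
have sh (a q1 q2 : C) : a + q1 - a - q2 = q1 - q2 by ring.
by move: E0; rewrite /E PE sh => /eqP; rewrite subr_eq0 => /eqP ->.
Qed.

(** By homotopy the circle may be replaced by a loop so close to [z] that [g] is nearly [g z] on it,
    and the kernel has mean 1. The kernel is put in the form 1 / (1 - (z / r) conj(w)), whose
    geometric series will produce the coefficients. *)
Lemma cauchy_formula1 :
  g z = cintegral (P01 R) (fun t => g (r%:C * expi t) * (1 - (z / r%:C) * conjc (expi t))^-1).
Proof.
have rC0 : r%:C != 0 :> C by rewrite -normc_eq0 normc_real normr_eq0 gt_eqF.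
have pi0 : (0 +i* (2 * pi) : C) != 0.
  rewrite -normc_eq0 /= expr0n add0r sqrtr_sqr normr_eq0.
  by rewrite mulf_neq0// gt_eqF// pi_gt0.
pose k (t : R) := (1 - (z / r%:C) * conjc (expi t))^-1.
have ex0 t : expi t != 0 :> C by rewrite -normc_eq0 normc_expi oner_eq0.
have kE t : k t = Gam t / v t.
  rewrite /k /v.
  have -> : conjc (expi t) = (expi t)^-1 by rewrite unimodularV ?normc_expi.
  rewrite /Gam; have vt := v_neq0 t; rewrite /v /Gam in vt.
  by field; rewrite rC0 ex0 vt.
have ck t : ccont k t.
  rewrite (_ : k = fun t => Gam t * (v t)^-1); last by apply/funext => x; exact: kE.
  apply: ccontM; first exact: cderiv_cont cderiv_Gam.
  by apply: ccontV => //; exact: cderiv_cont cderiv_v.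
have bk t : normc (k t) <= r / (r - normc z).
  rewrite kE normcM normcV normGam ler_pM2l// lef_pV2 ?posrE ?subr_gt0//.
  by apply: lt_le_trans (v_lb t); rewrite subr_gt0.
have B0 : 0 < r / (r - normc z) by rewrite divr_gt0// subr_gt0.
have M0 : 0 <= M by apply: le_trans (normc_ge0 (g 0)) _; apply: gM; rewrite normc0.
have QE s t : 0 < s -> Q h s t = (0 +i* (2 * pi)) * (g (gam s t) * k t).
  move=> s0; rewrite /Q /h kE /gam addrAC subrr add0r /dGam -/(Gam t).
  have sC0 : s%:C != 0 :> C by rewrite -normc_eq0 normc_real normr_eq0 gt_eqF.
  by rewrite /Gam; field; rewrite sC0 v_neq0.
pose J s := cintegral (P01 R) (fun t => g (gam s t) * k t).
have cg s t : 0 <= s <= 1 -> ccont (fun t => g (gam s t) * k t) t.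
  by move=> s01; apply: ccontM => //; apply: ccont_comp_t => //; apply: dg; exact: gam_lt1.
have bg s t : 0 <= s <= 1 -> normc (g (gam s t) * k t) <= M * (r / (r - normc z)).
  by move=> s01; rewrite normcM ler_pM ?normc_ge0// gM// gam_lt1.
have iJ s : 0 <= s <= 1 -> cintegrable (P01 R) (fun t => g (gam s t) * k t).
  by move=> s01; apply: (@cintegrable_bounded _ _ _ _ _ (M * (r / (r - normc z))));
    [apply: cmeasurable_cont => t; exact: cg|move=> t; exact: bg].
have lJ s : 0 < s <= 1 -> lint 0 1 (Q h s) = (0 +i* (2 * pi)) * J s.
  move=> /andP[s0 s1]; have s01 : 0 <= s <= 1 by rewrite ltW.
  rewrite /J -cintegralZ; last exact: iJ.
  rewrite (@cintegral_P01 _ _ (2 * pi * (M * (r / (r - normc z))))).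
  - by apply: eq_lint => t _; exact: QE.
  - by move=> t; apply: ccontM; [exact: ccont_cst|exact: cg].
  - move=> t; rewrite normcM; apply: ler_pM; rewrite ?normc_ge0//; last exact: bg.
    by rewrite /= expr0n add0r sqrtr_sqr ger0_norm// mulr_ge0// pi_ge0.
have Jinv s : 0 < s <= 1 -> J s = J 1.
  move=> s01; apply: (mulfI pi0); rewrite -!lJ ?ltr01 ?lexx//.
  by apply: homotopy_invariance; case/andP: s01.
have k1 : cintegral (P01 R) k = 1.
  by apply: cauchy_kernel_mean; rewrite normcM normcV normc_real gtr0_norm// ltr_pdivrMr// mul1r.
have ik : cintegrable (P01 R) k.
  by apply: (@cintegrable_bounded _ _ _ _ _ (r / (r - normc z))) => //; exact: cmeasurable_cont.
transitivity (J 1); last first.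
  by apply: eq_cintegral => t; rewrite /gam mul1r /v addrC subrK.
apply/esym/eqP; rewrite -subr_eq0 -normc_eq0; apply/negPn/negP => N0.
have {}N0 : 0 < normc (J 1 - g z) by rewrite lt_def N0 normc_ge0.
pose e := normc (J 1 - g z) / (2 * (r / (r - normc z))).
have e0 : 0 < e by rewrite divr_gt0// mulr_gt0.
have z1 : normc z < 1 by apply: lt_trans zr r1.
have [d d0 hd] := complex_diff_cont (dg z1) e0.
(* The loop lies within 2 s of [z], by [v_ub]. *)
pose s := Num.min 1 (d / 4).
have s01 : 0 < s <= 1 by rewrite lt_min ltr01 divr_gt0//= ge_min lexx.
have s01' : 0 <= s <= 1 by case/andP: s01 => /ltW -> ->.
have sd : s * 2 < d.
  have : s <= d / 4 by rewrite ge_min lexx orbT.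
  lra.
have : normc (J s - g z) <= e * (r / (r - normc z)).
  have -> : J s - g z = cintegral (P01 R) (fun t => (g (gam s t) - g z) * k t).
    rewrite -[X in J s - X]mulr1 -{1}k1 -cintegralZ// -cintegralB//.
    + by apply: eq_cintegral => t; rewrite mulrBl.
    + exact: iJ.
    + exact: cintegrableZ.
  apply: normc_cintegral_bound.
    apply: cmeasurable_cont => t; apply: ccontM => //.
    apply: ccontD; last exact: ccont_cst.
    by apply: ccont_comp_t => //; apply: dg; exact: gam_lt1.
  move=> t; rewrite normcM ler_pM ?normc_ge0// ltW// hd//.
  rewrite /gam addrAC subrr add0r normcM normc_real ger0_norm; last by case/andP: s01'.
  by apply: le_lt_trans sd; rewrite ler_wpM2l//; case/andP: s01'.
rewrite Jinv// /e; move: B0 N0; set B := r / _; set N := normc _ => B0 N0.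
have -> : N / (2 * B) * B = N / 2 by field; rewrite gt_eqF.
by apply/negP; rewrite -ltNge ltr_pdivrMr// ltr_pMr// ltr1n.
Qed.

End cauchy_one_variable.

(** * Monomials and Fejer means *)

Section multi_indices.
Implicit Types a b : multi_index.

Definition supp_lt a N := forall j, (N <= j)%N -> a j = 0.

Definition idx_bound a : nat := (\max_(j <- finsupp a) j).+1.

Lemma idx_boundP a : supp_lt a (idx_bound a).
Proof.
move=> j; rewrite /idx_bound => h; apply/eqP; apply: contraLR h.
rewrite -mem_finsupp => ja; rewrite -leqNgt.
by rewrite (big_rem j)//= leq_maxl.
Qed.

Lemma supp_ltW a N M : (N <= M)%N -> supp_lt a N -> supp_lt a M.
Proof. by move=> NM h j Mj; apply: h; exact: leq_trans Mj. Qed.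

Lemma common_supp_lt (s : seq multi_index) : exists N, forall a, a \in s -> supp_lt a N.
Proof.
exists (\max_(a <- s) idx_bound a)%N => a as_; apply: (supp_ltW _ (@idx_boundP a)).
by rewrite (big_rem a)//= leq_maxl.
Qed.

Definition mkidx N (e : nat -> int) : multi_index :=
  [fsfun j in seq_fset tt (iota 0 N) => e j].

Lemma mkidxE N e j : mkidx N e j = if (j < N)%N then e j else 0.
Proof. by rewrite /mkidx fsfunE seq_fsetE mem_iota /= add0n. Qed.

Lemma supp_lt_mkidx N e : supp_lt (mkidx N e) N.
Proof. by move=> j Nj; rewrite mkidxE ltnNge Nj. Qed.

Definition idx_sub a b : multi_index :=
  mkidx (maxn (idx_bound a) (idx_bound b)) (fun j => a j - b j).

Lemma idx_subE a b j : idx_sub a b j = a j - b j.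
Proof.
rewrite /idx_sub mkidxE; case: ifPn => //; rewrite -leqNgt geq_max => /andP[ja jb].
by rewrite (idx_boundP ja) (idx_boundP jb) subrr.
Qed.

Definition idx_add a b : multi_index :=
  mkidx (maxn (idx_bound a) (idx_bound b)) (fun j => a j + b j).

Lemma idx_addE a b j : idx_add a b j = a j + b j.
Proof.
rewrite /idx_add mkidxE; case: ifPn => //; rewrite -leqNgt geq_max => /andP[ja jb].
by rewrite (idx_boundP ja) (idx_boundP jb) addr0.
Qed.

Lemma idx_subDK a b : idx_sub (idx_add a b) b = a.
Proof. by apply/fsfunP => j; rewrite idx_subE idx_addE addrK. Qed.

Lemma idx_subK a b : idx_add (idx_sub a b) b = a.
Proof. by apply/fsfunP => j; rewrite idx_addE idx_subE subrK. Qed.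

Lemma idx_subI b : injective (idx_sub ^~ b).
Proof. by move=> a a' /(congr1 (idx_add ^~ b)); rewrite !idx_subK. Qed.

Lemma idx_addI b : injective (idx_add ^~ b).
Proof. by move=> a a' /(congr1 (idx_sub ^~ b)); rewrite !idx_subDK. Qed.

End multi_indices.

Section monomials.
Variable R : realType.
Implicit Types (a b : multi_index) (z : nat -> R[i]).

Lemma prod_finsupp a N (F : nat -> R[i]) : supp_lt a N -> (forall j, a j = 0 -> F j = 1) ->
  \prod_(j <- finsupp a) F j = \prod_(j < N) F j.
Proof.
move=> aN F1; rewrite -(big_mkord xpredT) /index_iota subn0.
rewrite [RHS](bigID (fun j => j \in finsupp a))/= [X in _ * X]big1 ?mulr1; last first.
  by move=> j; rewrite mem_finsupp negbK => /eqP; exact: F1.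
rewrite -[RHS]big_filter; apply: perm_big; apply: uniq_perm.
- exact: fset_uniq.
- by rewrite filter_uniq// iota_uniq.
- move=> j; rewrite mem_filter mem_iota /= add0n.
  case: (boolP (j \in finsupp a)) => //=; rewrite mem_finsupp => aj.
  by apply/esym; rewrite ltnNge; apply: contra aj => /aN ->.
Qed.

Lemma monomialE z a N : supp_lt a N -> monomial z a = \prod_(j < N) z j ^ a j.
Proof. by move=> aN; apply: prod_finsupp => // j ->; rewrite expr0z. Qed.

Lemma monomial_nat z a N : nonneg_index a -> supp_lt a N ->
  monomial z a = \prod_(j < N) z j ^+ `|a j|%N.
Proof.
move=> a0 aN; rewrite (monomialE _ aN); apply: eq_bigr => j _.
by have := a0 j; case: (a j).
Qed.

Lemma monomial_sub z a b : (forall j, z j != 0) ->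
  monomial z (idx_sub a b) = monomial z a * (monomial z b)^-1.
Proof.
move=> z0; pose N := maxn (idx_bound a) (idx_bound b).
have aN : supp_lt a N by apply: (supp_ltW _ (@idx_boundP a)); exact: leq_maxl.
have bN : supp_lt b N by apply: (supp_ltW _ (@idx_boundP b)); exact: leq_maxr.
have cN : supp_lt (idx_sub a b) N by exact: supp_lt_mkidx.
rewrite (monomialE _ aN) (monomialE _ bN) (monomialE _ cN) -prodfV -big_split /=.
by apply: eq_bigr => j _; rewrite idx_subE expfzDr// invr_expz.
Qed.

Lemma normcXz (x : R[i]) (k : int) : normc (x ^ k) = normc x ^ k.
Proof.
case: k => n; first by rewrite -!exprnP normcX.
by rewrite !NegzE -!exprnN normcV normcX.
Qed.

Lemma normc_monomial z a N : nonneg_index a -> supp_lt a N ->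
  normc (monomial z a) = \prod_(j < N) normc (z j) ^+ `|a j|%N.
Proof.
by move=> a0 aN; rewrite (monomial_nat _ a0 aN) normc_prod; apply: eq_bigr => j _; rewrite normcX.
Qed.

Lemma normc_monomial_torus z a : (forall j, normc (z j) = 1) -> normc (monomial z a) = 1.
Proof.
by move=> z1; rewrite /monomial normc_prod big1// => j _; rewrite normcXz z1 exp1rz.
Qed.

Lemma monomial_eq z z' a : (forall j, a j != 0 -> z j = z' j) -> monomial z a = monomial z' a.
Proof. by move=> h; apply: eq_big_seq => j; rewrite mem_finsupp => /h ->. Qed.

Lemma monomialM z z' a : monomial (fun j => z j * z' j) a = monomial z a * monomial z' a.
Proof. by rewrite /monomial -big_split; apply: eq_bigr => j _; rewrite expfzMl. Qed.

Lemma monomial_split z a j :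
  monomial z a = z j ^ a j * \prod_(i <- finsupp a | i != j) z i ^ a i.
Proof.
case: (boolP (j \in finsupp a)) => ja; first by rewrite /monomial (bigD1_seq j)//= fset_uniq.
move: (ja); rewrite mem_finsupp negbK => /eqP ->; rewrite expr0z mul1r /monomial.
rewrite [LHS]big_seq_cond [RHS]big_seq_cond; apply: eq_bigl => i; rewrite andbT.
by case: (boolP (i \in finsupp a)) => //= ia; apply/esym; apply: contraNneq ja => <-.
Qed.

(** A polynomial is a list of exponents together with a coefficient function on all indices, of
    which only the values on the list matter. *)
Definition peval (s : seq multi_index) (c : multi_index -> R[i]) z : R[i] :=
  \sum_(a <- s) c a * monomial z a.

End monomials.

Section torus_monomials.
Variable R : realType.
Local Notation m := (torus_measure R).
Implicit Types (a b : multi_index).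

Lemma cmeasurable_monomial a : cmeasurable (fun w : torus R => monomial (tval w) a).
Proof.
apply: cmeasurable_prod => j; apply: cmeasurableXz; last exact: cmeasurable_tval.
by move=> w; exact: normc_tval.
Qed.

Lemma normc_tmonomial (w : torus R) a : normc (monomial (tval w) a) = 1.
Proof. by apply: normc_monomial_torus => j; exact: normc_tval. Qed.

Lemma cmeasurable_monomialV a : cmeasurable (fun w : torus R => (monomial (tval w) a)^-1).
Proof.
apply: (eq_cmeasurable _ (cmeasurableJ (cmeasurable_monomial a))) => w.
by rewrite (unimodularV (normc_tmonomial w a)).
Qed.

Lemma normc_tmonomialV (w : torus R) a : normc ((monomial (tval w) a)^-1) = 1.
Proof. by rewrite normcV normc_tmonomial invr1. Qed.

Lemma cmeasurable_peval s (c : multi_index -> R[i]) : cmeasurable (fun w : torus R => peval s c (tval w)).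
Proof.
apply: cmeasurable_sum => a.
by apply: cmeasurableM; [exact: cmeasurable_cst|exact: cmeasurable_monomial].
Qed.

Lemma normc_peval_le s (c : multi_index -> R[i]) (w : torus R) :
  normc (peval s c (tval w)) <= \sum_(a <- s) normc (c a).
Proof.
apply: le_trans (normc_sum _ _ _) _; apply: ler_sum => a _.
by rewrite normcM normc_tmonomial mulr1.
Qed.

Lemma cintegrable_peval s (c : multi_index -> R[i]) : cintegrable m (fun w => peval s c (tval w)).
Proof.
apply: (@cintegrable_bounded _ _ _ _ _ (\sum_(a <- s) normc (c a))).
  exact: cmeasurable_peval.
by move=> w; exact: normc_peval_le.
Qed.

Lemma cintegrable_monomial a : cintegrable m (fun w => monomial (tval w) a).
Proof.
apply: (@cintegrable_bounded _ _ _ _ _ 1); first exact: cmeasurable_monomial.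
by move=> w; rewrite normc_tmonomial.
Qed.

Lemma cintegral_expiz (k : int) : cintegral (P01 R) (fun t => expi t ^ k) = (k == 0)%:R.
Proof.
case: k => n; first by under eq_cintegral do rewrite -exprnP; rewrite cintegral_expiX.
under eq_cintegral => t do rewrite NegzE -exprnN -exprVn (unimodularV (normc_expi t)).
by rewrite cintegral_expiJX.
Qed.

(** Resampling coordinate [j] splits off the mean of a nontrivial character of the circle. *)
Lemma cintegral_monomial a j : a j != 0 -> cintegral m (fun w => monomial (tval w) a) = 0.
Proof.
move=> aj.
have b1 (w : torus R) : normc (monomial (tval w) a) <= 1 by rewrite normc_tmonomial.
have [_ ->] := resample j (cmeasurable_monomial a) b1.
rewrite -[RHS](cintegral_cst m 0); apply: eq_cintegral => w.
pose K := \prod_(i <- finsupp a | i != j) tval w i ^ a i.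
transitivity (cintegral (P01 R) (fun t => K * expi t ^ a j)).
  apply: eq_cintegral => t; rewrite (monomial_split _ a j) mulrC tval_upd eqxx; congr (_ * _).
  by apply: eq_bigr => i /negbTE ij; rewrite tval_upd ij.
rewrite cintegralZ ?cintegral_expiz ?(negbTE aj) ?mulr0//.
apply: (@cintegrable_bounded _ _ _ _ _ 1); last by move=> t; rewrite normcXz normc_expi exp1rz.
apply: cmeasurableXz; first exact: normc_expi.
by apply: cmeasurable_cont => t; exact: ccont_expi.
Qed.

Lemma orthogonality a b :
  cintegral m (fun w => monomial (tval w) a * (monomial (tval w) b)^-1) = (a == b)%:R.
Proof.
case: (eqVneq a b) => [->|ab].
  rewrite -[RHS](cintegral_cst m); apply: eq_cintegral => w.
  by rewrite divff// -normc_eq0 normc_tmonomial oner_eq0.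
have [j aj] : exists j, a j != b j.
  apply: contrapT => h; move/eqP: ab; apply; apply/fsfunP => j.
  by apply/eqP/negPn/negP => aj; apply: h; exists j.
rewrite -[RHS](@cintegral_monomial (idx_sub a b) j); last by rewrite idx_subE subr_eq0.
by apply: eq_cintegral => w; rewrite monomial_sub// => i; exact: tval_neq0.
Qed.

Lemma fourier_coefE (f : torus R -> R[i]) a :
  fourier_coef f a = cintegral m (fun w => f w * (monomial (tval w) a)^-1).
Proof. by []. Qed.

Lemma fourier_peval s (c : multi_index -> R[i]) a : uniq s ->
  fourier_coef (fun w => peval s c (tval w)) a = if a \in s then c a else 0.
Proof.
move=> us; rewrite fourier_coefE.
have iab b : cintegrable m (fun w => monomial (tval w) b * (monomial (tval w) a)^-1).
  apply: (@cintegrableM_bounded _ _ _ _ _ _ 1).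
  - exact: cintegrable_monomial.
  - exact: cmeasurable_monomialV.
  - by move=> w; rewrite normc_tmonomialV.
transitivity (\sum_(b <- s) c b * (b == a)%:R).
  under eq_cintegral do rewrite /peval mulr_suml.
  rewrite cintegral_sum; last first.
    by move=> b; apply: eq_cintegrable (cintegrableZ (c b) (iab b)) => w; rewrite mulrA.
  apply: eq_bigr => b _; rewrite -orthogonality -cintegralZ//.
  by apply: eq_cintegral => w; rewrite mulrA.
case: ifPn => as_.
  rewrite (bigD1_seq a)//= eqxx mulr1 big1 ?addr0// => b /negbTE ->.
  by rewrite mulr0.
rewrite big_seq big1// => b bs; case: eqP => [ba|_]; last by rewrite mulr0.
by rewrite -ba bs in as_.
Qed.

Lemma cintegrable_fourier (f : torus R -> R[i]) a : cintegrable m f ->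
  cintegrable m (fun w => f w * (monomial (tval w) a)^-1).
Proof.
move=> i; apply: (@cintegrableM_bounded _ _ _ _ _ _ 1) => //.
  exact: cmeasurable_monomialV.
by move=> w; rewrite normc_tmonomialV.
Qed.

End torus_monomials.

Lemma ler_sum_sub (R : numDomainType) (I : eqType) (s1 s : seq I) (F : I -> R) :
  uniq s1 -> uniq s -> {subset s1 <= s} -> (forall i, 0 <= F i) ->
  \sum_(i <- s1) F i <= \sum_(i <- s) F i.
Proof.
move=> u1 us sub F0; rewrite -(perm_big _ (permEl (perm_filterC (mem s1) s)))/= big_cat /=.
rewrite -(perm_big _ (_ : perm_eq s1 [seq x <- s | x \in s1])) ?lerDl ?sumr_ge0//.
apply: uniq_perm => //; first by rewrite filter_uniq.
by move=> a; rewrite mem_filter; apply/idP/andP => [as1|[]//]; split => //; exact: sub.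
Qed.

Section fejer.
Variable R : realType.
Local Notation m := (torus_measure R).
Local Notation Re := complex.Re.
Implicit Types (w : torus R) (B s : seq multi_index) (a b : multi_index).

(** For a box [B] this is the product of the one-variable Fejer kernels. Written as a square it is
    visibly positive, and a general list [B] keeps the algebra free of coordinates. *)
Definition fejer_kernel B w w' : R :=
  normc (\sum_(k <- B) monomial (tval w) k * conjc (monomial (tval w') k)) ^+ 2 / (size B)%:R.

Lemma fejer_kernel_ge0 B w w' : 0 <= fejer_kernel B w w'.
Proof. by rewrite divr_ge0// sqr_ge0. Qed.

Lemma tmonomial_conj w a : conjc (monomial (tval w) a) = (monomial (tval w) a)^-1.
Proof. by rewrite unimodularV// normc_tmonomial. Qed.

Lemma tmonomial_neq0 w a : monomial (tval w) a != 0.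
Proof. by rewrite -normc_eq0 normc_tmonomial oner_eq0. Qed.

Lemma fejer_kernelE B w w' : (fejer_kernel B w w')%:C = (size B)%:R^-1 *
  \sum_(k <- B) \sum_(l <- B) monomial (tval w) (idx_sub k l) * (monomial (tval w') (idx_sub k l))^-1.
Proof.
rewrite /fejer_kernel rmorphM /= fmorphV rmorph_nat mulrC; congr (_ * _).
rewrite -mulcJ rmorph_sum mulr_suml; apply: eq_bigr => k _.
rewrite mulr_sumr; apply: eq_bigr => l _.
rewrite !monomial_sub; try exact: tval_neq0.
rewrite rmorphM /= conjcK !tmonomial_conj.
by field; rewrite !tmonomial_neq0.
Qed.

Lemma cmeasurable_fejer_term a w : cmeasurable (fun w' => monomial (tval w) a * (monomial (tval w') a)^-1).
Proof. by apply: cmeasurableM; [exact: cmeasurable_cst|exact: cmeasurable_monomialV]. Qed.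

Lemma fejer_kernelC B w w' : fejer_kernel B w w' = fejer_kernel B w' w.
Proof.
rewrite /fejer_kernel -normc_conjc rmorph_sum; congr (normc _ ^+ 2 / _).
by apply: eq_bigr => k _; rewrite rmorphM /= conjcK mulrC.
Qed.

Lemma fejer_kernel_bound B w w' : fejer_kernel B w w' <= (size B)%:R.
Proof.
rewrite /fejer_kernel; have [->|B0] := eqVneq (size B) 0%N; first by rewrite invr0 mulr0.
rewrite ler_pdivrMr ?ltr0n ?lt0n// -expr2 ler_pXn2r ?nnegrE ?normc_ge0//.
apply: le_trans (normc_sum _ _ _) _.
have -> : (size B)%:R = \sum_(k <- B) 1 :> R by rewrite big_const_seq count_predT iter_addr_0.
by apply: ler_sum => i _; rewrite normcM normc_conjc !normc_tmonomial mulr1.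
Qed.

Lemma cmeasurable_fejer B w : cmeasurable (fun w' => (fejer_kernel B w w')%:C).
Proof.
apply: (@eq_cmeasurable _ _ _ (fun w' => (size B)%:R^-1 *
  \sum_(k <- B) \sum_(l <- B) monomial (tval w) (idx_sub k l) * (monomial (tval w') (idx_sub k l))^-1)).
  by move=> w'; rewrite fejer_kernelE.
apply: cmeasurableM; first exact: cmeasurable_cst.
by do 2!(apply: cmeasurable_sum => ?); exact: cmeasurable_fejer_term.
Qed.

Lemma cintegrable_fejer B w : cintegrable m (fun w' => (fejer_kernel B w w')%:C).
Proof.
apply: (cintegrable_bounded m (M := (size B)%:R)); first exact: cmeasurable_fejer.
by move=> w'; rewrite normc_real ger0_norm ?fejer_kernel_ge0// fejer_kernel_bound.
Qed.

Lemma cintegral_monomialV a j : a j != 0 -> cintegral m (fun w => (monomial (tval w) a)^-1) = 0.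
Proof.
move=> aj; have h w : (monomial (tval w) a)^-1 = conjc (monomial (tval w) a) by rewrite tmonomial_conj.
rewrite (eq_cintegral _ h) (cintegral_conj (cintegrable_monomial _ a)).
by rewrite (cintegral_monomial _ aj); exact: conjc0.
Qed.

Lemma cintegral_fejer B w : uniq B -> (0 < size B)%N ->
  cintegral m (fun w' => (fejer_kernel B w w')%:C) = 1.
Proof.
move=> uB B0.
have it a : cintegrable m (fun w' => monomial (tval w) a * (monomial (tval w') a)^-1).
  apply: (cintegrable_bounded m (M := 1)); first exact: cmeasurable_fejer_term.
  by move=> w'; rewrite normcM normc_tmonomial normc_tmonomialV mulr1.
rewrite (eq_cintegral _ (fejer_kernelE B w)) cintegralZ; last first.
  by do 2!(apply: cintegrable_sum => ?); exact: it.
rewrite cintegral_sum; last by move=> k; apply: cintegrable_sum => l; exact: it.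
rewrite big_seq (eq_bigr (fun=> 1)); last first.
  move=> k kB; rewrite cintegral_sum// (bigD1_seq k)//= big1 ?addr0.
    rewrite -[RHS](cintegral_cst m); apply: eq_cintegral => w'.
    by rewrite !monomial_sub ?divff ?mulr1 ?invr1 ?tmonomial_neq0// => i; exact: tval_neq0.
  move=> l lk.
  have [j aj] : exists j, k j != l j.
    apply: contrapT => h; move/eqP: lk; apply; apply/fsfunP => j.
    by apply/esym/eqP/negPn/negP => aj; apply: h; exists j.
  rewrite cintegralZ ?(@cintegral_monomialV _ j) ?mulr0//; first by rewrite idx_subE subr_eq0.
  apply: (cintegrable_bounded m (M := 1)); first exact: cmeasurable_monomialV.
  by move=> w'; rewrite normc_tmonomialV.
by rewrite -big_seq big_const_seq count_predT iter_addr_0 mulVf// pnatr_eq0 -lt0n.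
Qed.

Lemma Rintegral_fejer B w : uniq B -> (0 < size B)%N -> \int[m]_w' fejer_kernel B w w' = 1.
Proof. by move=> uB B0; have [] := cintegral_fejer w uB B0. Qed.

(** The number of ways to write [a] as a difference of two elements of [B], relative to the size of
    [B]. This is the factor by which the mean multiplies the coefficient at [a]. *)
Definition fejer_weight B a : R := (count (fun l => idx_add a l \in B) B)%:R / (size B)%:R.

Definition fejer_supp B : seq multi_index :=
  [seq a <- undup [seq idx_sub k l | k <- B, l <- B] | `[< nonneg_index a >]].

(** Expanding the square, the pair (k, l) contributes at the index k - l, and grouping pairs by
    their difference produces the weights. Indices with a negative entry drop out together with the
    coefficients of [f]. *)
Lemma fejer_mean (f : torus R -> R[i]) B w : cintegrable m f -> uniq B ->
  (forall a, ~ nonneg_index a -> fourier_coef f a = 0) ->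
  cintegral m (fun w' => f w' * (fejer_kernel B w w')%:C) =
  peval (fejer_supp B) (fun a => (fejer_weight B a)%:C * fourier_coef f a) (tval w).
Proof.
move=> i uB f0.
have iF a : cintegrable m (fun w' => f w' * (monomial (tval w') a)^-1) by exact: cintegrable_fourier.
have h w' : f w' * (fejer_kernel B w w')%:C = (size B)%:R^-1 * \sum_(k <- B) \sum_(l <- B)
   monomial (tval w) (idx_sub k l) * (f w' * (monomial (tval w') (idx_sub k l))^-1).
  rewrite fejer_kernelE mulrCA; congr (_ * _); rewrite mulr_sumr; apply: eq_bigr => k _.
  by rewrite mulr_sumr; apply: eq_bigr => l _; rewrite mulrCA.
rewrite (eq_cintegral _ h) cintegralZ; last first.
  by do 2!(apply: cintegrable_sum => ?); exact: cintegrableZ.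
rewrite cintegral_sum; last by move=> k; apply: cintegrable_sum => l; exact: cintegrableZ.
under eq_bigr => k _.
  rewrite cintegral_sum; last by move=> l; exact: cintegrableZ.
  under eq_bigr => l _ do rewrite cintegralZ// -fourier_coefE.
  over.
set F := fun a => monomial (tval w) a * fourier_coef f a.
set S := undup [seq idx_sub k l | k <- B, l <- B].
have e l : l \in B -> \sum_(k <- B) F (idx_sub k l) = \sum_(a <- S | idx_add a l \in B) F a.
  move=> lB; rewrite -[RHS]big_filter -(big_map (idx_sub ^~ l) xpredT F).
  apply: perm_big; apply: uniq_perm.
  - by rewrite map_inj_uniq//; exact: idx_subI.
  - by rewrite filter_uniq// undup_uniq.
  - move=> a; rewrite mem_filter mem_undup; apply/mapP/andP.
      move=> [k kB ->]; rewrite idx_subK kB; split => //.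
      by apply/allpairsP; exists (k, l).
    by move=> [aB _]; exists (idx_add a l) => //; rewrite idx_subDK.
rewrite exchange_big /= big_seq (eq_bigr _ e) -big_seq.
rewrite /peval /fejer_supp big_filter -/S.
under eq_bigr => l _ do rewrite big_mkcond.
rewrite exchange_big /= mulr_sumr [RHS]big_mkcond /=; apply: eq_bigr => a _.
rewrite -big_mkcond big_const_seq iter_addr_0 /fejer_weight /F.
case: asboolP => [_|/f0 ->]; last by rewrite mulr0 mul0rn mulr0.
by rewrite rmorphM /= fmorphV !rmorph_nat -mulr_natr; ring.
Qed.

Lemma normc_fejer_le (f : torus R -> R[i]) B w M : cmeasurable f -> (forall w, normc (f w) <= M) ->
  uniq B -> (0 < size B)%N ->
  normc (cintegral m (fun w' => f w' * (fejer_kernel B w w')%:C)) <= M.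
Proof.
move=> mf fM uB B0; have i := cintegrable_bounded m mf fM.
have iK := cintegrable_fejer B w.
have iKr : m.-integrable setT (EFin \o fejer_kernel B w) by case: iK.
have ifK : cintegrable m (fun w' => f w' * (fejer_kernel B w w')%:C).
  apply: (cintegrableM_bounded (M := (size B)%:R)) => //; first exact: cmeasurable_fejer.
  by move=> w'; rewrite normc_real ger0_norm ?fejer_kernel_ge0// fejer_kernel_bound.
apply: le_trans (normc_cintegral_le ifK) _.
rewrite -[leRHS]mulr1 -(Rintegral_fejer w uB B0) -RintegralZl//.
apply: le_Rintegral => //.
- exact: cintegrable_normc.
- exact: (integrableZl measurableT M iKr).
- move=> w' _; rewrite normcM normc_real ger0_norm ?fejer_kernel_ge0//.
  by apply: ler_wpM2r => //; exact: fejer_kernel_ge0.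
Qed.

(** Fubini-Tonelli, with the kernel integrated in its first variable, where it has mean 1 too by
    [fejer_kernelC]. *)
Lemma Rintegral_fejer_le (f : torus R -> R[i]) B (Q : torus R -> R[i]) : cintegrable m f ->
  uniq B -> (0 < size B)%N -> cintegrable m Q ->
  (forall w, cintegral m (fun w' => f w' * (fejer_kernel B w w')%:C) = Q w) ->
  \int[m]_w normc (Q w) <= \int[m]_w normc (f w).
Proof.
move=> i uB B0 iQ QE; have mf := cintegrable_meas i.
have iKr w : m.-integrable setT (EFin \o fejer_kernel B w) by case: (cintegrable_fejer B w).
have ifK w : cintegrable m (fun w' => f w' * (fejer_kernel B w w')%:C).
  apply: (cintegrableM_bounded (M := (size B)%:R)) => //; first exact: cmeasurable_fejer.
  by move=> w'; rewrite normc_real ger0_norm ?fejer_kernel_ge0// fejer_kernel_bound.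
have mfst : measurable_fun setT (fst : torus R * torus R -> torus R) by exact: measurable_fst.
have msnd : measurable_fun setT (snd : torus R * torus R -> torus R) by exact: measurable_snd.
have mK : cmeasurable (fun p : torus R * torus R => (fejer_kernel B p.1 p.2)%:C).
  apply: (@eq_cmeasurable _ _ _ (fun p : torus R * torus R => (size B)%:R^-1 *
    \sum_(k <- B) \sum_(l <- B) monomial (tval p.1) (idx_sub k l) * (monomial (tval p.2) (idx_sub k l))^-1)).
    by move=> p; rewrite fejer_kernelE.
  apply: cmeasurableM; first exact: cmeasurable_cst.
  do 2!(apply: cmeasurable_sum => ?); apply: cmeasurableM.
    exact: (cmeasurable_comp mfst (cmeasurable_monomial _ _)).
  exact: (cmeasurable_comp msnd (cmeasurable_monomialV _ _)).
pose g (p : torus R * torus R) : R := normc (f p.2) * fejer_kernel B p.1 p.2.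
have g0 p : (0 <= (g p)%:E)%E by rewrite lee_fin mulr_ge0 ?normc_ge0 ?fejer_kernel_ge0.
have mg : measurable_fun setT (EFin \o g).
  apply/measurable_EFinP/measurable_funM; last by case: mK.
  exact: (measurableT_comp (measurable_normc mf) msnd).
have ig w : m.-integrable setT (EFin \o (fun w' => g (w, w'))).
  have := cintegrable_normc (ifK w); apply: eq_integrable => // w' _ /=.
  by rewrite normcM normc_real ger0_norm ?fejer_kernel_ge0.
rewrite -lee_fin /Rintegral !fineK; last 2 first.
- by apply: integrable_fin_num => //; exact: cintegrable_normc.
- by apply: integrable_fin_num => //; exact: cintegrable_normc.
apply: (@le_trans _ _ (\int[m]_w \int[m]_w' (g (w, w'))%:E)%E).
  apply: ge0_le_integral => //.
  - by move=> w _; rewrite lee_fin normc_ge0.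
  - apply/measurable_EFinP/measurable_normc.
    exact: cintegrable_meas iQ.
  - exact: (measurable_fun_fubini_tonelli_F (EFin \o g)).
  - move=> w _; rewrite -[leRHS]fineK; last exact: integrable_fin_num (ig w).
    rewrite lee_fin -QE; apply: le_trans (normc_cintegral_le (ifK w)) _.
    rewrite le_eqVlt; apply/orP; left; apply/eqP; apply: eq_Rintegral => w' _.
    by rewrite normcM normc_real ger0_norm ?fejer_kernel_ge0.
rewrite (fubini_tonelli (EFin \o g))// le_eqVlt; apply/orP; left; apply/eqP.
apply: eq_integral => w' _ /=.
rewrite /g /=.
transitivity ((normc (f w'))%:E * \int[m]_w (fejer_kernel B w' w)%:E)%E.
  have := integralZl measurableT (iKr w') (normc (f w')) => /= <-.
  by apply: eq_integral => w _; rewrite fejer_kernelC EFinM.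
have -> : (\int[m]_w (fejer_kernel B w' w)%:E = 1)%E.
  have := Rintegral_fejer w' uB B0; rewrite /Rintegral => h1.
  have := integrable_fin_num measurableT (iKr w') => /fineK /= <-.
  by rewrite h1.
by rewrite mule1.
Qed.

Definition idx_of_ffun N n (k : {ffun 'I_N -> 'I_n}) : multi_index :=
  mkidx N (fun j => if insub j is Some i then (nat_of_ord (k i))%:Z else 0).

Lemma idx_of_ffunE N n (k : {ffun 'I_N -> 'I_n}) i : idx_of_ffun k (nat_of_ord i) = (nat_of_ord (k i))%:Z.
Proof. by rewrite /idx_of_ffun mkidxE ltn_ord (valK i). Qed.

Lemma idx_of_ffun_inj N n : injective (@idx_of_ffun N n).
Proof.
move=> k l kl; apply/ffunP => i; apply/val_inj.
by have := congr1 (fun f : multi_index => f i) kl; rewrite /= !idx_of_ffunE => -[].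
Qed.

Lemma idx_of_ffun_nonneg N n (k : {ffun 'I_N -> 'I_n}) : nonneg_index (idx_of_ffun k).
Proof.
move=> j; case: (ltnP j N) => jN; last by rewrite (supp_lt_mkidx _ jN).
by rewrite (idx_of_ffunE k (Ordinal jN)).
Qed.

Definition idx_box N n : seq multi_index := [seq idx_of_ffun k | k : {ffun 'I_N -> 'I_n}].

Lemma mem_idx_box N n a : (a \in idx_box N n) <-> supp_lt a N /\ (forall j, (j < N)%N -> 0 <= a j < n%:Z).
Proof.
split.
  move=> /mapP[k _ ->]; split; first exact: supp_lt_mkidx.
  by move=> j jN; rewrite (idx_of_ffunE k (Ordinal jN)) ltz_nat ltn_ord.
move=> [aN ha].
have ha' (i : 'I_N) : (`|a i| < n)%N by have := ha i (ltn_ord i); case: (a i).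
apply/mapP; exists [ffun i => Ordinal (ha' i)]; first by rewrite mem_enum.
apply/fsfunP => j; case: (ltnP j N) => jN; last by rewrite (supp_lt_mkidx _ jN) aN.
rewrite (idx_of_ffunE _ (Ordinal jN)) ffunE /=; have := ha j jN; case: (a j) => //.
Qed.

Lemma uniq_idx_box N n : uniq (idx_box N n).
Proof. by rewrite map_inj_uniq ?enum_uniq//; exact: idx_of_ffun_inj. Qed.

Lemma size_idx_box N n : size (idx_box N n) = (n ^ N)%N.
Proof. by rewrite size_map -cardE card_ffun !card_ord. Qed.

(** Every [l] in the box of side n - d is counted, since a + l stays in the box of side [n]. *)
Lemma fejer_weight_box N n d a : nonneg_index a -> supp_lt a N -> (forall j, (a j <= d%:Z)) ->
  (d <= n)%N -> ((n - d) ^ N)%N%:R / (n ^ N)%N%:R <= fejer_weight (idx_box N n) a.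
Proof.
move=> a0 aN ad dn; rewrite /fejer_weight size_idx_box ler_wpM2r ?invr_ge0// ler_nat.
rewrite -size_filter -size_idx_box; apply: uniq_leq_size; first exact: uniq_idx_box.
move=> l /(mem_idx_box N (n - d)%N)[lN hl]; rewrite mem_filter; apply/andP; split.
  apply: (mem_idx_box N n _).2; split=> j jN; rewrite idx_addE; first by rewrite lN ?aN.
  have /andP[l0 l1] := hl j jN; rewrite addr_ge0//=.
  by have := ad j; move: l1; rewrite -subzn// => l1 ad'; lia.
apply: (mem_idx_box N n _).2; split=> // j jN; have /andP[l0 l1] := hl j jN; rewrite l0/=.
by apply: lt_le_trans l1 _; rewrite lez_nat leq_subr.
Qed.

Lemma pow_ratio_ge N n d : (0 < n)%N -> (d <= n)%N ->
  1 - (N * d)%N%:R / n%:R <= ((n - d) ^ N)%N%:R / (n ^ N)%N%:R :> R.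
Proof.
move=> n0 dn; rewrite !natrX natrB// -expr_div_n mulrBl divff ?pnatr_eq0 -?lt0n//.
have q1 : d%:R / n%:R <= 1 :> R by rewrite ler_pdivrMr ?ltr0n// mul1r ler_nat.
have q0 : 0 <= d%:R / n%:R :> R by rewrite divr_ge0.
rewrite natrM -mulrA; move: q0 q1; set q := d%:R / n%:R => q0 q1.
elim: N => [|N IH]; first by rewrite mul0r subr0 expr0.
rewrite exprS; apply: le_trans (_ : (1 - q) * (1 - N%:R * q) <= _); last first.
  by apply: ler_wpM2l => //; rewrite subr_ge0.
rewrite -natr1; have : 0 <= N%:R * q * q by rewrite !mulr_ge0.
lra.
Qed.

(* The polynomials are the Fejer means of f over large boxes. *)
Lemma fejer_approx (f : torus R -> R[i]) (s0 : seq multi_index) (e : R) : cintegrable m f ->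
  (forall a, ~ nonneg_index a -> fourier_coef f a = 0) ->
  (forall a, a \in s0 -> nonneg_index a) -> 0 < e ->
  exists s c, [/\ uniq s, (forall a, a \in s -> nonneg_index a),
    (forall a, a \in s0 -> (1 - e) * normc (fourier_coef f a) <= normc (c a) /\
       (fourier_coef f a != 0 -> e < 1 -> a \in s)),
    (forall M, (forall w, normc (f w) <= M) -> forall w, normc (peval s c (tval w)) <= M) &
    \int[m]_w normc (peval s c (tval w)) <= \int[m]_w normc (f w)].
Proof.
move=> i f0 s00 e0.
have [N hN] := common_supp_lt s0.
pose d := (\max_(a <- s0) \max_(j < N) `|a j|)%N.
have hd a j : a \in s0 -> a j <= d%:Z.
  move=> as0; apply: (@le_trans _ _ (`|a j|%N%:Z)); first by rewrite lez_abs.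
  rewrite lez_nat; case: (ltnP j N) => jN; last by rewrite (hN a as0 j jN).
  apply: (@leq_trans (\max_(j < N) `|a j|)%N).
    by rewrite (bigD1 (Ordinal jN))//= leq_maxl.
  by rewrite /d (big_rem a)//= leq_maxl.
(* With this [n], N d / n is at most [e], so by Bernoulli's inequality all weights on [s0] are at
   least 1 - e. *)
pose n := maxn d.+1 (Num.bound ((N * d)%N%:R / e)).
have n0 : (0 < n)%N by rewrite leq_max.
have dn : (d <= n)%N by rewrite leq_max leqnSn.
have ne : (N * d)%N%:R / n%:R <= e.
  rewrite ler_pdivrMr ?ltr0n// mulrC -ler_pdivrMr//.
  apply: le_trans (ltW (archi_boundP _)) _; first by rewrite divr_ge0// ltW.
  by rewrite ler_nat leq_maxr.
pose B := idx_box N n.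
have uB : uniq B := uniq_idx_box N n.
have B0 : (0 < size B)%N by rewrite size_idx_box expn_gt0 n0.
have wB a : a \in s0 -> 1 - e <= fejer_weight B a.
  move=> as0; apply: le_trans (fejer_weight_box (s00 a as0) (hN a as0) (fun j => hd a j as0) dn).
  by apply: le_trans (pow_ratio_ge N n0 dn); rewrite lerD2l lerN2.
exists (fejer_supp B), (fun a => (fejer_weight B a)%:C * fourier_coef f a).
have w0 a : 0 <= fejer_weight B a by rewrite divr_ge0.
split.
- by rewrite filter_uniq// undup_uniq.
- by move=> a; rewrite mem_filter => /andP[/asboolP].
- move=> a as0; split.
    by rewrite normcM normc_real ger0_norm// ler_wpM2r ?normc_ge0 ?wB.
  move=> fa e1; rewrite mem_filter; apply/andP; split; first exact/asboolP/s00.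
  have : 0 < fejer_weight B a by apply: lt_le_trans (wB a as0); rewrite subr_gt0.
  rewrite /fejer_weight pmulr_lgt0 ?invr_gt0 ?ltr0n// -has_count => /hasP[l lB alB].
  rewrite mem_undup; apply/allpairsP; exists (idx_add a l, l); split => //=.
  by rewrite idx_subDK.
- move=> M fM w; rewrite -fejer_mean//; apply: normc_fejer_le => //.
  exact: cintegrable_meas i.
- apply: (Rintegral_fejer_le (B := B)) => //; first exact: cintegrable_peval.
  by move=> w; rewrite fejer_mean.
Qed.

(** The means reproduce each coefficient of [f] up to a factor 1 - e, which disappears as e tends to
    0, and neither their supremum nor their mean modulus exceeds that of [f]. The supremum serves
    for p = oo, the mean modulus for finite p. *)
Lemma fejer_transfer (f : torus R -> R[i]) (s0 : seq multi_index) (z : nat -> R[i]) (L : R) :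
  cintegrable m f -> (forall a, ~ nonneg_index a -> fourier_coef f a = 0) ->
  uniq s0 -> (forall a, a \in s0 -> nonneg_index a) ->
  (forall s c, uniq s -> (forall a, a \in s -> nonneg_index a) ->
    (forall M, (forall w, normc (f w) <= M) -> forall w, normc (peval s c (tval w)) <= M) ->
    \int[m]_w normc (peval s c (tval w)) <= \int[m]_w normc (f w) ->
    \sum_(a <- s) normc (c a * monomial z a) <= L) ->
  \sum_(a <- s0) normc (fourier_coef f a * monomial z a) <= L.
Proof.
move=> i f0 us0 s00 H.
set S := \sum_(a <- s0) _.
have S0 : 0 <= S by apply: sumr_ge0 => a _; exact: normc_ge0.
have HS e : 0 < e -> e < 1 -> (1 - e) * S <= L.
  move=> e0 e1; have [s [c [us sn hs hM hI]]] := fejer_approx i f0 s00 e0.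
  apply: le_trans (H s c us sn hM hI).
  rewrite /S mulr_sumr (bigID (fun a => fourier_coef f a != 0))/= [X in _ + X]big1 ?addr0; last first.
    by move=> a /negPn/eqP ->; rewrite mul0r normc0 mulr0.
  rewrite big_seq_cond; apply: (@le_trans _ _ (\sum_(a <- s0 | (a \in s0) && (fourier_coef f a != 0)) normc (c a * monomial z a))).
    apply: ler_sum => a /andP[as0 _]; rewrite !normcM mulrA ler_wpM2r ?normc_ge0//.
    by have [] := hs a as0.
  rewrite -[leLHS]big_filter.
  apply: (@ler_sum_sub R _ _ s (fun a => normc (c a * monomial z a))) => //.
  - by rewrite filter_uniq.
  - by move=> a; rewrite mem_filter => /andP[/andP[as0 fa] _]; have [_] := hs a as0; apply.
  - by move=> a; exact: normc_ge0.
rewrite leNgt; apply/negP => LS.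
have Sp : 0 < S.
  rewrite lt_def S0 andbT; apply/eqP => Se; have := HS 2^-1.
  rewrite Se mulr0 invr_gt0 ltr0n invf_lt1 ?ltr1n// => /(_ isT isT).
  by rewrite leNgt -Se LS.
pose e := Num.min 2^-1 ((S - L) / (2 * S)).
have e0 : 0 < e by rewrite lt_min invr_gt0 ltr0n/= divr_gt0 ?subr_gt0 ?mulr_gt0.
have e1 : e < 1 by rewrite gt_min invf_lt1 ?ltr1n.
have := HS e e0 e1.
have : e * S <= (S - L) / 2.
  have : e <= (S - L) / (2 * S) by rewrite ge_min lexx orbT.
  rewrite ler_pdivlMr ?mulr_gt0//; lra.
lra.
Qed.

End fejer.

(** * Carleman's inequality in one variable *)

Section carleman.
Variable R : realType.
Local Notation C := (R[i]).
Implicit Types p q G H : {poly C}.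

Lemma ccont_horner p (t : R) : ccont (fun t => p.[expi t]) t.
Proof.
elim/poly_ind: p => [|p c IH].
  by under eq_fun do rewrite horner0; exact: ccont_cst.
under eq_fun do rewrite hornerMXaddC; apply: ccontD; last exact: ccont_cst.
by apply: ccontM => //; exact: ccont_expi.
Qed.

Definition l1_coef p : R := \sum_(k < size p) normc p`_k.

Lemma l1_coef_ge0 p : 0 <= l1_coef p.
Proof. by apply: sumr_ge0 => k _; exact: normc_ge0. Qed.

Lemma normc_horner_le p (x : C) : normc x <= 1 -> normc p.[x] <= l1_coef p.
Proof.
move=> x1; rewrite horner_coef; apply: le_trans (normc_sum _ _ _) _.
apply: ler_sum => k _; rewrite normcM normcX ler_piMr ?normc_ge0//.
by rewrite exprn_ile1 ?normc_ge0.
Qed.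

Lemma cintegrable_horner p : cintegrable (P01 R) (fun t => p.[expi t]).
Proof.
apply: (cintegrable_bounded (P01 R) (M := l1_coef p)).
  by apply: cmeasurable_cont => t; exact: ccont_horner.
by move=> t; apply: normc_horner_le; rewrite normc_expi.
Qed.

Lemma cintegral_expi_ortho k l :
  cintegral (P01 R) (fun t => expi t ^+ k * conjc (expi t) ^+ l) = (k == l)%:R.
Proof.
rewrite -[k == l](_ : (k%:Z - l%:Z == 0) = _); last by rewrite subr_eq0.
rewrite -cintegral_expiz; apply: eq_cintegral => t.
have e0 : expi t != 0 :> C by rewrite -normc_eq0 normc_expi oner_eq0.
by rewrite expfzDr// -invr_expz -!exprnP -exprVn unimodularV ?normc_expi.
Qed.

Lemma cintegrable_expi_mono k l : cintegrable (P01 R) (fun t => expi t ^+ k * conjc (expi t) ^+ l).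
Proof.
apply: (cintegrable_bounded (P01 R) (M := 1)).
  by apply: cmeasurable_cont => t; apply: ccontM; apply: ccontX; [|apply: ccontJ]; exact: ccont_expi.
by move=> t; rewrite normcM !normcX normc_conjc normc_expi !expr1n mulr1.
Qed.

Lemma coef_cintegral p k :
  cintegral (P01 R) (fun t => p.[expi t] * conjc (expi t) ^+ k) = p`_k.
Proof.
have e (t : measurableTypeR R) : p.[expi t] * conjc (expi t) ^+ k = \sum_(j < size p) p`_j * (expi t ^+ j * conjc (expi t) ^+ k).
  by rewrite horner_coef mulr_suml; apply: eq_bigr => j _; rewrite mulrA.
rewrite (eq_cintegral _ e) cintegral_sum; last by move=> j; apply: cintegrableZ; exact: cintegrable_expi_mono.
rewrite (eq_bigr (fun j : 'I_(size p) => p`_j * (nat_of_ord j == k)%:R)); last first.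
  by move=> j _; rewrite (cintegralZ _ (cintegrable_expi_mono j k)) cintegral_expi_ortho.
case: (ltnP k (size p)) => kp.
  rewrite (bigD1 (Ordinal kp))//= eqxx mulr1 big1 ?addr0// => j jk.
  by rewrite (_ : _ == _ = false) ?mulr0//; apply/negbTE; apply: contra jk => /eqP h; apply/eqP/val_inj.
rewrite nth_default// big1// => j _.
by rewrite (_ : _ == _ = false) ?mulr0//; apply/negbTE; rewrite neq_ltn (leq_trans _ kp).
Qed.

Lemma normc_coef_le_mean p k : normc p`_k <= \int[P01 R]_t normc p.[expi t].
Proof.
have i : cintegrable (P01 R) (fun t => p.[expi t] * conjc (expi t) ^+ k).
  apply: (cintegrableM_bounded (M := 1)); first exact: cintegrable_horner.
    by apply: cmeasurable_cont => t; apply: ccontX; apply: ccontJ; exact: ccont_expi.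
  by move=> t; rewrite normcX normc_conjc normc_expi expr1n.
rewrite -coef_cintegral; apply: le_trans (normc_cintegral_le i) _.
rewrite le_eqVlt; apply/orP; left; apply/eqP; apply: eq_Rintegral => t _.
by rewrite normcM normcX normc_conjc normc_expi expr1n mulr1.
Qed.

Lemma integrable_normc_horner p : (P01 R).-integrable setT (fun t => (normc p.[expi t])%:E).
Proof. exact: cintegrable_normc (cintegrable_horner p). Qed.

Lemma mean_le p M : (forall w, normc w = 1 -> normc p.[w] <= M) ->
  \int[P01 R]_t normc p.[expi t] <= M.
Proof.
move=> h; rewrite -[leRHS](Rintegral_prob_cst (P01 R)).
apply: le_Rintegral => //; first exact: integrable_normc_horner.
  exact: (@finite_measure_integrable_cst _ _ _ (P01 R)).
by move=> t _; apply: h; rewrite normc_expi.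
Qed.

Lemma normc_coef_le p k M : (forall w, normc w = 1 -> normc p.[w] <= M) -> normc p`_k <= M.
Proof. by move=> h; apply: le_trans (normc_coef_le_mean p k) _; exact: mean_le. Qed.

Lemma integrable_sqr_horner p : (P01 R).-integrable setT (fun t => (normc p.[expi t] ^+ 2)%:E).
Proof.
apply: (@integrable_bounded _ _ _ (P01 R) _ (l1_coef p ^+ 2)).
  apply: measurable_funX; apply: measurable_normc.
  by apply: cmeasurable_cont => t; exact: ccont_horner.
move=> t; rewrite ger0_norm ?sqr_ge0// ler_pXn2r ?nnegrE ?normc_ge0 ?l1_coef_ge0//.
by apply: normc_horner_le; rewrite normc_expi.
Qed.

Lemma parseval p : \int[P01 R]_t normc p.[expi t] ^+ 2 = \sum_(k < size p) normc p`_k ^+ 2.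
Proof.
have iX (k : nat) : cintegrable (P01 R) (fun t => p.[expi t] * conjc (expi t) ^+ k).
  apply: (cintegrableM_bounded (M := 1)); first exact: cintegrable_horner.
    by apply: cmeasurable_cont => t; apply: ccontX; apply: ccontJ; exact: ccont_expi.
  by move=> t; rewrite normcX normc_conjc normc_expi expr1n.
have e (t : measurableTypeR R) : (normc p.[expi t] ^+ 2)%:C = \sum_(k < size p) conjc p`_k * (p.[expi t] * conjc (expi t) ^+ k).
  rewrite -mulcJ {2}horner_coef rmorph_sum mulr_sumr; apply: eq_bigr => k _.
  by rewrite rmorphM rmorphXn /= mulrCA.
have : cintegral (P01 R) (fun t => (normc p.[expi t] ^+ 2)%:C) = (\sum_(k < size p) normc p`_k ^+ 2)%:C.
  rewrite (eq_cintegral _ e) cintegral_sum; last by move=> k; exact: cintegrableZ.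
  rewrite rmorph_sum; apply: eq_bigr => k _.
  by rewrite cintegralZ// coef_cintegral mulrC mulcJ.
by move=> [].
Qed.

Lemma sum_sqr_coef_le p M : (forall w, normc w = 1 -> normc p.[w] ^+ 2 <= M w) ->
  (P01 R).-integrable setT (fun t => (M (expi t))%:E) ->
  \sum_(k < size p) normc p`_k ^+ 2 <= \int[P01 R]_t M (expi t).
Proof.
move=> h iM; rewrite -parseval; apply: le_Rintegral => //.
  exact: integrable_sqr_horner.
by move=> t _; apply: h; rewrite normc_expi.
Qed.

(** Replaces the factorization of an H_1 function into two H_2 functions of equal modulus. With an
    error [e] the factors can be polynomials, and the property is stable under products, so that
    linear factors suffice. *)
Definition factorable p := forall e : R, 0 < e -> exists G H, forall w, normc w = 1 ->
  [/\ normc ((G * H).[w] - p.[w]) <= e, normc G.[w] ^+ 2 <= normc p.[w] + e &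
      normc H.[w] ^+ 2 <= normc p.[w] + e].

Lemma factorable_const (c : C) : factorable c%:P.
Proof.
move=> e e0; exists (sqrtc c)%:P, (sqrtc c)%:P => w w1.
have h : normc (sqrtc c) ^+ 2 = normc c by rewrite -normcX sqr_sqrtc.
by rewrite -polyCM !hornerC -expr2 sqr_sqrtc subrr normc0 h ltW// lerDl !ltW.
Qed.

Lemma factorableM p q : factorable p -> factorable q -> factorable (p * q).
Proof.
move=> fp fq e e0.
set Mp := l1_coef p; set Mq := l1_coef q.
have Mp0 : 0 <= Mp := l1_coef_ge0 p; have Mq0 : 0 <= Mq := l1_coef_ge0 q.
pose K := Mp + Mq + 1; have K0 : 0 < K by rewrite ltr_wpDl// addr_ge0.
pose d := Num.min 1 (e / K).
have d0 : 0 < d by rewrite lt_min ltr01 divr_gt0.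
have d1 : d <= 1 by rewrite ge_min lexx.
have dK : d * K <= e by rewrite -ler_pdivlMr// ge_min lexx orbT.
have [G1 [H1 h1]] := fp d d0; have [G2 [H2 h2]] := fq d d0.
exists (G1 * G2), (H1 * H2) => w w1.
have [a1 b1 c1] := h1 w w1; have [a2 b2 c2] := h2 w w1.
have pM : normc p.[w] <= Mp by apply: normc_horner_le; rewrite w1.
have qM : normc q.[w] <= Mq by apply: normc_horner_le; rewrite w1.
have p0 := normc_ge0 p.[w]; have q0 := normc_ge0 q.[w].
have bnd (x y : R) : 0 <= x -> 0 <= y -> x <= normc p.[w] + d -> y <= normc q.[w] + d ->
    x * y <= normc p.[w] * normc q.[w] + e.
  move=> x0 y0 xp yq; apply: le_trans (ler_pM x0 y0 xp yq) _.
  have t1 : d * normc q.[w] <= d * Mq by rewrite ler_wpM2l// ltW.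
  have t2 : d * normc p.[w] <= d * Mp by rewrite ler_wpM2l// ltW.
  have t3 : d * d <= d * 1 by rewrite ler_wpM2l// ltW.
  rewrite mulrDl !mulrDr; move: dK; rewrite /K !mulrDr [_ * d]mulrC; lra.
split.
- have -> : (G1 * G2 * (H1 * H2)).[w] - (p * q).[w] =
    ((G1 * H1).[w] - p.[w]) * (G2 * H2).[w] + p.[w] * ((G2 * H2).[w] - q.[w]).
    by rewrite !hornerM; ring.
  apply: le_trans (le_normcD _ _) _; rewrite !normcM.
  have u2 : normc (G2 * H2).[w] <= Mq + d.
    by rewrite -(subrK q.[w] (G2 * H2).[w]) (le_trans (le_normcD _ _))// addrC lerD.
  have t1 : normc ((G1 * H1).[w] - p.[w]) * normc (G2 * H2).[w] <= d * (Mq + d).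
    by apply: ler_pM => //; exact: normc_ge0.
  have t2 : normc p.[w] * normc ((G2 * H2).[w] - q.[w]) <= Mp * d.
    by apply: ler_pM => //; exact: normc_ge0.
  have t3 : d * d <= d * 1 by rewrite ler_wpM2l// ltW.
  move: dK t1 t2; rewrite /K !mulrDr [_ * d]mulrC; lra.
- rewrite !hornerM !normcM exprMn; apply: bnd => //; exact: sqr_ge0.
- rewrite !hornerM !normcM exprMn; apply: bnd => //; exact: sqr_ge0.
Qed.

(* y_(n+1) = (X + y_n^2)/2 converges to 1 - sqrt(1 - X) uniformly on the closed disc,
   being dominated there by its value at 1 *)
Fixpoint sqrt_iter n : {poly C} :=
  if n is n'.+1 then (2%:R^-1)%:P * ('X + sqrt_iter n' ^+ 2) else 0.

Lemma sqrt_iterS n x : (sqrt_iter n.+1).[x] = 2^-1 * (x + (sqrt_iter n).[x] ^+ 2).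
Proof. by rewrite /= !hornerE. Qed.

Fixpoint sqrt_iter1 n : R := if n is n'.+1 then 2^-1 * (1 + sqrt_iter1 n' ^+ 2) else 0.

Lemma sqrt_iter1_le1 n : 0 <= sqrt_iter1 n <= 1.
Proof.
elim: n => [|n /andP[h0 h1]] /=; first by rewrite lexx ler01.
have := sqr_ge0 (sqrt_iter1 n); have : sqrt_iter1 n ^+ 2 <= 1 by rewrite exprn_ile1.
move=> a b; apply/andP; split; lra.
Qed.

Lemma normc_half : normc (2^-1 : C) = 2^-1.
Proof. by rewrite normcV -[2](rmorph_nat (real_complex R)) normc_real ger0_norm. Qed.

Lemma sqrt_iter_dom x n : normc x <= 1 -> normc (sqrt_iter n).[x] <= sqrt_iter1 n.
Proof.
move=> x1; elim: n => [|n IH]; first by rewrite horner0 normc0.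
rewrite sqrt_iterS normcM normc_half ler_pM2l ?invr_gt0//.
apply: le_trans (le_normcD _ _) _; rewrite lerD// normcX ler_pXn2r ?nnegrE ?normc_ge0//.
by have /andP[] := sqrt_iter1_le1 n.
Qed.

Lemma sqrt_iter_incr x n : normc x <= 1 ->
  normc ((sqrt_iter n.+1).[x] - (sqrt_iter n).[x]) <= sqrt_iter1 n.+1 - sqrt_iter1 n.
Proof.
move=> x1; elim: n => [|n IH].
  by rewrite sqrt_iterS horner0 expr0n addr0 subr0 /= expr0n addr0 subr0 normcM normc_half ler_pM2l ?invr_gt0.
rewrite !(sqrt_iterS n.+1) {2}(sqrt_iterS n).
have -> : 2^-1 * (x + (sqrt_iter n.+1).[x] ^+ 2) - 2^-1 * (x + (sqrt_iter n).[x] ^+ 2) =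
  2^-1 * (((sqrt_iter n.+1).[x] - (sqrt_iter n).[x]) * ((sqrt_iter n.+1).[x] + (sqrt_iter n).[x])) by ring.
have -> : sqrt_iter1 n.+2 - sqrt_iter1 n.+1 =
  2^-1 * ((sqrt_iter1 n.+1 - sqrt_iter1 n) * (sqrt_iter1 n.+1 + sqrt_iter1 n)) by rewrite /=; ring.
rewrite !normcM normc_half ler_pM2l ?invr_gt0//; apply: ler_pM; rewrite ?normc_ge0//.
by apply: le_trans (le_normcD _ _) _; apply: lerD; exact: sqrt_iter_dom.
Qed.

(** The error is twice an increment of the iteration. It is dominated by the increment at 1, where
    the iterates stay below 1, so that not all increments can exceed e / 2. *)
Lemma sqrt_poly (e : R) : 0 < e -> exists S : {poly C}, forall x, normc x <= 1 ->
  normc (S.[x] ^+ 2 - (1 - x)) <= e.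
Proof.
move=> e0.
have [n hn] : exists n, sqrt_iter1 n.+1 - sqrt_iter1 n <= e / 2.
  apply: contrapT => h.
  have lb n : n%:R * (e / 2) <= sqrt_iter1 n.
    elim: n => [|n IH]; first by rewrite mul0r.
    have : e / 2 < sqrt_iter1 n.+1 - sqrt_iter1 n.
      by rewrite ltNge; apply/negP => hn; apply: h; exists n.
    rewrite -[n.+1%:R]natr1 mulrDl mul1r; lra.
  have ee : 0 <= (e / 2)^-1 by rewrite invr_ge0 divr_ge0 ?ltW.
  have := archi_boundP ee; set N := Num.bound _ => hN.
  have := lb N; have /andP[_] := sqrt_iter1_le1 N.
  have : 1 < N%:R * (e / 2) by rewrite -ltr_pdivrMr ?divr_gt0// mul1r.
  lra.
exists (1 - sqrt_iter n) => x x1.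
have -> : (1 - sqrt_iter n).[x] ^+ 2 - (1 - x) = 2 * ((sqrt_iter n.+1).[x] - (sqrt_iter n).[x]).
  by rewrite sqrt_iterS hornerD hornerN hornerC; field.
rewrite normcM -[2](rmorph_nat (real_complex R)) normc_real ger0_norm//.
have := sqrt_iter_incr n x1; lra.
Qed.

(** Without a zero in the open disc, both factors can be the same approximate square root. *)
Lemma factorable_1B (b : C) : normc b <= 1 -> factorable (1 - b *: 'X).
Proof.
move=> b1 e e0; have [S hS] := sqrt_poly e0.
have Sw w : (S \Po (b *: 'X)).[w] = S.[b * w] by rewrite horner_comp hornerZ hornerX.
have pw w : (1 - b *: 'X).[w] = 1 - b * w by rewrite hornerD hornerN hornerZ hornerX hornerC.
exists (S \Po (b *: 'X)), (S \Po (b *: 'X)) => w w1.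
have bw : normc (b * w) <= 1 by rewrite normcM w1 mulr1.
have k : normc S.[b * w] ^+ 2 <= normc (1 - b * w) + e.
  rewrite -normcX -(subrK (1 - b * w) (S.[b * w] ^+ 2)).
  by apply: le_trans (le_normcD _ _) _; rewrite addrC lerD2l hS.
by rewrite hornerM !Sw pw -expr2; split => //; exact: hS.
Qed.

(** A zero [a] in the open disc is reflected in the circle, where |w - a| = |1 - conj(a) w|; [G]
    approximates the root of 1 - conj(a) w. The other factor is [G] times the Blaschke quotient,
    with 1 / (1 - conj(a) w) replaced by the geometric sum [V]. The other zeros reduce to
    [factorable_1B]. *)
Lemma factorable_XB (a : C) : factorable ('X - a%:P).
Proof.
have [a1|a1] := lerP 1 (normc a).
  have a0 : a != 0 by rewrite -normc_gt0 (lt_le_trans ltr01).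
  have -> : 'X - a%:P = (- a)%:P * (1 - a^-1 *: 'X) :> {poly C}.
    by rewrite mulrBr mulr1 -mul_polyC mulrA -polyCM mulNr divff// polyCN polyCN mulN1r opprK addrC.
  apply: factorableM; first exact: factorable_const.
  by apply: factorable_1B; rewrite normcV invf_le1// (lt_le_trans ltr01).
move=> e e0.
pose b := conjc a; pose beta := normc b.
have b1 : beta < 1 by rewrite /beta normc_conjc.
have b0 : 0 <= beta by exact: normc_ge0.
pose K := (1 - beta)^-1.
have K0 : 0 < K by rewrite invr_gt0 subr_gt0.
have e6 : 0 < e / 12 by rewrite divr_gt0.
have b01 : 0 <= beta < 1 by rewrite b0.
have [n hn] := cvg_pow0 b01 1 e6.
rewrite mul1r in hn.
(* As beta^n < e / 12, the product is within 2 (2 K d + beta^n) of w - a, and the squared modulus of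
   the second factor exceeds |w - a| by at most 6 beta^n + 4 d. Both errors are at most [e]. *)
pose d := Num.min (e / 8) (e / (8 * K)).
have d0 : 0 < d.
  rewrite lt_min; apply/andP; split; first exact: divr_gt0.
  by apply: divr_gt0 => //; exact: mulr_gt0.
have d8 : d <= e / 8 by rewrite ge_min lexx.
have dK : d * K <= e / 8.
  by rewrite -ler_pdivlMr// -mulrA -invfM ge_min lexx orbT.
have [S hS] := sqrt_poly d0.
pose V : {poly C} := \sum_(k < n) (b *: 'X) ^+ k.
pose G := S \Po (b *: 'X).
exists G, (('X - a%:P) * V * G) => w w1.
have Gw : G.[w] = S.[b * w] by rewrite horner_comp hornerZ hornerX.
have Vw : V.[w] = \sum_(k < n) (b * w) ^+ k.
  by rewrite horner_sum; apply: eq_bigr => k _; rewrite horner_exp hornerZ hornerX.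
have bw : normc (b * w) = beta by rewrite normcM w1 mulr1.
have Ve : V.[w] * (1 - b * w) = 1 - (b * w) ^+ n.
  rewrite Vw; have := subrX1 (b * w) n; set T := \sum_(_ < _) _ => h.
  have -> : T * (1 - b * w) = - ((b * w - 1) * T) by ring.
  by rewrite -h opprB.
have aw : normc (w - a) = normc (1 - b * w).
  have -> : w - a = w * conjc (1 - b * w).
    rewrite rmorphB rmorph1 rmorphM /= conjcK mulrBr mulr1 mulrCA mulcJ w1 expr1n.
    by rewrite mulr1.
  by rewrite normcM w1 mul1r normc_conjc.
have lb : 1 - beta <= normc (1 - b * w) by rewrite -bw normc_1B_ge.
have q0 : 0 <= beta ^+ n by rewrite exprn_ge0.
have q1 : beta ^+ n <= 1 by rewrite exprn_ile1// ltW.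
have Vn : normc V.[w] * normc (1 - b * w) <= 1 + beta ^+ n.
  by rewrite -normcM Ve (le_trans (normcB _ _))// normc1 normcX bw.
have VK : normc V.[w] <= 2 * K.
  rewrite ler_pdivlMr ?subr_gt0//; apply: le_trans (ler_wpM2l (normc_ge0 _) lb) _.
  by apply: le_trans Vn _; rewrite -[2]/(1 + 1) lerD2l.
have wa2 : normc (w - a) <= 2 by rewrite (le_trans (normcB _ _))// w1 -[2]/(1 + 1) lerD2l ltW.
have G2 : normc S.[b * w] ^+ 2 <= normc (w - a) + d.
  rewrite aw -normcX -(subrK (1 - b * w) (S.[b * w] ^+ 2)).
  by apply: le_trans (le_normcD _ _) _; rewrite addrC lerD2l hS// bw ltW.
have Xa : ('X - a%:P).[w] = w - a by rewrite hornerXsubC.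
split.
- rewrite !hornerM Gw Xa.
  have -> : S.[b * w] * ((w - a) * V.[w] * S.[b * w]) - (w - a) =
    (w - a) * (V.[w] * (S.[b * w] ^+ 2 - (1 - b * w)) + (V.[w] * (1 - b * w) - 1)) by ring.
  rewrite Ve [1 - _ - 1]addrAC subrr add0r normcM.
  have t1 : normc (V.[w] * (S.[b * w] ^+ 2 - (1 - b * w)) - (b * w) ^+ n) <= 2 * K * d + beta ^+ n.
    apply: le_trans (normcB _ _) _; rewrite normcX bw lerD2r normcM.
    by apply: ler_pM => //; rewrite ?normc_ge0// hS// bw ltW.
  apply: le_trans (ler_pM (normc_ge0 _) (normc_ge0 _) wa2 t1) _.
  move: dK hn; rewrite [d * K]mulrC; lra.
- rewrite Gw Xa; apply: le_trans G2 _; rewrite lerD2l; lra.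
- rewrite !hornerM Gw Xa !normcM exprMn.
  have u0 : 0 <= normc (w - a) * normc V.[w] by rewrite mulr_ge0 ?normc_ge0.
  have u1 : (normc (w - a) * normc V.[w]) ^+ 2 <= 1 + 3 * beta ^+ n.
    apply: (@le_trans _ _ ((1 + beta ^+ n) ^+ 2)).
      by rewrite ler_pXn2r ?nnegrE ?addr_ge0// aw mulrC.
    have : beta ^+ n * beta ^+ n <= beta ^+ n * 1 by rewrite ler_wpM2l.
    rewrite expr2; lra.
  apply: le_trans (ler_pM (sqr_ge0 _) (sqr_ge0 _) u1 G2) _.
  have t1 : beta ^+ n * normc (w - a) <= beta ^+ n * 2 by rewrite ler_wpM2l.
  have t2 : beta ^+ n * d <= 1 * d by rewrite ler_wpM2r// ltW.
  move: t1 t2 hn d8; set q := beta ^+ n; set A := normc (w - a) => t1 t2 hn' d8'.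
  have -> : (1 + 3 * q) * (A + d) = A + d + 3 * (q * A) + 3 * (q * d) by ring.
  lra.
Qed.

Lemma factorable_poly p : factorable p.
Proof.
have [r ->] := closed_field_poly_normal p.
rewrite -mul_polyC; apply: factorableM; first exact: factorable_const.
elim: r => [|a r IH]; first by rewrite big_nil -polyC1; exact: factorable_const.
by rewrite big_cons; apply: factorableM => //; exact: factorable_XB.
Qed.

(** Cauchy-Schwarz on the k + 1 terms of a coefficient of the product costs exactly the weight. The
    squares are stored as coefficients of the polynomials [sq], so that the remaining double sum is
    a product of two values at 1. *)
Lemma sum_sqr_coefM G H n :
  \sum_(k < n) normc (G * H)`_k ^+ 2 / k.+1%:R <=
  (\sum_(k < size G) normc G`_k ^+ 2) * (\sum_(k < size H) normc H`_k ^+ 2).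
Proof.
pose sq (p : {poly C}) : {poly R} := \poly_(k < size p) (normc p`_k ^+ 2).
have sqE p k : (sq p)`_k = normc p`_k ^+ 2.
  by rewrite coef_poly; case: ltnP => // hk; rewrite nth_default// normc0 expr0n.
have sq1 p : (sq p).[1] = \sum_(k < size p) normc p`_k ^+ 2.
  rewrite (horner_coef_wide 1 (size_poly _ _)).
  by apply: eq_bigr => k _; rewrite sqE expr1n mulr1.
have cs k : normc (G * H)`_k ^+ 2 / k.+1%:R <= (sq G * sq H)`_k.
  rewrite ler_pdivrMr ?ltr0n// !coefM.
  under [X in _ <= X * _]eq_bigr => j _ do rewrite !sqE -exprMn -normcM.
  set F := fun j : 'I_k.+1 => G`_j * H`_(k - j).
  have h : normc (\sum_j F j) <= \sum_j normc (F j) by exact: normc_sum.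
  apply: (@le_trans _ _ ((\sum_j normc (F j)) ^+ 2)).
    by rewrite ler_pXn2r ?nnegrE ?normc_ge0 ?sumr_ge0// => j _; exact: normc_ge0.
  have -> : (\sum_j normc (F j)) ^+ 2 = \sum_(i < k.+1) \sum_(j < k.+1) normc (F i) * normc (F j).
    by rewrite expr2 mulr_suml; apply: eq_bigr => i _; rewrite mulr_sumr.
  apply: (@le_trans _ _ (\sum_(i < k.+1) \sum_(j < k.+1) (normc (F i) ^+ 2 + normc (F j) ^+ 2) / 2)).
    apply: ler_sum => i _; apply: ler_sum => j _.
    have := sqr_ge0 (normc (F i) - normc (F j)); rewrite sqrrB; lra.
  set S2 := \sum_(j < k.+1) normc (F j) ^+ 2.
  have e1 i : \sum_(j < k.+1) (normc (F i) ^+ 2 + normc (F j) ^+ 2) / 2 =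
      (k.+1%:R * normc (F i) ^+ 2 + S2) / 2.
    by rewrite -mulr_suml big_split /= sumr_const card_ord mulr_natl.
  rewrite (eq_bigr _ (fun i _ => e1 i)) -mulr_suml big_split /= -mulr_sumr -/S2 sumr_const card_ord.
  by rewrite -[S2 *+ _]mulr_natl le_eqVlt; apply/orP; left; apply/eqP; field.
rewrite -!sq1 -hornerM; apply: (@le_trans _ _ (\sum_(k < n) (sq G * sq H)`_k)); first exact: ler_sum.
have c0 k : 0 <= (sq G * sq H)`_k by rewrite coefM sumr_ge0// => j _; rewrite mulr_ge0// sqE sqr_ge0.
rewrite (horner_coef_wide 1 (leq_maxr n (size (sq G * sq H)))).
under [leRHS]eq_bigr do rewrite expr1n mulr1.
rewrite -!(big_mkord xpredT (fun k => (sq G * sq H)`_k)).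
by rewrite [leRHS](big_cat_nat (leq0n n)) ?leq_maxl//= lerDl sumr_ge0.
Qed.

(* If p = G H with |G|^2 = |H|^2 = |p| on the circle, then
   |p_k|^2 <= (k+1) sum_j |G_j H_(k-j)|^2. *)
Lemma carleman p n :
  \sum_(k < n) normc p`_k ^+ 2 / k.+1%:R <= (\int[P01 R]_t normc p.[expi t]) ^+ 2.
Proof.
set A := \int[P01 R]_t _.
have A0 : 0 <= A by apply: Rintegral_ge0 => t _; exact: normc_ge0.
(* Collects the errors: e (2 A + 3) in each of the [n] terms, and e (2 A + 1) from (A + e)^2. *)
pose K := n%:R * (2 * A + 3) + (2 * A + 1).
have K0 : 0 < K by rewrite /K ltr_wpDl ?mulr_ge0 ?addr_ge0 ?ltr_wpDl ?mulr_ge0.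
suff main (e : R) : 0 < e -> e <= 1 -> \sum_(k < n) normc p`_k ^+ 2 / k.+1%:R <= A ^+ 2 + K * e.
  apply/ler_addgt0Pr => e e0; pose e1 := Num.min 1 (e / K).
  have e10 : 0 < e1 by rewrite lt_min ltr01 divr_gt0.
  apply: le_trans (main e1 e10 _) _; first by rewrite ge_min lexx.
  by rewrite lerD2l mulrC -ler_pdivlMr// ge_min lexx orbT.
move=> e0 e1; have [G [H h]] := factorable_poly p e0.
have iM : (P01 R).-integrable setT (fun t => (normc p.[expi t] + e)%:E).
  apply: (@integrable_bounded _ _ _ (P01 R) _ (l1_coef p + e)).
    apply: measurable_funD => //; apply: measurable_normc.
    by apply: cmeasurable_cont => t; exact: ccont_horner.
  move=> t; rewrite ger0_norm ?addr_ge0 ?normc_ge0 ?(ltW e0)// lerD2r.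
  by apply: normc_horner_le; rewrite normc_expi.
have Ie : \int[P01 R]_t (normc p.[expi t] + e) = A + e.
  rewrite RintegralD//; first by rewrite Rintegral_prob_cst.
    exact: integrable_normc_horner.
  exact: (@finite_measure_integrable_cst _ _ _ (P01 R)).
have hG : \sum_(k < size G) normc G`_k ^+ 2 <= A + e.
  rewrite -Ie; apply: (@sum_sqr_coef_le G (fun w => normc p.[w] + e)) => // w w1.
  by have [] := h w w1.
have hH : \sum_(k < size H) normc H`_k ^+ 2 <= A + e.
  rewrite -Ie; apply: (@sum_sqr_coef_le H (fun w => normc p.[w] + e)) => // w w1.
  by have [] := h w w1.
have sq0 (q : {poly C}) : 0 <= \sum_(k < size q) normc q`_k ^+ 2 by apply: sumr_ge0 => k _; exact: sqr_ge0.
have GH : \sum_(k < n) normc (G * H)`_k ^+ 2 / k.+1%:R <= (A + e) ^+ 2.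
  by apply: le_trans (sum_sqr_coefM G H n) _; rewrite expr2; apply: ler_pM.
have ck k : normc p`_k ^+ 2 / k.+1%:R <= normc (G * H)`_k ^+ 2 / k.+1%:R + e * (2 * A + 3).
  have d : normc ((G * H)`_k - p`_k) <= e.
    rewrite -coefB; apply: normc_coef_le => w w1; rewrite hornerD hornerN.
    by have [] := h w w1.
  have pA : normc p`_k <= A by exact: normc_coef_le_mean.
  have k1 : 0 < (k.+1%:R^-1 : R) <= 1 by rewrite invr_gt0 ltr0n invf_le1 ?ltr0n// ler1n.
  have t1 : normc p`_k <= normc (G * H)`_k + e.
    rewrite -{1}(subKr (G * H)`_k p`_k) (le_trans (normcB _ _))// lerD2l//.
  have t2 : normc (G * H)`_k <= A + e.
    by rewrite -(subrK p`_k (G * H)`_k) (le_trans (le_normcD _ _))// addrC lerD.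
  have g0 := normc_ge0 (G * H)`_k.
  have t3 : normc p`_k ^+ 2 <= normc (G * H)`_k ^+ 2 + e * (2 * A + 3).
    apply: (@le_trans _ _ ((normc (G * H)`_k + e) ^+ 2)).
      by rewrite ler_pXn2r ?nnegrE ?normc_ge0 ?addr_ge0// ltW.
    have s1 : e * normc (G * H)`_k <= e * (A + e) by rewrite ler_wpM2l// ltW.
    have s2 : e * e <= e * 1 by rewrite ler_wpM2l// ltW.
    rewrite sqrrD !expr2 mulrC; move: s1 s2; rewrite !mulrDr; lra.
  case/andP: k1 => k0 k1; apply: le_trans (ler_wpM2r (ltW k0) t3) _.
  by rewrite mulrDl lerD2l ler_piMr// mulr_ge0 ?(ltW e0)// addr_ge0// mulr_ge0.
apply: (@le_trans _ _ (\sum_(k < n) (normc (G * H)`_k ^+ 2 / k.+1%:R + e * (2 * A + 3)))).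
  by apply: ler_sum => k _; exact: ck.
rewrite big_split /= sumr_const card_ord; apply: le_trans (lerD GH (lexx _)) _.
have s2 : e * e <= e * 1 by rewrite ler_wpM2l// ltW.
have -> : A ^+ 2 + K * e = (A + e) ^+ 2 + (e * (2 * A + 3)) *+ n + (e * 1 - e * e).
  by rewrite /K -mulr_natl; ring.
by rewrite lerDl subr_ge0.
Qed.

End carleman.

Section Rintegral_finite_sums.
Context d (T : measurableType d) (R : realType) (mu : probability T R).

Lemma integrable_real_sum (I : Type) (s : seq I) (F : I -> T -> R) :
  (forall i, mu.-integrable setT (EFin \o F i)) ->
  mu.-integrable setT (EFin \o (fun x => \sum_(i <- s) F i x)).
Proof.
move=> iF; apply: (eq_integrable measurableT (fun x => \sum_(i <- s) (F i x)%:E)%E).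
  by move=> x _; rewrite /= -sumEFin.
by apply: integrable_sum => // i _; exact: iF.
Qed.

Lemma Rintegral_sum (I : Type) (s : seq I) (F : I -> T -> R) :
  (forall i, mu.-integrable setT (EFin \o F i)) ->
  \int[mu]_x (\sum_(i <- s) F i x) = \sum_(i <- s) \int[mu]_x F i x.
Proof.
move=> iF; elim: s => [|i s IH].
  rewrite big_nil -[RHS](Rintegral_prob_cst mu); apply: eq_Rintegral => x _.
  by rewrite big_nil.
rewrite big_cons -IH -RintegralD//; last exact: integrable_real_sum.
by apply: eq_Rintegral => x _; rewrite big_cons.
Qed.

End Rintegral_finite_sums.

Lemma cauchy_schwarz_sum (R : realFieldType) (I : Type) (s : seq I) (a b : I -> R) :
  (\sum_(i <- s) a i * b i) ^+ 2 <= (\sum_(i <- s) a i ^+ 2) * (\sum_(i <- s) b i ^+ 2).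
Proof.
elim: s => [|i s IH]; first by rewrite !big_nil expr0n mul0r.
rewrite !big_cons.
set S := \sum_(_ <- s) a _ * b _ in IH *; set A := \sum_(_ <- s) a _ ^+ 2 in IH *.
set B := \sum_(_ <- s) b _ ^+ 2 in IH *.
have A0 : 0 <= A by apply: sumr_ge0 => j _; exact: sqr_ge0.
have B0 : 0 <= B by apply: sumr_ge0 => j _; exact: sqr_ge0.
suff h : 2 * (a i * b i) * S <= a i ^+ 2 * B + b i ^+ 2 * A.
  have -> : (a i * b i + S) ^+ 2 = a i ^+ 2 * b i ^+ 2 + 2 * (a i * b i) * S + S ^+ 2 by ring.
  have -> : (a i ^+ 2 + A) * (b i ^+ 2 + B) =
    a i ^+ 2 * b i ^+ 2 + (a i ^+ 2 * B + b i ^+ 2 * A) + A * B by ring.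
  lra.
set x := a i ^+ 2 * B; set y := b i ^+ 2 * A.
have x0 : 0 <= x by rewrite mulr_ge0 ?sqr_ge0.
have y0 : 0 <= y by rewrite mulr_ge0 ?sqr_ge0.
have [h|h] := leP (2 * (a i * b i) * S) 0; first by rewrite (le_trans h)// addr_ge0.
rewrite -(@ler_pXn2r _ 2)// ?nnegrE ?addr_ge0 ?(ltW h)//.
apply: (@le_trans _ _ (4 * (x * y))).
  have -> : (2 * (a i * b i) * S) ^+ 2 = 4 * ((a i * b i) ^+ 2 * S ^+ 2) by ring.
  have -> : x * y = (a i * b i) ^+ 2 * (A * B) by rewrite /x /y; ring.
  by rewrite ler_pM2l// ler_wpM2l// sqr_ge0.
by have := sqr_ge0 (x - y); rewrite sqrrB sqrrD; lra.
Qed.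

(** * Carleman's inequality on the torus *)

Section exponent_families.
Variables (R : realType) (I : eqType) (e : I -> nat -> nat).
Implicit Types (s : seq I).

(** Exponents are attached to an arbitrary index type so that the same inequalities apply to a
    polynomial and to its partial derivatives, with [dexp] in place of [e]. Looking at the first [N]
    coordinates only allows induction on [N]. *)
Definition sep_exponents N s :=
  forall i i', i \in s -> i' \in s -> (forall j, (j < N)%N -> e i j = e i' j) -> i = i'.

Lemma sep_exponents_fiber N s k : sep_exponents N.+1 s ->
  sep_exponents N [seq i <- s | e i N == k].
Proof.
move=> h i i'; rewrite !mem_filter => /andP[/eqP ei si] /andP[/eqP ei' si'] hj.
by apply: h => // j; rewrite ltnS leq_eqVlt => /predU1P[->|/hj//]; rewrite ei ei'.
Qed.

Definition fiber_bound N s := (\max_(i <- s) e i N).+1.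

Lemma sum_fibers (V : nmodType) N s (F : I -> V) :
  \sum_(i <- s) F i = \sum_(k < fiber_bound N s) \sum_(i <- [seq i <- s | e i N == k]) F i.
Proof.
rewrite big_seq (partition_big (fun i => inord (e i N) : 'I_(fiber_bound N s)) xpredT)//=.
apply: eq_bigr => k _; rewrite big_filter [RHS]big_seq_cond; apply: eq_bigl => i.
case: (boolP (i \in s)) => //= si; rewrite -(inj_eq val_inj) /= inordK// ltnS.
by rewrite (big_rem i)//= leq_maxl.
Qed.

Lemma sep_exponents0 s : uniq s -> sep_exponents 0 s -> s = [::] \/ exists i, s = [:: i].
Proof.
case: s => [|i [|i' s]]; [by left|by right; exists i|].
move=> /= /andP[ii' _] h; exfalso; move/negP: ii'; apply.
by rewrite (h i i')// ?inE ?eqxx// orbT.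
Qed.

(** Distinct exponents lie in a box, over which the sum of products factors; the proof slices along
    the last coordinate. *)
Lemma sum_prod_le_prod_sum N s (f : nat -> nat -> R) (F : nat -> R) :
  uniq s -> sep_exponents N s -> (forall j k, 0 <= f j k) ->
  (forall j d, \sum_(k < d) f j k <= F j) ->
  \sum_(i <- s) \prod_(j < N) f j (e i j) <= \prod_(j < N) F j.
Proof.
move=> us hs f0 fF.
have F0 j : 0 <= F j by have := fF j 0%N; rewrite big_ord0.
elim: N s us hs => [|N IH] s us hs.
  rewrite big_ord0; have [->|[i ->]] := sep_exponents0 us hs; first by rewrite big_nil.
  by rewrite big_seq1 big_ord0.
rewrite (sum_fibers N); set d := fiber_bound N s.
apply: (@le_trans _ _ (\sum_(k < d) (\prod_(j < N) F j) * f N k)).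
  apply: ler_sum => k _.
  rewrite (@eq_big_seq _ _ _ _ _ _ (fun i => \prod_(j < N) f j (e i j) * f N k)).
    rewrite -mulr_suml ler_wpM2r//; apply: IH; first by rewrite filter_uniq.
    exact: sep_exponents_fiber.
  by move=> i; rewrite mem_filter => /andP[/eqP ei _]; rewrite big_ord_recr /= ei.
by rewrite -mulr_sumr [leRHS]big_ord_recr /= ler_wpM2l ?prodr_ge0//; exact: fF.
Qed.

Local Notation m := (torus_measure R).

Definition epoly N s (c : I -> R[i]) (w : torus R) : R[i] :=
  \sum_(i <- s) c i * \prod_(j < N) tval w j ^+ e i j.

Lemma cmeasurable_epoly N s c : cmeasurable (epoly N s c).
Proof.
apply: cmeasurable_sum => i; apply: cmeasurableM; first exact: cmeasurable_cst.
by apply: cmeasurable_prod => j; apply: cmeasurableX; exact: cmeasurable_tval.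
Qed.

Lemma normc_epoly_le N s c w : normc (epoly N s c w) <= \sum_(i <- s) normc (c i).
Proof.
apply: le_trans (normc_sum _ _ _) _; apply: ler_sum => i _.
rewrite normcM normc_prod big1 ?mulr1// => j _.
by rewrite normcX normc_tval expr1n.
Qed.

Lemma integrable_normc_epoly N s c : m.-integrable setT (fun w => (normc (epoly N s c w))%:E).
Proof.
apply: cintegrable_normc; apply: (cintegrable_bounded m (M := \sum_(i <- s) normc (c i))).
  exact: cmeasurable_epoly.
by move=> w; exact: normc_epoly_le.
Qed.

Lemma epoly_upd N s c w (u : circle R) :
  epoly N s c (upd w N u) = epoly N s c w.
Proof.
apply: eq_bigr => i _; congr (_ * _); apply: eq_bigr => j _.
by rewrite tval_upd ltn_eqF.
Qed.

(** In the last variable, Carleman's inequality bounds sum |q_k(w)|^2 / (k + 1) by the square of the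
    inner mean; induction bounds the coefficients of [q k] by its mean [X k]. It remains to
    interchange the mean with a weighted l_2 norm. This is Minkowski's inequality, obtained here by
    duality with the vector [X] itself as test vector. *)
Lemma carleman_torus N s (c : I -> R[i]) : uniq s -> sep_exponents N s ->
  \sum_(i <- s) normc (c i) ^+ 2 / \prod_(j < N) (e i j).+1%:R <=
  (\int[m]_w normc (epoly N s c w)) ^+ 2.
Proof.
elim: N s => [|N IH] s us hs.
  have [->|[i ->]] := sep_exponents0 us hs; first by rewrite big_nil sqr_ge0.
  rewrite big_seq1 big_ord0 divr1.
  have -> // : \int[m]_w normc (epoly 0 [:: i] c w) = normc (c i).
  rewrite -[RHS](Rintegral_prob_cst m); apply: eq_Rintegral => w _.
  by rewrite /epoly big_seq1 big_ord0 mulr1.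
pose sk k := [seq i <- s | e i N == k].
pose d := fiber_bound N s.
pose q k := epoly N (sk k) c.
pose X k := \int[m]_w normc (q k w).
have X0 k : 0 <= X k by apply: Rintegral_ge0 => w _; exact: normc_ge0.
set A := \int[m]_w _.
have A0 : 0 <= A by apply: Rintegral_ge0 => w _; exact: normc_ge0.
pose Y := \sum_(k < d) X k ^+ 2 / k.+1%:R.
apply: (@le_trans _ _ Y).
  rewrite (sum_fibers N); apply: ler_sum => k _.
  rewrite (@eq_big_seq _ _ _ _ _ _ (fun i => normc (c i) ^+ 2 / \prod_(j < N) (e i j).+1%:R / k.+1%:R)).
    rewrite -mulr_suml ler_pM2r ?invr_gt0 ?ltr0n//; apply: IH; first by rewrite filter_uniq.
    exact: sep_exponents_fiber.
  by move=> i; rewrite mem_filter => /andP[/eqP ei _]; rewrite big_ord_recr /= ei invfM mulrA.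
have Y0 : 0 <= Y by apply: sumr_ge0 => k _; rewrite divr_ge0 ?sqr_ge0.
pose inner w := \int[P01 R]_t normc (epoly N.+1 s c (upd w N (angle t))).
have inner0 w : 0 <= inner w by apply: Rintegral_ge0 => t _; exact: normc_ge0.
have [minner Ainner] : measurable_fun setT inner /\ A = \int[m]_w inner w.
  apply: (@resample_real _ N (fun w => normc (epoly N.+1 s c w)) (\sum_(i <- s) normc (c i))).
    by apply: measurable_normc; exact: cmeasurable_epoly.
  by move=> w; rewrite ger0_norm ?normc_ge0// normc_epoly_le.
have sliceE w t : epoly N.+1 s c (upd w N (angle t)) = (\poly_(k < d) q k w).[expi t].
  rewrite horner_poly /epoly (sum_fibers N); apply: eq_bigr => k _.
  rewrite /q -(epoly_upd N (sk k) c w (angle t)) /epoly mulr_suml; apply: eq_big_seq => i.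
  rewrite mem_filter => /andP[/eqP ei _].
  by rewrite big_ord_recr /= ei mulrA [tval _ N]tval_upd eqxx.
have car w : \sum_(k < d) normc (q k w) ^+ 2 / k.+1%:R <= inner w ^+ 2.
  have := carleman (\poly_(k < d) q k w) d.
  rewrite (eq_bigr (fun k : 'I_d => normc (q k w) ^+ 2 / k.+1%:R)); last first.
    by move=> k _; rewrite coef_poly ltn_ord.
  move/le_trans; apply; rewrite le_eqVlt; apply/orP; left; apply/eqP; congr (_ ^+ 2).
  by apply: eq_Rintegral => t _; rewrite sliceE.
(* Cauchy-Schwarz with weights 1 / (k + 1); its integral over [w] reads Y <= sqrt(Y) A. *)
have pw w : \sum_(k < d) X k / k.+1%:R * normc (q k w) <= Num.sqrt Y * inner w.
  rewrite -(@ler_pXn2r _ 2)// ?nnegrE; last 2 first.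
  - by apply: sumr_ge0 => k _; rewrite mulr_ge0 ?normc_ge0// divr_ge0.
  - by rewrite mulr_ge0 ?sqrtr_ge0.
  rewrite exprMn sqr_sqrtr//.
  pose g (k : nat) : R := Num.sqrt k.+1%:R.
  have g2 (k : nat) : g k ^+ 2 = k.+1%:R by rewrite sqr_sqrtr.
  have g0 (k : nat) : g k != 0 by rewrite sqrtr_eq0 -ltNge ltr0n.
  have h := cauchy_schwarz_sum (index_enum 'I_d) (fun k : 'I_d => X k / g k) (fun k : 'I_d => normc (q k w) / g k).
  rewrite (eq_bigr (fun k : 'I_d => X k / k.+1%:R * normc (q k w))) in h; last first.
    by move=> k _; rewrite -g2; field; exact: g0.
  apply: le_trans h _.
  rewrite (eq_bigr (fun k : 'I_d => X k ^+ 2 / k.+1%:R)); last by move=> k _ /=; rewrite exprMn exprVn g2.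
  rewrite -/Y.
  rewrite (eq_bigr (fun k : 'I_d => normc (q k w) ^+ 2 / k.+1%:R)); last by move=> k _ /=; rewrite exprMn exprVn g2.
  by rewrite ler_wpM2l.
have iinner : m.-integrable setT (EFin \o inner).
  apply: (@integrable_bounded _ _ _ m _ (\sum_(i <- s) normc (c i))) => // w.
  rewrite ger0_norm//.
  rewrite -[leRHS](Rintegral_prob_cst (P01 R)); apply: le_Rintegral => //.
  - apply: (@integrable_bounded _ _ _ (P01 R) _ (\sum_(i <- s) normc (c i))).
      apply: measurable_normc; apply: (cmeasurable_comp (measurable_upd N w)).
      exact: cmeasurable_epoly.
    by move=> t; rewrite ger0_norm ?normc_ge0// normc_epoly_le.
  - exact: (@finite_measure_integrable_cst _ _ _ (P01 R)).
  - by move=> t _; exact: normc_epoly_le.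
have YA : Y <= Num.sqrt Y * A.
  rewrite Ainner -RintegralZl//.
  have iq k : m.-integrable setT (EFin \o (fun w => X k / k.+1%:R * normc (q k w))).
    exact: (integrableZl measurableT (X k / k.+1%:R) (integrable_normc_epoly N (sk k) c)).
  have eY : Y = \int[m]_w \sum_(k < d) X k / k.+1%:R * normc (q k w).
    rewrite Rintegral_sum; last by move=> k; exact: iq.
    apply: eq_bigr => k _; rewrite RintegralZl//; last exact: integrable_normc_epoly.
    by rewrite -/(X k) expr2 mulrAC.
  rewrite {1}eY; apply: le_Rintegral => //.
  - by apply: integrable_real_sum => k; exact: iq.
  - exact: (integrableZl measurableT (Num.sqrt Y) iinner).
have [->|Yp] := eqVneq Y 0; first exact: sqr_ge0.
have sY : 0 < Num.sqrt Y by rewrite sqrtr_gt0 lt_def Yp.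
have : Num.sqrt Y <= A by rewrite -(ler_pM2l sY) -expr2 sqr_sqrtr.
by move=> h; rewrite -(sqr_sqrtr Y0) ler_pXn2r ?nnegrE ?sqrtr_ge0.
Qed.

End exponent_families.

(** * The maximum principle on the polydisc *)

Section maximum_principle.
Variable R : realType.
Local Notation C := (R[i]).

Lemma pow_le_linear (q K : R) : 0 <= K -> (forall n : nat, q ^+ n <= K * n%:R + 1) -> q <= 1.
Proof.
move=> K0 h; rewrite leNgt; apply/negP => q1.
pose d := q - 1; have d0 : 0 < d by rewrite subr_gt0.
have bern (n : nat) : 1 + n%:R * d <= q ^+ n.
  elim: n => [|n IH]; first by rewrite mul0r addr0 expr0.
  rewrite exprS -[n.+1%:R]natr1.
  have qd : q = 1 + d by rewrite /d; ring.
  apply: (@le_trans _ _ ((1 + d) * (1 + n%:R * d))).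
    have : 0 <= d * (n%:R * d) by apply: mulr_ge0; [exact: ltW|apply: mulr_ge0 => //; exact: ltW].
    have -> : (1 + d) * (1 + n%:R * d) = 1 + (n%:R + 1) * d + d * (n%:R * d) by ring.
    by rewrite lerDl.
  by apply: le_trans (ler_wpM2l _ IH) _; [rewrite addr_ge0// ltW|rewrite -qd].
have [n hn] : exists n : nat, (2 * K + 1) / d ^+ 2 < n%:R.
  exists (Num.bound ((2 * K + 1) / d ^+ 2)); apply: archi_boundP.
  by rewrite divr_ge0 ?sqr_ge0// addr_ge0// mulr_ge0.
rewrite ltr_pdivrMr ?exprn_gt0// in hn.
have n0 : 0 < n%:R :> R.
  rewrite ltr0n lt0n; apply/eqP => n0; move: hn; rewrite n0 mul0r ltNge.
  by rewrite addr_ge0// mulr_ge0.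
(* Bernoulli's bound is only linear; its square, at the exponent 2 n, is quadratic in [n] and
   exceeds the linear bound. *)
have := h (2 * n)%N; apply/negP; rewrite -ltNge mulnC exprM.
apply: (@lt_le_trans _ _ ((1 + n%:R * d) ^+ 2)); last first.
  rewrite ler_pXn2r ?nnegrE//; first by rewrite addr_ge0// mulr_ge0// ltW.
  by rewrite exprn_ge0// (le_trans ler01)// ltW.
have : (2 * K + 1) * n%:R < n%:R * d ^+ 2 * n%:R by rewrite ltr_pM2r.
have -> : (1 + n%:R * d) ^+ 2 = 1 + 2 * (n%:R * d) + n%:R * d ^+ 2 * n%:R by ring.
have : 0 < n%:R * d by rewrite mulr_gt0.
rewrite natrM; set x := n%:R * d; set y := n%:R * d ^+ 2 * n%:R.
have -> : K * (n%:R * 2) + 1 = (2 * K + 1) * n%:R + 1 - n%:R by ring.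
lra.
Qed.

(** Tensor power trick: the coefficients of p^n are at most M^n, and there are at most (size p) n +
    1 of them. Such a linear factor cannot survive for all n unless |p(x)| <= M. *)
Lemma max_principle1 (p : {poly C}) M : (forall w, normc w = 1 -> normc p.[w] <= M) ->
  forall x, normc x <= 1 -> normc p.[x] <= M.
Proof.
move=> h x x1.
have M0 : 0 <= M by apply: le_trans (normc_ge0 _) (h 1 (@normc1 R)).
have hn (n : nat) : normc p.[x] ^+ n <= ((size p)%:R * n%:R + 1) * M ^+ n.
  rewrite -normcX -horner_exp; apply: le_trans (normc_horner_le _ x1) _.
  apply: (@le_trans _ _ (\sum_(k < size (p ^+ n)) M ^+ n)).
    apply: ler_sum => k _; apply: normc_coef_le => w w1.
    by rewrite horner_exp normcX lerXn2r ?nnegrE ?normc_ge0// h.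
  have -> : \sum_(k < size (p ^+ n)) M ^+ n = (size (p ^+ n))%:R * M ^+ n.
    by rewrite sumr_const card_ord mulr_natl.
  apply: ler_wpM2r; first exact: exprn_ge0.
  rewrite -natrM natr1 ler_nat.
  by apply: leq_trans (size_poly_exp_leq _ _) _; rewrite ltnS leq_mul2r leq_pred orbT.
rewrite leNgt; apply/negP => My.
have y0 : 0 < normc p.[x] by apply: le_lt_trans My.
move: M0; rewrite le_eqVlt => /predU1P[M0|M0].
  by have := hn 1%N; rewrite !expr1 -M0 mulr0 leNgt y0.
have : normc p.[x] / M <= 1.
  apply: (@pow_le_linear _ (size p)%:R) => // n.
  by rewrite expr_div_n ler_pdivrMr ?exprn_gt0.
by rewrite ler_pdivrMr// mul1r leNgt My.
Qed.

Variables (I : eqType) (e : I -> nat -> nat).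
Implicit Types (s : seq I) (c : I -> C) (z : nat -> C).

Definition pol N s c z : C := \sum_(i <- s) c i * \prod_(j < N) z j ^+ e i j.

(** The restriction to the complex line t |-> a + b t; its coefficient of degree one is the
    derivative at [a] in the direction [b]. *)
Definition line_poly N s c (a b : nat -> C) : {poly C} :=
  \sum_(i <- s) c i *: \prod_(j < N) ((a j)%:P + b j *: 'X) ^+ e i j.

Lemma horner_line_poly N s c a b t :
  (line_poly N s c a b).[t] = pol N s c (fun j => a j + b j * t).
Proof.
rewrite horner_sum; apply: eq_bigr => i _; rewrite hornerZ horner_prod; congr (_ * _).
by apply: eq_bigr => j _; rewrite horner_exp hornerD hornerC hornerZ hornerX.
Qed.

Lemma eq_pol N s c z z' : (forall j, (j < N)%N -> z j = z' j) -> pol N s c z = pol N s c z'.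
Proof.
by move=> zz; apply: eq_bigr => i _; congr (_ * _); apply: eq_bigr => j _; rewrite zz.
Qed.

(** The coordinates leave the torus one at a time; in the induction, [k] counts those that may lie
    inside the disc. *)
Lemma max_principle N s c M :
  (forall z, (forall j, normc (z j) = 1) -> normc (pol N s c z) <= M) ->
  forall z, (forall j, normc (z j) <= 1) -> normc (pol N s c z) <= M.
Proof.
move=> H z z1.
suff main k : forall z, (forall j, normc (z j) <= 1) ->
    (forall j, (k <= j)%N -> normc (z j) = 1) -> normc (pol N s c z) <= M.
  rewrite (@eq_pol _ _ _ _ (fun j => if (j < N)%N then z j else 1)); last by move=> j ->.
  apply: (main N) => j; first by case: ifP => // _; rewrite normc1.
  by rewrite leqNgt => /negbTE ->; rewrite normc1.
elim: k => [|k IH] {}z {}z1 zk; first by apply: H => j; exact: zk.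
pose a j := if j == k then 0 else z j.
pose b j : C := if j == k then 1 else 0.
have E u : (line_poly N s c a b).[u] = pol N s c (fun j => if j == k then u else z j).
  rewrite horner_line_poly; apply: eq_pol => j _; rewrite /a /b.
  by case: eqP => _; rewrite ?add0r ?mul1r ?mul0r ?addr0.
have -> : pol N s c z = (line_poly N s c a b).[z k].
  by rewrite E; apply: eq_pol => j _; case: eqP => [->|].
apply: max_principle1 => // w w1; rewrite E; apply: IH => j.
  by case: eqP => _ //; rewrite w1.
by move=> kj; case: eqP => // /eqP jk; apply: zk; rewrite ltn_neqAle eq_sym jk.
Qed.

Lemma coef0_pow (a b : C) n : ((a%:P + b *: 'X) ^+ n)`_0 = a ^+ n.
Proof. by rewrite -horner_coef0 horner_exp hornerD hornerC hornerZ hornerX mulr0 addr0. Qed.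

Lemma coef1M (p q : {poly C}) : (p * q)`_1 = p`_0 * q`_1 + p`_1 * q`_0.
Proof. by rewrite coefM !big_ord_recl big_ord0 addr0. Qed.

Lemma coef1_pow (a b : C) n : ((a%:P + b *: 'X) ^+ n)`_1 = n%:R * b * a ^+ n.-1.
Proof.
elim: n => [|n IH]; first by rewrite expr0 coef1 !mul0r.
have h0 : (a%:P + b *: 'X)`_0 = a by rewrite coefD coefC coefZ coefX /= mulr0 addr0.
have h1 : (a%:P + b *: 'X)`_1 = b by rewrite coefD coefC coefZ coefX /= mulr1 add0r.
rewrite exprS coef1M IH coef0_pow h0 h1.
case: n {IH} => [|n]; first by rewrite !mul0r mulr0 add0r mul1r.
by rewrite /= -[n.+2%:R]natr1 exprS; ring.
Qed.

Lemma coef1_prod N (a b : nat -> C) (r : nat -> nat) :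
  (\prod_(j < N) ((a j)%:P + b j *: 'X) ^+ r j)`_1 =
  \sum_(k < N) (r k)%:R * b k * \prod_(j < N) a j ^+ (r j - (j == k :> nat)).
Proof.
elim: N => [|N IH]; first by rewrite !big_ord0 coef1.
have c0 n : (\prod_(j < n) ((a j)%:P + b j *: 'X) ^+ r j)`_0 = \prod_(j < n) a j ^+ r j.
  rewrite -horner_coef0 horner_prod; apply: eq_bigr => j _.
  by rewrite horner_coef0 coef0_pow.
rewrite big_ord_recr /= coef1M IH c0 coef0_pow coef1_pow [RHS]big_ord_recr /= [LHS]addrC; congr (_ + _).
  rewrite mulr_suml; apply: eq_bigr => k _; rewrite [in RHS]big_ord_recr /=.
  by rewrite (gtn_eqF (ltn_ord k)) subn0 mulrA.
rewrite mulrCA; congr (_ * _); rewrite [in RHS]big_ord_recr /= eqxx subn1; congr (_ * _).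
by apply: eq_bigr => j _; rewrite (ltn_eqF (ltn_ord j)) subn0.
Qed.

(** Truncated subtraction is harmless, since [dpol] keeps only the terms whose exponent at [k] is
    positive. *)
Definition dexp (k : nat) (i : I) (j : nat) : nat := (e i j - (j == k))%N.

Definition dpol N s c k z : C :=
  \sum_(i <- [seq i <- s | (0 < e i k)%N]) (c i * (e i k)%:R) * \prod_(j < N) z j ^+ dexp k i j.

Lemma coef1_line_poly N s c a b :
  (line_poly N s c a b)`_1 = \sum_(k < N) b k * dpol N s c k a.
Proof.
rewrite coef_sum; under eq_bigr do rewrite coefZ coef1_prod mulr_sumr.
rewrite exchange_big /=; apply: eq_bigr => k _.
rewrite /dpol mulr_sumr big_filter [RHS]big_mkcond /=; apply: eq_bigr => i _.
case: ifPn => [_|]; first by rewrite /dexp; ring.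
by rewrite lt0n negbK => /eqP ->; rewrite !mul0r mulr0.
Qed.

(** Cauchy's estimate on a single line. With [b k] the phase of the k-th derivative at rho z, the
    derivative in the direction [b] is the whole sum, and rho z + (1 - rho) w b stays in the
    polydisc. Estimating the derivatives one by one would lose a factor [N]. *)
Lemma dpol_sum_le N s c M rho z : 0 < rho < 1 ->
  (forall z, (forall j, normc (z j) <= 1) -> normc (pol N s c z) <= M) ->
  (forall j, normc (z j) = 1) ->
  \sum_(k < N) normc (dpol N s c k (fun j => rho%:C * z j)) <= M / (1 - rho).
Proof.
move=> /andP[r0 r1] H z1.
have r10 : 0 < 1 - rho by rewrite subr_gt0.
pose a j := rho%:C * z j.
pose b k := phase (dpol N s c k a).
pose p := line_poly N s c a b.
have -> : \sum_(k < N) normc (dpol N s c k a) = normc p`_1.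
  rewrite coef1_line_poly (eq_bigr (fun k : 'I_N => (normc (dpol N s c k a))%:C)); last first.
    by move=> k _; rewrite phaseM.
  by rewrite -rmorph_sum normc_real ger0_norm// sumr_ge0// => k _; exact: normc_ge0.
rewrite ler_pdivlMr// mulrC.
have := @normc_coef_le R (p \Po ((1 - rho)%:C *: 'X)) 1 M.
have -> : (p \Po ((1 - rho)%:C *: 'X))`_1 = (1 - rho)%:C * p`_1.
  rewrite comp_polyE coef_sum (eq_bigr (fun i : 'I_(size p) => (nat_of_ord i == 1%N)%:R * ((1 - rho)%:C * p`_1))).
    case: (ltnP 1 (size p)) => sp.
      rewrite (bigD1 (Ordinal sp))//= mul1r big1 ?addr0// => i i1.
      rewrite (_ : (_ == 1)%N = false) ?mul0r//; apply/negbTE; apply: contra i1 => /eqP i1.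
      by apply/eqP/val_inj.
    rewrite [p`_1]nth_default// mulr0 big1// => i _; exact: mulr0.
  move=> i _; rewrite exprZn !coefZ coefXn eq_sym.
  by case: eqP => [->|_]; rewrite ?mul0r ?mulr0// expr1 mulr1 mul1r mulrC.
rewrite normcM normc_real gtr0_norm//; apply => w w1.
rewrite horner_comp hornerZ hornerX horner_line_poly; apply: H => j.
apply: le_trans (le_normcD _ _) _.
rewrite !normcM !normc_real z1 w1 normc_phase !gtr0_norm//; lra.
Qed.

End maximum_principle.

(** * Weighted sums of coefficients *)

Section coefficient_sums.
Variable R : realType.
Variables (I : eqType).
Implicit Types (s : seq I) (e : I -> nat -> nat) (c : I -> R[i]) (t : nat -> R).
Local Notation m := (torus_measure R).

Lemma sum_succ_geom (x : R) d : 0 <= x -> x < 1 ->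
  \sum_(k < d) k.+1%:R * x ^+ k <= (1 - x) ^- 2.
Proof.
move=> x0 x1; have y0 : 0 < 1 - x by rewrite subr_gt0.
rewrite -[leRHS]mul1r ler_pdivlMr ?exprn_gt0//.
have E : (\sum_(k < d) k.+1%:R * x ^+ k) * (1 - x) ^+ 2 = 1 - d.+1%:R * x ^+ d + d%:R * x ^+ d.+1.
  elim: d => [|d IH]; first by rewrite big_ord0 expr0; ring.
  rewrite big_ord_recr /= mulrDl IH -[d.+2%:R]natr1 -[d.+1%:R]natr1 !exprS; ring.
rewrite E -addrA gerDl exprS addrC subr_le0 -[d.+1%:R]natr1 mulrDl mul1r.
have h : x * x ^+ d <= x ^+ d by rewrite ler_piMl ?exprn_ge0// ltW.
have h2 : d%:R * (x * x ^+ d) <= d%:R * x ^+ d by rewrite ler_wpM2l.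
apply: le_trans h2 _; rewrite lerDl exprn_ge0//.
Qed.

(** Cauchy-Schwarz after splitting off the root of the weight [W i]. One factor is [carleman_torus],
    the other the sum of prod (e_j + 1) t_j^(2 e_j), at most prod (1 - t_j^2)^(-2). *)
Lemma weighted_sum_bound e N s c t : uniq s -> sep_exponents e N s ->
  (forall j, 0 <= t j < 1) ->
  \sum_(i <- s) normc (c i) * \prod_(j < N) t j ^+ e i j <=
  (\int[m]_w normc (epoly e N s c w)) * \prod_(j < N) (1 - t j ^+ 2)^-1.
Proof.
move=> us hs t01.
have t0 j : 0 <= t j by case/andP: (t01 j).
have t2 j : t j ^+ 2 < 1 by have /andP[h0 h1] := t01 j; rewrite exprn_ilt1.
pose W i : R := \prod_(j < N) (e i j).+1%:R.
have W0 i : 0 < W i by apply: prodr_gt0 => j _; rewrite ltr0n.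
have sW i : Num.sqrt (W i) != 0 by rewrite sqrtr_eq0 -ltNge.
set A := \int[m]_w _; set P := \prod_(j < N) _.
have A0 : 0 <= A by apply: Rintegral_ge0 => w _; exact: normc_ge0.
have P0 : 0 <= P by apply: prodr_ge0 => j _; rewrite invr_ge0 subr_ge0 ltW.
rewrite -(@ler_pXn2r _ 2)// ?nnegrE ?mulr_ge0//; last first.
  by apply: sumr_ge0 => i _; rewrite mulr_ge0 ?normc_ge0// prodr_ge0// => j _; rewrite exprn_ge0.
have := cauchy_schwarz_sum s (fun i => normc (c i) / Num.sqrt (W i))
  (fun i => Num.sqrt (W i) * \prod_(j < N) t j ^+ e i j).
rewrite (eq_bigr (fun i => normc (c i) * \prod_(j < N) t j ^+ e i j)); last first.
  by move=> i _; rewrite mulrA divfK.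
move=> h; apply: le_trans h _; rewrite exprMn.
apply: ler_pM; rewrite ?sumr_ge0//.
- by move=> i _; exact: sqr_ge0.
- by move=> i _; exact: sqr_ge0.
- apply: le_trans (carleman_torus c us hs); rewrite le_eqVlt; apply/orP; left; apply/eqP.
  by apply: eq_bigr => i _; rewrite expr_div_n sqr_sqrtr// ltW.
- apply: (@le_trans _ _ (\prod_(j < N) (1 - t j ^+ 2) ^- 2)); last first.
    by rewrite /P -prodrXl; apply: ler_prod => j _; rewrite exprVn lexx invr_ge0 sqr_ge0.
  apply: le_trans (@sum_prod_le_prod_sum _ _ e N s (fun j k => k.+1%:R * (t j ^+ 2) ^+ k)
    (fun j => (1 - t j ^+ 2) ^- 2) us hs _ _).
  + rewrite le_eqVlt; apply/orP; left; apply/eqP; apply: eq_bigr => i _.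
    rewrite exprMn sqr_sqrtr; last exact: ltW.
    rewrite -prodrXl -big_split /=; apply: eq_bigr => j _.
    by rewrite -!exprM mulnC.
  + by move=> j k; rewrite mulr_ge0// exprn_ge0// sqr_ge0.
  + by move=> j d; apply: sum_succ_geom; rewrite ?sqr_ge0.
Qed.

(* Every nonzero exponent is charged to a coordinate of its support where t is smallest. *)
Lemma min_coord_bound e N s c t rho M B : uniq s -> sep_exponents e N s -> 0 < rho < 1 -> 0 <= B ->
  (forall z, (forall j, normc (z j) = 1) -> normc (pol e N s c z) <= M) ->
  (forall j, 0 <= t j < rho) ->
  (forall k, (k < N)%N -> t k * \prod_(j < N | t k <= t j) (1 - (t j / rho) ^+ 2)^-1 <= B) ->
  \sum_(i <- s) normc (c i) * \prod_(j < N) t j ^+ e i j <= M * (1 + B / (1 - rho)).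
Proof.
move=> us hs /[dup] rho01 /andP[r0 r1] B0 H t0r hB.
have r10 : 0 < 1 - rho by rewrite subr_gt0.
have t0 j : 0 <= t j by case/andP: (t0r j).
have H1 := max_principle H.
have M0 : 0 <= M by apply: le_trans (normc_ge0 _) (H (fun=> 1) (fun=> normc1 R)).
pose F i := normc (c i) * \prod_(j < N) t j ^+ e i j.
have F0 i : 0 <= F i by rewrite mulr_ge0 ?normc_ge0// prodr_ge0// => j _; rewrite exprn_ge0.
pose nz i := [exists j : 'I_N, (0 < e i j)%N].
pose T (k : 'I_N) i := (0 < e i k)%N && [forall j : 'I_N, (0 < e i j)%N ==> (t k <= t j)].
rewrite (bigID nz)/= mulrDr mulr1 addrC; apply: lerD.
  (* The zero exponent occurs at most once, and its coefficient is the value at the origin, which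
     the maximum principle bounds by [M]. *)
  rewrite -big_filter; set s0 := [seq i <- s | ~~ nz i].
  have s00 i : i \in s0 -> forall j, (j < N)%N -> e i j = 0%N.
    rewrite mem_filter => /andP[/existsPn h _] j jN.
    by have := h (Ordinal jN); rewrite /= lt0n negbK => /eqP.
  have us0 : uniq s0 by rewrite filter_uniq.
  have ss0 : sep_exponents e 0 s0.
    move=> i i' si si' _; apply: hs.
    + by move: si; rewrite mem_filter => /andP[].
    + by move: si'; rewrite mem_filter => /andP[].
    + by move=> j jN; rewrite !s00.
  have [->|[i0 Ei0]] := sep_exponents0 us0 ss0; first by rewrite big_nil.
  rewrite Ei0 big_seq1 big1 ?mulr1; last first.
    by move=> j _; rewrite (s00 i0) ?expr0// Ei0 inE.
  have z01 (j : nat) : normc (0 : R[i]) <= 1 by rewrite normc0.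
  have := H1 (fun=> 0) z01.
  rewrite /pol (bigID nz)/= big1 ?add0r; last first.
    move=> i /existsP[j ej]; rewrite (bigD1 j)//= expr0n.
    by rewrite eqn0Ngt ej mul0r mulr0.
  rewrite -big_filter -/s0 Ei0 big_seq1 big1 ?mulr1// => j _.
  by rewrite (s00 i0) ?expr0// Ei0 inE.
(* The mean modulus of the k-th derivative on the torus of radius [rho]; [dpol_sum_le] bounds the
   sum of all these means at once. *)
pose X k := \int[m]_w normc (epoly (dexp e k) N [seq i <- s | (0 < e i k)%N]
  (fun i => c i * (e i k)%:R * (rho ^+ (\sum_(j < N) dexp e k i j))%:C) w).
have X0 k : 0 <= X k by apply: Rintegral_ge0 => w _; exact: normc_ge0.
have XM : \sum_(k < N) X k <= M / (1 - rho).
  rewrite -Rintegral_sum; last by move=> k; exact: integrable_normc_epoly.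
  rewrite -[leRHS](Rintegral_prob_cst m); apply: le_Rintegral => //.
  - by apply: integrable_real_sum => k; exact: integrable_normc_epoly.
  - exact: (@finite_measure_integrable_cst _ _ _ m).
  - move=> w _; apply: le_trans (dpol_sum_le rho01 H1 (normc_tval w)).
    rewrite le_eqVlt; apply/orP; left; apply/eqP; apply: eq_bigr => k _; congr normc.
    apply: eq_bigr => i _; rewrite -[LHS]mulrA; congr (_ * _).
    rewrite [RHS](eq_bigr (fun j : 'I_N => rho%:C ^+ dexp e k i j * tval w j ^+ dexp e k i j)).
      by rewrite big_split /= -expr_sum rmorphXn.
    by move=> j _; rewrite exprMn.
have step : \sum_(i <- s | nz i) F i <= \sum_(k < N) \sum_(i <- s | T k i) F i.
  under [leRHS]eq_bigr do rewrite big_mkcond.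
  rewrite exchange_big /= big_mkcond; apply: ler_sum => i _.
  case: ifPn => [/existsP[j0 ej0]|_]; last first.
    by apply: sumr_ge0 => k _; case: ifP.
  case: (@Order.TotalTheory.arg_minP _ _ _ j0 (fun j : 'I_N => (0 < e i j)%N) (fun j : 'I_N => t j) ej0) => k ek hk.
  rewrite (bigD1 k)//= ifT; last first.
    by apply/andP; split => //; apply/forallP => j; apply/implyP => ej; exact: hk.
  by rewrite lerDl; apply: sumr_ge0 => k' _; case: ifP.
apply: le_trans step _; rewrite (_ : M * (B / (1 - rho)) = M / (1 - rho) * B); last by rewrite mulrA mulrAC.
apply: (@le_trans _ _ (\sum_(k < N) X k * B)); last first.
  by rewrite -mulr_suml ler_wpM2r.
apply: ler_sum => k _.
pose sk := [seq i <- s | (0 < e i k)%N].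
(* An exponent charged to [k] only involves coordinates with t k <= t j, so the others may be set to
   0. Division by [rho] compensates for the powers of [rho] in [X k]. *)
pose t' j := if t k <= t j then t j / rho else 0.
have t'01 j : 0 <= t' j < 1.
  rewrite /t'; case: ifP => _; last by rewrite lexx ltr01.
  by have /andP[h0 h1] := t0r j; rewrite divr_ge0 ?(ltW r0)//= ltr_pdivrMr// mul1r.
have usk : uniq sk by rewrite filter_uniq.
have ssk : sep_exponents (dexp e k) N sk.
  move=> i i'; rewrite !mem_filter => /andP[ei si] /andP[ei' si'] h; apply: hs => // j jN.
  have := h j jN; rewrite /dexp; case: eqP => [->|_]; last by rewrite !subn0.
  by rewrite -{2}(prednK ei) -{2}(prednK ei') !subn1 => ->.
have W := weighted_sum_bound (fun i => c i * (e i k)%:R * (rho ^+ (\sum_(j < N) dexp e k i j))%:C) usk ssk t'01.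
have PE : \prod_(j < N) (1 - t' j ^+ 2)^-1 = \prod_(j < N | t k <= t j) (1 - (t j / rho) ^+ 2)^-1.
  rewrite [RHS]big_mkcond; apply: eq_bigr => j _; rewrite /t'; case: ifP => // _.
  by rewrite expr0n subr0 invr1.
have FE i : T k i -> F i <= t k * (normc (c i * (e i k)%:R * (rho ^+ (\sum_(j < N) dexp e k i j))%:C) *
    \prod_(j < N) t' j ^+ dexp e k i j).
  move=> /andP[eik /forallP hi].
  have -> : \prod_(j < N) t' j ^+ dexp e k i j =
      \prod_(j < N) t j ^+ dexp e k i j / rho ^+ (\sum_(j < N) dexp e k i j).
    rewrite expr_sum -prodfV -big_split /=; apply: eq_bigr => j _.
    have [->|dj] := posnP (dexp e k i j); first by rewrite !expr0 divr1.
    have ej : (0 < e i j)%N by apply: leq_trans dj _; exact: leq_subr.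
    by have := hi j; rewrite ej /t' /= => ->; rewrite expr_div_n.
  have FF : F i = normc (c i) * (t k * \prod_(j < N) t j ^+ dexp e k i j).
    rewrite /F; congr (_ * _); rewrite (bigD1 k)//= [in RHS](bigD1 k)//= mulrA; congr (_ * _).
      by rewrite /dexp eqxx subn1 -exprS prednK.
    by apply: eq_bigr => j jk; rewrite /dexp (_ : (_ == _ :> nat) = false) ?subn0//; exact/negbTE.
  rewrite FF !normcM normc_real ger0_norm; last by rewrite exprn_ge0// ltW.
  have P0 : 0 <= \prod_(j < N) t j ^+ dexp e k i j by apply: prodr_ge0 => j _; rewrite exprn_ge0.
  have rp : rho ^+ (\sum_(j < N) dexp e k i j) != 0 by rewrite expf_neq0// gt_eqF.
  rewrite -[(e i k)%:R](rmorph_nat (real_complex R)) normc_real ger0_norm//.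
  set P := \prod_(j < N) _ in P0 *; set q := rho ^+ _ in rp *.
  have -> : t k * (normc (c i) * (e i k)%:R * q * (P / q)) = (e i k)%:R * (normc (c i) * (t k * P)).
    by field.
  by rewrite ler_peMl ?ler1n// mulr_ge0 ?normc_ge0// mulr_ge0.
apply: (@le_trans _ _ (t k * (X k * \prod_(j < N | t k <= t j) (1 - (t j / rho) ^+ 2)^-1))); last first.
  by rewrite mulrCA ler_wpM2l// hB.
rewrite -PE; apply: le_trans (ler_wpM2l (t0 k) W).
rewrite mulr_sumr /sk big_filter big_mkcond [leRHS]big_mkcond; apply: ler_sum => i _.
case: ifPn => [Tki|_]; first by rewrite ifT ?FE//; case/andP: Tki.
case: ifP => // _; rewrite mulr_ge0// mulr_ge0 ?normc_ge0// prodr_ge0// => j _.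
by rewrite exprn_ge0//; case/andP: (t'01 j).
Qed.

End coefficient_sums.

Lemma sumr_const_seq (V : nmodType) (I : Type) (s : seq I) (x : V) :
  \sum_(i <- s) x = x *+ size s.
Proof. by rewrite big_const_seq iter_addr_0 count_predT. Qed.

Lemma prodr_const_seq (A : comPzRingType) (I : Type) (s : seq I) (x : A) :
  \prod_(i <- s) x = x ^+ size s.
Proof. by rewrite big_const_seq iter_mulr_1 count_predT. Qed.

(** * Decreasing rearrangements *)

Section rearrangement.
Variable R : realType.
Implicit Types (z : ell_infty R) (s : seq nat).

Let tail z (J : {fset nat}) := [set normc (z j) | j in [set j | j \notin J]].

Lemma tail_bounded z J : has_sup (tail z J).
Proof.
split; last by exists (sup_norm z) => _ [j _ <-]; exact: le_sup_norm.
have [j hj] : exists j, j \notin J.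
  exists (\max_(i <- J) i).+1; apply/negP => h.
  have /leq_trans : ((\max_(i <- J) i).+1 <= \max_(i <- J) i)%N.
    by rewrite [leqRHS](big_rem _ h) /= leq_maxl.
  by move/(_ _ (leqnn _)); rewrite ltnn.
by exists (normc (z j)); exists j.
Qed.

Lemma tail_ge0 z J : 0 <= sup (tail z J).
Proof.
have [[x [j jJ e]] ub] := tail_bounded z J; move: jJ => jJ.
apply: le_trans (normc_ge0 (z j)) _; apply: (ub_le_sup ub); by exists j.
Qed.

Lemma decr_rearr_set n z : (0 < n)%N ->
  [set sup (tail z J) | J in [set J : {fset nat} | (#|` J| < n)%N]] !=set0.
Proof. by move=> n0; exists (sup (tail z fset0)); exists fset0 => //=; rewrite cardfs0. Qed.

(** A set with fewer elements than [s] misses one of them. *)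
Lemma decr_rearr_ge z s (v : R) : uniq s -> (0 < size s)%N ->
  (forall j, j \in s -> v <= normc (z j)) -> v <= decr_rearr z (size s).
Proof.
move=> us s0 hv; apply: lb_le_inf; first exact: decr_rearr_set.
move=> _ [J /= hJ <-].
have [j js jJ] : exists2 j, j \in s & j \notin J.
  have [/hasP[j js jJ]|/hasPn h] := boolP (has (fun j => j \notin J) s); first by exists j.
  suff : (size s <= #|` J|)%N by rewrite leqNgt hJ.
  by apply: uniq_leq_size => // j /h; rewrite negbK.
by apply: le_trans (hv j js) _; apply: ub_le_sup; [case: (tail_bounded z J)|exists j].
Qed.

Lemma decr_rearr_le z (J : {fset nat}) n : (#|` J| < n)%N -> decr_rearr z n <= sup (tail z J).
Proof.
by move=> hJ; apply: ge_inf; [exists 0 => _ [K _ <-]; exact: tail_ge0|exists J].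
Qed.

Lemma decr_rearr_ge0 z n : (0 < n)%N -> 0 <= decr_rearr z n.
Proof.
by move=> n0; apply: lb_le_inf; [exact: decr_rearr_set|move=> _ [J _ <-]; exact: tail_ge0].
Qed.

(** Induction that removes the element [b] where |z| is smallest. All values on the list are at
    least |z_b|, so |z_b| is at most the last term of the rearrangement. *)
Lemma sum_sqr_le_rearr z s : uniq s ->
  \sum_(j <- s) normc (z j) ^+ 2 <= \sum_(1 <= j < (size s).+1) decr_rearr z j ^+ 2.
Proof.
have [n] := ubnP (size s); elim: n s => // n IH [|a s]; first by rewrite big_nil big_geq.
set s' := a :: s => hs us.
have := @Order.TotalTheory.arg_minP _ _ 'I_(size s') (ord0 : 'I_(size s).+1) predT
  (fun i => normc (z (nth 0%N s' i))) isT.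
case=> i _ hi; set b := nth 0%N s' i.
have bs : b \in s' by rewrite mem_nth.
have hb j : j \in s' -> normc (z b) <= normc (z j).
  move=> js; have js' := js; rewrite -index_mem in js'.
  by have := hi (Ordinal js') isT; rewrite /= nth_index.
rewrite (big_rem b)//= addrC.
have sz : size (rem b s') = size s by rewrite size_rem.
rewrite [leRHS]big_nat_recr//=; apply: lerD.
  have := IH (rem b s'); rewrite sz; apply => //; exact: rem_uniq.
rewrite ler_sqr ?nnegrE ?normc_ge0 ?decr_rearr_ge0//.
exact: (decr_rearr_ge us).
Qed.

(** Greedy choice: the infimum defining the next term, tested on the [n] indices chosen so far,
    leaves an index outside them whose square comes within [eta] of that term's. Suprema need not be
    attained, hence the error. *)
Lemma rearr_approx z n (eta : R) : 0 < eta -> exists s : seq nat,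
  [/\ uniq s, size s = n &
   \sum_(1 <= j < n.+1) decr_rearr z j ^+ 2 <= \sum_(j <- s) normc (z j) ^+ 2 + n%:R * eta].
Proof.
move=> eta0; elim: n => [|n [s [us sn hs]]].
  by exists [::]; split => //; rewrite big_geq// big_nil mul0r addr0.
set v := decr_rearr z n.+1; have v0 : 0 <= v by exact: decr_rearr_ge0.
pose J : {fset nat} := [fset x in s]%fset.
have hJ : (#|` J| < n.+1)%N by rewrite /J card_fseq undup_id// sn.
have [j jJ hj] : exists2 j, j \notin J & v ^+ 2 - eta < normc (z j) ^+ 2.
  apply: contrapT => hn.
  have hn' j : j \notin J -> normc (z j) ^+ 2 <= v ^+ 2 - eta.
    by move=> jJ; rewrite leNgt; apply/negP => h; apply: hn; exists j.
  have [[_ [j jJ _]] _] := tail_bounded z J.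
  have e0 : 0 <= v ^+ 2 - eta by apply: (le_trans _ (hn' j jJ)); rewrite exprn_ge0 ?normc_ge0.
  have : v <= Num.sqrt (v ^+ 2 - eta).
    apply: le_trans (decr_rearr_le z hJ) _; apply: ge_sup; first by case: (tail_bounded z J).
    move=> _ [k kJ <-]; rewrite -[leLHS]ger0_norm ?normc_ge0// -sqrtr_sqr.
    exact/ler_wsqrtr/hn'.
  rewrite -ler_sqr ?nnegrE ?sqrtr_ge0// sqr_sqrtr// leNgt => /negP; apply.
  by rewrite gtrBl.
exists (j :: s); split => /=; first 1 last.
- by rewrite sn.
- rewrite big_nat_recr//= big_cons -natr1 mulrDl mul1r; move: hs hj; rewrite -/v.
  by set x := \sum_(_ <= _ < _) _; set y := \sum_(_ <- _) _; set w := n%:R * eta; lra.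
by rewrite us andbT; move: jJ; rewrite /J !inE.
Qed.

Lemma rearr_sum_le z n (G : R) :
  (forall s, uniq s -> size s = n -> \sum_(j <- s) normc (z j) ^+ 2 <= G) ->
  \sum_(1 <= j < n.+1) decr_rearr z j ^+ 2 <= G.
Proof.
move=> H; apply/ler_addgt0Pr => eps eps0.
have e0 : 0 < eps / n.+1%:R by rewrite divr_gt0.
have [s [us sn hs]] := rearr_approx z n e0.
apply: le_trans hs (lerD (H s us sn) _).
rewrite mulrCA ler_piMr //; first exact: ltW.
by rewrite ler_pdivrMr// mul1r ler_nat.
Qed.

End rearrangement.

(** * The weight behind the lower inclusion *)

Section log_sums.
Variable R : realType.
Variables (t : nat -> R) (c : R) (n0 : nat).
Hypotheses (t0 : forall j, 0 <= t j) (c01 : 0 <= c < 1).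
(** A consequence of membership of sqrt(2) t in [B_set], stated for arbitrary finite sets instead of
    the decreasing rearrangement. *)
Hypothesis hc : forall s : seq nat, uniq s -> (n0 <= size s)%N ->
  \sum_(j <- s) t j ^+ 2 <= c / 2 * ln (size s)%:R.

Lemma ln_sqr_le (x : R) : 1 <= x -> ln x ^+ 2 <= 4 * x.
Proof.
move=> x1; have x0 : 0 < x by apply: (lt_le_trans _ x1).
have l0 : 0 <= ln x by rewrite ln_ge0.
have h : ln x / 2 <= expR (ln x / 2) by apply: (le_trans _ (expR_ge1Dx _)); rewrite lerDr.
have xE : x = expR (ln x / 2) ^+ 2 by rewrite expr2 -expRD -splitr lnK.
have : (ln x / 2) ^+ 2 <= expR (ln x / 2) ^+ 2.
  by rewrite ler_sqr ?nnegrE ?divr_ge0 ?expR_ge0.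
rewrite -xE => h2; rewrite (_ : ln x ^+ 2 = 4 * (ln x / 2) ^+ 2); last by field.
by rewrite ler_wpM2l.
Qed.

(** If n >= n0 squares exceed d, then n d <= (ln n) / 2, whereas (ln n)^2 <= 4 n. Together they give
    ln n <= 2 / d, and then n <= d^(-2). *)
Lemma few_large (d : R) : 0 < d -> exists m : nat, forall s : seq nat, uniq s ->
  (forall j, j \in s -> d < t j ^+ 2) -> (size s <= m)%N.
Proof.
move=> d0; exists (n0 + (Num.truncn (d ^- 2)).+1)%N => s us hs; rewrite leqNgt; apply/negP => hsz.
set n := size s in hsz.
have n0n : (n0 <= n)%N by apply: leq_trans (leq_addr _ _) (ltnW hsz).
have n1 : (0 < n)%N by apply: (leq_trans _ hsz).
have nd : n%:R * d <= ln n%:R / 2.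
  apply: (@le_trans _ _ (\sum_(j <- s) t j ^+ 2)).
    rewrite mulr_natl /n -sumr_const_seq big_seq [leRHS]big_seq.
    by apply: ler_sum => j /hs /ltW.
  apply: le_trans (hc us n0n) _; rewrite mulrAC ler_pM2r// ler_piMl ?ln_ge0 ?ler1n//.
  by case/andP: c01 => _ /ltW.
have l0 : 0 <= ln n%:R :> R by rewrite ln_ge0 ?ler1n.
have := @ln_sqr_le n%:R; rewrite ler1n n1 => /(_ isT) h4.
have lpos : 0 < ln n%:R :> R.
  by rewrite -(pmulr_lgt0 _ (_ : 0 < 2^-1))//; apply: (lt_le_trans _ nd); rewrite mulr_gt0// ltr0n.
have l2 : ln n%:R <= 2 / d.
  rewrite ler_pdivlMr// -(ler_pM2r lpos).
  have -> : ln n%:R * d * ln n%:R = ln n%:R ^+ 2 * d by ring.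
  apply: le_trans (ler_wpM2r (ltW d0) h4) _.
  by rewrite -mulrA; move: nd; set x := _ * d; set y := ln _; lra.
have : n%:R <= d ^- 2 :> R.
  rewrite -(ler_pM2r d0); apply: le_trans nd _.
  rewrite (_ : d ^- 2 * d = d^-1); last by field; rewrite gt_eqF.
  by rewrite ler_pdivrMr// mulrC.
apply/negP; rewrite -ltNge; apply: lt_trans (truncnS_gt _) _.
by rewrite ltr_nat; apply: (leq_ltn_trans _ hsz); exact: leq_addl.
Qed.

Lemma inv_1B_le_expR (y d : R) : 0 <= y <= d -> d < 1 -> (1 - y)^-1 <= expR (y / (1 - d)).
Proof.
move=> /andP[y0 yd] d1; have y1 : 0 < 1 - y by lra.
have d10 : 0 < 1 - d by lra.
have -> : (1 - y)^-1 = 1 + y / (1 - y) by field; rewrite gt_eqF.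
apply: le_trans (expR_ge1Dx _) _; rewrite ler_expR ler_wpM2l// lef_pV2 ?posrE//.
by lra.
Qed.

Hypothesis t12 : forall j, 2 * t j ^+ 2 <= 1.

(** Let n be the number of indices with t_j >= t_k. Then t_k^2 <= (ln n) / n, and up to boundedly
    many large coordinates the product is at most exp((1 + o(1)) sum t_j^2), hence at most n^(g/2)
    with g < 1. The square of the weight is thus of order (ln n) n^(g - 1), which is bounded. Here
    half a logarithm is the threshold. *)
Lemma min_coord_weight : exists rho B : R, [/\ 0 < rho < 1, 0 <= B,
  forall j, 0 <= t j < rho &
  forall N k, (k < N)%N -> t k * \prod_(j < N | t k <= t j) (1 - (t j / rho) ^+ 2)^-1 <= B].
Proof.
have /andP[c0 c1] := c01.
(* Keeps c / (1 - d)^2 below 1, because c = 1 - 4 d and (1 - d)^2 = 1 - 2 d + d^2. *)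
pose d := (1 - c) / 4.
have d0 : 0 < d by rewrite /d; lra.
have d4 : d <= 4^-1 by rewrite /d; lra.
pose r2 := 1 - d; have r20 : 0 < r2 by rewrite /r2; lra.
pose rho := Num.sqrt r2.
have rho0 : 0 < rho by rewrite sqrtr_gt0.
have rhoE : rho ^+ 2 = r2 by rewrite sqr_sqrtr// ltW.
have [m hm] := few_large (mulr_gt0 d0 r20).
pose g := c / r2 ^+ 2.
have g1 : g < 1.
  rewrite /g ltr_pdivrMr ?exprn_gt0// mul1r /r2 (_ : c = 1 - 4 * d); last by rewrite /d; field.
  by rewrite (_ : (1 - d) ^+ 2 = 1 - 4 * d + (2 * d + d ^+ 2)); [rewrite ltrDl; nra|ring].
have g10 : 0 < 1 - g by lra.
pose y j := (t j / rho) ^+ 2.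
have yE j : y j = t j ^+ 2 / r2 by rewrite /y expr_div_n rhoE.
have y0 j : 0 <= y j by rewrite /y exprn_even_ge0.
(* t_j^2 <= 1/2 and r2 >= 3/4; therefore each factor of the product is at most 3. *)
have y23 j : y j <= 2 / 3.
  rewrite yE ler_pdivrMr//; have := t12 j; rewrite /r2; set x := _ ^+ 2; lra.
have inv3 j : 1 <= (1 - y j)^-1 <= 3.
  have h1 : 0 < 1 - y j by have := y23 j; lra.
  rewrite -div1r ler_pdivlMr// ler_pdivrMr//; apply/andP.
  by have := y23 j; have := y0 j; split; lra.
(* A factor 3 for each of the at most [m] large coordinates, or for each coordinate if there are
   fewer than [n0], when [hc] does not apply. *)
pose B := 3 ^+ (m + n0) * (1 + (1 - g)^-1).
have B1 : 1 <= 1 + (1 - g)^-1 by rewrite lerDl invr_ge0 ltW.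
exists rho, B; split.
- by rewrite rho0 /=; rewrite -(@ltr_pXn2r _ 2) ?nnegrE ?(ltW rho0)// rhoE expr1n /r2; lra.
- by rewrite mulr_ge0 ?exprn_ge0// (le_trans ler01).
- move=> j; rewrite t0 /= -(@ltr_pXn2r _ 2) ?nnegrE ?(ltW rho0)// rhoE.
  by have := t12 j; rewrite /r2; set x := _ ^+ 2; lra.
move=> N k kN.
pose s := [seq j <- iota 0 N | t k <= t j].
have us : uniq s by rewrite filter_uniq ?iota_uniq.
have ks : k \in s by rewrite mem_filter lexx mem_iota.
have -> : \prod_(j < N | t k <= t j) (1 - (t j / rho) ^+ 2)^-1 = \prod_(j <- s) (1 - y j)^-1.
  rewrite /s big_filter -(big_mkord (fun j => t k <= t j) (fun j => (1 - y j)^-1)).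
  by rewrite /index_iota subn0.
have t1 j : t j <= 1.
  rewrite -(@ler_pXn2r _ 2) ?nnegrE// expr1n; have := t12 j.
  by have := sqr_ge0 (t j); set x := _ ^+ 2; lra.
have P0 : 0 <= \prod_(j <- s) (1 - y j)^-1.
  by apply: prodr_ge0 => j _; have /andP[h _] := inv3 j; apply: (le_trans _ h).
have [sn|sn] := ltnP (size s) n0.
  apply: (@le_trans _ _ (1 * 3 ^+ (m + n0))); last first.
    by rewrite mul1r ler_peMr// exprn_ge0.
  apply: ler_pM => //.
  apply: (@le_trans _ _ (\prod_(j <- s) 3)).
    by apply: ler_prod => j _; have /andP[h ->] := inv3 j; rewrite andbT (le_trans _ h).
  rewrite prodr_const_seq ler_eXn2l ?ltr1n//.
  by apply: leq_trans (ltnW sn) (leq_addl _ _).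
set n := size s in sn; have n1 : (0 < n)%N by rewrite /n; case: (s) ks.
have hs := hc us sn; rewrite -/n in hs.
set L := ln n%:R in hs; have L0 : 0 <= L by rewrite ln_ge0 ?ler1n.
have tk : t k ^+ 2 <= L / n%:R.
  rewrite ler_pdivlMr ?ltr0n// mulr_natr.
  apply: (@le_trans _ _ (\sum_(j <- s) t j ^+ 2)).
    rewrite /n -sumr_const_seq big_seq [leRHS]big_seq; apply: ler_sum => j.
    by rewrite mem_filter => /andP[h _]; rewrite ler_sqr ?nnegrE.
  apply: le_trans hs _; rewrite ler_piMl//; lra.
have PB : \prod_(j <- s) (1 - y j)^-1 <= 3 ^+ m * expR (g / 2 * L).
  rewrite (bigID (fun j => d * r2 < t j ^+ 2))/=; apply: ler_pM.
  - by apply: prodr_ge0 => j _; have /andP[h _] := inv3 j; apply: (le_trans _ h).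
  - by apply: prodr_ge0 => j _; have /andP[h _] := inv3 j; apply: (le_trans _ h).
  - rewrite -big_filter; set s1 := [seq j <- s | _].
    apply: (@le_trans _ _ (\prod_(j <- s1) 3)).
      by apply: ler_prod => j _; have /andP[h ->] := inv3 j; rewrite andbT (le_trans _ h).
    rewrite prodr_const_seq ler_eXn2l ?ltr1n//.
    by apply: hm; [rewrite filter_uniq|move=> j; rewrite mem_filter => /andP[]].
  apply: (@le_trans _ _ (\prod_(j <- s | ~~ (d * r2 < t j ^+ 2)) expR (y j / (1 - d)))).
    apply: ler_prod => j hj; have /andP[h _] := inv3 j; rewrite (le_trans _ h)//=.
    apply: inv_1B_le_expR; last by lra.
    by rewrite y0 yE ler_pdivrMr// leNgt.
  rewrite -expR_sum ler_expR.
  apply: (@le_trans _ _ (\sum_(j <- s) y j / (1 - d))).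
    rewrite [leRHS](bigID (fun j => d * r2 < t j ^+ 2))/= lerDr.
    by apply: sumr_ge0 => j _; rewrite divr_ge0// ltW.
  have -> : \sum_(j <- s) y j / (1 - d) = (\sum_(j <- s) t j ^+ 2) / r2 ^+ 2.
    rewrite mulr_suml; apply: eq_bigr => j _; rewrite yE -/r2 expr2 invfM mulrA //.
  rewrite ler_pdivrMr ?exprn_gt0//; apply: le_trans hs _.
  rewrite le_eqVlt; apply/orP; left; apply/eqP; rewrite /g; field.
  by rewrite gt_eqF.
have e0 := expR_ge0 (g / 2 * L).
(* After squaring, what is needed is L exp(- (1 - g) L) <= 1 / (1 - g), a case of e^x >= 1 + x. *)
have : (t k * expR (g / 2 * L)) ^+ 2 <= (1 + (1 - g)^-1) ^+ 2.
  rewrite exprMn [expR _ ^+ 2]expr2 -expRD.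
  apply: (@le_trans _ _ (L / n%:R * expR (g / 2 * L + g / 2 * L))).
    by rewrite ler_wpM2r ?expR_ge0.
  have -> : n%:R^-1 = expR (- L) by rewrite expRN lnK// posrE ltr0n.
  rewrite -mulrA -expRD (_ : - L + _ = - ((1 - g) * L)); last by field.
  rewrite expRN; apply: (@le_trans _ _ (1 - g)^-1); last first.
    apply: (@le_trans _ _ ((1 + (1 - g)^-1))); first by rewrite lerDr.
    by rewrite ler_eXnr.
  rewrite ler_pdivrMr ?expR_gt0// mulrC ler_pdivlMr//.
  by apply: (le_trans _ (expR_ge1Dx _)); rewrite mulrC lerDr.
rewrite ler_sqr ?nnegrE; last 2 first.
- by rewrite mulr_ge0.
- exact: (le_trans ler01 B1).
move=> h.
apply: le_trans (ler_wpM2l (t0 k) PB) _; rewrite mulrCA /B.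
apply: ler_pM => //; rewrite ?mulr_ge0 ?exprn_ge0//.
by rewrite ler_eXn2l ?ltr1n// leq_addr.
Qed.

End log_sums.

(** * Unordered sums and the inequality for polynomials *)

Section sums_over_sets.
Variables (R : realType) (I : choiceType) (A : set I) (u : I -> R).

Lemma esum_bounded (L : R) :
  (forall s : seq I, uniq s -> (forall i, i \in s -> A i) -> \sum_(i <- s) u i <= L) ->
  (\esum_(i in A) (u i)%:E <= L%:E)%E.
Proof.
move=> H; apply: ge_ereal_sup => _ [X [/finite_fsetP[Y ->] XA] <-].
rewrite -(fsbig_seq _ _ (fset_uniq Y)) sumEFin lee_fin; apply: H; first exact: fset_uniq.
by move=> i iY; apply: XA.
Qed.

Lemma esum_lty_bounded : (forall i, 0 <= u i) -> (\esum_(i in A) (u i)%:E < +oo)%E ->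
  exists L : R, forall s : seq I, uniq s -> (forall i, i \in s -> A i) -> \sum_(i <- s) u i <= L.
Proof.
move=> u0 H; have f : (\esum_(i in A) (u i)%:E)%E \is a fin_num.
  by rewrite ge0_fin_numE// esum_ge0// => i _; rewrite lee_fin.
exists (fine (\esum_(i in A) (u i)%:E)%E) => s us sA.
rewrite -lee_fin fineK// -sumEFin fsbig_seq//; apply: ereal_sup_ubound.
by exists [set` s] => //; split => //; exact: finite_seq.
Qed.

End sums_over_sets.

Section unit_ball_coordinates.
Variable R : realType.

Lemma unit_ballE (z : ell_infty R) : unit_ball R z <-> sup_norm z < 1.
Proof.
rewrite /unit_ball /= (_ : `|z| = (sup_norm z)%:C)//.
by rewrite (_ : 1 = 1%:C)// ltcR.
Qed.

Lemma unit_ball_lt1 (z : ell_infty R) j : unit_ball R z -> normc (z j) < 1.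
Proof. by move=> /unit_ballE; apply: le_lt_trans; exact: le_sup_norm. Qed.

Lemma unit_ball_intro (z : ell_infty R) (r : R) : r < 1 -> (forall j, normc (z j) <= r) ->
  unit_ball R z.
Proof. by move=> r1 zr; apply/unit_ballE; apply: le_lt_trans r1; exact: sup_norm_le. Qed.

End unit_ball_coordinates.

Section ae_integrals.
Context d (T : measurableType d) (R : realType) (mu : probability T R).

Lemma ae_cintegral (f g : T -> R[i]) : cmeasurable f -> cmeasurable g ->
  {ae mu, forall x, f x = g x} -> cintegral mu f = cintegral mu g.
Proof.
move=> [f1 f2] [g1 g2] fg; rewrite /cintegral /Rintegral.
congr (fine _ +i* fine _); apply: ae_eq_integral => //; try exact/measurable_EFinP.
  by move: fg; apply: filterS => x -> _.
by move: fg; apply: filterS => x -> _.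
Qed.

End ae_integrals.

(* The condition characterizing all the sets of monomial convergence for p = oo. *)
Definition poly_majorized (R : realType) (z : nat -> R[i]) := exists2 C : R, 0 <= C &
  forall (s : seq multi_index) (c : multi_index -> R[i]) (M : R),
    uniq s -> (forall a, a \in s -> nonneg_index a) ->
    (forall w, (forall j, normc (w j) = 1) -> normc (peval s c w) <= M) ->
    \sum_(a <- s) normc (c a * monomial z a) <= C * M.

Section majorized.
Variable R : realType.
Local Notation m := (torus_measure R).

Definition to_torus (w : nat -> R[i]) : torus R :=
  fun j => insubd (exist _ 1 (introT eqP (normr1 R[i])) : circle R) (w j).

Lemma to_torusK w : (forall j, normc (w j) = 1) -> tval (to_torus w) = w.
Proof.
by move=> w1; apply/funext => j; rewrite /tval /to_torus insubdK// unfold_in normE w1.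
Qed.

Lemma abs_expr_nonneg (x : int) : 0 <= x -> `|x|%N%:Z = x. Proof. by case: x. Qed.

Lemma sep_nonneg N (s : seq multi_index) :
  (forall a, a \in s -> nonneg_index a) -> (forall a, a \in s -> supp_lt a N) ->
  sep_exponents (fun (a : multi_index) j => `|a j|%N) N s.
Proof.
move=> s0 sN a b as_ bs h; apply/fsfunP => j.
have [jN|jN] := ltnP j N; last by rewrite (sN a) ?(sN b).
by rewrite -(abs_expr_nonneg (s0 a as_ j)) h// abs_expr_nonneg//; exact: s0.
Qed.

Lemma peval_pol N (s : seq multi_index) (c : multi_index -> R[i]) z :
  (forall a, a \in s -> nonneg_index a) -> (forall a, a \in s -> supp_lt a N) ->
  peval s c z = pol (fun (a : multi_index) j => `|a j|%N) N s c z.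
Proof.
move=> s0 sN; apply: eq_big_seq => a as_; congr (_ * _).
exact: monomial_nat (s0 a as_) (sN a as_).
Qed.

Lemma peval_epoly N (s : seq multi_index) (c : multi_index -> R[i]) w :
  (forall a, a \in s -> nonneg_index a) -> (forall a, a \in s -> supp_lt a N) ->
  peval s c (tval w) = epoly (fun (a : multi_index) j => `|a j|%N) N s c w.
Proof. by move=> s0 sN; rewrite (peval_pol _ _ s0 sN). Qed.

Lemma peval_max_principle (s : seq multi_index) (c : multi_index -> R[i]) M :
  (forall a, a \in s -> nonneg_index a) ->
  (forall w, (forall j, normc (w j) = 1) -> normc (peval s c w) <= M) ->
  forall w, (forall j, normc (w j) <= 1) -> normc (peval s c w) <= M.
Proof.
move=> s0 H; have [N sN] := common_supp_lt s.
move=> w w1; rewrite (peval_pol _ _ s0 sN); apply: max_principle => // z z1.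
by rewrite -(peval_pol _ _ s0 sN); exact: H.
Qed.

Lemma weight_majorized (z : nat -> R[i]) rho B : 0 < rho < 1 -> 0 <= B ->
  (forall j, normc (z j) < rho) ->
  (forall N k, (k < N)%N -> normc (z k) *
     \prod_(j < N | normc (z k) <= normc (z j)) (1 - (normc (z j) / rho) ^+ 2)^-1 <= B) ->
  poly_majorized z.
Proof.
move=> /[dup] rho01 /andP[r0 r1] B0 zr hB.
exists (1 + B / (1 - rho)); first by rewrite addr_ge0// divr_ge0// subr_ge0 ltW.
move=> s c M us s0 H; have [N sN] := common_supp_lt s; rewrite mulrC.
have K := @min_coord_bound R _ (fun (a : multi_index) j => `|a j|%N) N s c
  (fun j => normc (z j)) rho M B us (sep_nonneg s0 sN) rho01 B0.
apply: le_trans (K _ _ (hB N)).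
- rewrite big_seq [leRHS]big_seq; apply: ler_sum => a as_.
  by rewrite normcM (normc_monomial _ (s0 a as_) (sN a as_)).
- by move=> w w1; rewrite -(peval_pol _ _ s0 sN); exact: H.
- by move=> j; rewrite normc_ge0 zr.
Qed.


Lemma limn_esup_lt1 (u : nat -> R) : (limn_esup (fun n => (u n)%:E) < 1)%E ->
  exists2 c, 0 <= c < 1 & exists n0, forall n, (n0 <= n)%N -> u n <= c.
Proof.
rewrite limn_esup_lim (cvg_lim _ (@cvg_esups_inf _ _))// => /ereal_inf_lt[_ [n0 _ <-]] h.
set v := esups _ _ in h.
have [c c01 vc] : exists2 c : R, 0 <= c < 1 & (v <= c%:E)%E.
  case: v h => [x| |] //; last by exists 0; rewrite ?lexx ?ltr01// leNye.
  rewrite lte_fin => x1; exists (Num.max 0 x); last by rewrite lee_fin le_max lexx orbT.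
  by rewrite le_max lexx /= gt_max ltr01.
exists c => //; exists n0 => n nn0; rewrite -lee_fin; apply: le_trans vc.
by apply: ereal_sup_ubound; exists n.
Qed.

Lemma B_set_majorized (w : ell_infty R) : B_set R w ->
  unit_ball R ((Num.sqrt 2)^-1%:C *: w) /\ poly_majorized ((Num.sqrt 2)^-1%:C *: w).
Proof.
move=> [w1 hw]; set z := _ *: w.
have zE j : normc (z j) = (Num.sqrt 2)^-1 * normc (w j).
  by rewrite [z j](_ : _ = (Num.sqrt 2)^-1%:C * w j)// normcM normc_real ger0_norm// invr_ge0 sqrtr_ge0.
have s2 : 1 <= Num.sqrt 2 :> R by rewrite -[leLHS]sqrtr1 ler_wsqrtr// (ler_nat R 1 2).
have z2 j : 2 * normc (z j) ^+ 2 = normc (w j) ^+ 2.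
  by rewrite zE exprMn exprVn sqr_sqrtr// mulrA divff ?mul1r.
split.
  apply: (@unit_ball_intro _ _ (sup_norm w)); first exact/unit_ballE.
  move=> j; rewrite zE; apply: le_trans (le_sup_norm w j).
  by rewrite ler_piMl ?normc_ge0// invf_le1// (lt_le_trans _ s2).
have [c c01 [n0 hc]] := limn_esup_lt1 hw.
(* At least two indices make the logarithm positive, so that the mean can be multiplied out. *)
have [||||rho [B [rho01 B0 trho hB]]] := @min_coord_weight R (fun j => normc (z j)) c (maxn n0 2).
- by move=> j; exact: normc_ge0.
- by [].
- move=> s us; rewrite geq_max => /andP[sn s2'].
  have L0 : 0 < ln (size s)%:R :> R by rewrite ln_gt0// ltr1n.
  have := hc _ sn; rewrite /log_mean ler_pdivrMl// => h.
  rewrite (_ : c / 2 * _ = ln (size s)%:R * c / 2); last by ring.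
  rewrite ler_pdivlMr// mulrC mulr_sumr.
  apply: le_trans h; rewrite (eq_bigr _ (fun j _ => z2 j)).
  exact: sum_sqr_le_rearr.
- move=> j; rewrite z2 expr_le1 ?normc_ge0//; exact/ltW/unit_ball_lt1.
apply: (@weight_majorized z rho B) => //.
by move=> j; case/andP: (trho j).
Qed.

(** Fejer means need a bound at every point, whereas the norm bounds [f] only almost everywhere. So
    [f] is replaced by [g], set to zero where |f| exceeds its norm, with the same Fourier
    coefficients. *)
Lemma majorized_mon_Hoo (z : ell_infty R) : unit_ball R z -> poly_majorized z ->
  mon_Hp_torus R +oo%E z.
Proof.
move=> z1 [C C0 H]; split => // f [[mf1 mf2 fL] f0].
have m0 : (0 < m [set: torus R])%E by rewrite [m _]probability_setT lte_fin.
move: fL; rewrite unlock /Lnorm m0 => fL.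
set K := ess_sup _ _ in fL.
have hK : {ae m, forall w, (normc (f w) <= fine K)%R}.
  have K0 : (0 <= K)%E by apply/ess_sup_gee => //; apply: nearW => w /=.
  have Kf : K \is a fin_num by rewrite ge0_fin_numE.
  have := ess_sup_ge m (abse \o (fun w => (normc (f w))%:E)); apply: filterS => w /=.
  by rewrite -/K ger0_norm ?normc_ge0// -{1}(fineK Kf) lee_fin.
have K0 : 0 <= fine K.
  by apply/fine_ge0/ess_sup_gee => //; apply: nearW => w /=.
pose B := [set w | normc (f w) <= fine K].
have cf : cmeasurable f by split.
have mB : measurable B.
  rewrite -[B]setTI; apply: measurable_fun_le => //; exact: measurable_normc.
pose g w := f w * (\1_B w)%:C.
have cg : cmeasurable g.
  apply: cmeasurableM => //; apply: cmeasurable_real; exact: measurable_indic.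
have fg : {ae m, forall w, f w = g w}.
  move: hK; apply: filterS => w hw; rewrite /g indicE mem_set// mulr1//.
have gK w : normc (g w) <= fine K.
  rewrite /g indicE; case: (boolP (w \in B)) => [/set_mem hw|_]; first by rewrite mulr1.
  by rewrite mulr0 normc0.
have ig : cintegrable m g by exact: (cintegrable_bounded m cg gK).
have coef a : fourier_coef f a = fourier_coef g a.
  rewrite /fourier_coef; apply: (@ae_cintegral _ _ _ m).
  - by apply: cmeasurableM => //; exact: cmeasurable_monomialV.
  - by apply: cmeasurableM => //; exact: cmeasurable_monomialV.
  - by move: fg; apply: filterS => w ->.
apply: (@le_lt_trans _ _ (C * fine K)%:E); last exact: ltry.
apply: esum_bounded => s us s0.
under eq_bigr do rewrite coef.
apply: (fejer_transfer ig) => // [a a0|s' c us' s0' hM _].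
  by rewrite -coef f0.
apply: H => // w w1; rewrite -(to_torusK w1); exact: hM.
Qed.

End majorized.

(** * Convergent series of integrable functions *)

Section complex_sequences.
Variable R : realType.
Local Notation Re := complex.Re.
Local Notation Im := complex.Im.
Implicit Types (u : nat -> R[i]) (l : R[i]).

Definition ccvg u l := (u : nat -> R[i]^o) @ \oo --> (l : R[i]^o).

Lemma ccvg_normcP u l : ccvg u l <-> (fun n => normc (u n - l)) @ \oo --> 0.
Proof.
split.
  move=> /cvgc_normP h; apply/cvgrPdist_lt => e /h; apply: filterS => n.
  by rewrite sub0r normrN ger0_norm ?normc_ge0// normc_distC.
move=> /cvgrPdist_lt h; apply/cvgc_normP => e /h; apply: filterS => n.
by rewrite sub0r normrN ger0_norm ?normc_ge0// normc_distC.
Qed.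

Lemma ccvgP u l : ccvg u l <->
  (fun n => Re (u n)) @ \oo --> Re l /\ (fun n => Im (u n)) @ \oo --> Im l.
Proof.
split => [h|[h1 h2]].
  split; first exact: (cvg_comp _ _ h (@continuous_Re R l)).
  exact: (cvg_comp _ _ h (@continuous_Im R l)).
apply/ccvg_normcP.
have h : (fun n => `|Re (u n) - Re l| + `|Im (u n) - Im l|) @ \oo --> 0.
  rewrite -[0]addr0; apply: cvgD; rewrite -(normr0 R); apply: cvg_norm.
    by apply/subr_cvg0.
  by apply/subr_cvg0.
apply: (squeeze_cvgr _ (cvg_cst 0) h); apply: nearW => n; rewrite normc_ge0/=.
by apply: le_trans (normc_le_ReIm _) _; rewrite cReD cImD cReN cImN.
Qed.

Lemma ccvg_normc u l : ccvg u l -> (fun n => normc (u n)) @ \oo --> normc l.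
Proof.
move=> /cvgc_normP h; apply/cvgrPdist_lt => e /h; apply: filterS => n.
by apply: le_lt_trans; exact: ler_normc_dist.
Qed.

Lemma ccvg_le u l M : ccvg u l -> (forall n, normc (u n) <= M) -> normc l <= M.
Proof.
move=> /ccvg_normc h uM; rewrite -(cvg_lim _ h)//; apply: limr_le; first by apply: cvgP h.
exact: nearW.
Qed.

Lemma ccvgMr u l c : ccvg u l -> ccvg (fun n => u n * c) (l * c).
Proof.
move=> /ccvg_normcP h; apply/ccvg_normcP.
rewrite (_ : (fun n => _) = (fun n => normc (u n - l) * normc c)); last first.
  by apply/funext => n; rewrite -mulrBl normcM.
by rewrite -[0](mul0r (normc c)); apply: cvgMl.
Qed.

Lemma ccvg_unique u l l' : ccvg u l -> ccvg u l' -> l = l'.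
Proof.
by move=> /ccvgP[h1 h2] /ccvgP[h1' h2']; apply: complexP;
  [exact: (cvg_unique _ h1 h1')|exact: (cvg_unique _ h2 h2')].
Qed.

End complex_sequences.

Section convergence_theorems.
Context d (T : measurableType d) (R : realType) (mu : probability T R).
Local Notation Re := complex.Re.
Local Notation Im := complex.Im.

Lemma cdominated_convergence (F : nat -> T -> R[i]) (f : T -> R[i]) (g : T -> \bar R) :
  (forall n, cmeasurable (F n)) -> cmeasurable f ->
  {ae mu, forall x, ccvg (F ^~ x) (f x)} -> mu.-integrable setT g ->
  (forall n x, ((normc (F n x))%:E <= g x)%E) ->
  cintegrable mu f /\ ccvg (fun n => cintegral mu (F n)) (cintegral mu f).
Proof.
move=> mF [f1 f2] Ff ig Fg.
have H (pr : R[i] -> R) : (forall z, `|pr z| <= normc z) ->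
    (forall n, measurable_fun setT (fun x => pr (F n x))) ->
    measurable_fun setT (fun x => pr (f x)) ->
    {ae mu, forall x, (fun n => pr (F n x)) @ \oo --> pr (f x)} ->
    mu.-integrable setT (fun x => (pr (f x))%:E) /\
    (fun n => \int[mu]_x pr (F n x)) @ \oo --> \int[mu]_x pr (f x).
  move=> prle m1 m2 c.
  have [|||||i _ h] := @dominated_convergence _ _ _ mu setT measurableT
    (fun n x => (pr (F n x))%:E) (fun x => (pr (f x))%:E) g.
  - by move=> n; exact/measurable_EFinP.
  - exact/measurable_EFinP.
  - by move: c; apply: filterS => x h _; apply/cvg_EFin; [apply: nearW|].
  - by [].
  - by apply: nearW => x n _; apply: (le_trans _ (Fg n x)); rewrite /= lee_fin prle.
  split => //.
  have iF n : mu.-integrable setT (fun x => (pr (F n x))%:E).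
    apply: (le_integrable measurableT _ _ ig); first exact/measurable_EFinP.
    move=> x _; apply: le_trans (lee_abs _); apply: (le_trans _ (Fg n x)).
    by rewrite /= lee_fin prle.
  apply: fine_cvg; rewrite fineK; last exact: integrable_fin_num.
  exact: h.
have [i1 h1] := H _ (@Re_le_normc R) (fun n => (mF n).1) f1
  (filterS (fun x h => ((ccvgP _ _).1 h).1) Ff).
have [i2 h2] := H _ (@Im_le_normc R) (fun n => (mF n).2) f2
  (filterS (fun x h => ((ccvgP _ _).1 h).2) Ff).
by split; [split|apply/ccvgP; split].
Qed.

Lemma half_sums n : \sum_(i < n) 2^-1 ^+ i <= 2 :> R.
Proof.
suff -> : \sum_(i < n) 2^-1 ^+ i = 2 - 2 * 2^-1 ^+ n :> R.
  by rewrite gerBl mulr_ge0 ?exprn_ge0 ?invr_ge0.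
elim: n => [|n IH]; first by rewrite big_ord0 expr0 mulr1 subrr.
by rewrite big_ord_recr /= IH exprS; field.
Qed.

Lemma series_L1 (Q : nat -> T -> R[i]) : (forall i, cintegrable mu (Q i)) ->
  (forall i, \int[mu]_x normc (Q i x) <= 2^-1 ^+ i) ->
  exists f : T -> R[i], [/\ cintegrable mu f,
    {ae mu, forall x, ccvg (fun n => \sum_(i < n) Q i x) (f x)} &
    forall h, cmeasurable h -> (forall x, normc (h x) <= 1) ->
      ccvg (fun n => cintegral mu (fun x => (\sum_(i < n) Q i x) * h x))
        (cintegral mu (fun x => f x * h x))].
Proof.
move=> iQ Q2; have mQ i := cintegrable_meas (iQ i).
pose g x := (\sum_(i <oo) (normc (Q i x))%:E)%E.
have g0 x : (0 <= g x)%E by apply: nneseries_ge0 => i _ _; rewrite lee_fin normc_ge0.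
have mg : measurable_fun setT g.
  apply: (ge0_emeasurable_sum (P := xpredT)).
    by move=> k x _ _; rewrite lee_fin normc_ge0.
  by move=> k _; apply/measurable_EFinP/measurable_normc.
have gub : (\int[mu]_x g x <= 2%:E)%E.
  rewrite /g integral_nneseries//; last 2 first.
  - by move=> n; apply/measurable_EFinP/measurable_normc.
  - by move=> n x _; rewrite lee_fin normc_ge0.
  apply: lime_le; first by apply: is_cvg_nneseries => n _ _; apply: integral_ge0 => x _; rewrite lee_fin normc_ge0.
  apply: nearW => n; rewrite big_mkord.
  apply: (@le_trans _ _ (\sum_(i < n) (2^-1 ^+ i)%:E)%E); last by rewrite sumEFin lee_fin half_sums.
  apply: lee_sum => i _; have := Q2 i.
  rewrite -lee_fin /Rintegral fineK//; exact/integrable_fin_num/cintegrable_normc.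
have ig : mu.-integrable setT g.
  apply/integrableP; split => //; under eq_integral do rewrite gee0_abs//.
  by apply: le_lt_trans gub _; exact: ltry.
have gfin : {ae mu, forall x, g x \is a fin_num}.
  by have := integrable_ae measurableT ig; apply: filterS => x /(_ I).
pose D := [set x | g x \is a fin_num].
have mD : measurable D.
  by rewrite -[D]setTI; apply: emeasurable_fin_num.
pose S n x := (\sum_(i < n) Q i x).
have Sg n x : ((normc (S n x))%:E <= g x)%E.
  apply: le_trans (nneseries_lim_ge n _); last by move=> k _ _; rewrite lee_fin normc_ge0.
  by rewrite big_mkord sumEFin lee_fin normc_sum.
have mS n : cmeasurable (S n) by exact: cmeasurable_sum.
have cvS (pr : R[i] -> R) : (forall z, `|pr z| <= normc z) -> (forall n x, pr (S n x) = \sum_(i < n) pr (Q i x)) ->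
    forall x, D x -> cvgn (fun n => pr (S n x)).
  move=> prle prS x Dx; rewrite (_ : (fun n => _) = series (fun i => pr (Q i x))); last first.
    by apply/funext => n; rewrite prS /series /= big_mkord.
  apply: normed_cvg; apply: nondecreasing_is_cvgn.
    by apply: nondecreasing_series => i _ _; rewrite normr_ge0.
  exists (fine (g x)) => _ [n _ <-]; rewrite -lee_fin fineK//.
  apply: le_trans (nneseries_lim_ge n _); last by move=> k _ _; rewrite lee_fin normc_ge0.
  by rewrite /series /= -sumEFin; apply: lee_sum => i _; rewrite lee_fin prle.
have ReS := cvS _ (@Re_le_normc R) (fun n x => cRe_sum _ _ _).
have ImS := cvS _ (@Im_le_normc R) (fun n x => cIm_sum _ _ _).
(* The indicator of [D] makes the limits exist at every point, as the measurability of a limit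
   requires. *)
pose f x : R[i] := limn (fun n => Re (S n x) * \1_D x) +i* limn (fun n => Im (S n x) * \1_D x).
have fS x : D x -> ccvg (S ^~ x) (f x).
  move=> Dx; have e (pr : R[i] -> R) : (fun n => pr (S n x) * \1_D x) = (fun n => pr (S n x)).
    by apply/funext => n; rewrite indicE mem_set// mulr1.
  by apply/ccvgP; rewrite /f /= !e; split; [exact: ReS|exact: ImS].
have mlim (pr : R[i] -> R) : (forall n, measurable_fun setT (fun x => pr (S n x))) ->
    (forall x, D x -> cvgn (fun n => pr (S n x))) ->
    measurable_fun setT (fun x => limn (fun n => pr (S n x) * \1_D x)).
  move=> mpr cpr; apply: (measurable_fun_cvg (h := fun n x => pr (S n x) * \1_D x)).
    by move=> n; apply: measurable_funM => //; exact: measurable_indic.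
  move=> x _; have [Dx|Dx] := boolP (x \in D).
    rewrite (_ : (fun n => _) = (fun n => pr (S n x))); first exact/cpr/set_mem.
    by apply/funext => n; rewrite indicE Dx mulr1.
  rewrite (_ : (fun n => _) = fun=> 0); first exact: is_cvg_cst.
  by apply/funext => n; rewrite indicE (negbTE Dx) mulr0.
have mf : cmeasurable f.
  split; first exact: (mlim _ (fun n => (mS n).1) ReS).
  exact: (mlim _ (fun n => (mS n).2) ImS).
have aeS : {ae mu, forall x, ccvg (S ^~ x) (f x)}.
  by move: gfin; apply: filterS => x; exact: fS.
exists f; split => //.
  by have [] := cdominated_convergence mS mf aeS ig Sg.
move=> h mh h1.
have mSh n : cmeasurable (fun x => S n x * h x) by exact: cmeasurableM.
have mfh : cmeasurable (fun x => f x * h x) by exact: cmeasurableM.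
have aeSh : {ae mu, forall x, ccvg (fun n => S n x * h x) (f x * h x)}.
  by move: aeS; apply: filterS => x; exact: ccvgMr.
have Shg n x : ((normc (S n x * h x))%:E <= g x)%E.
  apply: le_trans (Sg n x); rewrite lee_fin normcM.
  by apply: ler_piMr; [exact: normc_ge0|exact: h1].
exact: (cdominated_convergence mSh mfh aeSh ig Shg).2.
Qed.

End convergence_theorems.

(** * Gliding humps *)

Section humps.
Variable R : realType.
Implicit Types (a b : multi_index) (z : nat -> R[i]).

Lemma monomial_add z a b : nonneg_index a -> nonneg_index b ->
  monomial z (idx_add a b) = monomial z a * monomial z b.
Proof.
move=> a0 b0; pose N := maxn (idx_bound a) (idx_bound b).
have aN : supp_lt a N by apply: (supp_ltW _ (@idx_boundP a)); exact: leq_maxl.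
have bN : supp_lt b N by apply: (supp_ltW _ (@idx_boundP b)); exact: leq_maxr.
have abN : supp_lt (idx_add a b) N by move=> j Nj; rewrite idx_addE aN// bN.
have ab0 : nonneg_index (idx_add a b) by move=> j; rewrite idx_addE addr_ge0.
rewrite (monomial_nat _ ab0 abN) (monomial_nat _ a0 aN) (monomial_nat _ b0 bN) -big_split /=.
apply: eq_bigr => j _; rewrite idx_addE -exprD; congr (_ ^+ _).
by have := a0 j; have := b0 j; case: (a j) => // p; case: (b j) => // q.
Qed.

Definition idx_one (j m : nat) : multi_index := mkidx j.+1 (fun i => if i == j then m%:Z else 0).

Lemma idx_oneE j m i : idx_one j m i = if i == j then m%:Z else 0.
Proof. by rewrite mkidxE; case: ifPn => //; case: eqP => // ->; rewrite ltnSn. Qed.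

Lemma nonneg_idx_one j m : nonneg_index (idx_one j m).
Proof. by move=> i; rewrite idx_oneE; case: ifP. Qed.

Lemma monomial_idx_one z j m : monomial z (idx_one j m) = z j ^+ m.
Proof.
rewrite (monomial_nat _ (nonneg_idx_one j m) (@supp_lt_mkidx _ _)) big_ord_recr /= big1.
  by rewrite mul1r idx_oneE eqxx.
by move=> i _; rewrite idx_oneE ltn_eqF// expr0.
Qed.

Lemma majorizedPn z (C : R) : ~ poly_majorized z -> 0 <= C ->
  exists (s : seq multi_index) (c : multi_index -> R[i]) (M : R), [/\ uniq s, forall a, a \in s -> nonneg_index a,
    forall w, (forall j, normc (w j) = 1) -> normc (peval s c w) <= M &
    C * M < \sum_(a <- s) normc (c a * monomial z a)].
Proof.
move=> nz C0; apply: contrapT => h; apply: nz; exists C => // s' c' M us s0 H.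
by rewrite leNgt; apply/negP => h'; apply: h; exists s', c', M.
Qed.

(** Provides the nonzero coordinate whose powers separate the spectra in [humps]. *)
Lemma zero_majorized z : (forall j, z j = 0) -> poly_majorized z.
Proof.
move=> z0; have h0 j : normc (z j) = 0 by rewrite z0 normc0.
apply: (@weight_majorized _ _ 2^-1 0) => //.
- by apply/andP; split; lra.
- by move=> j; rewrite h0.
- by move=> N k _; rewrite h0 mul0r.
Qed.

(** Multiplication by the m-th power of coordinate [j0] leaves moduli on the torus unchanged and
    costs a factor |z_j0|^m at [z]. The failure of the inequality is used with a constant that pays
    for this loss and for 2^i. *)
Lemma shifted_hump z j0 i m : z j0 != 0 -> ~ poly_majorized z ->
  exists p : seq multi_index * (multi_index -> R[i]),
   [/\ uniq p.1, forall a, a \in p.1 -> nonneg_index a /\ m%:Z <= a j0,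
     forall w, (forall j, normc (w j) = 1) -> normc (peval p.1 p.2 w) <= 2^-1 ^+ i &
     1 <= \sum_(a <- p.1) normc (p.2 a * monomial z a)].
Proof.
move=> z0 nz; have zm0 : 0 < normc (z j0) ^+ m by rewrite exprn_gt0// normc_gt0.
have C0 : 0 < 2 ^+ i / normc (z j0) ^+ m by apply: divr_gt0 => //; rewrite exprn_gt0.
have [s [c [M [us s0 H CS]]]] := majorizedPn nz (ltW C0).
set S := \sum_(a <- s) _ in CS.
have M0 : 0 <= M by apply: le_trans (normc_ge0 _) (H (fun=> 1) (fun=> normc1 R)).
have S0 : 0 < S by apply: le_lt_trans CS; rewrite mulr_ge0// ltW.
pose t := (S * normc (z j0) ^+ m)^-1.
have t0 : 0 < t by rewrite invr_gt0 mulr_gt0.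
pose b := idx_one j0 m.
exists ([seq idx_add a b | a <- s], fun a => t%:C * c (idx_sub a b)) => /=; split.
- by rewrite map_inj_uniq//; exact: idx_addI.
- move=> _ /mapP[a as_ ->]; split.
    by by move=> j; rewrite idx_addE addr_ge0 ?(s0 a as_)// nonneg_idx_one.
  by rewrite idx_addE idx_oneE eqxx lerDr; exact: s0.
- move=> w w1; rewrite /peval big_map (eq_big_seq (fun a => t%:C * monomial w b * (c a * monomial w a))).
    rewrite -mulr_sumr !normcM normc_real ger0_norm ?(ltW t0)// normc_monomial_torus// mulr1.
    apply: le_trans (ler_wpM2l (ltW t0) (H w w1)) _.
    rewrite /t mulrC ler_pdivrMr ?mulr_gt0// exprVn mulrC.
    rewrite -ler_pdivrMr ?invr_gt0 ?exprn_gt0// invrK.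
    by move: CS => /ltW; rewrite mulrAC ler_pdivrMr// mulrC.
  by move=> a as_; rewrite idx_subDK monomial_add; [ring|exact: s0|exact: nonneg_idx_one].
- rewrite big_map (eq_big_seq (fun a => t * normc (z j0) ^+ m * normc (c a * monomial z a))).
    by rewrite -mulr_sumr -/S /t -mulrA [_ ^+ m * S]mulrC mulVf// mulf_neq0 ?gt_eqF.
  move=> a as_; rewrite idx_subDK monomial_add; [|exact: s0|exact: nonneg_idx_one].
  rewrite monomial_idx_one !normcM normcX normc_real ger0_norm ?(ltW t0)//; ring.
Qed.

Lemma humps z : ~ poly_majorized z -> exists (s : nat -> seq multi_index) (c : nat -> multi_index -> R[i]),
  [/\ forall i, uniq (s i), forall i a, a \in s i -> nonneg_index a,
      forall i k a, a \in s i -> a \in s k -> i = k,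
      forall i w, (forall j, normc (w j) = 1) -> normc (peval (s i) (c i) w) <= 2^-1 ^+ i &
      forall i, 1 <= \sum_(a <- s i) normc (c i a * monomial z a)].
Proof.
move=> nz; have [j0 z0] : exists j0, z j0 != 0.
  apply: contrapT => h; apply: nz; apply: zero_majorized => j.
  by apply/eqP; rewrite -[_ == _]negbK; apply/negP => hj; apply: h; exists j.
pose G i m := projT1 (cid (shifted_hump i m z0 nz)).
have GP i m := projT2 (cid (shifted_hump i m z0 nz)); rewrite -/(G _ _) in GP.
pose deg (s : seq multi_index) := (\max_(a <- s) `|a j0|%N).+1.
(* Hump [k] uses degrees in coordinate [j0] from [m k] on and below [m k.+1]; so no index belongs to
   two humps. *)
pose m := fix m n := if n is k.+1 then maxn (m k) (deg (G k (m k)).1) else 0%N.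
have mm : {homo m : i k / (i <= k)%N} by apply: homo_leq => // [x y u|n]; [exact: leq_trans|rewrite /= leq_maxl].
exists (fun i => (G i (m i)).1), (fun i => (G i (m i)).2); split.
- by move=> i; have [] := GP i (m i).
- by move=> i a ai; have [_ h _ _] := GP i (m i); have [] := h a ai.
- have lt i k a : a \in (G i (m i)).1 -> a \in (G k (m k)).1 -> (k <= i)%N.
    move=> ai ak; rewrite leqNgt; apply/negP => ik.
    have [_ h _ _] := GP k (m k); have [a0 mk] := h a ak.
    have : (m i.+1 <= m k)%N by exact: mm.
    apply/negP; rewrite -ltnNge -ltz_nat; apply: le_lt_trans mk _.
    rewrite -(abs_expr_nonneg (a0 j0)) ltz_nat /= leq_max; apply/orP; right.
    by rewrite /deg ltnS (big_rem _ ai) /= leq_maxl.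
  move=> i k a ai ak; apply/eqP; rewrite eqn_leq; apply/andP; split; [exact: (lt _ _ a)|exact: (lt _ _ a)].
- by move=> i; have [] := GP i (m i).
- by move=> i; have [] := GP i (m i).
Qed.

Variables (s : nat -> seq multi_index) (c : nat -> multi_index -> R[i]).
Hypotheses (us : forall i, uniq (s i)) (s0 : forall i a, a \in s i -> nonneg_index a)
  (sd : forall i k a, a \in s i -> a \in s k -> i = k).

Lemma not_summable z (g : multi_index -> R[i]) :
  (forall i a, a \in s i -> g a = c i a) ->
  (forall i, 1 <= \sum_(a <- s i) normc (c i a * monomial z a)) ->
  ~ (\esum_(a in nonneg_index) (normc (g a * monomial z a))%:E < +oo)%E.
Proof.
move=> gc h /esum_lty_bounded[a|L hL]; first exact: normc_ge0.
pose n := (Num.truncn L).+1; pose r := flatten [seq s i | i <- iota 0 n].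
have ur k : uniq (flatten [seq s i | i <- iota 0 k]).
  elim: k => // k IH; rewrite -addn1 iotaD map_cat flatten_cat cat_uniq IH /= add0n cats0 us andbT.
  apply/hasPn => a ak; apply/negP => /flatten_mapP[i ik ai].
  by move: ik; rewrite (sd ai ak) mem_iota ltnn.
have := hL r (ur n).
have -> : \sum_(a <- r) normc (g a * monomial z a) =
    \sum_(i <- iota 0 n) \sum_(a <- s i) normc (c i a * monomial z a).
  rewrite /r big_flatten big_map; apply: eq_bigr => i _; apply: eq_big_seq => a ai.
  by rewrite (gc i a ai).
move=> H; have : n%:R <= L.
  apply: le_trans (H _); last by move=> a /flatten_mapP[i _ /s0].
  apply: (@le_trans _ _ (\sum_(i <- iota 0 n) 1)).
    by rewrite sumr_const_seq size_iota.
  by apply: ler_sum => i _; exact: h.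
by apply/negP; rewrite -ltNge truncnS_gt.
Qed.

(** By disjointness, a given coefficient of the partial sums is constant from some point on. *)
Lemma series_fourier : (forall i, \int[torus_measure R]_w normc (peval (s i) (c i) (tval w)) <= 2^-1 ^+ i) ->
  exists f : torus R -> R[i], [/\ cintegrable (torus_measure R) f,
    {ae torus_measure R, forall w, ccvg (fun n => \sum_(i < n) peval (s i) (c i) (tval w)) (f w)},
    forall i a, a \in s i -> fourier_coef f a = c i a &
    forall a, (forall i, a \notin s i) -> fourier_coef f a = 0].
Proof.
move=> hI; have [f [fi fae hf]] := series_L1 (fun i => cintegrable_peval (s i) (c i)) hI.
have coefS n a : cintegral (torus_measure R)
    (fun w => (\sum_(i < n) peval (s i) (c i) (tval w)) * (monomial (tval w) a)^-1) =
    \sum_(i < n) if a \in s i then c i a else 0.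
  rewrite -(eq_bigr _ (fun (i : 'I_n) _ => fourier_peval (c i) a (us i))).
  rewrite -cintegral_sum.
    by apply: eq_cintegral => w; rewrite mulr_suml.
  by move=> i; exact: cintegrable_fourier (cintegrable_peval _ _).
have coef a (l : R[i]) n0 : (forall n, (n0 <= n)%N -> \sum_(i < n) (if a \in s i then c i a else 0) = l) ->
    fourier_coef f a = l.
  move=> hl; have h1 w : normc ((monomial (tval w) a)^-1 : R[i]) <= 1 by rewrite normc_tmonomialV.
  have := hf _ (cmeasurable_monomialV R a) h1; rewrite -fourier_coefE => h.
  apply: (ccvg_unique h); apply: cvg_near_cst; exists n0 => // n /= nn0.
  by rewrite coefS; exact: hl.
exists f; split => //.
  move=> i a ai; apply: (coef _ _ i.+1) => n ni; rewrite (bigD1 (Ordinal ni))//= ai big1 ?addr0// => k ki.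
  case: ifP => // ak; have := sd ak ai; move=> e; move: ki; rewrite -(inj_eq val_inj) /= e eqxx.
  by [].
move=> a ha; apply: (coef _ _ 0%N) => n _; rewrite big1// => i _.
by rewrite (negbTE (ha i)).
Qed.

End humps.

Lemma mon_Hoo_majorized (R : realType) (z : ell_infty R) : mon_Hp_torus R +oo%E z -> poly_majorized z.
Proof.
move=> [z1 H]; apply: contrapT => nz.
have [s [c [us s0 sd sup1 sum1]]] := humps nz.
have [|f [fi fae fc fc0]] := series_fourier us sd (c := c).
  move=> i; rewrite -[leRHS](Rintegral_prob_cst (torus_measure R)); apply: le_Rintegral => //.
  - exact/cintegrable_normc/cintegrable_peval.
  - exact: (@finite_measure_integrable_cst _ _ _ (torus_measure R)).
  - by move=> w _; apply: sup1 => j; exact: normc_tval.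
apply: (not_summable us s0 sd fc sum1); apply: H; have [mf1 mf2] := cintegrable_meas fi.
have m0 : (0 < torus_measure R [set: torus R])%E by rewrite [torus_measure R _]probability_setT lte_fin.
split; [split => //|].
  rewrite unlock /Lnorm m0; apply: (@le_lt_trans _ _ 2%:E); last exact: ltry.
  apply/ess_supP; move: fae; apply: filterS => w hw /=; rewrite lee_fin ger0_norm ?normc_ge0//.
  apply: (ccvg_le hw) => n; apply: le_trans (normc_sum _ _ _) _.
  apply: le_trans (half_sums R n); apply: ler_sum => i _.
  by apply: sup1 => j; exact: normc_tval.
move=> a na; apply: fc0 => i; apply/negP => ai; apply: na; exact: s0 ai.
Qed.

(** * Khintchine's inequality and square summability *)

Section khintchine.
Variable R : realType.
Local Notation m := (torus_measure R).
Local Notation C := (R[i]).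

Lemma normc_nat n : normc (n%:R : C) = n%:R.
Proof. by rewrite -(rmorph_nat (real_complex R)) normc_real ger0_norm. Qed.

(** Parseval's identity for the polynomial (x + b X)^k. *)
Lemma circle_mean_binomial (x b : C) k :
  \int[P01 R]_t normc (x + b * expi t) ^+ (2 * k) <=
  \sum_(l < k.+1) ('C(k, l))%:R ^+ 2 * (normc x ^+ 2) ^+ (k - l) * (normc b ^+ 2) ^+ l.
Proof.
pose p : {poly C} := (x%:P + b *: 'X) ^+ k.
have pE t : p.[expi t] = (x + b * expi t) ^+ k.
  by rewrite /p horner_exp !hornerE.
have -> : \int[P01 R]_t normc (x + b * expi t) ^+ (2 * k) = \int[P01 R]_t normc p.[expi t] ^+ 2.
  by apply: eq_Rintegral => t _; rewrite pE normcX exprM exprAC.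
rewrite parseval.
have sp : (size p <= k.+1)%N.
  apply: leq_trans (size_poly_exp_leq _ _) _.
  set q : {poly C} := x%:P + b *: 'X; have : (size q <= 2)%N.
    rewrite (leq_trans (size_polyD _ _))// geq_max (leq_trans (size_polyC_leq1 _))//=.
    by rewrite (leq_trans (size_scale_leq _ _))// size_polyX.
  by case: (size _) => [|[|[|//]]] _; rewrite ?mul0n ?mul1n.
apply: (@le_trans _ _ (\sum_(l < k.+1) normc p`_l ^+ 2)).
  rewrite -!(big_mkord xpredT (fun l => normc p`_l ^+ 2)) (big_cat_nat _ sp)//= lerDl.
  by apply: sumr_ge0 => l _; exact: sqr_ge0.
apply: ler_sum => l _; rewrite le_eqVlt; apply/orP; left; apply/eqP.
have -> : p`_l = 'C(k, l)%:R * x ^+ (k - l) * b ^+ l.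
  rewrite /p exprDn coef_sum (bigD1 l)//= big1 ?addr0.
    rewrite exprZn coefMn -polyC_exp coefCM coefZ coefXn eqxx mulr1 -mulr_natl; ring.
  move=> i il; rewrite exprZn coefMn -polyC_exp coefCM coefZ coefXn.
  by rewrite (_ : (_ == _ :> nat) = false) ?mulr0 ?mul0rn//; apply/negbTE; rewrite eq_sym.
by rewrite !normcM !normcX normc_nat !exprMn -!exprM !(exprM _ _ 2) -!expr2.
Qed.

Definition linform (r : seq (nat * C)) (w : torus R) : C := \sum_(x <- r) x.2 * tval w x.1.

Lemma cmeasurable_linform r : cmeasurable (linform r).
Proof.
apply: cmeasurable_sum => x; apply: cmeasurableM; [exact: cmeasurable_cst|exact: cmeasurable_tval].
Qed.

Lemma normc_linform_le r w : normc (linform r w) <= \sum_(x <- r) normc x.2.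
Proof.
apply: le_trans (normc_sum _ _ _) _; apply: ler_sum => x _.
by rewrite normcM normc_tval mulr1.
Qed.

Lemma normc_linformX_le r n w : `|normc (linform r w) ^+ n| <= (\sum_(x <- r) normc x.2) ^+ n.
Proof.
rewrite ger0_norm ?exprn_ge0 ?normc_ge0// lerXn2r ?nnegrE ?normc_ge0//; last exact: normc_linform_le.
by apply: sumr_ge0 => x _; exact: normc_ge0.
Qed.

Lemma measurable_linformX r n : measurable_fun setT (fun w => normc (linform r w) ^+ n).
Proof. by apply: measurable_funX; apply: measurable_normc; exact: cmeasurable_linform. Qed.

Lemma integrable_linformX r n : m.-integrable setT (fun w => (normc (linform r w) ^+ n)%:E).
Proof.
apply: (@integrable_bounded _ _ _ m _ ((\sum_(x <- r) normc x.2) ^+ n)).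
  exact: measurable_linformX.
exact: normc_linformX_le.
Qed.

Lemma linform_upd r j w u : j \notin [seq x.1 | x <- r] -> linform r (upd w j u) = linform r w.
Proof.
move=> jr; apply: eq_big_seq => x xr; rewrite tval_upd (_ : (_ == _) = false)//.
by apply/negbTE; apply: contra jr => /eqP <-; exact: map_f.
Qed.

(** C(k, l) (k - l)! equals k! / l!, at most k!. This lets the constant k! pass through the
    induction in [khintchine]. *)
Lemma bin_fact_le k l : (l <= k)%N -> ('C(k, l) * 'C(k, l) * (k - l)`! <= k`! * 'C(k, l))%N.
Proof.
move=> lk; rewrite [leqRHS]mulnC -mulnA leq_mul2l; apply/orP; right.
by rewrite -(bin_fact lk) leq_mul2l; apply/orP; right; rewrite leq_pmull ?fact_gt0.
Qed.

(** Averaging over the newest variable leaves terms with squared binomial coefficients and lower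
    even moments. One binomial factor is absorbed by (k - l)! against k!; with the other the terms
    add up to the k-th power of S + |b|^2. *)
Lemma khintchine r k : uniq [seq x.1 | x <- r] ->
  \int[m]_w normc (linform r w) ^+ (2 * k) <= k`!%:R * (\sum_(x <- r) normc x.2 ^+ 2) ^+ k.
Proof.
elim: r k => [|[j b] r IH] k.
  move=> _; rewrite big_nil -[leRHS](Rintegral_prob_cst m) le_eqVlt; apply/orP; left; apply/eqP.
  apply: eq_Rintegral => w _; rewrite /linform big_nil normc0 exprM expr0n /=.
  by case: k => [|k]; rewrite ?expr0 ?mul1r// !expr0n mulr0.
move=> /= /andP[jr ur]; set S := \sum_(x <- r) normc x.2 ^+ 2 in IH *.
have [mf ->] := resample_real j (measurable_linformX ((j, b) :: r) (2 * k)) (normc_linformX_le ((j, b) :: r) (2 * k)).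
set rhs := k`!%:R * _.
pose G w := \sum_(l < k.+1) 'C(k, l)%:R ^+ 2 * (normc b ^+ 2) ^+ l * normc (linform r w) ^+ (2 * (k - l)).
have iG l : m.-integrable setT (fun w => (('C(k, l)%:R ^+ 2 * (normc b ^+ 2) ^+ l * normc (linform r w) ^+ (2 * (k - l)))%:E)).
  exact: (integrableZl measurableT _ (integrable_linformX r (2 * (k - l)))).
have inner w : \int[P01 R]_t normc (linform ((j, b) :: r) (upd w j (angle t))) ^+ (2 * k) <= G w.
  have -> : \int[P01 R]_t normc (linform ((j, b) :: r) (upd w j (angle t))) ^+ (2 * k) =
      \int[P01 R]_t normc (linform r w + b * expi t) ^+ (2 * k).
    apply: eq_Rintegral => t _; congr (normc _ ^+ _).
    by rewrite {1}/linform big_cons /= tval_upd eqxx -/(linform r _) linform_upd// addrC val_angle.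
  apply: le_trans (circle_mean_binomial _ _ _) _; apply: ler_sum => l _.
  by rewrite mulrAC exprM.
apply: (@le_trans _ _ (\int[m]_w G w)).
  apply: le_Rintegral => //.
  - apply: (@integrable_bounded _ _ _ m _ ((\sum_(x <- (j, b) :: r) normc x.2) ^+ (2 * k))) => // w.
    rewrite ger0_norm; last by apply: Rintegral_ge0 => t _; rewrite exprn_ge0 ?normc_ge0.
    rewrite -[leRHS](Rintegral_prob_cst (P01 R)); apply: le_Rintegral => //.
    + apply: (@integrable_bounded _ _ _ (P01 R) _ ((\sum_(x <- (j, b) :: r) normc x.2) ^+ (2 * k))).
        by apply: (measurableT_comp (measurable_linformX _ _)); exact: measurable_upd.
      by move=> t; exact: normc_linformX_le.
    + exact: (@finite_measure_integrable_cst _ _ _ (P01 R)).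
    + by move=> t _; apply: le_trans (ler_norm _) (normc_linformX_le _ _ _).
  - by apply: integrable_real_sum => l; exact: iG.
rewrite Rintegral_sum; last by move=> l; exact: iG.
rewrite /rhs big_cons /= addrC exprDn mulr_sumr; apply: ler_sum => l _.
have lk : (l <= k)%N by rewrite -ltnS.
rewrite RintegralZl//; last exact: integrable_linformX.
apply: le_trans (ler_wpM2l _ (IH (k - l)%N ur)) _; first by apply: mulr_ge0; [exact: sqr_ge0|apply: exprn_ge0; exact: sqr_ge0].
rewrite -/S; have S0 : 0 <= S by apply: sumr_ge0 => x _; exact: sqr_ge0.
set u := (normc b ^+ 2) ^+ l; set v := S ^+ (k - l).
have uv0 : 0 <= v * u by apply: mulr_ge0; [exact: exprn_ge0|apply: exprn_ge0; exact: sqr_ge0].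
rewrite (_ : _ * _ * (_ * v) = ('C(k, l) * 'C(k, l) * (k - l)`!)%:R * (v * u)); last by rewrite !natrM; ring.
rewrite -[(v * u) *+ _]mulr_natr (_ : _ * (v * u * _) = (k`! * 'C(k, l))%:R * (v * u)); last by rewrite natrM; ring.
by rewrite ler_wpM2r// ler_nat bin_fact_le.
Qed.

End khintchine.

Section square_summable.
Variable R : realType.
Local Notation m := (torus_measure R).
Implicit Types (z : ell_infty R) (f : torus R -> R[i]).

Lemma Lnorm_integrand (p : R) f :
  (\int[m]_w (`| (normc (f w))%:E | `^ p))%E = (\int[m]_w (normc (f w) `^ p)%:E)%E.
Proof.
apply: eq_integral => w _.
by rewrite abse_EFin ger0_norm ?normc_ge0// poweR_EFin.
Qed.

Lemma Lp_integral (p : R) f : 0 < p -> Lp_torus p%:E f ->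
  (\int[m]_w (normc (f w) `^ p)%:E < +oo)%E.
Proof.
move=> p0 [_ _ h]; have := poweR_lty p h.
by rewrite poweR_Lnorm ?Lnorm_integrand//; rewrite gt_eqF.
Qed.

Lemma Lp_torus_intro (p : R) f : 0 < p -> cmeasurable f ->
  (\int[m]_w (normc (f w) `^ p)%:E < +oo)%E -> Lp_torus p%:E f.
Proof.
move=> p0 [f1 f2] h; split => //; rewrite unlock /Lnorm; apply: poweR_lty.
by rewrite Lnorm_integrand.
Qed.

Lemma Lp_cintegrable (p : R) f : 1 <= p -> Lp_torus p%:E f -> cintegrable m f.
Proof.
move=> p1 Lf; have p0 : 0 < p by exact: lt_le_trans ltr01 p1.
have mf : cmeasurable f by case: Lf.
have mp : measurable_fun setT (fun w => normc (f w) `^ p).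
  exact: (measurableT_comp (measurable_powR p) (measurable_normc mf)).
apply/(cintegrable_normcP m mf).
have ip : m.-integrable setT (EFin \o (fun w => normc (f w) `^ p)).
  apply/integrableP; split; first exact/measurable_EFinP.
  apply: le_lt_trans (Lp_integral p0 Lf); rewrite le_eqVlt; apply/orP; left; apply/eqP.
  by apply: eq_integral => w _; rewrite /= ger0_norm ?powR_ge0.
apply: (@integrable_le _ _ _ m _ (fun w => 1 + normc (f w) `^ p)).
- exact: measurable_normc.
- move=> w; rewrite ger0_norm ?normc_ge0//; have [h|h] := leP (normc (f w)) 1.
    by rewrite (le_trans h)// lerDl powR_ge0.
  by rewrite -[leLHS]powRr1 ?normc_ge0// (le_trans (ler_powR (ltW h) p1))// lerDr.
- have i1 : m.-integrable setT (EFin \o (fun=> 1 : R)) by exact: (@finite_measure_integrable_cst _ _ _ m).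
  exact: (integrableD measurableT i1 ip).
Qed.

Lemma ell_2_bounded z : ell_2 R z -> exists2 S : R, 0 <= S & forall N, \sum_(j < N) normc (z j) ^+ 2 <= S.
Proof.
rewrite /ell_2 /= => h.
have e0 j : (0 <= (normc (z j) ^+ 2)%:E)%E by rewrite lee_fin sqr_ge0.
have f : (\sum_(0 <= j <oo) (normc (z j) ^+ 2)%:E)%E \is a fin_num.
  by rewrite ge0_fin_numE//; apply: nneseries_ge0.
have hS N : \sum_(j < N) normc (z j) ^+ 2 <= fine (\sum_(0 <= j <oo) (normc (z j) ^+ 2)%:E)%E.
  rewrite -lee_fin fineK// -sumEFin -(big_mkord xpredT (fun j => (normc (z j) ^+ 2)%:E)).
  exact: nneseries_lim_ge.
exists (fine (\sum_(0 <= j <oo) (normc (z j) ^+ 2)%:E)%E) => //.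
by have := hS 0%N; rewrite big_ord0.
Qed.

(** As z is square summable with supremum r < 1, the products of 1 / (1 - |z_j|^2) are bounded, so
    [weighted_sum_bound] is uniform in the number of variables. It only needs the mean modulus,
    hence serves for every p >= 1. *)
Lemma ell_2_mon_Hp (p : R) z : 1 <= p -> ell_2 R z -> unit_ball R z -> mon_Hp_torus R p%:E z.
Proof.
move=> p1 z2 z1; split => // f [Lf f0]; have fi := Lp_cintegrable p1 Lf.
have [S S0 hS] := ell_2_bounded z2.
pose r := sup_norm z; have r1 : r < 1 by exact/unit_ballE.
have r0 : 0 <= r by apply: le_trans (normc_ge0 _) (le_sup_norm z 0%N).
have zr j : normc (z j) <= r by exact: le_sup_norm.
have r21 : r ^+ 2 < 1 by rewrite expr_lt1.
pose L := expR (S / (1 - r ^+ 2)).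
have HP N : \prod_(j < N) (1 - normc (z j) ^+ 2)^-1 <= L.
  apply: (@le_trans _ _ (\prod_(j < N) expR (normc (z j) ^+ 2 / (1 - r ^+ 2)))).
    have z2r j : normc (z j) ^+ 2 <= r ^+ 2 by rewrite lerXn2r ?nnegrE ?normc_ge0.
    apply: ler_prod => j _; rewrite invr_ge0 subr_ge0 (le_trans (z2r j) (ltW r21))/=.
    by apply: inv_1B_le_expR => //; rewrite sqr_ge0 z2r.
  rewrite -expR_sum ler_expR -mulr_suml ler_pM2r//.
  by rewrite invr_gt0 subr_gt0.
apply: (@le_lt_trans _ _ ((\int[m]_w normc (f w)) * L)%:E); last exact: ltry.
apply: esum_bounded => s us s0; apply: (fejer_transfer fi) => // s' c us' s0' _ hI.
have [N sN] := common_supp_lt s'.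
have t01 j : 0 <= normc (z j) < 1 by rewrite normc_ge0 (le_lt_trans (zr j)).
have W := weighted_sum_bound c us' (sep_nonneg s0' sN) t01.
apply: (@le_trans _ _ ((\int[m]_w normc (peval s' c (tval w))) * L)); last first.
  by rewrite ler_wpM2r// expR_ge0.
have -> : \sum_(a <- s') normc (c a * monomial z a) =
    \sum_(a <- s') normc (c a) * \prod_(j < N) normc (z j) ^+ `|a j|%N.
  by apply: eq_big_seq => a as_; rewrite normcM (normc_monomial _ (s0' a as_) (sN a as_)).
apply: le_trans W _; rewrite (eq_Rintegral _ (g := fun w => normc (peval s' c (tval w)))); last first.
  by move=> w _; rewrite (peval_epoly _ _ s0' sN).
by rewrite ler_wpM2l//; apply: Rintegral_ge0 => w _; exact: normc_ge0.
Qed.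

Lemma not_ell_2_block z (a : nat) (K : R) : ~ ell_2 R z ->
  exists n, (a <= n)%N /\ K <= \sum_(a <= j < n) normc (z j) ^+ 2.
Proof.
move=> nz; apply: contrapT => h; apply: nz; rewrite /ell_2 /=.
have hK n : (a <= n)%N -> \sum_(a <= j < n) normc (z j) ^+ 2 <= K.
  by move=> an; rewrite leNgt; apply/negP => h'; apply: h; exists n; split => //; exact: ltW.
pose B := \sum_(0 <= j < a) normc (z j) ^+ 2 + K.
apply: (@le_lt_trans _ _ B%:E); last exact: ltry.
apply: lime_le; first by apply: is_cvg_nneseries => n _ _; rewrite lee_fin sqr_ge0.
apply: nearW => n; rewrite sumEFin lee_fin.
apply: (@le_trans _ _ (\sum_(0 <= j < maxn a n) normc (z j) ^+ 2)).
  rewrite [leRHS](big_cat_nat (n := n)) ?leq_maxr//= lerDl.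
  by apply: sumr_ge0 => j _; exact: sqr_ge0.
by rewrite [leLHS](big_cat_nat (n := a)) ?leq_maxl//= lerD2l hK// leq_maxl.
Qed.

(** Fatou's lemma, applied to the lower limit, with which the limit agrees almost everywhere. *)
Lemma integral_lim_le (F : nat -> torus R -> R[i]) f (n : nat) (B : R) :
  (forall i, cmeasurable (F i)) -> cmeasurable f -> {ae m, forall w, ccvg (F ^~ w) (f w)} ->
  (forall i, (\int[m]_w (normc (F i w) ^+ n)%:E <= B%:E)%E) ->
  (\int[m]_w (normc (f w) ^+ n)%:E <= B%:E)%E.
Proof.
move=> mF mf Ff hB.
have mFn i : measurable_fun setT (fun w => (normc (F i w) ^+ n)%:E).
  by apply/measurable_EFinP; apply: measurable_funX; exact: measurable_normc.
have e : {ae m, forall w, setT w -> (normc (f w) ^+ n)%:E = limn_einf (fun i => (normc (F i w) ^+ n)%:E)}.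
  move: Ff; apply: filterS => w /ccvg_normc h _.
  rewrite (cvg_limn_einf_sup (l := (normc (f w) ^+ n)%:E) _).1//; apply/cvg_EFin; first exact: nearW.
  exact: (cvg_comp _ _ h (@exprn_continuous R n _)).
have F0 i w : (0 <= (normc (F i w) ^+ n)%:E)%E by rewrite lee_fin exprn_ge0 ?normc_ge0.
pose L w := limn_einf (fun i => (normc (F i w) ^+ n)%:E).
have mf' : measurable_fun setT (fun w => (normc (f w) ^+ n)%:E).
  by apply/measurable_EFinP; apply: measurable_funX; exact: measurable_normc.
have mL : measurable_fun setT L.
  under [L]eq_fun do rewrite limn_einf_lim.
  apply: (@emeasurable_fun_cvg _ _ _ _ (fun k w => einfs (fun i => (normc (F i w) ^+ n)%:E) k)).
    by move=> k; exact: measurable_fun_einfs.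
  by move=> w _; exact: is_cvg_einfs.
have L0 w : (0 <= L w)%E.
  rewrite /L limn_einf_lim; apply: lime_ge; first exact: is_cvg_einfs.
  by apply: nearW => k; apply: le_ereal_inf_tmp => _ [i _ <-]; exact: F0.
have -> : (\int[m]_w (normc (f w) ^+ n)%:E = \int[m]_w L w)%E.
  apply: ge0_ae_eq_integral => //; first by move=> w _; rewrite lee_fin exprn_ge0 ?normc_ge0.
apply: (le_trans (fatou m measurableT mFn (fun i w _ => F0 i w))).
rewrite limn_einf_lim; apply: lime_le; first exact: is_cvg_einfs.
by apply: nearW => i; apply: le_trans (hB i); apply: ereal_inf_lbound; exists i => /=.
Qed.

Lemma mon_Hp_ell_2 (p : R) z : 1 <= p -> mon_Hp_torus R p%:E z -> ell_2 R z.
Proof.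
move=> p1 [z1 H]; apply: contrapT => nz; have p0 : 0 < p by exact: lt_le_trans ltr01 p1.
have nb a i := cid (not_ell_2_block a (4 ^+ i) nz).
pose nx a i := projT1 (nb a i).
(* Consecutive blocks of coordinates, the i-th with square sum at least 4^i. *)
pose b := fix b n := if n is k.+1 then nx (b k) k else 0%N.
have bP i : (b i <= b i.+1)%N /\ 4 ^+ i <= \sum_(b i <= j < b i.+1) normc (z j) ^+ 2.
  exact: projT2 (nb (b i) i).
pose V i := \sum_(b i <= j < b i.+1) normc (z j) ^+ 2.
have V4 i : 4 ^+ i <= V i by case: (bP i).
have V0 i : 0 < V i by apply: lt_le_trans (V4 i); rewrite exprn_gt0.
pose sg i := Num.sqrt (V i).
have sgE i : sg i ^+ 2 = V i by rewrite sqr_sqrtr// ltW.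
have sg0 i : 0 < sg i by rewrite sqrtr_gt0.
have sg2 i : 2 ^+ i <= sg i.
  have e : (2 ^+ i) ^+ 2 = 4 ^+ i :> R by rewrite -exprM mulnC exprM; congr (_ ^+ _); ring.
  by rewrite -(@ler_pXn2r _ 2) ?nnegrE ?exprn_ge0 ?(ltW (sg0 i))// sgE e.
(* With coefficients t_i |z_j| on block i, the linear form has square norm 4^(-i), while its
   monomial sum at [z] is t_i V_i = 2^(-i) sqrt(V_i) >= 1. *)
pose t i := 2^-1 ^+ i / sg i.
have t0 i : 0 < t i by rewrite divr_gt0// exprn_gt0// invr_gt0.
pose I i := index_iota (b i) (b i.+1).
pose s i := [seq idx_one j 1 | j <- I i].
pose c i (a : multi_index) : R[i] := (t i * normc (monomial z a))%:C.
pose r i := [seq (j, (t i * normc (z j))%:C) | j <- I i].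
have peE i w : peval (s i) (c i) (tval w) = linform (r i) w.
  rewrite /peval /linform /s /r !big_map; apply: eq_bigr => j _.
  by rewrite /c /= !monomial_idx_one !expr1.
have rI i : [seq x.1 | x <- r i] = I i.
  by rewrite /r -map_comp map_id_in.
have sq i : \sum_(x <- r i) normc x.2 ^+ 2 = 4^-1 ^+ i.
  rewrite /r big_map (eq_bigr (fun j => t i ^+ 2 * normc (z j) ^+ 2)); last first.
    by move=> j _; rewrite normc_real ger0_norm ?exprMn// mulr_ge0 ?normc_ge0 ?ltW.
  rewrite -mulr_sumr -/(V i) /t expr_div_n sgE mulfVK ?gt_eqF//.
  by rewrite exprAC; congr (_ ^+ _); field.
have idx_inj : injective (fun j => idx_one j 1).
  move=> j k /(congr1 (fun a : multi_index => a j)); rewrite !idx_oneE eqxx.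
  by case: eqP.
have us i : uniq (s i) by rewrite map_inj_uniq// iota_uniq.
have s0 i a : a \in s i -> nonneg_index a by move=> /mapP[j _ ->]; exact: nonneg_idx_one.
have bm : {homo b : i k / (i <= k)%N}.
  by apply: homo_leq => // [x y u|n]; [exact: leq_trans|case: (bP n)].
have sd i k a : a \in s i -> a \in s k -> i = k.
  have lt i' k' j : j \in I i' -> j \in I k' -> (k' <= i')%N.
    rewrite !mem_index_iota => /andP[_ j1] /andP[j2 _]; rewrite leqNgt; apply/negP => ik.
    by have := leq_ltn_trans (leq_trans (bm _ _ ik) j2) j1; rewrite ltnn.
  move=> /mapP[j ji ->] /mapP[j' jk /idx_inj jj']; rewrite -jj' in jk.
  by apply/eqP; rewrite eqn_leq; apply/andP; split; [exact: (lt _ _ j)|exact: (lt _ _ j)].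
have ub i : uniq [seq x.1 | x <- r i] by rewrite rI iota_uniq.
have int1 i : \int[m]_w normc (peval (s i) (c i) (tval w)) <= 2^-1 ^+ i.
  have h2 := khintchine 1 (ub i); rewrite (_ : 1`! = 1)%N// mul1r expr1 sq muln1 in h2.
  set l : R := 2^-1 ^+ i; have l0 : 0 < l by rewrite exprn_gt0// invr_gt0.
  have i2 : m.-integrable setT (fun w => (l^-1 / 2 * normc (linform (r i) w) ^+ 2)%:E).
    exact: (integrableZl measurableT _ (integrable_linformX _ _)).
  have ic : m.-integrable setT (fun w => (l / 2)%:E).
    exact: (@finite_measure_integrable_cst _ _ _ m).
  (* The inequality x <= x^2 / (2 l) + l / 2 turns the bound l^2 for the second moment into the
     bound l for the first. *)
  apply: (@le_trans _ _ (\int[m]_w (l^-1 / 2 * normc (linform (r i) w) ^+ 2 + l / 2))).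
    apply: le_Rintegral => //.
    - exact/cintegrable_normc/cintegrable_peval.
    - exact: (integrableD measurableT i2 ic).
    - move=> w _; rewrite peE; set x := normc _.
      have := sqr_ge0 (x - l); rewrite -(pmulr_rge0 _ (_ : 0 < l^-1 / 2)); last by rewrite divr_gt0// invr_gt0.
      rewrite (_ : l^-1 / 2 * (x - l) ^+ 2 = l^-1 / 2 * x ^+ 2 + l / 2 - x); first by rewrite subr_ge0.
      by field; rewrite gt_eqF.
  rewrite RintegralD// Rintegral_prob_cst RintegralZl//; last exact: integrable_linformX.
  apply: (@le_trans _ _ (l^-1 / 2 * 4^-1 ^+ i + l / 2)).
    by rewrite lerD2r ler_wpM2l// divr_ge0// invr_ge0 ltW.
  rewrite (_ : 4^-1 ^+ i = l ^+ 2); last by rewrite /l exprAC; congr (_ ^+ _); field.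
  by rewrite le_eqVlt; apply/orP; left; apply/eqP; field; rewrite gt_eqF.
have [f [fi fae fc fc0]] := series_fourier us sd int1.
have mf := cintegrable_meas fi.
have ic0 : forall i, 1 <= \sum_(a <- s i) normc (c i a * monomial z a).
  move=> i; rewrite /s big_map (eq_bigr (fun j => t i * normc (z j) ^+ 2)); last first.
    move=> j _; rewrite /c monomial_idx_one expr1 normcM normc_real ger0_norm; last first.
      by rewrite mulr_ge0 ?normc_ge0 ?ltW.
    by rewrite expr2 mulrA.
  rewrite -mulr_sumr -/(V i) -sgE /t expr2 mulrA mulfVK ?gt_eqF//.
  by rewrite exprVn mulrC ler_pdivlMr ?exprn_gt0// mul1r sg2.
apply: (not_summable us s0 sd fc ic0); apply: H; split; last first.
  by move=> a na; apply: fc0 => i; apply/negP => ai; apply: na; exact: s0 ai.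
apply: Lp_torus_intro => //.
(* Now p <= 2 k and |f|^p <= 1 + |f|^(2 k). The partial sums are linear forms in distinct variables
   with square sum at most 2, so their moments of order 2 k are uniformly bounded. *)
pose k := (Num.truncn p).+1.
pose S n w := \sum_(i < n) peval (s i) (c i) (tval w).
have mS n : cmeasurable (S n) by apply: cmeasurable_sum => i; exact: cmeasurable_peval.
pose rr n := flatten [seq r i | i <- iota 0 n].
have SE n w : S n w = linform (rr n) w.
  rewrite /linform /rr big_flatten big_map /S -(big_mkord xpredT (fun i => peval (s i) (c i) (tval w))).
  by rewrite /index_iota subn0; apply: eq_bigr => i _; rewrite peE.
have urr n : [seq x.1 | x <- rr n] = iota 0 (b n).
  elim: n => // n IH; have -> : rr n.+1 = rr n ++ r n.
    by rewrite /rr -addn1 iotaD map_cat flatten_cat /= cats0 add0n.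
  rewrite map_cat IH rI /I /index_iota -{2}[b n]add0n -iotaD subnKC//.
  by case: (bP n).
have sqr n : \sum_(x <- rr n) normc x.2 ^+ 2 <= 2.
  rewrite /rr big_flatten big_map (_ : iota 0 n = index_iota 0 n) ?big_mkord; last by rewrite /index_iota subn0.
  apply: le_trans (half_sums R n); apply: ler_sum => i _; rewrite sq lerXn2r ?nnegrE//; lra.
have Sint n : (\int[m]_w (normc (S n w) ^+ (2 * k))%:E <= (k`!%:R * 2 ^+ k)%:E)%E.
  have ilin := integrable_linformX (rr n) (2 * k).
  under eq_integral do rewrite SE.
  rewrite -[leLHS]fineK; last exact: integrable_fin_num.
  rewrite lee_fin; have := @khintchine _ (rr n) k; rewrite urr iota_uniq => /(_ isT) h.
  apply: le_trans h _; rewrite ler_wpM2l// lerXn2r ?nnegrE//.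
  by apply: sumr_ge0 => x _; exact: sqr_ge0.
have hf := integral_lim_le mS mf fae Sint.
apply: (@le_lt_trans _ _ (\int[m]_w (1%:E + (normc (f w) ^+ (2 * k))%:E))%E).
  apply: ge0_le_integral => //.
  - by move=> w _; rewrite lee_fin powR_ge0.
  - by apply/measurable_EFinP; exact: (measurableT_comp (measurable_powR p) (measurable_normc mf)).
  - by apply/measurable_EFinP; apply: measurable_funD => //; apply: measurable_funX; exact: measurable_normc.
  - move=> w _; rewrite -EFinD lee_fin; have [h|h] := leP (normc (f w)) 1.
      apply: (@le_trans _ _ 1); last by rewrite lerDl exprn_ge0 ?normc_ge0.
      have := @ge0_ler_powR R p (ltW p0) (normc (f w)) 1; rewrite powR1 => h1p; apply: h1p; by rewrite ?nnegrE ?normc_ge0.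
    rewrite -powR_mulrn ?normc_ge0// (le_trans (ler_powR (ltW h) (_ : p <= (2 * k)%:R))) ?lerDr//.
    apply: le_trans (ltW (truncnS_gt p)) _; rewrite ler_nat /k; exact: leq_pmull.
rewrite ge0_integralD//; last 2 first.
- by move=> w _; rewrite lee_fin exprn_ge0 ?normc_ge0.
- by apply/measurable_EFinP; apply: measurable_funX; exact: measurable_normc.
have m1 : m [set: torus R] = 1%E by exact: probability_setT.
rewrite integral_cst// mul1e; move: m1 => /= ->.
by apply: le_lt_trans (leeD2l _ hf) _; rewrite -EFinD ltry.
Qed.

End square_summable.

(** * Random polynomials *)

Section exponential_bounds.
Variable R : realType.
Implicit Types x y : R.

Lemma expR_le_inv_sqr x : x < 2 -> expR x <= (1 - x / 2) ^- 2.
Proof.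
move=> x2; have h : 0 < 1 - x / 2 by lra.
have h1 : 1 - x / 2 <= expR (- (x / 2)) by exact: expR_ge1Dx.
have -> : expR x = expR (- (x / 2)) ^- 2.
  rewrite -exprVn -expRN opprK expr2 -expRD; congr expR; lra.
rewrite lef_pV2 ?posrE ?exprn_gt0 ?expR_gt0//.
by rewrite lerXn2r ?nnegrE ?expR_ge0// ltW.
Qed.

Lemma expR_le_quadratic x : -1 <= 3 * x <= 1 -> expR x <= 1 + x + x ^+ 2.
Proof.
move=> /andP[x0 x1]; apply: le_trans (expR_le_inv_sqr _) _; first by lra.
have h : 0 < 1 - x / 2 by lra.
rewrite -div1r ler_pdivrMr ?exprn_gt0// -subr_ge0.
have -> : (1 + x + x ^+ 2) * (1 - x / 2) ^+ 2 - 1 = x ^+ 2 / 4 * (1 - 3 * x + x ^+ 2) by field.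
rewrite mulr_ge0 ?divr_ge0 ?sqr_ge0//.
by have := sqr_ge0 x; lra.
Qed.

(** With x = |z_j|^2 this bounds exp(|z_j|^2) by one factor of the product that the random
    polynomials control, so that no constant is lost in front of the sum of squares. *)
Lemma expR_le_cubic x : 0 <= x <= 1 -> expR x <= 1 + x + x ^+ 2 + x ^+ 3.
Proof.
move=> /andP[x0 x1]; apply: le_trans (expR_le_inv_sqr _) _; first by lra.
have h : 0 < 1 - x / 2 by lra.
rewrite -div1r ler_pdivrMr ?exprn_gt0// -subr_ge0.
have -> : (1 + x + x ^+ 2 + x ^+ 3) * (1 - x / 2) ^+ 2 - 1 =
  x ^+ 2 / 4 * ((1 - x) * (1 + x + x * (1 - x))) by field.
rewrite mulr_ge0 ?divr_ge0 ?sqr_ge0// mulr_ge0 ?subr_ge0//.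
by rewrite addr_ge0 ?mulr_ge0 ?subr_ge0// addr_ge0.
Qed.

(** The subgaussian bound for a random sign. The sharp constant 1/2 is not aimed at, since 3 only
    affects the numerical factor in [random_bpol]. *)
Lemma cosh_le x : (expR x + expR (- x)) / 2 <= expR (3 * x ^+ 2).
Proof.
have [h|h] := boolP (-1 <= 3 * x <= 1).
  have h' : -1 <= 3 * (- x) <= 1 by move: h => /andP[? ?]; apply/andP; split; lra.
  apply: (@le_trans _ _ (1 + 3 * x ^+ 2)); last exact: expR_ge1Dx.
  have := expR_le_quadratic h; have := expR_le_quadratic h'; rewrite sqrrN.
  by have := sqr_ge0 x; set y := x ^+ 2; lra.
have h3 : `|x| <= 3 * x ^+ 2.
  rewrite -[x ^+ 2]real_normK ?num_real// expr2 mulrA ler_peMl//.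
  move: h; rewrite negb_and -!ltNge; case: (ger0P x) => x0 /orP[]; lra.
have a : expR x <= expR (3 * x ^+ 2) by rewrite ler_expR (le_trans (ler_norm _)).
have b : expR (- x) <= expR (3 * x ^+ 2) by rewrite ler_expR (le_trans _ h3)// -normrN ler_norm.
lra.
Qed.

(** The right-hand side is an expectation over independent signs. The signs are fixed one after the
    other so that the conditional expectation never increases. *)
Lemma ex_signs (G : finType) (I : eqType) (s : seq I) (W : G -> R) (X : I -> G -> R) : uniq s ->
  (forall g, 0 <= W g) ->
  exists e : I -> R, (forall i, e i ^+ 2 = 1) /\
    \sum_g W g * expR (\sum_(i <- s) e i * X i g) <=
    \sum_g W g * \prod_(i <- s) ((expR (X i g) + expR (- X i g)) / 2).
Proof.
elim: s W => [|a s IH] W us W0.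
  exists (fun=> 1); split => [i|]; first by rewrite expr1n.
  by apply: ler_sum => g _; rewrite !big_nil expR0.
move: us => /= /andP[as_ us].
have [|e [e1 he]] := IH (fun g => W g * ((expR (X a g) + expR (- X a g)) / 2)) us.
  by move=> g; rewrite mulr_ge0 ?divr_ge0 ?addr_ge0 ?expR_ge0.
pose A (t : R) := \sum_g W g * expR (t * X a g + \sum_(i <- s) e i * X i g).
have hA : (A 1 + A (-1)) / 2 <= \sum_g W g * \prod_(i <- a :: s) ((expR (X i g) + expR (- X i g)) / 2).
  apply: le_trans (_ : _ <= \sum_g W g * ((expR (X a g) + expR (- X a g)) / 2) *
    expR (\sum_(i <- s) e i * X i g)) _; last first.
    apply: le_trans he _; by apply: ler_sum => g _; rewrite big_cons !mulrA.
  rewrite /A /= -big_split /= mulr_suml; apply: ler_sum => g _.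
  by rewrite !expRD mul1r mulN1r le_eqVlt; apply/orP; left; apply/eqP; field.
have sgn (t : R) : t ^+ 2 = 1 -> A t <= \sum_g W g * \prod_(i <- a :: s) ((expR (X i g) + expR (- X i g)) / 2) ->
   exists e : I -> R, (forall i, e i ^+ 2 = 1) /\
    \sum_g W g * expR (\sum_(i <- a :: s) e i * X i g) <=
    \sum_g W g * \prod_(i <- a :: s) ((expR (X i g) + expR (- X i g)) / 2).
  move=> t1 h; exists (fun i => if i == a then t else e i); split; first by move=> i; case: ifP.
  apply: le_trans h; apply: ler_sum => g _; rewrite big_cons eqxx.
  rewrite (eq_big_seq (fun i => e i * X i g))// => i is_.
  by case: eqP => // ia; rewrite -ia is_ in as_.
set Z := \sum_g _ in hA sgn *.
have [h|h] := leP (A 1) Z; first by apply: (sgn 1) => //; rewrite expr1n.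
by apply: (sgn (-1)); [rewrite sqrrN expr1n|lra].
Qed.

End exponential_bounds.

Section polydisc_net.
Variable R : realType.
Local Notation C := (R[i]).
Local Notation Re := complex.Re.
Local Notation Im := complex.Im.

(** Rounding towards 0, so that moduli do not increase and a rounded point of the disc stays in
    it. *)
Definition round0 (m : nat) (x : R) : R := Num.sg x * ((Num.truncn (`|x| * m%:R))%:R / m%:R).

Lemma round0P m x : (0 < m)%N -> `|round0 m x| <= `|x| /\ `|x - round0 m x| <= m%:R^-1.
Proof.
move=> m0; have m0' : 0 < m%:R :> R by rewrite ltr0n.
have y0 : 0 <= `|x| * m%:R by rewrite mulr_ge0.
have /andP[h1 h2] := truncn_itv y0.
set k := Num.truncn _ in h1 h2; set u : R := k%:R / m%:R.
have u0 : 0 <= u by rewrite divr_ge0.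
have ux : u <= `|x| by rewrite ler_pdivrMr.
have xu : `|x| - u <= m%:R^-1.
  rewrite lerBlDr -(ler_pM2r m0') mulrDl mulVf ?gt_eqF// mulfVK ?gt_eqF//.
  by rewrite -natr1 in h2; rewrite addrC ltW.
rewrite /round0 -/k -/u; have [->|x0] := eqVneq x 0.
  by rewrite sgr0 mul0r subrr normr0; split => //; rewrite invr_ge0 ltW.
split; first by rewrite normrM normr_sg x0 mul1r ger0_norm.
rewrite {1}[x]numEsg -mulrBr normrM normr_sg x0 mul1r ger0_norm//.
by rewrite subr_ge0.
Qed.

Definition cround m (u : C) : C := round0 m (Re u) +i* round0 m (Im u).

Lemma normc_cround_le m u : (0 < m)%N -> normc (cround m u) <= normc u.
Proof.
move=> m0; rewrite -(@ler_pXn2r _ 2) ?nnegrE ?normc_ge0// !sqr_normcE /=.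
apply: lerD; rewrite -[leLHS]real_normK ?num_real// -[leRHS]real_normK ?num_real//.
  by rewrite lerXn2r ?nnegrE//; case: (round0P (Re u) m0).
by rewrite lerXn2r ?nnegrE//; case: (round0P (Im u) m0).
Qed.

Lemma normc_cround_dist m u : (0 < m)%N -> normc (u - cround m u) <= 2 / m%:R.
Proof.
move=> m0; apply: le_trans (normc_le_ReIm _) _.
rewrite cReD cImD cReN cImN /= (_ : 2 / m%:R = m%:R^-1 + m%:R^-1); last by field; rewrite pnatr_eq0 -lt0n.
by apply: lerD; [case: (round0P (Re u) m0)|case: (round0P (Im u) m0)].
Qed.

(** Grid points outside the disc become 0, so that every grid index yields a point of the closed
    disc. *)
Definition gpoint m (p : 'I_m.*2.+1 * 'I_m.*2.+1) : C :=
  let u := ((p.1%:R - m%:R) / m%:R) +i* ((p.2%:R - m%:R) / m%:R) in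
  if normc u <= 1 then u else 0.

Lemma normc_gpoint m p : normc (@gpoint m p) <= 1.
Proof. by rewrite /gpoint; case: ifP => // _; rewrite normc0. Qed.

Lemma round0_grid m (x : R) : (0 < m)%N -> `|x| <= 1 ->
  exists k : 'I_m.*2.+1, round0 m x = (k%:R - m%:R) / m%:R.
Proof.
move=> m0 x1; have m0' : 0 < m%:R :> R by rewrite ltr0n.
set k := Num.truncn (`|x| * m%:R).
have km : (k <= m)%N.
  rewrite -(ler_nat R); apply: le_trans (_ : _ <= `|x| * m%:R) _.
    by rewrite truncn_le// mulr_ge0.
  by rewrite ler_piMl// ltW.
rewrite /round0 -/k; have [x0|x0|->] := ltgtP x 0.
- exists (inord (m - k)); rewrite inordK; last by rewrite ltnS -addnn (leq_trans (leq_subr _ _))// leq_addr.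
  by rewrite ltr0_sg// natrB// mulN1r -mulNr; congr (_ / _); ring.
- exists (inord (m + k)); rewrite inordK; last by rewrite ltnS -addnn leq_add2l.
  by rewrite gtr0_sg// mul1r natrD; congr (_ / _); ring.
- exists (inord m); rewrite inordK; last by rewrite ltnS -addnn leq_addr.
  by rewrite sgr0 mul0r subrr mul0r.
Qed.

Lemma cround_grid m u : (0 < m)%N -> normc u <= 1 -> exists p : 'I_m.*2.+1 * 'I_m.*2.+1, cround m u = gpoint p.
Proof.
move=> m0 u1.
have [k1 e1] := round0_grid m0 (le_trans (Re_le_normc u) u1).
have [k2 e2] := round0_grid m0 (le_trans (Im_le_normc u) u1).
exists (k1, k2); rewrite /gpoint /= -e1 -e2 -/(cround m u).
by rewrite (le_trans (normc_cround_le u m0)).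
Qed.

End polydisc_net.

Section kahane_salem_zygmund.
Variables (R : realType) (n : nat).
Local Notation C := (R[i]).
Local Notation E := {ffun 'I_n -> 'I_4}.
Implicit Types (c : E -> C) (v : nat -> C).

Definition bpol c v : C := \sum_(f : E) c f * \prod_(i < n) v i ^+ f i.

Definition subst1 v k (u : C) : nat -> C := fun i => if i == k then u else v i.

Lemma bpol_subst1 c v (k : 'I_n) u :
  bpol c (subst1 v k u) = \sum_(f : E) (c f * \prod_(i < n | i != k) v i ^+ f i) * u ^+ f k.
Proof.
apply: eq_bigr => f _; rewrite (bigD1 k)//= {1}/subst1 eqxx [u ^+ _ * _]mulrC mulrA.
congr (_ * _ * _); apply: eq_bigr => i ik; rewrite /subst1 (_ : (_ == _ :> nat) = false)//.
exact/negbTE.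
Qed.

(** The slice is a cubic polynomial with coefficients at most [M], and u^l - u'^l is at most l |u -
    u'|; the constant is 6 = 1 + 2 + 3. *)
Lemma bpol_lipschitz c M (k : 'I_n) v u u' :
  (forall v, (forall i, normc (v i) <= 1) -> normc (bpol c v) <= M) ->
  (forall i, normc (v i) <= 1) -> normc u <= 1 -> normc u' <= 1 ->
  normc (bpol c (subst1 v k u) - bpol c (subst1 v k u')) <= 6 * M * normc (u - u').
Proof.
move=> H v1 u1 u1'.
pose q : {poly C} := \sum_(f : E) (c f * \prod_(i < n | i != k) v i ^+ f i) *: 'X^(f k).
have qE w : q.[w] = bpol c (subst1 v k w).
  by rewrite bpol_subst1 /q horner_sum; apply: eq_bigr => f _; rewrite hornerZ hornerXn.
have sq : (size q <= 4)%N.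
  apply: (leq_trans (size_sum _ _ _)); apply/bigmax_leqP => f _.
  by rewrite (leq_trans (size_scale_leq _ _))// size_polyXn.
have qM l : normc q`_l <= M.
  apply: normc_coef_le => w w1; rewrite qE; apply: H => i.
  by rewrite /subst1; case: ifP => // _; rewrite w1.
have M0 : 0 <= M by apply: le_trans (normc_ge0 _) (qM 0%N).
have Xd l : normc (u ^+ l - u' ^+ l) <= l%:R * normc (u - u').
  elim: l => [|l IH]; first by rewrite !expr0 subrr normc0 mul0r.
  rewrite !exprS (_ : _ - _ = u * (u ^+ l - u' ^+ l) + (u - u') * u' ^+ l); last by ring.
  apply: le_trans (le_normcD _ _) _; rewrite !normcM -[l.+1%:R]natr1 mulrDl mul1r; apply: lerD.
    by apply: le_trans IH; rewrite ler_piMl ?normc_ge0.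
  by rewrite ler_piMr ?normc_ge0// normcX exprn_ile1 ?normc_ge0.
rewrite -!qE !(horner_coef_wide _ sq) -sumrB.
apply: le_trans (normc_sum _ _ _) _.
have -> : 6 * M * normc (u - u') = \sum_(l < 4) M * (l%:R * normc (u - u')).
  by rewrite !big_ord_recr big_ord0 /=; ring.
apply: ler_sum => l _; rewrite -mulrBr normcM; apply: ler_pM => //; exact: normc_ge0.
Qed.

Lemma bpol_net c M m : (0 < m)%N ->
  (forall v, (forall i, normc (v i) <= 1) -> normc (bpol c v) <= M) ->
  forall v, (forall i, normc (v i) <= 1) ->
  normc (bpol c v - bpol c (fun i => cround m (v i))) <= n%:R * (6 * M * (2 / m%:R)).
Proof.
move=> m0 H v v1.
pose h k i := if (i < k)%N then cround m (v i) else v i.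
have h1 k i : normc (h k i) <= 1.
  by rewrite /h; case: ifP => // _; apply: le_trans (normc_cround_le _ m0) _.
have M0 : 0 <= M by apply: le_trans (normc_ge0 _) (H v v1).
have step k : (k <= n)%N -> normc (bpol c v - bpol c (h k)) <= k%:R * (6 * M * (2 / m%:R)).
  elim: k => [|k IH] kn.
    by rewrite (_ : h 0%N = v) ?subrr ?normc0 ?mul0r//; apply/funext => i; rewrite /h ltn0.
  rewrite -[k.+1%:R]natr1 mulrDl mul1r.
  rewrite (_ : _ - _ = (bpol c v - bpol c (h k)) + (bpol c (h k) - bpol c (h k.+1))); last by ring.
  apply: le_trans (le_normcD _ _) _; apply: lerD; first exact: IH (ltnW kn).
  have e1 : h k = subst1 (h k) (Ordinal kn) (v k).
    by apply/funext => i; rewrite /subst1 /h; case: eqP => //= ->; rewrite ltnn.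
  have e2 : h k.+1 = subst1 (h k) (Ordinal kn) (cround m (v k)).
    apply/funext => i; rewrite /subst1 /h /= ltnS leq_eqVlt; case: eqP => //= ->.
    by [].
  rewrite e2 [in X in X - _]e1; apply: le_trans (bpol_lipschitz _ H (h1 k) (v1 k) _) _.
    by apply: le_trans (normc_cround_le _ m0) _.
  by rewrite ler_wpM2l ?mulr_ge0// normc_cround_dist.
have hn : bpol c (h n) = bpol c (fun i => cround m (v i)).
  by apply: eq_bigr => f _; congr (_ * _); apply: eq_bigr => i _; rewrite /h ltn_ord.
by rewrite -hn; exact: step.
Qed.

Lemma bpol_bound c v : (forall i, normc (v i) <= 1) -> normc (bpol c v) <= \sum_(f : E) normc (c f).
Proof.
move=> v1; apply: le_trans (normc_sum _ _ _) _; apply: ler_sum => f _.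
rewrite normcM ler_piMr ?normc_ge0// normc_prod; apply: prodr_ile1 => i _.
by rewrite normcX exprn_ge0 ?exprn_ile1 ?normc_ge0.
Qed.

(* Half of the supremum over the polydisc is attained on the net of mesh 1/(24n). *)
Lemma bpol_sup_le c B : (0 < n)%N ->
  (forall v, (forall i, normc (v i) <= 1) -> normc (bpol c (fun i => cround (24 * n) (v i))) <= B) ->
  forall v, (forall i, normc (v i) <= 1) -> normc (bpol c v) <= 2 * B.
Proof.
move=> n0 hB.
pose S := [set normc (bpol c v) | v in [set v : nat -> C | forall i, normc (v i) <= 1]].
have hS : has_sup S.
  split; first by exists (normc (bpol c (fun=> 0))); exists (fun=> 0) => // i; rewrite normc0.
  by exists (\sum_(f : E) normc (c f)) => _ [v v1 <-]; exact: bpol_bound.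
have Sub v : (forall i, normc (v i) <= 1) -> normc (bpol c v) <= sup S.
  by move=> v1; apply: ub_le_sup; [case: hS|exists v].
suff h : sup S <= 2 * B by move=> v v1; apply: le_trans (Sub v v1) h.
have m0 : (0 < 24 * n)%N by rewrite muln_gt0.
(* The rounding error, n times 6 sup S times 2 / (24 n), is half the supremum and is absorbed on the
   left. *)
have : sup S <= B + sup S / 2.
  apply: ge_sup; first by case: hS.
  move=> _ [v v1 <-]; have := bpol_net m0 Sub v1.
  have -> : n%:R * (6 * sup S * (2 / (24 * n)%:R)) = sup S / 2.
    by rewrite natrM; field; rewrite pnatr_eq0 -lt0n.
  move=> h; rewrite -[bpol c v](subrK (bpol c (fun i => cround (24 * n) (v i)))).
  apply: le_trans (le_normcD _ _) _; rewrite addrC; apply: lerD => //; exact: hB.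
by set x := sup S; lra.
Qed.

(** Logarithm of the number of terms in a union bound: all points of the net, and at each the four
    functionals plus and minus the real and the imaginary part. *)
Definition net_log : R := ln (4 * (#|{: {ffun 'I_n -> 'I_(24 * n).*2.+1 * 'I_(24 * n).*2.+1}}|)%:R).

(** A Chernoff bound at all points of the net at once. As l^2 A = L, the exponentials sum to at most
    exp(L + 3 L), so each functional [D] is at most 4 L / l = 4 sqrt(L A). Adding real and imaginary
    parts doubles this, and so does the passage from the net to the polydisc, which gives 16. *)
Lemma random_bpol (a : E -> R) : (0 < n)%N -> (forall f, 0 <= a f) -> 0 < \sum_f a f ^+ 2 ->
  exists e : E -> R, (forall f, e f ^+ 2 = 1) /\
    forall v, (forall i, normc (v i) <= 1) ->
      normc (bpol (fun f => (e f * a f)%:C) v) <= 16 * Num.sqrt (net_log * \sum_f a f ^+ 2).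
Proof.
move=> n0 a0; set A := \sum_f _ => A0.
pose m := (24 * n)%N.
pose G := {ffun 'I_n -> 'I_m.*2.+1 * 'I_m.*2.+1}.
have G0 : (0 < #|{: G}|)%N by apply/card_gt0P; exists [ffun=> (ord0, ord0)].
have G1 : 1 <= (#|{: G}|)%:R :> R by rewrite ler1n.
set L := net_log; have L0 : 0 < L.
  by rewrite /L /net_log -/m -/G ln_gt0//; lra.
pose pt (g : G) : nat -> C := fun i => if insub i is Some j then gpoint R (g j) else 0.
have pt1 g i : normc (pt g i) <= 1.
  by rewrite /pt; case: insubP => [j _ _|_]; rewrite ?normc_gpoint// normc0.
pose mon (f : E) (g : G) : C := \prod_(i < n) pt g i ^+ f i.
have mon1 f g : normc (mon f g) <= 1.
  rewrite normc_prod; apply: prodr_ile1 => i _.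
  by rewrite normcX exprn_ge0 ?exprn_ile1 ?normc_ge0.
pose D (d : bool * bool) (x : C) : R := (if d.1 then 1 else -1) * (if d.2 then complex.Re x else complex.Im x).
have D1 d x : `|D d x| <= normc x.
  rewrite /D normrM; case: d => [[] []] /=; rewrite ?normrN normr1 mul1r ?Re_le_normc ?Im_le_normc//.
pose l := Num.sqrt (L / A); have LA : 0 < L / A by rewrite divr_gt0.
have l0 : 0 < l by rewrite sqrtr_gt0.
have l2 : l ^+ 2 * A = L by rewrite sqr_sqrtr ?ltW// mulfVK ?gt_eqF.
pose GB : finType := (G * (bool * bool))%type.
pose X (f : E) (g : GB) : R := l * a f * D g.2 (mon f g.1).
have [|//|e [e1 he]] := @ex_signs R GB E (index_enum E) (fun=> 1) X.
  exact: index_enum_uniq.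
exists e; split => // .
pose P g := bpol (fun f => (e f * a f)%:C) (pt g).
have hP g d : l * D d (P g) <= 4 * L.
  have DP : l * D d (P g) = \sum_f e f * X f (g, d).
    rewrite /P /bpol /X /D /= !cRe_sum !cIm_sum; case: d => d1 []; rewrite /= mulr_sumr mulr_sumr;
    apply: eq_bigr => f _; rewrite -/(mon f g) ?cReM ?cImM /=; ring.
  rewrite DP -ler_expR; apply: le_trans (_ : _ <= \sum_(g : GB) 1 * expR (\sum_f e f * X f g)) _.
    by rewrite (bigD1 (g, d))//= mul1r lerDl; apply: sumr_ge0 => x _; rewrite mul1r expR_ge0.
  apply: le_trans he _.
  apply: (@le_trans _ _ (\sum_(g : GB) expR (3 * L))).
    apply: ler_sum => x _; rewrite mul1r -l2 mulrA mulr_sumr expR_sum.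
    apply: ler_prod => f _; rewrite divr_ge0 ?addr_ge0 ?expR_ge0//=.
    apply: le_trans (cosh_le _) _; rewrite ler_expR -mulrA ler_wpM2l// /X exprMn -exprMn [leRHS](_ : _ = (l * a f) ^+ 2); last by rewrite exprMn.
    rewrite [leLHS]exprMn; apply: ler_piMr; first exact: sqr_ge0.
    rewrite -[D _ _ ^+ 2]real_normK ?num_real// expr_le1//; exact: le_trans (D1 _ _) (mon1 _ _).
  rewrite sumr_const card_prod card_prod card_bool.
  have -> : 4 * L = L + 3 * L by ring.
  rewrite expRD -[leLHS]mulr_natl; apply: ler_wpM2r; first exact: expR_ge0.
  have -> : expR L = 4 * (#|{: G}|)%:R by rewrite lnK// posrE; lra.
  by rewrite natrM mulrC.
have lA : 4 * L / l = 4 * Num.sqrt (L * A).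
  rewrite (_ : L * A = (l * A) ^+ 2); last by rewrite -l2; ring.
  rewrite sqrtr_sqr ger0_norm ?mulr_ge0 ?ltW// -{1}l2; field; exact: lt0r_neq0.
rewrite (_ : 16 * _ = 2 * (2 * (4 * Num.sqrt (L * A)))); last by ring.
apply: bpol_sup_le => // v v1.
have [g gE] : exists g : G, forall i : 'I_n, cround m (v i) = pt g i.
  have m0 : (0 < m)%N by rewrite muln_gt0.
  pose F (i : 'I_n) := projT1 (cid (cround_grid m0 (v1 i))).
  exists [ffun i => F i] => i; rewrite /pt valK ffunE.
  exact: projT2 (cid (cround_grid m0 (v1 i))).
have -> : bpol (fun f => (e f * a f)%:C) (fun i => cround m (v i)) = P g.
  by apply: eq_bigr => f _; congr (_ * _); apply: eq_bigr => i _; rewrite gE.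
have hD d : D d (P g) <= 4 * Num.sqrt (L * A).
  by rewrite -lA ler_pdivlMr// mulrC; exact: hP.
apply: le_trans (normc_le_ReIm _) _; rewrite [leRHS]mulrDl !mul1r; apply: lerD; rewrite ler_norml; apply/andP; split.
- by have := hD (false, true); rewrite /D /= mulN1r lerNl.
- by have := hD (true, true); rewrite /D /= mul1r.
- by have := hD (false, false); rewrite /D /= mulN1r lerNl.
- by have := hD (true, false); rewrite /D /= mul1r.
Qed.

End kahane_salem_zygmund.

(** * The upper inclusion *)

Section majorized_Bbar.
Variable R : realType.
Local Notation C := (R[i]).

Section box_indices.
Variable S : seq nat.
Let n := size S.
Local Notation E := {ffun 'I_n -> 'I_4}.

Definition box_idx (f : E) : multi_index :=
  mkidx (\max_(j <- S) j).+1 (fun j => if insub (index j S) is Some i then (f i : nat)%:Z else 0).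

Lemma box_idxE (us : uniq S) (f : E) (i : 'I_n) : box_idx f (nth 0%N S i) = f i.
Proof.
rewrite mkidxE ifT; last by rewrite ltnS (big_rem (nth 0%N S i)) ?mem_nth//= leq_maxl.
by rewrite index_uniq// valK.
Qed.

Lemma box_idx_out (f : E) j : j \notin S -> box_idx f j = 0.
Proof.
move=> jS; rewrite mkidxE; case: ifP => // _.
by rewrite insubF// memNindex// ltnn.
Qed.

Lemma box_idx_nonneg f : nonneg_index (box_idx f).
Proof. by move=> j; rewrite mkidxE; case: ifP => // _; case: insub. Qed.

Lemma box_idx_inj : uniq S -> injective box_idx.
Proof.
move=> us f g fg; apply/ffunP => i; apply: val_inj.
by have := congr1 (fun a : multi_index => a (nth 0%N S i)) fg; rewrite /= !box_idxE// => -[].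
Qed.

Lemma monomial_box (us : uniq S) (z : nat -> C) f :
  monomial z (box_idx f) = \prod_(i < n) z (nth 0%N S i) ^+ f i.
Proof.
have e : \prod_(i < n) z (nth 0%N S i) ^+ f i = \prod_(j <- S) z j ^ box_idx f j.
  rewrite (big_nth 0%N) big_mkord; apply: eq_bigr => i _.
  by rewrite (box_idxE us).
rewrite e /monomial [RHS](bigID (fun j => j \in finsupp (box_idx f)))/= [X in _ = _ * X]big1 ?mulr1; last first.
  by move=> j; rewrite mem_finsupp negbK => /eqP ->; rewrite expr0z.
rewrite -[RHS]big_filter; apply: perm_big; apply: uniq_perm.
- exact: fset_uniq.
- by rewrite filter_uniq.
- move=> j; rewrite mem_filter; case: (boolP (j \in finsupp _)) => // hj /=.
  apply/esym; apply: contraLR hj => jS; rewrite mem_finsupp negbK.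
  by rewrite box_idx_out.
Qed.

(** With coefficients of modulus a_f = |z^f| and random signs, the monomial sum at [z] is A = sum
    a_f^2, while the supremum is only of order sqrt(A L), L being [net_log]. So A <= 16 K sqrt(A L),
    which is solved for A; and A factors into the product over [S]. *)
Lemma majorized_box_sum (z : nat -> C) (K : R) : uniq S -> (0 < n)%N -> 0 <= K ->
  (forall s c M, uniq s -> (forall a, a \in s -> nonneg_index a) ->
    (forall w, (forall j, normc (w j) = 1) -> normc (peval s c w) <= M) ->
    \sum_(a <- s) normc (c a * monomial z a) <= K * M) ->
  \prod_(j <- S) (1 + normc (z j) ^+ 2 + (normc (z j) ^+ 2) ^+ 2 + (normc (z j) ^+ 2) ^+ 3)
    <= 256 * K ^+ 2 * net_log R n.
Proof.
move=> us n0 K0 H; pose a (f : E) := \prod_(i < n) normc (z (nth 0%N S i)) ^+ f i.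
have a0 f : 0 <= a f by apply: prodr_ge0 => i _; rewrite exprn_ge0 ?normc_ge0.
have AE : \sum_f a f ^+ 2 = \prod_(j <- S) (1 + normc (z j) ^+ 2 + (normc (z j) ^+ 2) ^+ 2 + (normc (z j) ^+ 2) ^+ 3).
  rewrite (big_nth 0%N) big_mkord (eq_bigr (fun i : 'I_n => \sum_(k < 4) (normc (z (nth 0%N S i)) ^+ 2) ^+ k)).
    rewrite bigA_distr_bigA /=; apply: eq_bigr => f _.
    by rewrite /a -prodrXl; apply: eq_bigr => i _; rewrite exprAC.
  by move=> i _; rewrite !big_ord_recr big_ord0 /= add0r expr0 expr1.
rewrite -AE; set A := \sum_f _.
have A1 : 1 <= A.
  rewrite /A (bigD1 [ffun=> ord0])//= (_ : a _ = 1); last first.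
    by rewrite /a big1// => i _; rewrite ffunE expr0.
  by rewrite expr1n lerDl; apply: sumr_ge0 => f _; exact: sqr_ge0.
have A0 : 0 < A by lra.
have [e [e1 he]] := random_bpol n0 a0 A0.
pose s := [seq box_idx f | f <- index_enum E].
pose c b : C := if [pick f | box_idx f == b] is Some f then (e f * a f)%:C else 0.
have cE f : c (box_idx f) = (e f * a f)%:C.
  rewrite /c; case: pickP => [g /eqP/(box_idx_inj us) ->//|/(_ f)]; by rewrite eqxx.
have us' : uniq s by rewrite map_inj_uniq ?index_enum_uniq//; exact: box_idx_inj.
have s0 b : b \in s -> nonneg_index b by move=> /mapP[f _ ->]; exact: box_idx_nonneg.
have pE w : peval s c w = bpol (fun f => (e f * a f)%:C) (fun i => w (nth 0%N S i)).
  by rewrite /peval /s big_map; apply: eq_bigr => f _; rewrite cE monomial_box.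
have := H s c _ us' s0 (fun w w1 => _).
move=> /(_ (16 * Num.sqrt (net_log R n * A))) H'.
have {H'} : \sum_(b <- s) normc (c b * monomial z b) <= K * (16 * Num.sqrt (net_log R n * A)).
  apply: H => // w w1; rewrite pE; apply: he => i; by rewrite w1.
rewrite /s big_map (eq_bigr (fun f => a f ^+ 2)); last first.
  move=> f _; rewrite cE monomial_box// !normcM normc_real normrM (ger0_norm (a0 f)).
  have -> : `|e f| = 1 by apply/eqP; rewrite -(@eqrXn2 _ 2)// real_normK ?num_real// e1 expr1n.
  by rewrite mul1r normc_prod expr2; congr (_ * _); apply: eq_bigr => i _; rewrite normcX.
rewrite -/A => h.
have L0 : 0 <= net_log R n * A.
  rewrite leNgt; apply/negP => h0; move: h; rewrite ler0_sqrtr ?(ltW h0)// !mulr0; lra.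
have : A ^+ 2 <= 256 * K ^+ 2 * net_log R n * A.
  apply: (@le_trans _ _ ((K * (16 * Num.sqrt (net_log R n * A))) ^+ 2)).
    by rewrite lerXn2r ?nnegrE ?(ltW A0)// mulr_ge0// mulr_ge0 ?sqrtr_ge0.
  rewrite !exprMn sqr_sqrtr// le_eqVlt; apply/orP; left; apply/eqP; ring.
by rewrite expr2 ler_pM2r.
Qed.

End box_indices.

Lemma ln_le_expR (e x : R) : 0 < e -> 0 < x -> ln x <= e^-1 * expR (e * ln x).
Proof.
move=> e0 x0; rewrite ler_pdivlMl//; apply: le_trans (expR_ge1Dx _).
by rewrite lerDr.
Qed.

(** The order n log n of [net_log] is relaxed to n^(1 + e), as only the exponent of n matters once
    logarithms are taken and divided by log n. The number 49 comes from 2 (24 n) + 1 <= 49 n. *)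
Lemma net_log_le (e : R) : 0 < e -> exists2 K : R, 0 < K & forall n, (0 < n)%N ->
  net_log R n <= K * expR ((1 + e) * ln n%:R).
Proof.
move=> e0; pose Q := 2 * e^-1 * expR (e * ln 49%:R).
have Q0 : 0 < Q by rewrite mulr_gt0 ?expR_gt0// mulr_gt0 ?invr_gt0.
exists (ln 4 + Q) => [|n n0]; first by rewrite addr_gt0// ln_gt0; lra.
have n1 : 1 <= n%:R :> R by rewrite ler1n.
have n0' : 0 < n%:R :> R by rewrite ltr0n.
have l0 : 0 <= ln n%:R :> R by rewrite ln_ge0.
rewrite /net_log card_ffun card_prod !card_ord natrX natrM -expr2 -exprM.
set q := ((24 * n).*2.+1)%:R.
have q0 : 0 < q :> R by rewrite ltr0n.
rewrite lnM ?posrE ?exprn_gt0// lnXn// -[ln q *+ _]mulr_natr natrM.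
have qn : q <= 49%:R * n%:R by rewrite -natrM ler_nat; lia.
have lq : ln q <= e^-1 * (expR (e * ln 49%:R) * expR (e * ln n%:R)).
  apply: (@le_trans _ _ (ln (49%:R * n%:R))); first by rewrite ler_ln ?posrE// mulr_gt0.
  apply: le_trans (ln_le_expR e0 _) _; first by rewrite mulr_gt0.
  by rewrite lnM ?posrE// mulrDr expRD.
rewrite [leRHS]mulrDl; apply: lerD.
  rewrite ler_peMr ?ln_ge0//; first by lra.
  by rewrite -[leLHS]expR0 ler_expR; apply: mulr_ge0 => //; lra.
rewrite [(1 + e) * _]mulrDl mul1r expRD lnK ?posrE//.
have -> : Q * (n%:R * expR (e * ln n%:R)) = e^-1 * (expR (e * ln 49%:R) * expR (e * ln n%:R)) * (2 * n%:R).
  by rewrite /Q; ring.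
by rewrite ler_wpM2r.
Qed.

Lemma majorized_sum_sqr (z : ell_infty R) (e : R) : unit_ball R z -> poly_majorized z -> 0 < e ->
  exists K : R, forall S : seq nat, uniq S -> (0 < size S)%N ->
    \sum_(j <- S) normc (z j) ^+ 2 <= K + (1 + e) * ln (size S)%:R.
Proof.
move=> z1 [C0 C00 H] e0; have [L L0 hL] := net_log_le e0.
(* Made positive, because its logarithm is taken. *)
pose C1 := C0 + 1; have C1p : 0 < C1 by rewrite /C1; lra.
exists (ln (256 * C1 ^+ 2 * L)) => S us S0.
have H1 s c M : uniq s -> (forall a, a \in s -> nonneg_index a) ->
    (forall w, (forall j, normc (w j) = 1) -> normc (peval s c w) <= M) ->
    \sum_(a <- s) normc (c a * monomial z a) <= C1 * M.
  move=> us' s0 hM; apply: le_trans (H s c M us' s0 hM) _; rewrite ler_wpM2r ?lerDl//.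
  by apply: le_trans (normc_ge0 _) (hM (fun=> 1) (fun=> normc1 R)).
have h := majorized_box_sum us S0 (ltW C1p) H1.
have p256 : 0 < 256 :> R by rewrite ltr0n.
have x0 : 0 < 256 * C1 ^+ 2 * L.
  by apply: mulr_gt0 L0; apply: mulr_gt0 p256 _; exact: exprn_gt0.
rewrite -ler_expR expRD lnK ?posrE// expR_sum.
apply: le_trans (_ : _ <= 256 * C1 ^+ 2 * net_log R (size S)) _; last first.
  rewrite -[leRHS]mulrA; apply: ler_wpM2l; last exact: hL.
  by apply: mulr_ge0 (ltW p256) _; exact: sqr_ge0.
apply: le_trans h; apply: ler_prod => j _; rewrite expR_ge0 /=.
apply: expR_le_cubic; rewrite sqr_ge0 expr_le1 ?normc_ge0//.
exact/ltW/unit_ball_lt1.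
Qed.

Lemma majorized_Bbar (z : ell_infty R) : unit_ball R z -> poly_majorized z -> Bbar_set R z.
Proof.
move=> z1 zm; split => //; apply/lee_addgt0Pr => e e0.
have e20 : 0 < e / 2 by rewrite divr_gt0.
have [K hK] := majorized_sum_sqr z1 zm e20.
(* From [n0] on, |K| <= (e / 2) ln n; the two successors also ensure n > 1, so that ln n > 0. *)
pose n0 := (Num.truncn (expR (`|K| / (e / 2)))).+2.
rewrite limn_esup_lim (cvg_lim _ (@cvg_esups_inf _ _))//.
apply: le_trans (ereal_inf_lbound _) _; first by exists n0.
apply: ge_ereal_sup => _ [n /= nn0 <-]; rewrite -EFinD lee_fin /log_mean.
have n1 : (1 < n)%N by apply: leq_trans nn0.
have l0 : 0 < ln n%:R :> R by rewrite ln_gt0// ltr1n.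
rewrite ler_pdivrMl//; apply: (@le_trans _ _ (K + (1 + e / 2) * ln n%:R)).
  by apply: rearr_sum_le => s us sn; rewrite -sn; apply: hK => //; rewrite sn; exact: ltnW.
have : K <= e / 2 * ln n%:R.
  rewrite mulrC -ler_pdivrMr//; apply: le_trans (_ : _ <= `|K| / (e / 2)) _.
    by rewrite ler_wpM2r ?ler_norm// invr_ge0 ltW.
  rewrite -ler_expR lnK ?posrE ?ltr0n; last exact: ltnW n1.
  by apply: le_trans (ltW (truncnS_gt _)) _; rewrite ler_nat; exact: ltnW.
by set x := ln _; lra.
Qed.

(** Otherwise n d^2 <= K + 2 ln n for every n. Functions on the ball are continuous in norm only,
    and this makes the truncations of [z] converge to [z] in norm. *)
Lemma majorized_c0 (z : ell_infty R) (d : R) : unit_ball R z -> poly_majorized z -> 0 < d ->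
  exists N, forall j, (N <= j)%N -> normc (z j) < d.
Proof.
move=> z1 zm d0; apply: contrapT => h.
have {}h N : exists j, (N <= j)%N /\ d <= normc (z j).
  apply: contrapT => hN; apply: h; exists N => j Nj; rewrite ltNge; apply/negP => dj.
  by apply: hN; exists j.
have [K hK] := majorized_sum_sqr z1 zm ltr01.
have hS n : exists S : seq nat, [/\ uniq S, size S = n & forall j, j \in S -> d <= normc (z j)].
  elim: n => [|n [S [us sn hS]]]; first by exists [::].
  have [j [Nj dj]] := h (\max_(j <- S) j).+1; exists (j :: S); split => /=.
  - rewrite us andbT; apply/negP => jS; move: Nj; rewrite ltnNge (big_rem _ jS) /=.
    by rewrite leq_maxl.
  - by rewrite sn.
  - by move=> i; rewrite inE => /orP[/eqP ->|/hS].
have lin n : (0 < n)%N -> n%:R * d ^+ 2 <= K + 2 * ln n%:R.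
  move=> n0; have [S [us sn hd]] := hS n.
  have := hK S us; rewrite sn (_ : 1 + 1 = 2)// => /(_ n0); apply: le_trans.
  rewrite -sn mulr_natl -sumr_const_seq big_seq [leRHS]big_seq; apply: ler_sum => j /hd dj.
  by rewrite lerXn2r ?nnegrE ?normc_ge0// ltW.
pose D := d ^+ 2; have D0 : 0 < D by rewrite exprn_gt0.
pose k := (Num.truncn ((`|K| + 4) / D)).+1.
have k0 : 1 <= k%:R :> R by rewrite ler1n.
have hk : `|K| + 4 < k%:R * D by rewrite -ltr_pdivrMr// truncnS_gt.
have lk : ln k%:R <= k%:R :> R.
  rewrite -[leRHS]lnK ?posrE ?ltr0n//; apply: le_trans _ (expR_ge1Dx _).
  by rewrite lerDr.
(* At n = k^2 the right-hand side is K + 4 ln k, at most linear in [k], against k^2 d^2 on the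
   left. *)
have := lin (k ^ 2)%N; rewrite expn_gt0 => /(_ isT).
rewrite natrX lnXn ?ltr0n// leNgt => /negP; apply.
have h1 : k%:R * (`|K| + 4) < k%:R ^+ 2 * d ^+ 2.
  by rewrite expr2 -mulrA ltr_pM2l// (lt_le_trans ltr01).
apply: le_lt_trans h1; rewrite [k%:R * (_ + _)]mulrDr; apply: lerD.
  by apply: le_trans (ler_norm _) _; rewrite ler_peMl.
by rewrite -mulr_natr; move: lk; set x := ln _; set y := k%:R; lra.
Qed.

End majorized_Bbar.

(** * Absolute sums and uniqueness of the coefficients *)

Section absolute_sums.
Variables (R : realType) (I : choiceType) (A : set I).
Implicit Types (s : seq I) (u : I -> R[i]) (h : I -> R).

Let filter_totally : Filter (@totally I).
Proof. by have [] := @totally_filter I. Qed.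

Lemma partial_sumE (V : zmodType) (F : I -> V) (X : {fset I}) :
  partial_sum F X = \sum_(i <- X) F i.
Proof. by rewrite /partial_sum big_seq_fsetE. Qed.

Lemma sum_sub_split (V : zmodType) s t (F : I -> V) : uniq s -> uniq t -> {subset s <= t} ->
  \sum_(i <- t) F i = \sum_(i <- s) F i + \sum_(i <- t | i \notin s) F i.
Proof.
move=> us ut st; rewrite (bigID (fun i => i \in s))/=; congr (_ + _).
rewrite -big_filter; apply: perm_big; apply: uniq_perm => //; first by rewrite filter_uniq.
by move=> i; rewrite mem_filter andb_idr//; exact: st.
Qed.

Lemma sum_tail h L (e : R) : 0 < e -> (forall i, 0 <= h i) ->
  (forall s, uniq s -> (forall i, i \in s -> A i) -> \sum_(i <- s) h i <= L) ->
  exists s0, [/\ uniq s0, forall i, i \in s0 -> A i &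
    forall t, uniq t -> (forall i, i \in t -> A i) -> {subset s0 <= t} ->
      \sum_(i <- t | i \notin s0) h i <= e].
Proof.
move=> e0 h0 hL.
pose S := [set \sum_(i <- s) h i | s in [set s | uniq s /\ forall i, i \in s -> A i]].
have hS : has_sup S.
  split; first by exists (\sum_(i <- [::]) h i); exists [::].
  by exists L => _ [s [us sA] <-]; exact: hL.
have [_ [s0 [us0 s0A] <-] hs] := sup_adherent e0 hS.
exists s0; split => // t ut tA s0t.
have := sum_sub_split h us0 ut s0t.
have : \sum_(i <- t) h i <= sup S by apply: ub_le_sup; [case: hS|exists t].
move: hs; set x := \sum_(i <- s0) _; set y := \sum_(i <- t) _; set v := \sum_(i <- t | _) _; lra.
Qed.

(** Bounded sums of moduli leave small tails outside some finite set. Hence it is enough that every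
    finite set is contained in one whose sum is close to [l], instead of all large sets having this
    property. *)
Lemma abs_sums_intro u (l : R[i]) L :
  (forall s, uniq s -> (forall i, i \in s -> A i) -> \sum_(i <- s) normc (u i) <= L) ->
  (forall (e : R) s, 0 < e -> (forall i, i \in s -> A i) -> exists t,
    [/\ uniq t, forall i, i \in t -> A i, {subset s <= t} & normc (l - \sum_(i <- t) u i) <= e]) ->
  abs_sums_to A u l.
Proof.
move=> hL hl; split; first exact: le_lt_trans (esum_bounded hL) (ltry _).
apply/(cvgc_normP (FF := filter_totally)) => e e0.
have e3 : 0 < e / 3 by rewrite divr_gt0.
have [s0 [us0 s0A tl]] := sum_tail e3 (fun i => normc_ge0 (u i)) hL.
exists [fset x in s0]%fset => // X /= s0X.
rewrite partial_sumE.
pose s := [seq i <- X | i \in A].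
have -> : \sum_(i <- X) (if i \in A then u i else 0) = \sum_(i <- s) u i.
  by rewrite /s big_filter -big_mkcond.
have us : uniq s by rewrite filter_uniq// fset_uniq.
have sA i : i \in s -> A i by rewrite mem_filter => /andP[/set_mem].
have s0s : {subset s0 <= s}.
  move=> i is0; rewrite mem_filter (mem_set (s0A i is0)) /=.
  by apply: (fsubsetP s0X); rewrite inE.
have [t [ut tA st ht]] := hl (e / 3) s e3 sA.
have h1 := sum_sub_split u us ut st.
have h2 : normc (\sum_(i <- t | i \notin s) u i) <= e / 3.
  apply: le_trans (normc_sum _ _ _) _.
  have := tl t ut tA (fun i hi => st i (s0s i hi)); apply: le_trans.
  rewrite big_mkcond [leRHS]big_mkcond; apply: ler_sum => i _.
  case: ifPn => [h|_]; last by case: ifP => // _; exact: normc_ge0.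
  by rewrite ifT//; apply: contra h; exact: s0s.
rewrite (_ : l - _ = (l - \sum_(i <- t) u i) + \sum_(i <- t | i \notin s) u i); last by rewrite h1; ring.
apply: le_lt_trans (le_normcD _ _) _; move: ht h2; set x := normc _; set y := normc _; lra.
Qed.

Lemma abs_sums_bounded u l : abs_sums_to A u l -> exists L : R, forall s, uniq s ->
  (forall i, i \in s -> A i) -> \sum_(i <- s) normc (u i) <= L.
Proof. by move=> [h _]; apply: esum_lty_bounded h => i; exact: normc_ge0. Qed.

Lemma abs_sums_approx u l (e : R) s : abs_sums_to A u l -> 0 < e -> (forall i, i \in s -> A i) ->
  exists t, [/\ uniq t, forall i, i \in t -> A i, {subset s <= t} & normc (l - \sum_(i <- t) u i) <= e].
Proof.
move=> [_ /(cvgc_normP (FF := filter_totally)) h0] e0 sA; have [X0 _ hX] := h0 e e0.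
pose X := ([fset x in s] `|` X0)%fset.
have := hX X; rewrite /= fsubsetUr => /(_ isT).
rewrite partial_sumE -big_mkcond -big_filter => hs.
exists [seq i <- X | i \in A]; split.
- by rewrite filter_uniq// fset_uniq.
- by move=> i; rewrite mem_filter => /andP[/set_mem].
- by move=> i is_; rewrite mem_filter (mem_set (sA i is_)) /= !inE is_.
- exact: ltW.
Qed.

(** The set [s0] depends only on the moduli [h], and so serves all families with these moduli; in
    [coef_unique] this gives uniformity over the torus. *)
Lemma abs_sums_tail u l h (e : R) s0 : abs_sums_to A u l -> (forall i, normc (u i) = h i) ->
  (forall t, uniq t -> (forall i, i \in t -> A i) -> {subset s0 <= t} ->
      \sum_(i <- t | i \notin s0) h i <= e) ->
  forall s, uniq s -> (forall i, i \in s -> A i) -> {subset s0 <= s} ->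
  normc (l - \sum_(i <- s) u i) <= e.
Proof.
move=> hu uh tl s us sA s0s; apply/ler_addgt0Pl => d d0.
have [t [ut tA st ht]] := abs_sums_approx hu d0 sA.
rewrite (_ : l - _ = (l - \sum_(i <- t) u i) + \sum_(i <- t | i \notin s) u i); last first.
  by rewrite (sum_sub_split u us ut st); ring.
apply: le_trans (le_normcD _ _) _; apply: lerD => //.
apply: le_trans (normc_sum _ _ _) _.
have := tl t ut tA (fun i hi => st i (s0s i hi)); apply: le_trans.
rewrite big_mkcond [leRHS]big_mkcond; apply: ler_sum => i _; rewrite uh.
have hi : 0 <= h i by rewrite -uh normc_ge0.
case: ifPn => [h'|_]; last by case: ifP.
by rewrite ifT//; apply: contra h'; exact: s0s.
Qed.

End absolute_sums.

Section uniqueness.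
Variable R : realType.
Local Notation C := (R[i]).
Implicit Types (a b : multi_index) (v : nat -> C).

Definition trunc (k : nat) v : nat -> C := fun j => if (j < k)%N then v j else 0.

Lemma monomial_trunc k v a : nonneg_index_lt k a -> monomial (trunc k v) a = monomial v a.
Proof.
move=> [_ ak]; apply: monomial_eq => j aj; rewrite /trunc; case: ltnP => // kj.
by rewrite (ak j kj) eqxx in aj.
Qed.

Lemma monomial_trunc0 k v a : nonneg_index a -> ~ nonneg_index_lt k a -> monomial (trunc k v) a = 0.
Proof.
move=> a0 ak; have [j kj aj] : exists2 j, (k <= j)%N & a j != 0.
  apply: contrapT => h; apply: ak; split => // j kj; apply/eqP; rewrite -[_ == _]negbK.
  by apply/negP => aj; apply: h; exists j.
rewrite (monomial_nat _ a0 (@idx_boundP a)).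
have jb : (j < idx_bound a)%N.
  by rewrite ltnNge; apply/negP => h; rewrite (idx_boundP h) eqxx in aj.
rewrite (bigD1 (Ordinal jb))//= /trunc ltnNge kj /= expr0n absz_eq0 (negbTE aj) mul0r.
by [].
Qed.

(** On a torus the moduli of the terms do not depend on the point, so the tails are uniform. The
    difference of the two expansions, cut off to a finite set, is then a uniformly small polynomial,
    and so is its coefficient (c b - c' b) q b. *)
Lemma coef_unique k (rho : R) (c c' : multi_index -> C) (g : torus R -> C) : 0 < rho ->
  (forall w, abs_sums_to (nonneg_index_lt k)
    (fun a => c a * monomial (trunc k (fun j => rho%:C * tval w j)) a) (g w)) ->
  (forall w, abs_sums_to (nonneg_index_lt k)
    (fun a => c' a * monomial (trunc k (fun j => rho%:C * tval w j)) a) (g w)) ->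
  forall a, nonneg_index_lt k a -> c a = c' a.
Proof.
move=> r0 hc hc' b kb.
pose q a : C := monomial (trunc k (fun=> rho%:C)) a.
have zE w a : monomial (trunc k (fun j => rho%:C * tval w j)) a = q a * monomial (tval w) a.
  rewrite /q -monomialM; congr monomial; apply/funext => j; rewrite /trunc.
  by case: ifP => // _; rewrite mul0r.
have nE (d : multi_index -> C) w a :
    normc (d a * monomial (trunc k (fun j => rho%:C * tval w j)) a) = normc (d a * q a).
  by rewrite zE mulrA normcM normc_tmonomial mulr1.
pose w0 : torus R := to_torus (fun=> 1).
have tails (d : multi_index -> C) (e : R) : 0 < e -> (forall w, abs_sums_to (nonneg_index_lt k)
    (fun a => d a * monomial (trunc k (fun j => rho%:C * tval w j)) a) (g w)) ->
    exists s0, [/\ uniq s0, forall a, a \in s0 -> nonneg_index_lt k a &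
    forall w s, uniq s -> (forall a, a \in s -> nonneg_index_lt k a) -> {subset s0 <= s} ->
      normc (g w - \sum_(a <- s) d a * (q a * monomial (tval w) a)) <= e].
  move=> e0 hd; have [L hL] := abs_sums_bounded (hd w0).
  have hL' s : uniq s -> (forall a, a \in s -> nonneg_index_lt k a) ->
      \sum_(a <- s) normc (d a * q a) <= L.
    by move=> us sA; apply: le_trans (hL s us sA); apply: ler_sum => a _; rewrite (nE d w0).
  have [s0 [us0 s0A tl]] := sum_tail e0 (fun a => normc_ge0 (d a * q a)) hL'.
  exists s0; split => // w s us sA s0s.
  have := abs_sums_tail (hd w) (nE d w) tl us sA s0s.
  by rewrite (eq_bigr (fun a => d a * (q a * monomial (tval w) a)))// => a _; rewrite zE.
have q0 : 0 < normc (q b).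
  rewrite normc_gt0 /q (monomial_trunc _ kb) /monomial prodf_seq_neq0; apply/allP => j _ /=.
  by apply: expfz_neq0; rewrite -normc_gt0 normc_real normr_gt0 gt_eqF.
suff : normc (c b - c' b) * normc (q b) <= 0.
  rewrite pmulr_lle0// => h; apply/eqP; rewrite -subr_eq0 -normc_eq0 eq_le h /=.
  exact: normc_ge0.
apply/ler_addgt0Pl => e e0; rewrite addr0; have e2 : 0 < e / 2 by rewrite divr_gt0.
have [s1 [us1 s1A h1]] := tails c _ e2 hc; have [s2 [us2 s2A h2]] := tails c' _ e2 hc'.
pose s := undup (b :: s1 ++ s2).
have us : uniq s by exact: undup_uniq.
have sA a : a \in s -> nonneg_index_lt k a.
  by rewrite mem_undup inE mem_cat => /or3P[/eqP ->//|/s1A|/s2A].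
have s1s : {subset s1 <= s} by move=> a h; rewrite mem_undup inE mem_cat h orbT.
have s2s : {subset s2 <= s} by move=> a h; rewrite mem_undup inE mem_cat h !orbT.
pose p a := (c a - c' a) * q a.
have pe w : normc (peval s p (tval w)) <= e.
  have -> : peval s p (tval w) = (g w - \sum_(a <- s) c' a * (q a * monomial (tval w) a)) -
      (g w - \sum_(a <- s) c a * (q a * monomial (tval w) a)).
    rewrite (_ : forall x y z : C, x - y - (x - z) = z - y); last by move=> x y z; ring.
    by rewrite -sumrB; apply: eq_bigr => a _; rewrite /p; ring.
  apply: le_trans (normcB _ _) _; rewrite [e]splitr; apply: lerD; [exact: h2|exact: h1].
have := fourier_peval p b us; rewrite mem_undup inE eqxx /= => fb.
rewrite -normcM -/(p b) -fb fourier_coefE.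
apply: normc_cintegral_bound.
  by apply: cintegrable_meas; apply: cintegrable_fourier; exact: cintegrable_peval.
by move=> w; rewrite normcM normc_tmonomialV mulr1.
Qed.

Lemma bernoulli_sub (r : R) n : 0 <= r <= 1 -> 1 - n%:R * (1 - r) <= r ^+ n.
Proof.
move=> /andP[r0 r1]; elim: n => [|n IH]; first by rewrite mul0r subr0 expr0.
rewrite exprS -natr1; have := ler_wpM2l r0 IH.
have : 0 <= n%:R * ((1 - r) * (1 - r)) by rewrite mulr_ge0// mulr_ge0// subr_ge0.
rewrite (_ : r * (1 - n%:R * (1 - r)) = r - n%:R * (1 - r) + n%:R * ((1 - r) * (1 - r))); last by ring.
rewrite (_ : 1 - (n%:R + 1) * (1 - r) = r - n%:R * (1 - r)); last by ring.
by set x := n%:R * (1 - r); set y := r ^+ n; lra.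
Qed.

(** Makes the limit r -> 1 explicit: for r = 1 - d, Bernoulli's inequality shows that at most d T is
    lost. *)
Lemma sum_radius_limit (I : Type) (s : seq I) (x : I -> R) (n : I -> nat) (L : R) :
  (forall i, 0 <= x i) ->
  (forall r, 0 < r < 1 -> \sum_(i <- s) x i * r ^+ n i <= L) -> \sum_(i <- s) x i <= L.
Proof.
move=> x0 h; pose T := \sum_(i <- s) x i * (n i)%:R.
have T0 : 0 <= T by apply: sumr_ge0 => i _; rewrite mulr_ge0.
apply/ler_addgt0Pl => e e0.
pose d := Num.min 2^-1 (e / (T + 1)).
have T1 : 0 < T + 1 by lra.
have d0 : 0 < d by rewrite lt_min invr_gt0 divr_gt0//= ltr0n.
have d2 : d <= 2^-1 by rewrite ge_min lexx.
have dT : d * T <= e.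
  apply: le_trans (_ : _ <= e / (T + 1) * T) _; first by rewrite ler_wpM2r// ge_min lexx orbT.
  by rewrite mulrAC ler_pdivrMr//; nra.
have hr : 0 < 1 - d < 1 by apply/andP; split; lra.
have h2 := h _ hr; apply: (le_trans _ (lerD dT h2)).
apply: (@le_trans _ _ (d * T + \sum_(i <- s) x i * (1 - (n i)%:R * d))).
  rewrite /T mulr_sumr -big_split /= le_eqVlt; apply/orP; left; apply/eqP.
  by apply: eq_bigr => i _; ring.
rewrite lerD2l; apply: ler_sum => i _; rewrite ler_wpM2l//.
have := @bernoulli_sub (1 - d) (n i); rewrite (_ : 1 - (1 - d) = d); last by ring.
by apply; apply/andP; split; lra.
Qed.

End uniqueness.

(** * Holomorphic functions on the polydisc *)

Section caratheodory.
Context d (T : measurableType d) (R : realType).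
Local Notation C := (R[i]).
Local Notation Re := complex.Re.
Local Notation Im := complex.Im.

Lemma cmeasurable_limit (F : nat -> T -> C) (f : T -> C) : (forall n, cmeasurable (F n)) ->
  (forall x, ccvg (F ^~ x) (f x)) -> cmeasurable f.
Proof.
move=> mF Ff; split.
  apply: (measurable_fun_cvg (h := fun n x => Re (F n x))); first by move=> n; case: (mF n).
  by move=> x _; case/ccvgP : (Ff x).
apply: (measurable_fun_cvg (h := fun n x => Im (F n x))); first by move=> n; case: (mF n).
by move=> x _; case/ccvgP : (Ff x).
Qed.

(** Half-open, so that the cells are disjoint; the cell a = 2 m is there for the end point 1. *)
Definition cell (m a : nat) : set R := `[a%:R / m%:R - 1, a.+1%:R / m%:R - 1[%classic.

Lemma cell_partition m (x : R) : (0 < m)%N -> `|x| <= 1 -> exists a : 'I_m.*2.+1,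
  `|(a%:R / m%:R - 1) - x| <= m%:R^-1 /\ forall b : 'I_m.*2.+1, \1_(cell m b) x = (b == a)%:R :> R.
Proof.
move=> m0; rewrite ler_norml => /andP[x0 x1]; have m0' : 0 < m%:R :> R by rewrite ltr0n.
have y0 : 0 <= (x + 1) * m%:R by apply: mulr_ge0; [lra|exact: ltW].
have /andP[h1 h2] := truncn_itv y0; set a := Num.truncn _ in h1 h2.
have am : (a < m.*2.+1)%N.
  rewrite ltnS -(ler_nat R); apply: le_trans h1 _; rewrite -mul2n natrM; apply: ler_wpM2r; [exact: ltW|lra].
have ha1 : a%:R / m%:R <= x + 1 by rewrite ler_pdivrMr.
have ha2 : x + 1 < a.+1%:R / m%:R by rewrite ltr_pdivlMr.
have ha3 : a.+1%:R / m%:R = a%:R / m%:R + m%:R^-1 :> R by rewrite -[a.+1%:R]natr1 mulrDl mul1r.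
exists (Ordinal am); split => /=.
  by rewrite ler_norml; apply/andP; split; move: ha1 ha2; rewrite ha3; set u := a%:R / _; set v := m%:R^-1; lra.
move=> b; rewrite indicE; congr (_%:R : R); congr nat_of_bool.
apply/idP/eqP.
  move=> /set_mem; rewrite /cell /= in_itv /= => /andP[hb1 hb2].
  have lt (p q : nat) : p%:R / m%:R < q.+1%:R / m%:R :> R -> (p <= q)%N.
    by rewrite ltr_pM2r ?invr_gt0// ltr_nat ltnS.
  apply: val_inj => /=; apply/eqP; rewrite eqn_leq; apply/andP; split; apply: lt; lra.
move=> ->; apply/mem_set; rewrite /cell /= in_itv /=; apply/andP; split; lra.
Qed.

(** [p] is approximated by simple functions with values in a grid: measurability in [x] serves at
    each grid point, continuity in [u] for the limit. Grid points near the circle may lie outside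
    it, hence the radius [rho] > 1. In this way boundary functions are measurable although only
    holomorphy in each variable is known. *)
Lemma caratheodory (phi : T -> C -> C) (p : T -> C) (rho : R) : cmeasurable p ->
  (forall x, normc (p x) <= 1) -> 1 < rho ->
  (forall u, normc u < rho -> cmeasurable (phi ^~ u)) ->
  (forall x (e : R), 0 < e -> exists2 del : R, 0 < del & forall u, normc (u - p x) < del ->
     normc u < rho -> normc (phi x u - phi x (p x)) < e) ->
  cmeasurable (fun x => phi x (p x)).
Proof.
move=> mp p1 rho1 mphi cphi; have rho0 : 0 < rho by lra.
pose pt m (a b : nat) : C := let u := (a%:R / m%:R - 1) +i* (b%:R / m%:R - 1) in
  if normc u < rho then u else 0.
have ptr m a b : normc (pt m a b) < rho by rewrite /pt /=; case: ifP => // _; rewrite normc0.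
pose F n x : C := \sum_(a < n.+1.*2.+1) \sum_(b < n.+1.*2.+1)
  phi x (pt n.+1 a b) * (\1_(cell n.+1 a) (Re (p x)) * \1_(cell n.+1 b) (Im (p x)))%:C.
apply: (@cmeasurable_limit F).
  move=> n; apply: cmeasurable_sum => a; apply: cmeasurable_sum => b.
  apply: cmeasurableM; first exact: mphi.
  have mi k : measurable_fun setT (\1_(cell n.+1 k) : measurableTypeR R -> R).
    by apply: measurable_indic; exact: measurable_itv.
  apply: cmeasurable_real; apply: measurable_funM.
    exact: (measurableT_comp (mi a) mp.1).
  exact: (measurableT_comp (mi b) mp.2).
move=> x; apply/cvgc_normP => e e0.
have [del del0 hd] := cphi x e e0.
pose dd := Num.min del (rho - 1); have dd0 : 0 < dd by rewrite lt_min del0 subr_gt0.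
exists (Num.truncn (2 / dd)) => // n /= hn.
have n2 : 2 / n.+1%:R < dd.
  rewrite ltr_pdivrMr// mulrC -ltr_pdivrMr//.
  by apply: lt_le_trans (truncnS_gt _) _; rewrite ler_nat.
have [a [ha1 ha2]] := cell_partition (ltn0Sn n) (le_trans (Re_le_normc (p x)) (p1 x)).
have [b [hb1 hb2]] := cell_partition (ltn0Sn n) (le_trans (Im_le_normc (p x)) (p1 x)).
have -> : F n x = phi x (pt n.+1 a b).
  rewrite /F (bigD1 a)//= (bigD1 b)//= ha2 hb2 !eqxx mulr1 mulr1 !big1 ?addr0//.
    by move=> a' aa; rewrite big1// => b' _; rewrite ha2 (negbTE aa) mul0r mulr0.
  by move=> b' bb; rewrite hb2 (negbTE bb) !mulr0.
pose u : C := (a%:R / n.+1%:R - 1) +i* (b%:R / n.+1%:R - 1).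
have up : normc (u - p x) < dd.
  apply: le_lt_trans n2; apply: le_trans (normc_le_ReIm _) _.
  rewrite cReD cImD cReN cImN /= (_ : 2 / n.+1%:R = n.+1%:R^-1 + n.+1%:R^-1); last by ring.
  exact: lerD.
have ur : normc u < rho.
  rewrite -[u](subrK (p x)); apply: le_lt_trans (le_normcD _ _) _.
  have : dd <= rho - 1 by rewrite ge_min lexx orbT.
  by move: up (p1 x); set y := normc _; set y' := normc _; lra.
have -> : pt n.+1 a b = u by rewrite /pt /= -/u ur.
by rewrite normc_distC; apply: hd => //; apply: lt_le_trans up _; rewrite ge_min lexx.
Qed.

End caratheodory.

Section one_variable.
Variables (R : realType) (g : R[i] -> R[i]) (M r : R).
Local Notation C := (R[i]).
Hypothesis dg : forall u, normc u < 1 -> complex_diff g u.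
Hypothesis gM : forall u, normc u < 1 -> normc (g u) <= M.
Hypothesis r01 : 0 < r < 1.

Lemma normc_circle_pt t : normc (r%:C * expi t : C) = r.
Proof. by have /andP[r0 _] := r01; rewrite normcM normc_expi mulr1 normc_real gtr0_norm. Qed.

Lemma cmeasurable_circle_fun : cmeasurable (fun t : measurableTypeR R => g (r%:C * expi t)).
Proof.
have /andP[r0 r1] := r01.
apply: cmeasurable_cont => t; apply/ccontP => e e0.
have [|d d0 hd] := complex_diff_cont (dg (u := r%:C * expi t) _) e0; first by rewrite normc_circle_pt.
have /ccontP/(_ d d0)[d' d'0 hd'] := ccont_expi t.
exists d' => // x tx; rewrite normc_distC; apply: hd; rewrite -mulrBr normcM normc_real gtr0_norm//.
apply: le_lt_trans (_ : _ <= normc (expi x - expi t)) _; first by rewrite ler_piMl ?normc_ge0 ?ltW.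
by rewrite normc_distC; exact: hd'.
Qed.

Lemma normc_circle_fun t : normc (g (r%:C * expi t)) <= M.
Proof. by apply: gM; rewrite normc_circle_pt; case/andP: r01. Qed.

(** The truncated Cauchy kernel: it keeps the sums over exponents finite at the cost of a geometric
    error. *)
Definition geom (n : nat) (x w : C) : C := \sum_(i < n) (x * conjc w) ^+ i.

Lemma normc_geom_le n x w (q : R) : normc w = 1 -> normc x <= q -> q < 1 -> normc (geom n x w) <= (1 - q)^-1.
Proof.
move=> w1 xq q1; have q0 : 0 <= q by apply: le_trans (normc_ge0 _) xq.
apply: le_trans (normc_sum _ _ _) _.
apply: (@le_trans _ _ (\sum_(i < n) q ^+ i)).
  apply: ler_sum => i _; rewrite normcX normcM normc_conjc w1 mulr1.
  by rewrite lerXn2r ?nnegrE ?normc_ge0.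
rewrite -div1r ler_pdivlMr ?subr_gt0// mulrC -opprB mulNr -subrX1 opprB lerBlDr lerDl.
exact: exprn_ge0.
Qed.

Lemma geom_remainder n x w (q : R) : normc w = 1 -> normc x <= q -> q < 1 ->
  normc ((1 - x * conjc w)^-1 - geom n x w) <= q ^+ n / (1 - q).
Proof.
move=> w1 xq q1; have q0 : 0 <= q by apply: le_trans (normc_ge0 _) xq.
have nx : normc (x * conjc w) <= q by rewrite normcM normc_conjc w1 mulr1.
have x1 : x * conjc w != 1.
  by apply/eqP => e; move: nx; rewrite e normc1 leNgt q1.
rewrite (geometric_remainder n x1) addrC addKr normcM normcX normcV.
apply: ler_pM; rewrite ?exprn_ge0 ?invr_ge0 ?normc_ge0//.
  by rewrite lerXn2r ?nnegrE ?normc_ge0.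
have h := normc_1B_ge (x * conjc w).
by rewrite lef_pV2 ?posrE; move: h nx; set y := normc _; set y' := normc _; lra.
Qed.

Lemma cmeasurable_geom n x : cmeasurable (fun t : measurableTypeR R => geom n x (expi t)).
Proof.
apply: cmeasurable_sum => i; apply: cmeasurable_cont => t.
by apply: ccontX; apply: ccontM; [exact: ccont_cst|apply: ccontJ; exact: ccont_expi].
Qed.

Lemma circle_geom_approx n (z : C) (q : R) : normc z < r -> normc (z / r%:C) <= q -> q < 1 ->
  normc (g z - cintegral (P01 R) (fun t => g (r%:C * expi t) * geom n (z / r%:C) (expi t)))
    <= M * (q ^+ n / (1 - q)).
Proof.
move=> zr zq q1; have /andP[r0 r1] := r01.
have q0 : 0 <= q by apply: le_trans (normc_ge0 _) zq.
have M0 : 0 <= M by apply: le_trans (normc_ge0 _) (normc_circle_fun 0).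
rewrite (cauchy_formula1 dg gM r0 r1 zr).
have mK : cmeasurable (fun t : measurableTypeR R => (1 - (z / r%:C) * conjc (expi t))^-1).
  apply: cmeasurable_cont => t; apply: ccontV.
    rewrite -normc_gt0; apply: lt_le_trans (normc_1B_ge _).
    by rewrite normcM normc_conjc normc_expi mulr1; lra.
  apply: (ccontD (ccont_cst 1 t)); apply: ccontN.
  by apply: ccontM; [exact: ccont_cst|apply: ccontJ; exact: ccont_expi].
have bK t : normc ((1 - (z / r%:C) * conjc (expi t))^-1) <= (1 - q)^-1.
  rewrite normcV lef_pV2 ?posrE; have := normc_1B_ge (z / r%:C * conjc (expi t));
  rewrite [normc (_ * conjc _)]normcM normc_conjc normc_expi mulr1; move: zq; set y := normc _; set y' := normc _; lra.
have i1 : cintegrable (P01 R) (fun t => g (r%:C * expi t) * (1 - (z / r%:C) * conjc (expi t))^-1).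
  apply: (@cintegrable_bounded _ _ _ _ _ (M * (1 - q)^-1)); first exact: cmeasurableM cmeasurable_circle_fun mK.
  by move=> t; rewrite normcM; apply: ler_pM; rewrite ?normc_ge0 ?normc_circle_fun ?bK.
have i2 : cintegrable (P01 R) (fun t => g (r%:C * expi t) * geom n (z / r%:C) (expi t)).
  apply: (@cintegrable_bounded _ _ _ _ _ (M * (1 - q)^-1)); first exact: cmeasurableM cmeasurable_circle_fun (cmeasurable_geom _ _).
  move=> t; rewrite normcM; apply: ler_pM; rewrite ?normc_ge0 ?normc_circle_fun//.
  by apply: normc_geom_le => //; exact: normc_expi.
rewrite -cintegralB//; apply: normc_cintegral_bound.
  exact: cintegrable_meas (cintegrableB i1 i2).
move=> t; rewrite -mulrBr normcM; apply: ler_pM; rewrite ?normc_ge0 ?normc_circle_fun//.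
by apply: geom_remainder => //; exact: normc_expi.
Qed.

(** Cauchy's formula at the origin for the function g(u) u^n. *)
Lemma circle_positive_moment n : (0 < n)%N ->
  cintegral (P01 R) (fun t => g (r%:C * expi t) * expi t ^+ n) = 0.
Proof.
move=> n0; have /andP[r0 r1] := r01.
have dX m u : complex_diff (fun v : C => v ^+ m) u.
  elim: m => [|m IH].
    rewrite (_ : (fun v : C => v ^+ 0) = (fun v => 1 + 0 * (v - 0))); first exact: complex_diff_affine.
    by apply/funext => v; rewrite expr0 mul0r addr0.
  rewrite (_ : (fun v : C => v ^+ m.+1) = (fun v => (0 + 1 * (v - 0)) * v ^+ m)).
    by apply: complex_diffM => //; exact: complex_diff_affine.
  by apply/funext => v; rewrite exprS add0r mul1r subr0.
have dh u : normc u < 1 -> complex_diff (fun v => g v * v ^+ n) u.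
  by move=> u1; apply: complex_diffM; [exact: dg|exact: dX].
have hM u : normc u < 1 -> normc (g u * u ^+ n) <= M.
  move=> u1; rewrite normcM normcX; apply: le_trans (gM u1).
  by rewrite ler_piMr ?normc_ge0// exprn_ile1 ?normc_ge0// ltW.
have z0 : normc (0 : C) < r by rewrite normc0.
have := cauchy_formula1 dh hM r0 r1 z0.
rewrite expr0n eqn0Ngt n0 mulr0.
have iF : cintegrable (P01 R) (fun t => g (r%:C * expi t) * expi t ^+ n).
  apply: (@cintegrable_bounded _ _ _ _ _ M).
    apply: cmeasurableM; first exact: cmeasurable_circle_fun.
    by apply: cmeasurable_cont => t; apply: ccontX; exact: ccont_expi.
  by move=> t; rewrite normcM normcX normc_expi expr1n mulr1 normc_circle_fun.
have -> : cintegral (P01 R) (fun t => g (r%:C * expi t) * (r%:C * expi t) ^+ n * (1 - 0 / r%:C * conjc (expi t))^-1) =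
    r%:C ^+ n * cintegral (P01 R) (fun t => g (r%:C * expi t) * expi t ^+ n).
  rewrite -cintegralZ//; apply: eq_cintegral => t.
  by rewrite !mul0r subr0 invr1 mulr1 exprMn; ring.
move=> /esym/eqP; rewrite mulf_eq0 => /orP[|/eqP //].
rewrite expf_eq0 n0 /= -normc_eq0 normc_real normr_eq0 gt_eqF//.
Qed.

End one_variable.

Section polydisc.
Variables (R : realType) (g : (nat -> R[i]) -> R[i]) (M : R).
Local Notation C := (R[i]).
Local Notation m := (torus_measure R).
Implicit Types (v z : nat -> C).
Hypothesis dg : forall v l, (forall j, normc (v j) < 1) -> complex_diff (fun u => g (subst1 v l u)) (v l).
Hypothesis gM : forall v, (forall j, normc (v j) < 1) -> normc (g v) <= M.

Lemma subst1_lt1 v l u : (forall j, normc (v j) < 1) -> normc u < 1 ->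
  forall j, normc (subst1 v l u j) < 1.
Proof. by move=> v1 u1 j; rewrite /subst1; case: ifP. Qed.

Lemma subst1_subst1 v l u u' : subst1 (subst1 v l u) l u' = subst1 v l u'.
Proof. by apply/funext => j; rewrite /subst1; case: eqP. Qed.

Lemma slice_diff v l u : (forall j, normc (v j) < 1) -> normc u < 1 ->
  complex_diff (fun u => g (subst1 v l u)) u.
Proof.
move=> v1 u1; have := dg l (subst1_lt1 l v1 u1).
have -> : subst1 v l u l = u by rewrite /subst1 eqxx.
by congr complex_diff; apply/funext => u'; rewrite subst1_subst1.
Qed.

Lemma slice_bound v l u : (forall j, normc (v j) < 1) -> normc u < 1 -> normc (g (subst1 v l u)) <= M.
Proof. by move=> v1 u1; apply: gM; exact: subst1_lt1. Qed.

Variable r : R.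
Hypothesis r01 : 0 < r < 1.

(** Interpolates between [z] and a point of the torus of radius [r]; each step from [l] to [l.+1]
    applies Cauchy's formula in one coordinate. *)
Definition hyb l z (w : torus R) : nat -> C := fun j => if (j < l)%N then r%:C * tval w j else z j.

Lemma normc_rtval (w : torus R) j : normc (r%:C * tval w j) = r.
Proof. by have /andP[r0 _] := r01; rewrite normcM normc_tval mulr1 normc_real gtr0_norm. Qed.

Lemma hyb_lt1 l z w : (forall j, normc (z j) < 1) -> forall j, normc (hyb l z w j) < 1.
Proof.
by move=> z1 j; rewrite /hyb; case: ifP => // _; rewrite normc_rtval; case/andP: r01.
Qed.

Lemma hybS l z w : hyb l.+1 z w = subst1 (hyb l z w) l (r%:C * tval w l).
Proof.
apply/funext => j; rewrite /subst1 /hyb ltnS leq_eqVlt; case: eqP => [->|_]//=.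
Qed.

Lemma hyb_subst1 l z w u : subst1 (hyb l z w) l u = hyb l (subst1 z l u) w.
Proof.
by apply/funext => j; rewrite /subst1 /hyb; case: eqP => // ->; rewrite ltnn.
Qed.

(** With a fixed number in coordinate [l] the function is measurable by induction, and it is
    continuous in that number; then [caratheodory] applies. The radius r^-1 > 1 is the one for which
    r u stays in the disc. *)
Lemma cmeasurable_hyb l z : (forall j, normc (z j) < 1) -> cmeasurable (fun w => g (hyb l z w)).
Proof.
have /andP[r0 r1] := r01.
elim: l z => [|l IH] z z1.
  apply: (eq_cmeasurable (f := fun=> g z)); last exact: cmeasurable_cst.
  by move=> w; congr g; apply/funext => j; rewrite /hyb ltn0.
pose phi w u := g (subst1 (hyb l z w) l (r%:C * u)).
have ru u : normc u < r^-1 -> normc (r%:C * u) < 1.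
  by move=> h; rewrite normcM normc_real gtr0_norm// -(ltr_pdivlMl _ _ r0) mulr1.
apply: (eq_cmeasurable (f := fun w => phi w (tval w l))).
  by move=> w; rewrite /phi hybS.
apply: (@caratheodory _ _ _ phi _ r^-1).
- exact: cmeasurable_tval.
- by move=> w; rewrite normc_tval.
- by rewrite invf_gt1.
- move=> u ur; apply: (eq_cmeasurable (f := fun w => g (hyb l (subst1 z l (r%:C * u)) w))).
    by move=> w; rewrite /phi hyb_subst1.
  by apply: IH; apply: subst1_lt1 => //; exact: ru.
- move=> w e e0; have [|del del0 hd] := complex_diff_cont (slice_diff l (hyb_lt1 l w z1) (u := r%:C * tval w l) _) e0.
    by rewrite normc_rtval.
  exists del => // u uw _; apply: hd; rewrite -mulrBr normcM normc_real gtr0_norm//.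
  by apply: le_lt_trans uw; rewrite ler_piMl ?normc_ge0 ?ltW.
Qed.

Definition ftorus (w : torus R) : C := g (fun j => r%:C * tval w j).

Lemma ftorus_bound w : normc (ftorus w) <= M.
Proof. by apply: gM => j; rewrite normc_rtval; case/andP: r01. Qed.

Definition gprod d z l (w : torus R) : C := \prod_(j < l) geom d (z j / r%:C) (tval w j).

Lemma gprod_upd d z l w u : gprod d z l (upd w l u) = gprod d z l w.
Proof. by apply: eq_bigr => j _; rewrite tval_upd ltn_eqF. Qed.

Lemma cmeasurable_gprod d z l : cmeasurable (gprod d z l).
Proof.
apply: cmeasurable_prod => j; apply: cmeasurable_sum => i; apply: cmeasurableX.
by apply: cmeasurableM; [exact: cmeasurable_cst|apply: cmeasurableJ; exact: cmeasurable_tval].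
Qed.

Lemma normc_gprod d z l w (q : R) : (forall j, normc (z j / r%:C) <= q) -> q < 1 ->
  normc (gprod d z l w) <= (1 - q)^-1 ^+ l.
Proof.
move=> zq q1; rewrite normc_prod -[X in _ <= _ ^+ X]card_ord -prodr_const.
apply: ler_prod => j _; rewrite normc_ge0 /=.
by apply: normc_geom_le => //; exact: normc_tval.
Qed.

(** Resampling coordinate [l] turns the second integral into the truncated Cauchy integral of a
    slice, which [circle_geom_approx] compares with the value at z_l. The kernels of the previous
    coordinates contribute the power of (1 - q)^-1. *)
Lemma cauchy_box_step d z (q : R) l : (forall j, normc (z j) < r) -> (forall j, normc (z j / r%:C) <= q) -> q < 1 ->
  normc (cintegral m (fun w => g (hyb l z w) * gprod d z l w) -
    cintegral m (fun w => g (hyb l.+1 z w) * gprod d z l.+1 w)) <=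
  (1 - q)^-1 ^+ l * (M * (q ^+ d / (1 - q))).
Proof.
move=> zr zq q1; have /andP[r0 r1] := r01.
have z1 j : normc (z j) < 1 by apply: lt_trans r1.
have q0 : 0 <= q by apply: le_trans (normc_ge0 _) (zq 0%N).
have iq0 : 0 <= (1 - q)^-1 by rewrite invr_ge0 subr_ge0 ltW.
have mG k : cmeasurable (fun w => g (hyb k z w) * gprod d z k w).
  by apply: cmeasurableM; [exact: cmeasurable_hyb|exact: cmeasurable_gprod].
have bG k w : normc (g (hyb k z w) * gprod d z k w) <= M * (1 - q)^-1 ^+ k.
  rewrite normcM; apply: ler_pM; rewrite ?normc_ge0//; first by apply: gM; exact: hyb_lt1.
  exact: normc_gprod.
have [mI ->] := resample l (mG l.+1) (bG l.+1).
have sE w : cintegral (P01 R) (fun t => g (hyb l.+1 z (upd w l (angle t))) * gprod d z l.+1 (upd w l (angle t))) =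
    gprod d z l w * cintegral (P01 R) (fun t => g (subst1 (hyb l z w) l (r%:C * expi t)) * geom d (z l / r%:C) (expi t)).
  rewrite -cintegralZ.
    apply: eq_cintegral => t; rewrite hybS {1}/gprod big_ord_recr /= -/(gprod d z l _) gprod_upd.
    rewrite tval_upd eqxx val_angle (_ : hyb l z (upd w l (angle t)) = hyb l z w); first by ring.
    by apply/funext => j; rewrite /hyb tval_upd; case: ltnP => // jl; rewrite ltn_eqF.
  apply: (@cintegrable_bounded _ _ _ _ _ (M * (1 - q)^-1)).
    apply: cmeasurableM; last exact: cmeasurable_geom.
    by apply: (cmeasurable_circle_fun (g := fun u => g (subst1 (hyb l z w) l u))) => // u u1; apply: slice_diff => //; exact: hyb_lt1.
  move=> t; rewrite normcM; apply: ler_pM; rewrite ?normc_ge0//.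
    by apply: slice_bound; [exact: hyb_lt1|rewrite normc_circle_pt].
  by apply: normc_geom_le => //; exact: normc_expi.
have iI : cintegrable m (fun w => cintegral (P01 R) (fun t => g (hyb l.+1 z (upd w l (angle t))) * gprod d z l.+1 (upd w l (angle t)))).
  apply: (@cintegrable_bounded _ _ _ _ _ (M * (1 - q)^-1 ^+ l.+1)) => // w.
  apply: normc_cintegral_bound; last by move=> t; exact: bG.
  exact: (cmeasurable_comp (measurable_upd l w) (mG l.+1)).
have iG : cintegrable m (fun w => g (hyb l z w) * gprod d z l w) by apply: (cintegrable_bounded m (mG l) (bG l)).
rewrite -cintegralB//; apply: normc_cintegral_bound; first exact: cintegrable_meas (cintegrableB iG iI).
move=> w; rewrite sE (_ : forall x y t : C, x * y - y * t = y * (x - t)); last by move=> *; ring.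
rewrite normcM; apply: ler_pM; rewrite ?normc_ge0 ?normc_gprod//.
have -> : hyb l z w = subst1 (hyb l z w) l (z l).
  by apply/funext => j; rewrite /subst1 /hyb; case: eqP => // ->; rewrite ltnn.
have sl2 : forall u, subst1 (subst1 (hyb l z w) l (z l)) l u = subst1 (hyb l z w) l u.
  by move=> u; rewrite subst1_subst1.
under eq_cintegral do rewrite sl2.
apply: (circle_geom_approx (g := fun u => g (subst1 (hyb l z w) l u))) => // u u1.
  by apply: slice_diff => //; exact: hyb_lt1.
by apply: slice_bound => //; exact: hyb_lt1.
Qed.

Lemma cauchy_box d z (q : R) k : (forall j, normc (z j) < r) -> (forall j, normc (z j / r%:C) <= q) -> q < 1 ->
  normc (g z - cintegral m (fun w => g (hyb k z w) * gprod d z k w)) <=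
  k%:R * ((1 - q)^-1 ^+ k * (M * (q ^+ d / (1 - q)))).
Proof.
move=> zr zq q1; have /andP[r0 r1] := r01.
have z1 j : normc (z j) < 1 by apply: lt_trans r1.
have q0 : 0 <= q by apply: le_trans (normc_ge0 _) (zq 0%N).
have M0 : 0 <= M by apply: le_trans (normc_ge0 _) (gM z1).
pose B := M * (q ^+ d / (1 - q)); have B0 : 0 <= B.
  by rewrite mulr_ge0// mulr_ge0 ?exprn_ge0// invr_ge0 subr_ge0 ltW.
have iq1 : 1 <= (1 - q)^-1 by rewrite invf_ge1 ?subr_gt0// gerBl.
elim: k => [|k IH].
  rewrite mul0r (_ : cintegral m _ = g z) ?subrr ?normc0//.
  rewrite -[RHS](cintegral_cst m); apply: eq_cintegral => w.
  rewrite /gprod big_ord0 mulr1; congr g; apply/funext => j; by rewrite /hyb ltn0.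
pose I k := cintegral m (fun w => g (hyb k z w) * gprod d z k w); rewrite -!/(I _) in IH *.
rewrite (_ : g z - I k.+1 = (g z - I k) + (I k - I k.+1)); last by ring.
apply: le_trans (le_normcD _ _) _; rewrite -[k.+1%:R]natr1 mulrDl mul1r; apply: lerD.
  apply: le_trans IH _; rewrite -/B ler_wpM2l// ler_wpM2r// ler_weXn2l//.
apply: le_trans (cauchy_box_step d k zr zq q1) _; rewrite -/B ler_wpM2r// ler_weXn2l//.
Qed.

Variable k : nat.
Hypothesis gext : forall v v', (forall j, (j < k)%N -> v j = v' j) -> g v = g v'.

Lemma ftorus_hyb z w : g (hyb k z w) = ftorus w.
Proof. by apply: gext => j jk; rewrite /hyb jk. Qed.

Lemma cmeasurable_ftorus : cmeasurable ftorus.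
Proof.
apply: (eq_cmeasurable (f := fun w => g (hyb k (fun=> 0) w))); first exact: ftorus_hyb.
by apply: cmeasurable_hyb => j; rewrite normc0.
Qed.

Lemma cintegrable_ftorus : cintegrable m ftorus.
Proof. exact: (cintegrable_bounded m cmeasurable_ftorus ftorus_bound). Qed.

Lemma normc_coef_ftorus a : normc (fourier_coef ftorus a) <= M.
Proof.
rewrite fourier_coefE; apply: normc_cintegral_bound.
  exact: cmeasurableM cmeasurable_ftorus (cmeasurable_monomialV R a).
by move=> w; rewrite normcM normc_tmonomialV mulr1 ftorus_bound.
Qed.

(** A negative exponent at [j] amounts to a positive moment of the slice in that coordinate, which
    vanishes. *)
Lemma ftorus_neg a : ~ nonneg_index a -> fourier_coef ftorus a = 0.
Proof.
move=> na; have [j aj] : exists j, a j < 0.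
  by apply: contrapT => h; apply: na => j; rewrite leNgt; apply/negP => aj; apply: h; exists j.
have /andP[r0 r1] := r01.
have mF := cmeasurableM cmeasurable_ftorus (cmeasurable_monomialV R a).
have bF w : normc (ftorus w * (monomial (tval w) a)^-1) <= M.
  by rewrite normcM normc_tmonomialV mulr1 ftorus_bound.
rewrite fourier_coefE (resample j mF bF).2 -[RHS](cintegral_cst m); apply: eq_cintegral => w.
have rw1 i : normc (r%:C * tval w i) < 1 by rewrite normc_rtval.
pose rest := \prod_(i <- finsupp a | i != j) tval w i ^ a i.
have [n an] : exists n, a j = Negz n by case: (a j) aj => // n _; exists n.
pose g1 u := g (subst1 (fun i => r%:C * tval w i) j u).
have dg1 u : normc u < 1 -> complex_diff g1 u by move=> u1; exact: slice_diff.
have gM1 u : normc u < 1 -> normc (g1 u) <= M by move=> u1; exact: slice_bound.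
have i1 : cintegrable (P01 R) (fun t => g1 (r%:C * expi t) * expi t ^+ n.+1).
  apply: (@cintegrable_bounded _ _ _ _ _ M).
    apply: cmeasurableM; first exact: (cmeasurable_circle_fun dg1).
    by apply: cmeasurable_cont => t; apply: ccontX; exact: ccont_expi.
  move=> t; rewrite normcM normcX normc_expi expr1n mulr1; apply: gM1.
  by rewrite normc_circle_pt.
transitivity (rest^-1 * cintegral (P01 R) (fun t => g1 (r%:C * expi t) * expi t ^+ n.+1)).
  rewrite -cintegralZ//; apply: eq_cintegral => t.
  rewrite (monomial_split _ a j) tval_upd eqxx val_angle an.
  have -> : \prod_(i <- finsupp a | i != j) tval (upd w j (angle t)) i ^ a i = rest.
    by apply: eq_bigr => i ij; rewrite tval_upd (negbTE ij).
  rewrite invfM NegzE -exprnN invrK mulrC -mulrA mulrCA; congr (_ * _); rewrite mulrC; congr (_ * _).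
  congr g; apply/funext => i; rewrite /subst1 tval_upd.
  by case: eqP.
by rewrite (circle_positive_moment dg1 gM1)// mulr0.
Qed.

Lemma gprodE d z w : gprod d z k w =
  \sum_(a <- idx_box k d) monomial (fun j => z j / r%:C) a * (monomial (tval w) a)^-1.
Proof.
rewrite /gprod /geom bigA_distr_bigA /= /idx_box big_map big_enum /=.
apply: eq_bigr => f _.
rewrite (monomial_nat _ (@idx_of_ffun_nonneg _ _ f) (@supp_lt_mkidx _ _)).
rewrite (monomial_nat _ (@idx_of_ffun_nonneg _ _ f) (@supp_lt_mkidx _ _)).
rewrite -prodfV -big_split /=; apply: eq_bigr => i _.
by rewrite idx_of_ffunE absz_nat -exprVn (unimodularV (normc_tval w i)) exprMn.
Qed.

Lemma cauchy_box_sum d z (q : R) : (forall j, normc (z j) < r) -> (forall j, normc (z j / r%:C) <= q) -> q < 1 ->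
  normc (g z - \sum_(a <- idx_box k d) fourier_coef ftorus a * monomial (fun j => z j / r%:C) a) <=
  k%:R * ((1 - q)^-1 ^+ k * (M * (q ^+ d / (1 - q)))).
Proof.
move=> zr zq q1; have := cauchy_box d k zr zq q1; rewrite (_ : cintegral m _ =
  \sum_(a <- idx_box k d) fourier_coef ftorus a * monomial (fun j => z j / r%:C) a)//.
have i1 a : cintegrable m (fun w => ftorus w * (monomial (tval w) a)^-1).
  by apply: cintegrable_fourier; exact: cintegrable_ftorus.
rewrite (eq_bigr (fun a => cintegral m (fun w => monomial (fun j => z j / r%:C) a * (ftorus w * (monomial (tval w) a)^-1)))); last first.
  by move=> a _; rewrite cintegralZ// fourier_coefE mulrC.
rewrite -cintegral_sum; last by move=> a; exact: cintegrableZ.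
apply: eq_cintegral => w; rewrite ftorus_hyb gprodE mulr_sumr.
by apply: eq_bigr => a _; ring.
Qed.

Lemma sub_idx_box (s : seq multi_index) : (forall a, a \in s -> nonneg_index_lt k a) ->
  exists d, forall n, {subset s <= idx_box k (n + d)}.
Proof.
move=> sA; exists (\max_(a <- s) \max_(j < k) `|a j|%N).+1 => n a as_; apply/mem_idx_box.
have [a0 ak] := sA a as_; split => // j jk; rewrite a0 /= -(abs_expr_nonneg (a0 j)) ltz_nat.
apply: leq_trans (leq_addl _ _); rewrite ltnS (big_rem _ as_) /= leq_max.
by apply/orP; left; exact: (@leq_bigmax _ (fun j : 'I_k => `|a j|%N) (Ordinal jk)).
Qed.

Lemma idx_box_lt d a : a \in idx_box k d -> nonneg_index_lt k a.
Proof.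
move=> /mem_idx_box[ak h]; split => // j; have [jk|kj] := ltnP j k; last by rewrite (ak j kj).
by have /andP[] := h j jk.
Qed.

Lemma sum_box_monomial d (x : nat -> C) (q : R) : (forall j, normc (x j) <= q) -> q < 1 ->
  \sum_(a <- idx_box k d) normc (monomial x a) <= (1 - q)^-1 ^+ k.
Proof.
move=> xq q1; have q0 : 0 <= q by apply: le_trans (normc_ge0 _) (xq 0%N).
have -> : \sum_(a <- idx_box k d) normc (monomial x a) = \prod_(j < k) \sum_(i < d) normc (x j) ^+ i.
  rewrite bigA_distr_bigA /= /idx_box big_map big_enum /=; apply: eq_bigr => f _.
  rewrite (normc_monomial _ (@idx_of_ffun_nonneg _ _ f) (@supp_lt_mkidx _ _)).
  by apply: eq_bigr => i _; rewrite idx_of_ffunE absz_nat.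
rewrite -[X in _ <= _ ^+ X]card_ord -prodr_const; apply: ler_prod => j _.
rewrite sumr_ge0 /=; last by move=> i _; rewrite exprn_ge0 ?normc_ge0.
apply: (@le_trans _ _ (\sum_(i < d) q ^+ i)).
  by apply: ler_sum => i _; rewrite lerXn2r ?nnegrE ?normc_ge0.
rewrite -div1r ler_pdivlMr ?subr_gt0// mulrC -opprB mulNr -subrX1 opprB lerBlDr lerDl.
exact: exprn_ge0.
Qed.

Lemma ftorus_sums z : (forall j, normc (z j) < r) ->
  abs_sums_to (nonneg_index_lt k)
    (fun a => fourier_coef ftorus a * monomial (fun j => z j / r%:C) a) (g z).
Proof.
move=> zr; have /andP[r0 r1] := r01.
have M0 : 0 <= M by apply: le_trans (normc_ge0 _) (ftorus_bound (to_torus (fun=> 1))).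
(* Only the first [k] coordinates matter. After truncation |y_j| / r has a bound q < 1, whereas
   infinitely many |z_j| could approach [r]. *)
pose y := trunc k z; pose x j := y j / r%:C.
have yr j : normc (y j) < r by rewrite /y /trunc; case: ifP => // _; rewrite normc0.
have nx j : normc (x j) = normc (y j) / r.
  by rewrite /x normcM normcV normc_real gtr0_norm.
have gy : g z = g y by apply: gext => j jk; rewrite /y /trunc jk.
have xE a : nonneg_index_lt k a -> monomial (fun j => z j / r%:C) a = monomial x a.
  move=> ak; rewrite -(monomial_trunc _ ak); congr monomial; apply/funext => j.
  by rewrite /trunc /x /y /trunc; case: ifP => // _; rewrite mul0r.
have [q [q0 q1 xq]] : exists q : R, [/\ 0 <= q, q < 1 & forall j, normc (x j) <= q].
  have : forall n, exists q : R, [/\ 0 <= q, q < 1 & forall j, (j < n)%N -> normc (x j) <= q].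
    elim=> [|n [q [q0 q1 h]]]; first by exists 0.
    exists (Num.max q (normc (x n))); split.
    - by rewrite le_max q0.
    - by rewrite gt_max q1 nx ltr_pdivrMr// mul1r yr.
    - move=> j; rewrite ltnS leq_eqVlt le_max => /orP[/eqP ->|/h ->//].
      by rewrite lexx orbT.
  move=> /(_ k)[q [q0 q1 h]]; exists q; split => // j; have [/h//|kj] := ltnP j k.
  have y0 : y j = 0 by rewrite /y /trunc ltnNge kj.
  by rewrite nx y0 normc0 mul0r.
rewrite gy; apply: (@abs_sums_intro _ _ _ _ _ (M * (1 - q)^-1 ^+ k)).
  move=> s us sA; have [d hd] := sub_idx_box sA.
  apply: (@le_trans _ _ (\sum_(a <- s) M * normc (monomial x a))).
    rewrite big_seq [leRHS]big_seq; apply: ler_sum => a as_; rewrite (xE a (sA a as_)) normcM.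
    by rewrite ler_wpM2r ?normc_ge0 ?normc_coef_ftorus.
  rewrite -mulr_sumr ler_wpM2l//; apply: le_trans (sum_box_monomial d xq q1).
  apply: ler_sum_sub => //; [exact: uniq_idx_box|by move=> a /(hd 0%N)|by move=> a; exact: normc_ge0].
move=> e s e0 sA; have [d hd] := sub_idx_box sA.
have q01 : 0 <= q < 1 by rewrite q0.
have [n hn] := cvg_pow0 q01 (k%:R * (1 - q)^-1 ^+ k * M / (1 - q)) e0.
exists (idx_box k (n + d)); split => //; [exact: uniq_idx_box|by move=> a; exact: idx_box_lt|].
rewrite (eq_big_seq (fun a => fourier_coef ftorus a * monomial x a)); last first.
  by move=> a /idx_box_lt ak; rewrite xE.
apply: le_trans (cauchy_box_sum (n + d) yr xq q1) _; apply: le_trans (ltW hn).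
have iq0 : 0 <= (1 - q)^-1 by rewrite invr_ge0 subr_ge0 ltW.
rewrite (_ : k%:R * _ = k%:R * (1 - q)^-1 ^+ k * M / (1 - q) * q ^+ (n + d)); last by ring.
apply: ler_wpM2l; first by rewrite mulr_ge0// mulr_ge0// mulr_ge0// exprn_ge0.
by apply: ler_wiXn2l; rewrite ?leq_addr// ltW.
Qed.

End polydisc.

(** * Holomorphic functions on the ball of bounded sequences *)

Section finite_points.
Variable R : realType.
Local Notation C := (R[i]).
Implicit Types (v : nat -> C) (z : ell_infty R).

Lemma trunc_bounded k v : trunc k v \in @bounded_seq R.
Proof.
apply/asboolP; exists (\sum_(j < k) normc (v j)) => j; rewrite /trunc.
case: ltnP => jk; last by rewrite normc0; apply: sumr_ge0 => i _; exact: normc_ge0.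
rewrite (bigD1 (Ordinal jk))//= lerDl; apply: sumr_ge0 => i _; exact: normc_ge0.
Qed.

Definition finpt k v : ell_infty R := EllInfty (trunc_bounded k v).

Lemma finptE k v j : finpt k v j = if (j < k)%N then v j else 0. Proof. by []. Qed.

Lemma ell_infty_eq (x y : ell_infty R) : (forall j, x j = y j) -> x = y.
Proof. by move=> xy; apply/val_inj/funext. Qed.

Lemma normE_ell (x : ell_infty R) : `|x| = (sup_norm x)%:C. Proof. by []. Qed.

Lemma sup_norm_ge0 (x : ell_infty R) : 0 <= sup_norm x.
Proof. exact: le_trans (normc_ge0 (x 0%N)) (le_sup_norm x 0%N). Qed.

Lemma finite_max_lt1 n v : (forall j, (j < n)%N -> normc (v j) < 1) ->
  exists2 q : R, 0 <= q < 1 & forall j, (j < n)%N -> normc (v j) <= q.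
Proof.
elim: n => [|n IH] h; first by exists 0; rewrite ?lexx ?ltr01.
have [|q /andP[q0 q1] hq] := IH; first by move=> j jn; apply: h; exact: ltnW.
exists (Num.max q (normc (v n))); first by rewrite le_max q0 gt_max q1 h.
move=> j; rewrite ltnS leq_eqVlt le_max => /orP[/eqP ->|/hq ->//].
by rewrite lexx orbT.
Qed.

Lemma finpt_ball k v : (forall j, (j < k)%N -> normc (v j) < 1) -> unit_ball R (finpt k v).
Proof.
move=> v1; have [q /andP[q0 q1] hq] := finite_max_lt1 v1.
apply: (unit_ball_intro q1) => j; rewrite finptE; case: ifP => [/hq//|_]; by rewrite normc0.
Qed.

Lemma finpt_id k z : (forall j, (k <= j)%N -> z j = 0) -> finpt k z = z.
Proof. by move=> zk; apply: ell_infty_eq => j; rewrite finptE; case: ltnP => // /zk. Qed.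

Lemma abs_sums_restrict (I : choiceType) (A B : set I) (u : I -> C) s : B `<=` A ->
  (forall i, A i -> ~ B i -> u i = 0) -> abs_sums_to A u s -> abs_sums_to B u s.
Proof.
move=> BA u0 h; have [L hL] := abs_sums_bounded h.
split; first by apply: le_lt_trans (esum_bounded (L := L) _) (ltry _) => t ut tB; apply: hL => // i /tB /BA.
have -> : (fun i => if i \in B then u i else 0) = (fun i => if i \in A then u i else 0); last by case: h.
apply/funext => i; case: (boolP (i \in B)) => [/set_mem Bi|/negP iB].
  by rewrite mem_set//; exact: BA.
by case: ifPn => // /set_mem Ai; apply/esym/u0 => // Bi; apply: iB; exact: mem_set.
Qed.

Lemma abs_sums_eq (I : choiceType) (A : set I) (u u' : I -> C) s :
  (forall i, A i -> u i = u' i) -> abs_sums_to A u s -> abs_sums_to A u' s.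
Proof.
move=> e [h1 h2]; split.
  by rewrite -(eq_esum (a := fun i => (normc (u i))%:E))// => i Ai; rewrite e.
rewrite -(_ : (fun i => if i \in A then u i else 0) = (fun i => if i \in A then u' i else 0))//.
by apply/funext => i; case: ifPn => // /set_mem /e.
Qed.

Lemma directional_diff (f : ell_infty R -> R[i]^o) (x v : ell_infty R) : differentiable f x ->
  exists c : C, forall e : R, 0 < e -> exists2 del : R, 0 < del & forall t : C, normc t < del ->
    normc (f (x + t *: v) - f x - c * t) <= e * normc t.
Proof.
move=> df; exists ('d f x v) => e e0.
have /eqaddoP h := diff_locally df.
(* The summand 1 allows for a zero direction [v]. *)
pose e' := e / (sup_norm v + 1).
have v1 : 0 < sup_norm v + 1 by have := sup_norm_ge0 v; lra.
have e'0 : 0 < e'%:C :> C by rewrite ltcR divr_gt0.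
have /nbhs_norm0P[d /= d0 hd] := h _ e'0.
have [d' d'0 dE] := complex_ltc0 d0.
exists (d' / (sup_norm v + 1)); first by rewrite divr_gt0.
move=> t td.
have nt : `|t *: v| = (normc t * sup_norm v)%:C by rewrite normrZ normE normE_ell -rmorphM.
have td' : `|t *: v| < d.
  rewrite nt dE ltcR; apply: le_lt_trans (_ : _ <= normc t * (sup_norm v + 1)) _.
    by rewrite ler_wpM2l ?normc_ge0// lerDl.
  by rewrite -ltr_pdivlMr.
have := hd _ td'; rewrite /= nt normE /= -rmorphM lecR.
have -> : (f \o shift x - (cst (f x) + 'd f x)) (t *: v) = f (x + t *: v) - f x - 'd f x v * t.
  rewrite -[LHS]/(f (t *: v + x) - (f x + 'd f x (t *: v))) linearZ [t *: v + x]addrC.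
  by rewrite opprD addrA; congr (_ - _); exact: mulrC.
move=> h1; apply: le_trans h1 _.
rewrite /e' mulrCA [leRHS]mulrC ler_wpM2l ?normc_ge0// mulrAC ler_pdivrMr// ler_wpM2l ?ltW//.
by rewrite ltrDl.
Qed.

Lemma diff_cont_normc (f : ell_infty R -> R[i]^o) (x : ell_infty R) (e : R) : differentiable f x -> 0 < e ->
  exists2 del : R, 0 < del & forall y, sup_norm (x - y) < del -> normc (f x - f y : C) < e.
Proof.
move=> df e0; have := differentiable_continuous df => /cvgc_normP/(_ e e0) h.
have /nbhs_normP[d /= d0 hd] := h.
have [d' d'0 dE] := complex_ltc0 d0.
by exists d' => // y xy; apply: hd; rewrite /ball_ /= normE_ell dE ltcR.
Qed.

End finite_points.

Section ball_coefficients.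
Variables (R : realType) (f : ell_infty R -> R[i]^o) (M : R).
Local Notation C := (R[i]).
Implicit Types (v : nat -> C) (z : ell_infty R) (a : multi_index).
Hypothesis fd : forall z, unit_ball R z -> differentiable f z.
Hypothesis fM : forall z, unit_ball R z -> normc (f z : C) <= M.

Let g k v : C := f (finpt k v).

Lemma slice_ball_diff k v l : (forall j, normc (v j) < 1) ->
  complex_diff (fun u => g k (subst1 v l u)) (v l).
Proof.
move=> v1; have vb : unit_ball R (finpt k v) by apply: finpt_ball => j _; exact: v1.
(* The l-th unit vector if l < k, and zero otherwise, in which case the slice is constant. *)
pose e : ell_infty R := finpt l.+1 (fun j => if (j < k)%N then (j == l)%:R else 0).
have [c hc] := directional_diff e (fd vb); exists c => eps eps0.
have [del del0 hd] := hc eps eps0; exists del => // u uv.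
have := hd _ uv; rewrite /g (_ : finpt k (subst1 v l (v l)) = finpt k v); last first.
  by apply: ell_infty_eq => j; rewrite !finptE /subst1; case: eqP => // ->.
rewrite (_ : finpt k v + (u - v l) *: e = finpt k (subst1 v l u))//.
apply: ell_infty_eq => j; rewrite -[LHS]/(finpt k v j + (u - v l) * e j) !finptE /subst1 ltnS.
have [->|/eqP jl] := eqVneq j l; first by rewrite leqnn; case: ifP => _; rewrite ?mulr1 ?subrKC ?mulr0 ?addr0.
by case: (ltnP j k) => _; case: ifP => _; rewrite ?mulr0 ?addr0.
Qed.

Lemma slice_ball_bound k v : (forall j, normc (v j) < 1) -> normc (g k v) <= M.
Proof. by move=> v1; apply: fM; apply: finpt_ball => j _; exact: v1. Qed.

Lemma slice_ball_ext k v v' : (forall j, (j < k)%N -> v j = v' j) -> g k v = g k v'.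
Proof.
move=> vv; congr f; apply: ell_infty_eq => j; rewrite !finptE; case: ifP => // /vv ->//.
Qed.

(** The Fourier coefficient on the torus of radius [r], freed from the factor r^|a|. That neither
    [k] nor [r] matters is [dcoef_eq]. *)
Definition dcoef k (r : R) a : C :=
  fourier_coef (ftorus (fun v => f (finpt k v)) r) a * (monomial (fun=> r%:C) a)^-1.

Lemma monomial_cst_neq0 (r : R) a : 0 < r -> monomial (fun=> r%:C : C) a != 0.
Proof.
move=> r0; rewrite /monomial prodf_seq_neq0; apply/allP => j _ /=; apply: expfz_neq0.
by rewrite -normc_gt0 normc_real normr_gt0 gt_eqF.
Qed.

Lemma dcoef_sums k r v : 0 < r < 1 -> (forall j, normc (v j) < r) ->
  abs_sums_to (nonneg_index_lt k) (fun a => dcoef k r a * monomial v a) (f (finpt k v)).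
Proof.
move=> /[dup] r01 /andP[r0 r1] vr.
have := ftorus_sums (@slice_ball_diff k) (@slice_ball_bound k) r01 (@slice_ball_ext k) vr.
apply: abs_sums_eq => a _; rewrite /dcoef -mulrA; congr (_ * _).
rewrite monomialM mulrC; congr (_ * _).
by rewrite /monomial -prodfV; apply: eq_bigr => j _; rewrite expfV.
Qed.

(** Two families of coefficients expand the same function on a torus of radius below both radii, so
    [coef_unique] applies. If the numbers of variables differ, the monomials in the additional
    variables vanish at truncated points. In general both are compared with k + l variables. *)
Lemma dcoef_eq k l r r' a : 0 < r < 1 -> 0 < r' < 1 -> nonneg_index_lt k a -> nonneg_index_lt l a ->
  dcoef k r a = dcoef l r' a.
Proof.
suff main k' l' r1 r2 b : (k' <= l')%N -> 0 < r1 < 1 -> 0 < r2 < 1 -> nonneg_index_lt k' b ->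
    dcoef l' r1 b = dcoef k' r2 b.
  move=> r01 r01' ak al.
  have e1 : dcoef (k + l)%N r a = dcoef k r a := main k _ r r a (leq_addr _ _) r01 r01 ak.
  have e2 : dcoef (k + l)%N r a = dcoef l r' a := main l _ r r' a (leq_addl _ _) r01 r01' al.
  exact: (etrans (esym e1) e2).
move=> kl /[dup] r01 /andP[r10 r11] /[dup] r02 /andP[r20 r21] bk.
pose rho := Num.min r1 r2 / 2; have m0 : 0 < Num.min r1 r2 by rewrite lt_min r10.
have rho0 : 0 < rho by rewrite divr_gt0.
have rho1 : rho < r1.
  have : Num.min r1 r2 <= r1 by rewrite ge_min lexx.
  by rewrite /rho; lra.
have rho2 : rho < r2.
  have : Num.min r1 r2 <= r2 by rewrite ge_min lexx orbT.
  by rewrite /rho; lra.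
pose pt (w : torus R) := trunc k' (fun j => rho%:C * tval w j).
have nw w j : normc (pt w j) <= rho.
  rewrite /pt /trunc; case: ifP => _; last by rewrite normc0 ltW.
  by rewrite normcM normc_tval mulr1 normc_real gtr0_norm.
apply: (@coef_unique _ k' rho (dcoef l' r1) (dcoef k' r2) (fun w => f (finpt k' (pt w)))) => //.
- move=> w; have := dcoef_sums l' r01 (fun j => le_lt_trans (nw w j) rho1).
  rewrite (_ : finpt l' (pt w) = finpt k' (pt w)); last first.
    apply: ell_infty_eq => j; rewrite !finptE /pt /trunc.
    by case: (ltnP j k') => jk; [rewrite (leq_trans jk kl)|case: ifP].
  apply: abs_sums_restrict.
    by move=> b' [b0 bk']; split => // j lj; apply: bk'; exact: leq_trans lj.
  by move=> b' [b0 _] nbk; rewrite monomial_trunc0 ?mulr0.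
- by move=> w; exact: (dcoef_sums k' r02 (fun j => le_lt_trans (nw w j) rho2)).
Qed.

Let half01 : 0 < (2^-1 : R) < 1.
Proof. by apply/andP; split; lra. Qed.

Lemma nonneg_lt_bound a : nonneg_index a -> nonneg_index_lt (idx_bound a) a.
Proof. by move=> a0; split => // j; exact: idx_boundP. Qed.

Lemma is_monomial_coef_dcoef : is_monomial_coef f (fun a => dcoef (idx_bound a) 2^-1 a).
Proof.
move=> k z z1 zk; have z1' : sup_norm z < 1 by exact/unit_ballE.
pose r := (sup_norm z + 1) / 2; have z0 := sup_norm_ge0 z.
have r01 : 0 < r < 1 by rewrite /r; apply/andP; split; lra.
have zr j : normc (z j) < r by apply: le_lt_trans (le_sup_norm z j) _; rewrite /r; lra.
have := dcoef_sums k r01 zr; rewrite (finpt_id zk); apply: abs_sums_eq => a ak.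
by rewrite (dcoef_eq r01 half01 ak (nonneg_lt_bound ak.1)).
Qed.

Lemma monomial_coef_spec : is_monomial_coef f (monomial_coef f).
Proof. by rewrite /monomial_coef; apply: xgetPex; exists (fun a => dcoef (idx_bound a) 2^-1 a); exact: is_monomial_coef_dcoef. Qed.

Lemma monomial_coefE k r a : 0 < r < 1 -> nonneg_index_lt k a -> monomial_coef f a = dcoef k r a.
Proof.
move=> r01 ak; pose pt (w : torus R) := trunc k (fun j => (2^-1)%:C * tval w j).
have nw w j : normc (pt w j) <= 2^-1.
  rewrite /pt /trunc; case: ifP => _; last by rewrite normc0; lra.
  by rewrite normcM normc_tval mulr1 normc_real ger0_norm; lra.
have ptb w : unit_ball R (finpt k (pt w)).
  by apply: finpt_ball => j _; apply: le_lt_trans (nw w j) _; lra.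
have ptk w j : (k <= j)%N -> finpt k (pt w) j = 0 by rewrite finptE ltnNge => ->.
have ptE w : finpt k (pt w) = pt w :> (nat -> C).
  by apply/funext => j; rewrite finptE /pt /trunc; case: (j < k)%N.
rewrite -(dcoef_eq half01 r01 (nonneg_lt_bound ak.1) ak).
apply: (@coef_unique _ k 2^-1 (monomial_coef f) (fun a => dcoef (idx_bound a) 2^-1 a) (fun w => f (finpt k (pt w)))) => //.
- by move=> w; have := monomial_coef_spec (ptb w) (ptk w); rewrite ptE.
- by move=> w; have := is_monomial_coef_dcoef (ptb w) (ptk w); rewrite ptE.
Qed.

(** For the function f(r w) of the first [N] variables the transfer from polynomials gives the bound
    with a factor r^|a| in each term; then r tends to 1. *)
Lemma majorized_ball_bound z (K : R) :
  (forall s c M, uniq s -> (forall a, a \in s -> nonneg_index a) ->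
    (forall w, (forall j, normc (w j) = 1) -> normc (peval s c w) <= M) ->
    \sum_(a <- s) normc (c a * monomial z a) <= K * M) ->
  forall s, uniq s -> (forall a, a \in s -> nonneg_index a) ->
  \sum_(a <- s) normc (monomial_coef f a * monomial z a) <= K * M.
Proof.
move=> H s us s0; have [N sN] := common_supp_lt s.
have sA a : a \in s -> nonneg_index_lt N a by move=> as_; split; [exact: s0|exact: sN].
apply: (@sum_radius_limit _ _ _ _ (fun a => \sum_(j < N) `|a j|%N)%N) => [a|r r01]; first exact: normc_ge0.
have /andP[r0 r1] := r01.
pose F := ftorus (fun v => f (finpt N v)) r.
have Fi : cintegrable (torus_measure R) F.
  exact: (cintegrable_ftorus (@slice_ball_diff N) (@slice_ball_bound N) r01 (@slice_ball_ext N)).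
have FM w : normc (F w) <= M by exact: (ftorus_bound (@slice_ball_bound N) r01).
have F0 a : ~ nonneg_index a -> fourier_coef F a = 0.
  exact: (ftorus_neg (@slice_ball_diff N) (@slice_ball_bound N) r01 (@slice_ball_ext N)).
apply: le_trans (fejer_transfer (f := F) (s0 := s) (z := z) (L := K * M) Fi F0 us s0 _); last first.
  move=> s' c us' s0' hM _; apply: H => // w w1; rewrite -(to_torusK w1); exact: hM.
rewrite big_seq [leRHS]big_seq; apply: ler_sum => a as_.
rewrite (monomial_coefE r01 (sA a as_)) /dcoef -/F.
have mr : normc (monomial (fun=> r%:C : C) a) = r ^+ (\sum_(j < N) `|a j|%N)%N.
  rewrite (normc_monomial _ (s0 a as_) (sN a as_)) expr_sum.
  by apply: eq_bigr => j _; rewrite normc_real gtr0_norm.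
rewrite -mr -normcM; have := monomial_cst_neq0 a r0; set q := monomial (fun=> _) a => q0.
by rewrite mulrAC mulfVK// mulrAC.
Qed.

End ball_coefficients.

(** [majorized_ball_bound] gives absolute convergence. The value of the sum is found at truncations
    of [z], where the expansion is the defining property of the coefficients; they tend to [z] in
    norm by [majorized_c0], and f is continuous. *)
Lemma majorized_mon_Hinf (R : realType) (z : ell_infty R) : unit_ball R z -> poly_majorized z ->
  mon_Hinf_ball R z.
Proof.
move=> z1 zm; split => // f [fd [M fM]].
have [K K0 HK] := zm.
apply: (@abs_sums_intro _ _ _ _ _ (K * M)).
  exact: (majorized_ball_bound fd fM HK).
move=> e s e0 s0; have e2 : 0 < e / 2 by rewrite divr_gt0.
have [del del0 hd] := diff_cont_normc (fd z z1) e2.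
have del2 : 0 < del / 2 by rewrite divr_gt0.
have [N1 hN1] := majorized_c0 z1 zm del2.
have [N2 sN2] := common_supp_lt s.
pose N := maxn N1 N2.
have zN : unit_ball R (finpt N z) by apply: finpt_ball => j _; exact: unit_ball_lt1.
have zN0 j : (N <= j)%N -> finpt N z j = 0 by rewrite finptE ltnNge => ->.
have fz : normc (f z - f (finpt N z) : R[i]) < e / 2.
  apply: hd; apply: le_lt_trans (_ : _ <= del / 2) _; last by lra.
  apply: sup_norm_le => j; rewrite -[(z - _) j]/(z j - finpt N z j) finptE; case: ltnP => jN.
    by rewrite subrr normc0 ltW.
  by rewrite subr0 ltW// hN1//; apply: leq_trans jN; exact: leq_maxl.
have sN a : a \in s -> nonneg_index_lt N a.
  by move=> as_; split; [exact: s0|apply: supp_ltW (sN2 a as_); exact: leq_maxr].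
have [t [ut tA st ht]] := abs_sums_approx (monomial_coef_spec fd fM zN zN0) e2 sN.
exists t; split => //; first by move=> a /tA[].
(* The indices in [t] are supported in the first [N] coordinates, where [z] and its truncation
   agree. *)
have -> : \sum_(a <- t) monomial_coef f a * monomial z a = \sum_(a <- t) monomial_coef f a * monomial (finpt N z) a.
  by apply: eq_big_seq => a /tA at_; rewrite -(monomial_trunc z at_).
rewrite (_ : f z - _ = (f z - f (finpt N z)) + (f (finpt N z) - \sum_(a <- t) monomial_coef f a * monomial (finpt N z) a)); last first.
  by rewrite addrA subrK.
apply: le_trans (le_normcD _ _) _; rewrite [e]splitr; apply: lerD => //; exact: ltW.
Qed.

(** * Gliding humps on the ball *)

Section complex_series.
Variable R : realType.
Local Notation C := (R[i]).
Local Notation Re := complex.Re.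
Local Notation Im := complex.Im.
Implicit Types (u v : nat -> C).

Definition csum u : C := limn (fun n => \sum_(i < n) Re (u i)) +i* limn (fun n => \sum_(i < n) Im (u i)).

Lemma ccvg_csum u (K : R) : (forall i, normc (u i) <= K * 2^-1 ^+ i) ->
  ccvg (fun n => \sum_(i < n) u i) (csum u).
Proof.
move=> uK.
have K0 : 0 <= K by have := uK 0%N; rewrite expr0 mulr1; apply: le_trans; exact: normc_ge0.
have H (pr : C -> R) : (forall z, `|pr z| <= normc z) -> cvgn (fun n => \sum_(i < n) pr (u i)).
  move=> prle; rewrite (_ : (fun n => _) = series (fun i => pr (u i))); last first.
    by apply/funext => n; rewrite /series /= big_mkord.
  apply: normed_cvg; apply: nondecreasing_is_cvgn.
    by apply: nondecreasing_series => i _ _; rewrite normr_ge0.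
  exists (K * 2) => _ [n _ <-].
  apply: (@le_trans _ _ (\sum_(0 <= i < n) K * 2^-1 ^+ i)).
    by apply: ler_sum => i _; apply: le_trans (prle _) (uK i).
  by rewrite -mulr_sumr ler_wpM2l// big_mkord half_sums.
apply/ccvgP; rewrite /csum /=; split.
  by under eq_fun do rewrite cRe_sum; exact: H (@Re_le_normc R).
by under eq_fun do rewrite cIm_sum; exact: H (@Im_le_normc R).
Qed.

Lemma csum_le u (K : R) : (forall i, normc (u i) <= K * 2^-1 ^+ i) -> normc (csum u) <= K * 2.
Proof.
move=> uK; apply: (ccvg_le (ccvg_csum uK)) => n.
have K0 : 0 <= K by have := uK 0%N; rewrite expr0 mulr1; apply: le_trans; exact: normc_ge0.
apply: le_trans (normc_sum _ _ _) _.
apply: (@le_trans _ _ (\sum_(i < n) K * 2^-1 ^+ i)); first by apply: ler_sum => i _.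
by rewrite -mulr_sumr ler_wpM2l// half_sums.
Qed.

Lemma ccvgD u v (l l' : C) : ccvg u l -> ccvg v l' -> ccvg (fun n => u n + v n) (l + l').
Proof.
move=> /ccvgP[u1 u2] /ccvgP[v1 v2]; apply/ccvgP; split.
  by rewrite cReD; under eq_fun do rewrite cReD; exact: cvgD.
by rewrite cImD; under eq_fun do rewrite cImD; exact: cvgD.
Qed.

Lemma csum_linear u v (a : C) (K K' : R) : (forall i, normc (u i) <= K * 2^-1 ^+ i) ->
  (forall i, normc (v i) <= K' * 2^-1 ^+ i) ->
  csum (fun i => a * u i + v i) = a * csum u + csum v.
Proof.
move=> uK vK.
have wK i : normc (a * u i + v i) <= (normc a * K + K') * 2^-1 ^+ i.
  apply: le_trans (le_normcD _ _) _; rewrite normcM mulrDl -mulrA; apply: lerD => //.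
  by rewrite ler_wpM2l ?normc_ge0.
apply: (ccvg_unique (ccvg_csum wK)).
have := ccvgD (ccvgMr (c := a) (ccvg_csum uK)) (ccvg_csum vK); rewrite [_ * a]mulrC.
congr ccvg; apply/funext => n; rewrite big_split /= mulr_suml; congr (_ + _).
by apply: eq_bigr => i _; rewrite mulrC.
Qed.

(** All coefficients are at most [K], and for |u| <= 1/2 the terms of degree two and more are
    dominated by a geometric series. *)
Lemma poly_second_order (q : {poly C}) (K : R) (u : C) :
  (forall w, normc w = 1 -> normc q.[w] <= K) -> 2 * normc u <= 1 ->
  normc (q.[u] - q`_0 - q`_1 * u) <= 2 * K * normc u ^+ 2.
Proof.
move=> qK u1; have cK n := normc_coef_le n qK.
have K0 : 0 <= K by apply: le_trans (normc_ge0 _) (cK 0%N).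
have u0 := normc_ge0 u.
pose n := (size q).+2; have sq : (size q <= n)%N by rewrite /n; lia.
rewrite (horner_coef_wide _ sq) /n big_ord_recl big_ord_recl /= expr0 expr1 mulr1.
rewrite (_ : forall x y z : C, x + (y + z) - x - y = z); last by move=> *; ring.
apply: le_trans (normc_sum _ _ _) _.
have -> : 2 * K * normc u ^+ 2 = K * normc u ^+ 2 * 2 by ring.
apply: (@le_trans _ _ (\sum_(i < size q) K * normc u ^+ 2 * 2^-1 ^+ i)).
  apply: ler_sum => i _; rewrite /bump /= !add1n normcM normcX -addn2 addnC exprD.
  rewrite -mulrA; apply: ler_pM; rewrite ?normc_ge0 ?mulr_ge0 ?exprn_ge0//.
  apply: ler_wpM2l; first by rewrite exprn_ge0.
  by rewrite lerXn2r ?nnegrE//; lra.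
rewrite -mulr_sumr ler_wpM2l ?half_sums// mulr_ge0// exprn_ge0//.
Qed.

End complex_series.

Section differentiability.
Variable R : realType.
Local Notation C := (R[i]).

(** Differentiability only asks for a remainder o(|h|); a quadratic one is what Cauchy's estimates
    provide and what can be summed over the humps. *)
Lemma diff_intro (f : ell_infty R -> R[i]^o) (x : ell_infty R) (D : ell_infty R -> C) (B r : R) :
  (forall a h h', D (a *: h + h') = a * D h + D h') ->
  0 <= B -> (forall h, normc (D h) <= B * sup_norm h) -> 0 < r ->
  (forall h : ell_infty R, sup_norm h <= r -> normc (f (h + x) - f x - D h : C) <= B * sup_norm h ^+ 2) ->
  differentiable f x.
Proof.
move=> lD B0 bD r0 hD.
have linD : linear (D : ell_infty R -> R[i]^o) by move=> a h h'; exact: lD.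
pose DM := GRing.isLinear.Build _ _ _ _ _ linD.
pose DL : {linear ell_infty R -> R[i]^o} := HB.pack (D : ell_infty R -> R[i]^o) DM.
have cD : continuous DL.
  move=> y; apply/(cvgc_normP (FF := nbhs_filter y)) => e e0.
  have d0 : 0 < e / (B + 1) by rewrite divr_gt0//; lra.
  have : \forall w \near (y : ell_infty R), normc (D y - D w : C) < e.
    apply/nbhs_normP; exists (e / (B + 1))%:C; first by rewrite /= ltcR.
    move=> w /=; rewrite /ball_ /= normE_ell ltcR => yw.
    rewrite (_ : D y - D w = D (y - w)); last by rewrite -[RHS]/(DL (y - w)) linearB.
    apply: le_lt_trans (bD _) _.
    apply: le_lt_trans (_ : _ <= (B + 1) * sup_norm (y - w)%R) _.
      by rewrite ler_wpM2r ?sup_norm_ge0// lerDl.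
    by rewrite mulrC -ltr_pdivlMr//; lra.
  by [].
have eq : f \o shift x = cst (f x) + DL +o_ (0 : ell_infty R) id.
  apply/eqaddoP => eps eps0; have [e e0 ->] := complex_ltc0 eps0.
  suff : \forall h \near (0 : ell_infty R), normc (f (h + x) - f x - D h : C) <= e * sup_norm h.
    apply: filterS => h hh; rewrite normE_ell normE -rmorphM lecR; apply: le_trans hh.
    by rewrite -[X in normc X <= _]/(f (h + x) - (f x + D h)) opprD addrA.
  apply/nbhs_norm0P; pose d := Num.min r (e / (B + 1)).
  have B1 : 0 < B + 1 by lra.
  have d0 : 0 < d by rewrite lt_min r0 divr_gt0.
  exists d%:C; first by rewrite /= ltcR.
  move=> h /=; rewrite normE_ell ltcR => hd; have h0 := sup_norm_ge0 h.
  apply: le_trans (hD h _) _; first by rewrite ltW// (lt_le_trans hd)// ge_min lexx.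
  rewrite expr2 mulrA ler_wpM2r//.
  have : sup_norm h <= e / (B + 1) by rewrite ltW// (lt_le_trans hd)// ge_min lexx orbT.
  rewrite ler_pdivlMr// => he; apply: le_trans he; rewrite mulrC ler_wpM2l//; lra.
have dE := diff_unique cD eq.
by apply/diff_locallyP; rewrite dE.
Qed.

Variables (s : nat -> seq multi_index) (c : nat -> multi_index -> C).
Hypotheses (us : forall i, uniq (s i)) (s0 : forall i a, a \in s i -> nonneg_index a)
  (sd : forall i k a, a \in s i -> a \in s k -> i = k)
  (hsup : forall i w, (forall j, normc (w j) = 1) -> normc (peval (s i) (c i) w) <= 2^-1 ^+ i).

Lemma hump_ball i w : (forall j, normc (w j) <= 1) -> normc (peval (s i) (c i) w) <= 1 * 2^-1 ^+ i.
Proof. by move=> w1; rewrite mul1r; apply: peval_max_principle => // [a /s0|]; [|exact: hsup]. Qed.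

Definition hump_sum (x : ell_infty R) : R[i]^o := csum (fun i => peval (s i) (c i) x).

Let N i := projT1 (cid (common_supp_lt (s i))).
Let sN i a : a \in s i -> supp_lt a (N i). Proof. exact: projT2 (cid (common_supp_lt (s i))) a. Qed.
Let ex (a : multi_index) j := `|a j|%N.
Let D i (x h : ell_infty R) : C := \sum_(k < N i) h k * dpol ex (N i) (s i) (c i) k x.

Let pE i w : peval (s i) (c i) w = pol ex (N i) (s i) (c i) w.
Proof. by apply: peval_pol; [exact: s0|exact: sN]. Qed.

(** Cauchy's estimates on the line through [x] in the direction of [h], rescaled to length [d] so
    that its unit disc stays in the ball. The derivative is the coefficient of degree one of [q],
    and [poly_second_order] bounds the remainder. *)
Let D_estimate i (x h : ell_infty R) (d : R) : 0 < d -> sup_norm x + d <= 1 ->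
  normc (D i x h) <= d^-1 * sup_norm h * 2^-1 ^+ i /\
  (2 * sup_norm h <= d ->
   normc (peval (s i) (c i) (h + x) - peval (s i) (c i) x - D i x h) <= 2 * d ^- 2 * sup_norm h ^+ 2 * 2^-1 ^+ i).
Proof.
move=> d0 xd; have h0 := sup_norm_ge0 h.
have [hz|hz] := eqVneq (sup_norm h) 0.
  have h0' j : h j = 0.
    by apply/eqP; rewrite -normc_eq0 eq_le normc_ge0 andbT -hz le_sup_norm.
  have -> : D i x h = 0 by rewrite /D big1// => k _; rewrite h0' mul0r.
  have z2 : 0 ^+ 2 = 0 :> R by rewrite expr0n.
  rewrite hz z2 !mulr0 !mul0r normc0 subr0; split => // _.
  have -> : peval (s i) (c i) (h + x : ell_infty R) = peval (s i) (c i) x.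
    by congr peval; apply/funext => j; rewrite -[LHS]/(h j + x j) h0' add0r.
  by rewrite subrr normc0.
have hp : 0 < sup_norm h by rewrite lt_def hz.
pose b j := (d / sup_norm h)%:C * h j.
pose q := line_poly ex (N i) (s i) (c i) x b.
have b1 j : normc (b j) <= d.
  rewrite normcM normc_real ger0_norm ?divr_ge0 ?(ltW d0)// mulrAC ler_pdivrMr//.
  by rewrite ler_wpM2l ?(ltW d0)// le_sup_norm.
have qK w : normc w = 1 -> normc q.[w] <= 2^-1 ^+ i.
  move=> w1; rewrite horner_line_poly -pE -[leRHS]mul1r; apply: hump_ball => j.
  apply: le_trans (le_normcD _ _) _; rewrite normcM w1 mulr1.
  by apply: le_trans (lerD (le_sup_norm x j) (b1 j)) xd.
have q1 : D i x h = q`_1 * (sup_norm h / d)%:C.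
  rewrite coef1_line_poly mulr_suml /D; apply: eq_bigr => k _.
  rewrite mulrAC; congr (_ * _); rewrite /b mulrAC -rmorphM /=.
  by rewrite (_ : d / sup_norm h * (sup_norm h / d) = 1) ?mul1r//; field; rewrite hz gt_eqF.
have nu : normc ((sup_norm h / d)%:C : C) = sup_norm h / d.
  by rewrite normc_real ger0_norm// divr_ge0// ltW.
split.
  rewrite q1 normcM nu [_^-1 * _]mulrC [leRHS]mulrC ler_wpM2r ?divr_ge0 ?(ltW d0)//.
  exact: normc_coef_le qK.
move=> h2; have hu : 2 * normc ((sup_norm h / d)%:C : C) <= 1.
  by rewrite nu mulrA ler_pdivrMr// mul1r.
have := poly_second_order qK hu.
rewrite nu -q1 horner_line_poly -pE.
have -> : q`_0 = peval (s i) (c i) x.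
  rewrite -horner_coef0 horner_line_poly pE; congr pol; apply/funext => j; by rewrite mulr0 addr0.
have -> : (fun j => x j + b j * (sup_norm h / d)%:C) = (h + x : ell_infty R).
  apply/funext => j; rewrite -[RHS]/(h j + x j) addrC; congr (_ + _); rewrite /b mulrAC -rmorphM /=.
  by rewrite (_ : d / sup_norm h * (sup_norm h / d) = 1) ?mul1r//; field; rewrite hz gt_eqF.
move=> H; apply: le_trans H _; rewrite le_eqVlt; apply/orP; left; apply/eqP; field.
by rewrite gt_eqF.
Qed.

(** The estimates carry the factor 2^(-i), so derivatives and remainders are summed term by term. In
    [B], 2 / d stems from the derivative and 4 / d^2 from the remainder, each doubled by
    [csum_le]. *)
Lemma hump_sum_diff x : unit_ball R x -> differentiable hump_sum x.
Proof.
move=> x1; have x1' : sup_norm x < 1 by exact/unit_ballE.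
pose d := (1 - sup_norm x) / 2.
have x0 := sup_norm_ge0 x.
have d0 : 0 < d by rewrite /d; lra.
have xd : sup_norm x + d <= 1 by rewrite /d; lra.
have DK (h : ell_infty R) i : normc (D i x h) <= d^-1 * sup_norm h * 2^-1 ^+ i by case: (D_estimate i h d0 xd).
have i0 : 0 <= d^-1 by rewrite invr_ge0 ltW.
have ball (y : ell_infty R) : sup_norm y <= 1 -> forall i, normc (peval (s i) (c i) y) <= 1 * 2^-1 ^+ i.
  by move=> y1 i; apply: hump_ball => j; apply: le_trans (le_sup_norm y j) y1.
pose B := 2 * d^-1 + 4 * d ^- 2.
have id20 : 0 <= d ^- 2 by rewrite invr_ge0 exprn_ge0// ltW.
apply: (@diff_intro _ x (fun h => csum (fun i => D i x h)) B (d / 2)).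
- move=> a h h'; rewrite -(csum_linear a (DK h) (DK h')); congr csum; apply/funext => i.
  rewrite /D mulr_sumr -big_split /=; apply: eq_bigr => k _.
  transitivity ((a * h k + h' k) * dpol ex (N i) (s i) (c i) k x); first by [].
  by rewrite mulrDl mulrA.
- by rewrite /B; lra.
- move=> h; apply: le_trans (csum_le (DK h)) _.
  rewrite mulrAC ler_wpM2r ?sup_norm_ge0// /B; lra.
- by rewrite divr_gt0.
move=> h hd; have h0 := sup_norm_ge0 h.
have hd2 : 2 * sup_norm h <= d by lra.
have hx1 : sup_norm (h + x) <= 1.
  apply: sup_norm_le => j; rewrite -[(h + x) j]/(h j + x j); apply: le_trans (le_normcD _ _) _.
  by have := le_sup_norm h j; have := le_sup_norm x j; lra.
pose r i := peval (s i) (c i) (h + x) - peval (s i) (c i) x - D i x h.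
have rK i : normc (r i) <= 2 * d ^- 2 * sup_norm h ^+ 2 * 2^-1 ^+ i.
  by case: (D_estimate i h d0 xd) => _; exact.
have -> : hump_sum (h + x) - hump_sum x - csum (fun i => D i x h) = csum r.
  have e1 := csum_linear (-1) (ball x (ltW x1')) (ball (h + x) hx1).
  have K1 i : normc (-1 * peval (s i) (c i) x + peval (s i) (c i) (h + x)) <= 2 * 2^-1 ^+ i.
    apply: le_trans (le_normcD _ _) _; rewrite normcM normcN normc1 mul1r.
    by have := ball x (ltW x1') i; have := ball (h + x) hx1 i; set y1 := normc _; set y2 := normc _; set y3 := _ ^+ i; lra.
  have e2 := csum_linear (-1) (DK h) K1.
  have gen (p q t : C) : p - q - t = -1 * t + (-1 * q + p) by ring.
  have -> : r = (fun i => -1 * D i x h + (-1 * peval (s i) (c i) x + peval (s i) (c i) (h + x))).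
    by apply/funext => i; exact: gen.
  rewrite [RHS]e2 [csum (fun i => -1 * peval (s i) (c i) x + _)]e1; exact: gen.
apply: le_trans (csum_le rK) _; rewrite mulrAC ler_wpM2r ?exprn_ge0// /B.
by move: i0 id20; set y1 := d^-1; set y2 := d ^- 2; lra.
Qed.

Lemma hump_sum_bound x : unit_ball R x -> normc (hump_sum x : C) <= 2.
Proof.
move=> x1; rewrite -[leRHS]mul1r; apply: csum_le => i; apply: hump_ball => j.
exact/ltW/unit_ball_lt1.
Qed.

(** The slice in [k] variables at radius 1/2 is the sum of the humps with coefficients multiplied by
    [q], which vanishes at indices involving further variables. The spectra are still disjoint, so
    [series_fourier] yields the coefficient c_a q_a, and [q a] is the factor that [dcoef] divides
    out. *)
Lemma hump_sum_coef i a : a \in s i -> monomial_coef hump_sum a = c i a.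
Proof.
move=> ai; have r01 : 0 < (2^-1 : R) < 1 by apply/andP; split; lra.
have /andP[r0 r1] := r01.
pose k := idx_bound a; have ak : nonneg_index_lt k a by apply: nonneg_lt_bound; exact: s0 ai.
rewrite (monomial_coefE hump_sum_diff hump_sum_bound r01 ak) /dcoef.
pose F := ftorus (fun v => hump_sum (finpt k v)) (2^-1).
pose q b : C := monomial (trunc k (fun=> (2^-1)%:C)) b.
pose c' i b := c i b * q b.
pose pt (w : torus R) := trunc k (fun j => (2^-1)%:C * tval w j).
have pt1 w j : normc (pt w j) <= 1.
  rewrite /pt /trunc; case: ifP => _; last by rewrite normc0.
  by rewrite normcM normc_tval mulr1 normc_real ger0_norm; lra.
have cE i' w : peval (s i') (c' i') (tval w) = peval (s i') (c i') (pt w).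
  apply: eq_bigr => b _; rewrite /c' /q -mulrA -monomialM; congr (_ * _); congr monomial.
  by apply/funext => j; rewrite /pt /trunc; case: ifP => // _; rewrite mul0r.
have FE w : F w = csum (fun i => peval (s i) (c i) (pt w)).
  rewrite /F /ftorus /hump_sum; congr csum.
have hI i' : \int[torus_measure R]_w normc (peval (s i') (c' i') (tval w)) <= 2^-1 ^+ i'.
  rewrite -[leRHS](Rintegral_prob_cst (torus_measure R)); apply: le_Rintegral => //.
  - exact/cintegrable_normc/cintegrable_peval.
  - exact: (@finite_measure_integrable_cst _ _ _ (torus_measure R)).
  - by move=> w _; rewrite cE; have := hump_ball i' (pt1 w); rewrite mul1r.
have [f [fi fae fc _]] := series_fourier us sd hI.
have Fm : cmeasurable F.
  by apply: (@cmeasurable_limit _ _ _ (fun n w => \sum_(i < n) peval (s i) (c' i) (tval w))) => [n|w];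
    [apply: cmeasurable_sum => i'; exact: cmeasurable_peval|
     rewrite FE; under eq_fun do under eq_bigr do rewrite cE; apply: ccvg_csum => i'; exact: hump_ball].
have -> : fourier_coef F a = fourier_coef f a.
  rewrite !fourier_coefE; apply: ae_cintegral.
  - by apply: cmeasurableM => //; exact: cmeasurable_monomialV.
  - by apply: cmeasurableM; [exact: cintegrable_meas fi|exact: cmeasurable_monomialV].
  - move: fae; apply: filterS => w h; congr (_ * _); apply: ccvg_unique h; rewrite FE.
    under eq_fun do under eq_bigr do rewrite cE; apply: ccvg_csum => i'; exact: hump_ball.
rewrite (fc i a ai) /c' /q (monomial_trunc _ ak) mulfK//.
exact: monomial_cst_neq0.
Qed.

End differentiability.

Lemma mon_Hinf_majorized (R : realType) (z : ell_infty R) : mon_Hinf_ball R z -> poly_majorized z.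
Proof.
move=> [z1 H]; apply: contrapT => nz.
have [s [c [us s0 sd sup1 sum1]]] := humps nz.
apply: (not_summable us s0 sd (hump_sum_coef us s0 sd sup1) sum1).
have [] := H (hump_sum s c) => //; split; last exists 2.
  exact: hump_sum_diff.
exact: hump_sum_bound.
Qed.

Theorem theorem4p5 (R : realType) :
  (mon_Hp_torus R +oo%E = mon_Hinf_ball R /\
   ([set ((Num.sqrt 2)^-1)%:C *: z | z in B_set R] `<=` mon_Hp_torus R +oo%E /\
    mon_Hp_torus R +oo%E `<=` Bbar_set R)) /\
  (forall p : R, 1 <= p -> mon_Hp_torus R p%:E = ell_2 R `&` unit_ball R).
Proof.
split; [split; [|split]|].
- apply/seteqP; split => z hz.
    by apply: majorized_mon_Hinf; [case: hz|exact: mon_Hoo_majorized].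
  by apply: majorized_mon_Hoo; [case: hz|exact: mon_Hinf_majorized].
- by move=> _ [w /B_set_majorized[w1 wm] <-]; exact: majorized_mon_Hoo.
- by move=> z hz; apply: majorized_Bbar; [case: hz|exact: mon_Hoo_majorized].
- move=> p p1; apply/seteqP; split => z.
    by move=> hz; split; [exact: mon_Hp_ell_2 hz|case: hz].
  by move=> [z2 z1]; exact: ell_2_mon_Hp.
Qed.
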